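(* Let $S^1=\mathbb{R}/(2\pi\mathbb{Z})$ and consider the scalar parabolic equation $$u_t=u_{xx}+f(x,u,u_x),\quad x\in S^1,\ t>0,\qquad u(0,x)=u_0(x),\quad x\in S^1,$$ where: (A) $f:S^1\times\mathbb{R}\times\mathbb{R}\to\mathbb{R}$ is of class $C^2$; (B) there exist a continuous function $K:[0,\infty)\to[0,\infty)$ and constants $\varepsilon\in(0,2)$, $\delta>0$ such that $|f(x,\xi,p)|\le K(r)(1+|p|^\varepsilon)$ for all $r>0$ and $(x,\xi,p)\in S^1\times[-r,r]\times\mathbb{R}$, and $\xi f(x,\xi,0)<0$ for all $(x,\xi)\in S^1\times\mathbb{R}$ with $|\xi|>\delta$. Let $\Phi$ be the continuous semiflow generated by this equation on the fractional power space $X$ described in the context. Then every connected component of the Birkhoff center $\mathcal{B}(\Phi)$, and every connected component of the support of any invariant Borel probability measure of $\Phi$, is homeomorphic to a compact invariant set in $\mathbb{R}^2$. Furthermore, the topological entropy of the system is zero.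
   Context: **Phase space.** Let $A:D(A)=H^2(S^1)\subset L^2(S^1)\to L^2(S^1)$, $Au=-u_{xx}$. Fix $a>0$, $G:=A+aI$, $\alpha\in(3/4,1)$, and set $X:=D(G^\alpha)$ with $\|u\|_X:=\|G^\alpha u\|_{L^2(S^1)}$. Then $X=H^{2\alpha}(S^1)\hookrightarrow C^1(S^1)$. Under (A) and (B), for every $u_0\in X$ the equation has a unique global solution $u(\cdot;u_0)\in C([0,\infty);X)$, classical for $t>0$, and $\Phi_t(u_0):=u(t,\cdot;u_0)$ defines a continuous semiflow $\Phi:[0,\infty)\times X\to X$. **Dynamical notions.** The $\omega$-limit set is $\omega(u)=\bigcap_{t\ge0}\overline{\bigcup_{s\ge t}\{\Phi_s(u)\}}$; a point is recurrent if $u\in\omega(u)$; the Birkhoff center $\mathcal{B}(\Phi)$ is the closure of the set of recurrent points. A Borel probability measure $\mu$ on $X$ is invariant if $\mu(\Phi_t^{-1}(E))=\mu(E)$ for all Borel $E$ and $t\ge0$; its support is the complement of the union of all open $\mu$-null sets. ''Invariant'' for the image set in $\mathbb{R}^2$ refers to the dynamics induced on it by transporting $\Phi$ restricted to the component through the homeomorphism. The topological entropy of the system is that of the time-one map $\Phi_1$ restricted to the (compact) global attractor of $\Phi$, i.e. the nonempty compact set $\Gamma\subset X$ with $\Phi_t(\Gamma)=\Gamma$ for all $t\ge 0$ that attracts every bounded set. *)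

(* Defs.v *)
From HB Require Import structures.
From mathcomp Require Import all_boot all_order all_algebra.
From mathcomp Require Import all_classical all_reals all_analysis.

Set Implicit Arguments.
Unset Strict Implicit.
Unset Printing Implicit Defensive.

Import Order.TTheory GRing.Theory Num.Theory.
Import numFieldNormedType.Exports.

Local Open Scope classical_set_scope.
Local Open Scope ring_scope.

Section circle.
Context {R : realType}.
Implicit Types (a alpha lam : R) (u v w phi psi : R -> R).

(* Functions on S^1 = R / 2 pi Z are represented by functions on R; an element
   of L^2(S^1) by any representative on the fundamental domain [0, 2 pi]. *)
Definition circle_measure : {measure set (measurableTypeR R) -> \bar R} :=
  mrestr (@lebesgue_measure R) (measurable_itv `[0, 2 * pi]).

Definition L2 : {pred R -> R} := Lfun circle_measure 2%:E.

Definition L2norm u : R := fine (Lnorm circle_measure 2%:E (EFin \o u)).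

Definition L2dot u v : R := \int[circle_measure]_x (u x * v x).

Definition smooth u := forall n x, derivable (derive1n n u) x 1.

Definition weak_derivative u v :=
  forall psi, smooth psi -> periodic psi (2 * pi) ->
    L2dot u (derive1 psi) = - L2dot v psi.

(* Unbounded operators on L^2(S^1) are given by their graphs, the second
   component being determined up to null sets. *)
Definition opA u w :=
  [/\ u \in L2, w \in L2 &
    exists v, [/\ v \in L2, weak_derivative u v & weak_derivative v (- w)]].

Definition opG a u w := opA u (w - a *: u).

(* G is self-adjoint with discrete spectrum in [a, +oo[ and its eigenfunctions
   span L^2(S^1), so that G^alpha is determined by G^alpha phi = lam^alpha phi
   on eigenfunctions: u is in D(G^alpha) with G^alpha u = w iff
   (w, phi) = lam^alpha (u, phi) for every eigenpair (lam, phi). *)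
Definition opG_power a alpha u w :=
  [/\ u \in L2, w \in L2 &
    forall lam phi, phi \in L2 -> opG a phi (lam *: phi) ->
      L2dot w phi = lam `^ alpha * L2dot u phi].

(* The continuous periodic representatives of the elements of D(G^alpha);
   they exist and are unique for alpha > 1/4. *)
Definition phase_set a alpha : set (R -> R) :=
  [set u | [/\ continuous u, periodic u (2 * pi) & exists w, opG_power a alpha u w]].

Definition phase_pred a alpha : {pred R -> R} := mem (phase_set a alpha).

(* |G^alpha u|; the infimum is over a singleton as G^alpha u is unique almost
   everywhere. *)
Definition power_norm a alpha u : R :=
  inf [set L2norm w | w in [set w | opG_power a alpha u w]].

Lemma L2_integrable u v : u \in L2 -> v \in L2 ->
  circle_measure.-integrable setT (EFin \o (fun x => u x * v x)).
Proof. by move=> uL vL; apply/Lfun1_integrable; exact: Lfun2_mul_Lfun1. Qed.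

Lemma L2_submod_closed : submod_closed L2.
Proof. by apply: Lfun_submod_closed; rewrite lee1n. Qed.

Lemma L2dot_linear (k : R) u v w : u \in L2 -> v \in L2 -> w \in L2 ->
  L2dot (k *: u + v) w = k * L2dot u w + L2dot v w.
Proof.
move=> uL vL wL; rewrite /L2dot -RintegralZl ?L2_integrable//.
rewrite -RintegralD//; last 2 first.
- have -> : EFin \o (fun x => k * (u x * w x)) =
            (fun x => (k%:E * (EFin \o (fun x => (u x * w x)%R)) x)%E) by [].
  exact/integrableZl/L2_integrable.
- exact: L2_integrable.
by apply: eq_Rintegral => x _; rewrite mulrA -mulrDl.
Qed.

Lemma opG_power_linear a alpha (k : R) u v w z :
  opG_power a alpha u w -> opG_power a alpha v z ->
  opG_power a alpha (k *: u + v) (k *: w + z).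
Proof.
have [_ L2P] := L2_submod_closed.
move=> [uL wL uw] [vL zL vz]; split; [exact: L2P|exact: L2P|].
move=> lam phi phiL Gphi; rewrite !L2dot_linear// (uw _ _ phiL Gphi).
by rewrite (vz _ _ phiL Gphi) mulrDr !mulrA (mulrC k).
Qed.

Lemma opG_power0 a alpha : opG_power a alpha 0 0.
Proof.
have [L20 _] := L2_submod_closed.
split=> // lam phi _ _; rewrite /L2dot.
under eq_Rintegral do rewrite mul0r.
by rewrite Rintegral_cst// !mul0r mulr0.
Qed.

Lemma phase_submod_closed a alpha : submod_closed (phase_pred a alpha).
Proof.
split=> [|k u v]; rewrite !inE.
  by split; [exact: cst_continuous | by [] | exists 0; exact: opG_power0].
move=> [uc up [w uw]] [vc vp [z vz]]; split.
- by move=> x; apply: continuousD; [exact/continuousZr/uc | exact: vc].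
- by move=> x; rewrite !fctE up vp.
- by exists (k *: w + z); exact: opG_power_linear.
Qed.

HB.instance Definition _ a alpha := GRing.isSubmodClosed.Build R (R -> R)
  (phase_pred a alpha) (phase_submod_closed a alpha).

End circle.

Record phase_space (R : realType) (a alpha : R) := PhaseSpace {
  phase_fun :> R -> R;
  phase_funP : phase_fun \in phase_pred a alpha }.

Section phase_space.
Context {R : realType} (a alpha : R).
Local Notation X := (phase_space a alpha).

HB.instance Definition _ := [isSub of X for @phase_fun R a alpha].
HB.instance Definition _ := [Choice of X by <:].
HB.instance Definition _ := [SubChoice_isSubLmodule of X by <:].
HB.instance Definition _ := isPointed.Build X 0.

Definition Xnorm (u : X) : R := power_norm a alpha u.

Let values (u : X) := [set L2norm w | w in [set w | opG_power a alpha u w]].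

Let values_inf (u : X) : has_inf (values u).
Proof.
split; last by exists 0 => _ [w _ <-]; exact/fine_ge0/Lnorm_ge0.
have := phase_funP u; rewrite inE => -[_ _ [w uw]].
by exists (L2norm w); exists w.
Qed.

Lemma Xnorm0 : Xnorm 0 = 0.
Proof.
apply/eqP; rewrite eq_le; apply/andP; split; last first.
  apply: lb_le_inf; first by case: (values_inf 0).
  by move=> _ [w _ <-]; exact/fine_ge0/Lnorm_ge0.
apply: ge_inf; first by case: (values_inf 0).
exists 0; first exact: opG_power0.
by rewrite /L2norm (_ : EFin \o 0 = cst 0%E)// Lnorm0//= ?eqe.
Qed.

Lemma XnormN u : Xnorm (- u) = Xnorm u.
Proof.
suff le v : Xnorm (- v) <= Xnorm v.
  by apply/eqP; rewrite eq_le le -[X in Xnorm X <= _](opprK u) le.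
apply: lb_le_inf; first by case: (values_inf v).
move=> _ [w vw <-]; apply: ge_inf; first by case: (values_inf (- v)).
exists (- w).
  have := opG_power_linear (-1) vw (opG_power0 a alpha).
  by rewrite !addr0 !scaleN1r.
have -> : L2norm (- w) = fine (Lnorm circle_measure 2%:E (\- (EFin \o w))%E) by [].
by rewrite oppe_Lnorm.
Qed.

Lemma XnormD u v : Xnorm (u + v) <= Xnorm u + Xnorm v.
Proof.
have [uv0 uvb] := (values_inf u, values_inf v).
rewrite /Xnorm /power_norm -inf_sumE//; apply: lb_le_inf.
  by case: uv0 uvb => -[x ux] _ [[y vy] _]; exists (x + y), x => //; exists y.
move=> _ [_ [w uw <-] [_ [z vz <-] <-]].
have fin (y : R -> R) : y \in L2 -> (Lnorm circle_measure 2%:E (EFin \o y) < +oo)%E.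
  by rewrite inE => /andP[_]; rewrite inE.
have meas (y : R -> R) : y \in L2 -> measurable_fun [set: measurableTypeR R] y.
  by rewrite inE => /andP[]; rewrite inE.
have [_ wL _] := uw; have [_ zL _] := vz.
apply: (@le_trans _ _ (L2norm (w + z))).
  apply: ge_inf; first by case: (values_inf (u + v)).
  exists (w + z) => //; have := opG_power_linear 1 uw vz.
  by rewrite !scale1r.
rewrite -lee_fin EFinD !fineK ?ge0_fin_numE ?Lnorm_ge0 ?fin//.
  by apply: eminkowski; [exact: meas|exact: meas|rewrite lee1n].
have [_ L2P] := @L2_submod_closed R.
by have := L2P 1 _ _ wL zL; rewrite scale1r.
Qed.

Definition Xball (u : X) (e : R) : set X := [set v | Xnorm (u - v) < e].

Let Xball_center u e : 0 < e -> Xball u e u.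
Proof. by rewrite /Xball /= subrr Xnorm0. Qed.

Let Xball_sym u v e : Xball u e v -> Xball v e u.
Proof. by rewrite /Xball /= -XnormN opprB. Qed.

Let Xball_triangle u v w d e :
  Xball u d v -> Xball v e w -> Xball u (d + e) w.
Proof.
rewrite /Xball /= => uv vw; rewrite -(subrKA v).
exact: (le_lt_trans (XnormD _ _)) (ltrD uv vw).
Qed.

HB.instance Definition _ := hasNbhs.Build X (nbhs_ (entourage_ Xball)).
HB.instance Definition _ := @Nbhs_isPseudoMetric.Build R X
  (entourage_ Xball) erefl Xball Xball_center Xball_sym Xball_triangle erefl.

Definition Xbounded (B : set X) := exists M, forall u, B u -> Xnorm u <= M.

End phase_space.

(* A semiflow is indexed by R, only its values at times t >= 0 being relevant. *)
Section dynamics.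
Context {R : realType}.

Definition continuous_semiflow (T : topologicalType) (Phi : R -> T -> T) :=
  [/\ {within [set p : R * T | 0 <= p.1], continuous (fun p => Phi p.1 p.2)},
      forall u, Phi 0 u = u &
      forall s t u, 0 <= s -> 0 <= t -> Phi (s + t) u = Phi s (Phi t u)].

Definition invariant_set T (Phi : R -> T -> T) (A : set T) :=
  forall t, 0 <= t -> Phi t @` A = A.

Definition omega_limit (T : topologicalType) (Phi : R -> T -> T) (u : T) : set T :=
  \bigcap_(t in [set t | 0 <= t]) closure [set Phi s u | s in [set s | t <= s]].

Definition birkhoff_center (T : topologicalType) (Phi : R -> T -> T) : set T :=
  closure [set u | omega_limit Phi u u].

Definition borel (T : topologicalType) := g_sigma_algebraType (@open T).

Definition invariant_measure (T : ptopologicalType) (Phi : R -> T -> T)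
    (mu : probability (borel T) R) :=
  forall t (E : set (borel T)), 0 <= t -> measurable E ->
    mu (Phi t @^-1` E) = mu E.

Definition measure_support (T : ptopologicalType)
    (mu : probability (borel T) R) : set T :=
  ~` \bigcup_(O in [set O : set T | open O /\ mu O = 0%E]) O.

Definition homeomorphism_between (S T : topologicalType) (C : set S) (K : set T)
    (h : S -> T) (g : T -> S) :=
  [/\ {within C, continuous h}, {within K, continuous g},
      h @` C = K & {in C, cancel h g}].

(* C is carried into itself by Phi, so that Phi restricted to C transports
   through the homeomorphism h : C -> K, of inverse g, to h \o Phi t \o g. *)
Definition homeo_planar_compact_invariant (T : topologicalType)
    (Phi : R -> T -> T) (C : set T) :=
  exists (K : set (R * R)) h g,
    [/\ homeomorphism_between C K h g, compact K,
        forall t, 0 <= t -> Phi t @` C `<=` C &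
        invariant_set (fun t => h \o Phi t \o g) K].

Definition separated (T : pseudoMetricType R) (F : T -> T) (n : nat) (e : R)
    (s : seq T) :=
  uniq s /\ forall x y, x \in s -> y \in s -> x != y ->
    exists2 k, (k < n)%N & ~ ball (iter k F x) e (iter k F y).

Definition max_separated (T : pseudoMetricType R) (F : T -> T) (K : set T)
    (n : nat) (e : R) : \bar R :=
  ereal_sup [set ((size s)%:R)%:E | s in
    [set s : seq T | separated F n e s /\ (forall x, x \in s -> K x)]].

(* Bowen's definition on K; the growth rate is nonincreasing in e, so the
   supremum over e is its limit as e -> 0. *)
Definition topological_entropy (T : pseudoMetricType R) (F : T -> T)
    (K : set T) : \bar R :=
  ereal_sup [set limn_esup (fun n => (n%:R^-1)%:E * lne (max_separated F K n e))%E
            | e in [set e : R | 0 < e]].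

Definition global_attractor (a alpha : R)
    (Phi : R -> phase_space a alpha -> phase_space a alpha)
    (Gamma : set (phase_space a alpha)) :=
  [/\ Gamma !=set0, compact Gamma, invariant_set Phi Gamma &
    forall B, Xbounded B -> forall e, 0 < e ->
      exists2 t0, 0 <= t0 & forall t u, t0 <= t -> B u ->
        exists2 v, Gamma v & Xnorm (Phi t u - v) < e].

End dynamics.

Section equation.
Context {R : realType}.

Fixpoint class_C (V : normedModType R) (k : nat) (F : V -> R) : Prop :=
  if k is k'.+1 then
    continuous F /\
    forall v, (forall x, derivable F x v) /\ class_C k' (fun x => 'D_v F x)
  else continuous F.

Implicit Types f : R * R * R -> R.

Definition hypothesis_A f :=
  (forall xi p, periodic (fun x => f (x, xi, p)) (2 * pi)) /\ class_C 2 f.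

Definition hypothesis_B f :=
  exists (K : R -> R) (eps delta : R),
    [/\ {within `[0, +oo[, continuous K} /\ (forall r, 0 <= r -> 0 <= K r),
        0 < eps < 2, 0 < delta,
        forall r x xi p, 0 < r -> - r <= xi <= r ->
          `|f (x, xi, p)| <= K r * (1 + `|p| `^ eps) &
        forall x xi, delta < `|xi| -> xi * f (x, xi, 0) < 0].

Definition classical_solution f (u : R -> R -> R) :=
  let u_t t x := derive1 (u^~ x) t in
  let u_x t x := derive1 (u t) x in
  let u_xx t x := derive1n 2 (u t) x in
  [/\ forall t x, 0 < t -> [/\ derivable (u^~ x) t 1, derivable (u t) x 1 &
        derivable (derive1 (u t)) x 1],
      {within [set p : R * R | 0 < p.1], continuous (fun p => u_t p.1 p.2)},
      {within [set p : R * R | 0 < p.1], continuous (fun p => u_x p.1 p.2)},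
      {within [set p : R * R | 0 < p.1], continuous (fun p => u_xx p.1 p.2)} &
      forall t x, 0 < t -> u_t t x = u_xx t x + f (x, u t x, u_x t x)].

Definition global_solution (a alpha : R) f (u0 : phase_space a alpha)
    (u : R -> phase_space a alpha) :=
  [/\ u 0 = u0, {within `[0, +oo[, continuous u} & classical_solution f u].

Definition generated_by (a alpha : R)
    (Phi : R -> phase_space a alpha -> phase_space a alpha) f :=
  forall u0, global_solution f u0 (Phi^~ u0) /\
    forall u, global_solution f u0 u -> forall t, 0 <= t -> u t = Phi t u0.

End equation.

(* Main.v *)
(* A solution of a linear parabolic equation on the circle never gains sign alternations and loses some at a multiple
 zero. For u, v on jointly recurrent orbits of the attractor, and for limits of such pairs, Phi_t u - Phi_t v therefore
 has only simple zeros, so v |-> (v x0, v_x x0) is injective. The orbit of a recurrent u becomes a simple plane curve,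
 which a winding argument a la Poincare-Bendixson forces to close: u is periodic. Two periodic orbits return almost
 simultaneously, so the embedding applies to limits of periodic points, which include the supports of invariant
 measures. If the entropy were positive, a minimal compact invariant set of exponential complexity would have a dense
 recurrent, hence periodic, orbit, of only linear complexity. *)
Require Import Defs.
From mathcomp Require Import all_boot all_order all_algebra.
From mathcomp Require Import all_classical all_reals all_analysis.
From mathcomp Require Import measurable_realfun.
From mathcomp Require Import ring lra zify.
Import Order.TTheory GRing.Theory Num.Theory.
Import numFieldNormedType.Exports.
Set Implicit Arguments.
Unset Strict Implicit.
Unset Printing Implicit Defensive.
Local Open Scope classical_set_scope.
Local Open Scope ring_scope.
(* Discards the variables foreign to the goal, which makes [lra] much faster; [keep] protects section variables. *)
Ltac rel_lra keep := first [solve [repeat match goal with v : ?T |- _ => lazymatch type of T with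
 | Prop => fail | _ => lazymatch keep with context [v] => fail | _ => clear dependent v end end end; lra] | lra].
Ltac lraR := rel_lra True.

(** Alternations replace zeros because they form an open condition and need no regularity: the
    maximum principle is applied to the product of the values of [w] at n ordered points, a function
    on a compact space of configurations. A Gaussian factor in the gaps makes this product decay for
    large n, so recurrent pairs have boundedly many alternations. The delicate point is the
    simplicity of zeros for mere limits of recurrent pairs. There a degenerate zero at time 1 is
    split by a small perturbation made slightly earlier, at a time when all zeros are simple and no
    alternation can be gained; the first-order response to the perturbation is computed through the
    heat semigroup in Fourier coordinates. As the norm of the phase space is an infimum over weak
    data, it is first translated into Fourier coefficients. The winding argument needs a velocity
    that is continuous on the attractor for the norm of [X]; this comes from second differences in
    time of size h^(3/2), obtained from the C^2 regularity of f and [alpha] > 3/4. *)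

Section continuous_functions.
Context {R : realType} {T : topologicalType}.
Implicit Types f g : T -> R.

Lemma ctsD f g : continuous f -> continuous g -> continuous (fun x => f x + g x).
Proof. by move=> cf cg x; exact: (cvgD (cf x) (cg x)). Qed.

Lemma ctsB f g : continuous f -> continuous g -> continuous (fun x => f x - g x).
Proof. by move=> cf cg x; exact: (cvgB (cf x) (cg x)). Qed.

Lemma ctsM f g : continuous f -> continuous g -> continuous (fun x => f x * g x).
Proof. by move=> cf cg x; exact: (cvgM (cf x) (cg x)). Qed.

Lemma ctsZ c f : continuous f -> continuous (fun x => c * f x).
Proof. by move=> cf x; exact: (cvgM (cvg_cst c) (cf x)). Qed.

Lemma ctsN f : continuous f -> continuous (fun x => - f x).
Proof. by move=> cf x; exact: (cvgN (cf x)). Qed.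

Lemma cts_abs f : continuous f -> continuous (fun x => `|f x|).
Proof. by move=> cf x; exact: (cvg_norm (cf x)). Qed.

Lemma ctsC (c : R) : continuous (fun _ : T => c).
Proof. by move=> x; exact: cvg_cst. Qed.

Lemma cts_comp (U V : topologicalType) (f : T -> U) (g : U -> V) :
 continuous f -> continuous g -> continuous (fun x => g (f x)).
Proof. by move=> cf cg x; apply: continuous_comp; [exact: cf | exact: cg]. Qed.

Lemma cts_pair (U V : topologicalType) (f : T -> U) (g : T -> V) :
 continuous f -> continuous g -> continuous (fun x => (f x, g x)).
Proof. by move=> cf cg x; apply: cvg_pair; [exact: cf | exact: cg]. Qed.

Lemma cts_exp f n : continuous f -> continuous (fun x => f x ^+ n).
Proof. by move=> cf; apply: (cts_comp (g := fun y : R => y ^+ n) cf); exact: exprn_continuous. Qed.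

End continuous_functions.

Lemma cts2 (R : realType) (T : topologicalType) (w : R -> R -> R) (f g : T -> R) :
 continuous (fun p : R * R => w p.1 p.2) -> continuous f -> continuous g ->
 continuous (fun x => w (f x) (g x)).
Proof. by move=> cw cf cg; apply: (cts_comp (f := fun p => (f p, g p)) _ cw); exact: cts_pair. Qed.

Lemma cts_fst (T U : topologicalType) : continuous (@fst T U).
Proof. by move=> x; exact: cvg_fst. Qed.

Lemma cts_snd (T U : topologicalType) : continuous (@snd T U).
Proof. by move=> x; exact: cvg_snd. Qed.

Lemma cts_id (T : topologicalType) : continuous (fun x : T => x).
Proof. by move=> x; exact: cvg_id. Qed.

(** * Derivatives and extremum tests in one real variable *)

Section calculus.
Context {R : realType}.
Implicit Types (f g : R -> R) (x y d e : R).

Lemma below2 x y : 0 < x -> 0 < y -> exists h, [/\ 0 < h, h < x & h < y].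
Proof.
move=> x0 y0; exists (Num.min x y / 2).
have m0 : 0 < Num.min x y by rewrite lt_min x0.
have [m1 m2] : Num.min x y <= x /\ Num.min x y <= y by rewrite !ge_min !lexx orbT.
by split; lra.
Qed.

Lemma is_derive_eps f x d : is_derive x 1 f d -> forall e, 0 < e ->
 exists2 r, 0 < r & forall y, `|y - x| < r -> `|f y - f x - d * (y - x)| <= e * `|y - x|.
Proof.
move=> [df <-] e e0; have := df; rewrite /derivable => /cvg_ex[l fl].
have lE : l = 'D_1 f x by rewrite /derive; apply/esym/cvg_lim.
rewrite -lE; move/cvgrPdist_lt : fl => /(_ _ e0).
rewrite near_withinE near_nbhs /= => /nbhs_ballP[r /= r0 H].
exists r => // y yx; have [->|yx0] := eqVneq y x.
 by rewrite !subrr mulr0 subrr normr0 mulr0.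
have := H (y - x); rewrite /ball /= sub0r normrN => /(_ yx) H1.
have yx' : y - x != 0 by rewrite subr_eq0.
move: (H1 yx').
rewrite scaler1 subrK => /ltW.
have yx1 : 0 < `|y - x| by rewrite normr_gt0 subr_eq0.
rewrite -(ler_pM2r yx1) -normrM -normrN; congr (`|_| <= _).
by rewrite -mulNr opprB mulrBl /GRing.scale /= mulrAC mulVf // mul1r.
Qed.

(** Only values to the left are compared: in the comparison arguments the contact happens at the
    last time for which the inequality is known, so nothing is available at later times. *)
Lemma left_max_derive_ge0 f x d r : 0 < r -> is_derive x 1 f d ->
 (forall y, x - r < y <= x -> f y <= f x) -> 0 <= d.
Proof.
move=> r0 fd H; rewrite leNgt; apply/negP => d0.
have [s s0 sH] := is_derive_eps fd (e := - d / 2) ltac:(lra).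
have [h [h0 hr hs]] := below2 r0 s0.
have := sH (x - h); have -> : x - h - x = - h by ring.
rewrite normrN gtr0_norm// => /(_ hs); rewrite ler_norml => /andP[H1 _].
have := H (x - h) ltac:(lra); nra.
Qed.

Lemma max_derive_eq0 f x d r : 0 < r -> is_derive x 1 f d ->
 (forall y, `|y - x| < r -> f y <= f x) -> d = 0.
Proof.
move=> r0 fd H; apply/eqP; rewrite eq_le; apply/andP; split; last first.
 by apply: (left_max_derive_ge0 r0 fd) => y yx; apply: H; rewrite ltr_norml; lra.
rewrite leNgt; apply/negP => d0.
have [s s0 sH] := is_derive_eps fd (e := d / 2) ltac:(lra).
have [h [h0 hr hs]] := below2 r0 s0.
have := sH (x + h); have -> : x + h - x = h by ring.
rewrite gtr0_norm// => /(_ hs); rewrite ler_norml => /andP[H1 _].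
have := H (x + h); have -> : x + h - x = h by ring.
by rewrite gtr0_norm// => /(_ hr); nra.
Qed.

Lemma is_derive_cont f x d : is_derive x 1 f d -> {for x, continuous f}.
Proof. by move=> [/derivable1_diffP/differentiable_continuous]. Qed.

Lemma mvt f g x y : x < y -> (forall z, x <= z <= y -> is_derive z 1 f (g z)) ->
 exists2 z, x < z < y & f y - f x = g z * (y - x).
Proof.
move=> xy H; have [||z zxy e] := @MVT R f g x y xy.
- by move=> z zI; apply: H; move: zI; rewrite in_itv/=; lra.
- apply: continuous_in_subspaceT => z; rewrite inE/= in_itv/= => /H; exact: is_derive_cont.
- by exists z => //; move: zxy; rewrite in_itv.
Qed.

Lemma max_derive2_le0 f g x d r : 0 < r -> (forall y, `|y - x| < r -> is_derive y 1 f (g y)) ->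
 is_derive x 1 g d -> (forall y, `|y - x| < r -> f y <= f x) -> d <= 0.
Proof.
move=> r0 fg gd H; rewrite leNgt; apply/negP => d0.
have g0 : g x = 0 by apply: (max_derive_eq0 r0 _ H); apply: fg; rewrite subrr normr0.
have [s s0 sH] := is_derive_eps gd (e := d / 2) ltac:(lra).
have [h [h0 hr hs]] := below2 r0 s0.
have [|z|z zI] := @mvt f g x (x + h); first lra.
 by move=> zx; apply: fg; rewrite ltr_norml; lra.
have -> : x + h - x = h by ring.
have := sH z; rewrite g0 subr0 ger0_norm; last lra.
move=> /(_ ltac:(lra)); rewrite ler_norml => /andP[H1 _] H2.
have gz : 0 < g z by nra.
have := H (x + h); have -> : x + h - x = h by ring.
by rewrite gtr0_norm// => /(_ hr); nra.
Qed.

Lemma dD f g x a b : is_derive x 1 f a -> is_derive x 1 g b ->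
 is_derive x 1 (fun y => f y + g y) (a + b).
Proof. exact: is_deriveD. Qed.

Lemma dB f g x a b : is_derive x 1 f a -> is_derive x 1 g b ->
 is_derive x 1 (fun y => f y - g y) (a - b).
Proof. exact: is_deriveB. Qed.

Lemma dM f g x a b : is_derive x 1 f a -> is_derive x 1 g b ->
 is_derive x 1 (fun y => f y * g y) (a * g x + f x * b).
Proof.
move=> fa gb; apply: is_derive_eq (is_deriveM fa gb) _.
by rewrite /GRing.scale /= addrC mulrC.
Qed.

Lemma dN f x a : is_derive x 1 f a -> is_derive x 1 (fun y => - f y) (- a).
Proof. exact: is_deriveN. Qed.

Lemma dcst (c : R) x : is_derive x 1 (fun _ => c) 0.
Proof. exact: is_derive_cst. Qed.

Lemma did x : is_derive x 1 (fun y : R => y) 1.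
Proof. exact: is_derive_id. Qed.

Lemma dcomp f g x a b : is_derive (g x) 1 f a -> is_derive x 1 g b ->
 is_derive x 1 (fun y => f (g y)) (a * b).
Proof. exact: is_derive1_comp. Qed.

Lemma dcM f x c a : is_derive x 1 f a -> is_derive x 1 (fun y => c * f y) (c * a).
Proof. by move=> fa; apply: is_derive_eq (dM (dcst c x) fa) _; rewrite mul0r add0r. Qed.

Lemma dsq f x a : is_derive x 1 f a -> is_derive x 1 (fun y => f y ^+ 2) (2 * f x * a).
Proof. by move=> fa; apply: is_derive_eq (dM fa fa) _; ring. Qed.

Lemma dexp f x a : is_derive x 1 f a ->
 is_derive x 1 (fun y => expR (f y)) (expR (f x) * a).
Proof. by move=> fa; apply: dcomp fa; exact: is_derive_expR. Qed.

Lemma dsum (I : finType) (f : I -> R -> R) x (a : I -> R) :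
 (forall i, is_derive x 1 (f i) (a i)) ->
 is_derive x 1 (fun y => \sum_i f i y) (\sum_i a i).
Proof.
move=> fa; elim: (index_enum I) => [|i l IH].
 by under eq_fun do rewrite big_nil; rewrite big_nil; exact: dcst.
by under eq_fun do rewrite big_cons; rewrite big_cons; exact: dD.
Qed.

Lemma deq f x a b : is_derive x 1 f a -> a = b -> is_derive x 1 f b.
Proof. by move=> H <-. Qed.

Lemma dshift f c x a : is_derive (x + c) 1 f a -> is_derive x 1 (fun y => f (y + c)) a.
Proof. by move=> H; apply: deq (@dcomp f (fun y => y + c) x _ _ H (dD (did x) (dcst c x))) _; ring. Qed.

End calculus.

Lemma inv_le (R : realType) i j : (i <= j)%N -> j.+1%:R^-1 <= i.+1%:R^-1 :> R.
Proof. by move=> ij; rewrite lef_pV2 ?posrE ?ltr0n// ler_nat ltnS. Qed.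

(** Skeleton of the maximum principle arguments below. The set where z >= 0 is compact, so it has an
    earliest point; this lies at a positive time, z vanishes there, and by continuity z <= 0 on the
    whole past. The hypothesis has to refute such a contact. *)
Lemma first_touch (R : realType) (Y : topologicalType) (K : set Y) (T : R) (z : R * Y -> R) :
 compact K -> continuous z -> (forall y, K y -> z (0, y) < 0) ->
 (forall (t : R) y, 0 < t <= T -> K y -> z (t, y) = 0 ->
  (forall (s : R) y', 0 <= s <= t -> K y' -> z (s, y') <= 0) -> False) ->
 forall (t : R) y, 0 <= t <= T -> K y -> z (t, y) < 0.
Proof.
move=> cK cz z0 H t1 y1 t1T Ky1; rewrite ltNge; apply/negP => z1.
pose P := (`[0, T]%classic `*` K) `&` [set p | 0 <= z p].
have cP : compact P.
 apply: compact_closedI; first by apply: compact_setX => //; exact: segment_compact.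
 have -> : [set p | 0 <= z p] = z @^-1` [set x | 0 <= x] by [].
 by apply: preimage_closed => [p _|]; [exact: cz | exact: closed_ge].
have P0 : P !=set0 by exists (t1, y1); split => //; split => //=; rewrite in_itv.
have [|[t y]] := compact_EVT_min P0 cP (f := fst).
 by apply: continuous_subspaceT => p; exact: cvg_fst.
rewrite inE => -[[/= tT Ky] zty] tmin; move: tT; rewrite in_itv/= => tT.
have neg (s : R) y' : 0 <= s < t -> K y' -> z (s, y') < 0.
 move=> st Ky'; rewrite ltNge; apply/negP => zs.
 have /tmin /= : (s, y') \in P; last by lra.
 by rewrite inE; split => //; split => //=; rewrite in_itv/=; lra.
have t0 : 0 < t by rewrite lt_neqAle; case: eqVneq zty => [<-|_]//=; [move: (z0 _ Ky); lra | lra].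
have le (s : R) y' : 0 <= s <= t -> K y' -> z (s, y') <= 0.
 move=> /andP[s0]; rewrite le_eqVlt => /orP[/eqP->|st] Ky'; last by apply/ltW/neg => //; lra.
 rewrite leNgt; apply/negP => zp.
 have /cvgrPdist_lt/(_ _ zp) := cz (t, y').
 move=> [[A B] /= [/nbhs_ballP[r /= r0 rA] B'] AB].
 have [h [h0 hr ht]] := below2 r0 t0.
 have /AB /= : (A `*` B) (t - h, y').
  split => /=; last exact: nbhs_singleton.
  by apply: rA; rewrite /ball/= ltr_norml; lra.
 have := neg (t - h) y' ltac:(lra) Ky'.
 by rewrite ltr_norml; lra.
apply: (H t y) => //; first lra.
by apply/eqP; rewrite eq_le zty andbT; apply: le => //; lra.
Qed.

(* Compactness in terms of sequences: a cluster point, visited at arbitrarily late indices. *)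
Lemma compact_seq (R : realType) (T : pseudoMetricType R) (K : set T) (u : nat -> T) :
 compact K -> (forall n, K (u n)) ->
 exists2 p, K p & exists2 phi : nat -> nat, (forall n, (n <= phi n)%N) &
  forall n, ball p (n.+1%:R^-1) (u (phi n)).
Proof.
move=> cK Ku.
have [|p [Kp cp]] := cK (u @ \oo) _; first by exists 0%N => // n _; exact: Ku.
exists p => //.
have /choice[phi H] : forall n, exists k, (n <= k)%N /\ ball p (n.+1%:R^-1) (u k).
 move=> n; have := cp [set u k | k in [set k | (n <= k)%N]] (ball p (n.+1%:R^-1)).
 case=> [||_ [[k /= nk <-] ?]]; last by exists k.
 - by exists n => // k /= nk; exists k.
 - by apply: nbhsx_ballx; rewrite invr_gt0.
by exists phi => n; have [] := H n.
Qed.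

Lemma inv_small (R : realType) (e : R) : 0 < e -> exists n : nat, n.+1%:R^-1 < e.
Proof.
move=> e0; exists (Num.truncn e^-1); rewrite invf_plt ?posrE ?ltr0n//; exact: truncnS_gt.
Qed.

Lemma linear_lt_power (R : realType) (x A : R) : 1 < x -> exists n : nat, n.+1%:R * A < x ^+ n.
Proof.
move=> x1; pose d := x - 1; have d0 : 0 < d by rewrite subr_gt0.
have bern (n : nat) : n%:R * d <= x ^+ n.
 suff : 1 + n%:R * d <= x ^+ n by apply: le_trans; rewrite lerDr.
 elim: n => [|n IH]; first by rewrite mul0r addr0.
 rewrite exprS; apply: le_trans (ler_wpM2l (ltW (lt_trans ltr01 x1)) IH).
 have q0 : 0 <= n%:R * d * d by rewrite !mulr_ge0 ?(ltW d0).
 have -> : x * (1 + n%:R * d) = 1 + n.+1%:R * d + n%:R * d * d by rewrite -natr1 /d; ring.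
 by rewrite lerDl.
pose B := `|A| + 1; have B0 : 0 < B by rewrite ltr_wpDl.
(* By Bernoulli x^(2n) >= (n d)^2, and n d^2 > 3 B makes this exceed 3 n B, which is at least (2n +
   1) A. *)
pose n := (Num.truncn (3 * B / d ^+ 2)).+1.
have nb : 3 * B / d ^+ 2 < n%:R by exact: truncnS_gt.
exists (n + n)%N; rewrite exprD.
have n1 : 1 <= n%:R :> R by rewrite ler1n.
have H := bern n; have nd : 0 <= n%:R * d by rewrite mulr_ge0 ?ler0n ?(ltW d0).
apply: lt_le_trans (ler_pM nd nd H H).
have AB : A < B by rewrite /B; have := ler_norm A; lra.
have d20 : 0 < d ^+ 2 by rewrite exprn_gt0.
rewrite ltr_pdivrMr// in nb.
have -> : n%:R * d * (n%:R * d) = n%:R * (n%:R * d ^+ 2) by ring.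
apply: lt_le_trans (_ : n%:R * (3 * B) <= _); last by rewrite ler_pM2l ?ltr0n// ltW.
have -> : (n + n).+1%:R = n%:R + n%:R + 1 :> R by rewrite -natr1 natrD.
move: n1; move: (n%:R) => m n1; nra.
Qed.

(** * Covers by dynamically small sets and minimal sets of exponential complexity *)

Section covers.
Context {R : realType} {T : pseudoPMetricType R}.
Variables (F : T -> T) (Gam : set T) (e : R).
Hypotheses (Fc : continuous F) (Gc : compact Gam) (Gcl : closed Gam)
 (GF : forall x, Gam x -> Gam (F x)) (e0 : 0 < e).
Implicit Types (K L D : set T) (n m k c : nat) (x y v w : T).

Definition small n D := forall x y, D x -> D y -> forall k, (k < n)%N -> ball (iter k F x) e (iter k F y).

(** Covering numbers for the metric of orbit segments of length n. Open covers are preferred to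
    separated sets because they multiply along orbits ([cov_mul]) and pass to intersections of
    chains of compact sets ([chain_cov]). *)
Definition cov n K c := exists (I : finType) (D : I -> set T),
 [/\ (#|I| <= c)%N, forall i, open (D i), forall i, small n (D i) & forall x, K x -> exists i, D i x].

Lemma iter_cts n : continuous (iter n F).
Proof. by elim: n => [|n IH] x; [exact: cvg_id | apply: continuous_comp; [exact: IH | exact: Fc]]. Qed.

Lemma iter_stable K n x : (forall x, K x -> K (F x)) -> K x -> K (iter n F x).
Proof. by move=> KF Kx; elim: n => [|n IH] //=; exact: KF. Qed.

Lemma cov_sub n K L c d : K `<=` L -> (c <= d)%N -> cov n L c -> cov n K d.
Proof. by move=> KL cd [I [D [Ic Do Ds Dc]]]; exists I, D; split=> // [|x /KL/Dc//]; exact: leq_trans cd. Qed.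

Lemma cov_len n m K c : (n <= m)%N -> cov m K c -> cov n K c.
Proof.
move=> nm [I [D [Ic Do Ds Dc]]]; exists I, D; split=> // i x y Dx Dy k kn.
by apply: (Ds i) => //; exact: leq_trans nm.
Qed.

(** A piece of the new cover records the piece containing x and the piece containing its n-th
    iterate. *)
Lemma cov_mul n k K L c d : (forall x, K x -> L (iter n F x)) -> cov n K c -> cov k L d -> cov (n + k) K (c * d).
Proof.
move=> KL [I [D [Ic Do Ds Dc]]] [J [E [Jc Eo Es Ec]]].
exists (I * J)%type, (fun q => D q.1 `&` (iter n F @^-1` E q.2)); split.
- by rewrite card_prod leq_mul.
- by move=> q; apply: openI => //; apply: open_comp => // x _; exact: iter_cts.
- move=> q x y [Dx Ex] [Dy Ey] l lk; have [ln|nl] := ltnP l n; first exact: (Ds q.1).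
 by rewrite -(subnK nl) !iterD; apply: (Es q.2) => //; rewrite ltn_subLR.
- move=> x Kx; have [i Di] := Dc x Kx; have [j Ej] := Ec _ (KL x Kx); by exists (i, j).
Qed.

Lemma cov_U n K L c d : cov n K c -> cov n L d -> cov n (K `|` L) (c + d).
Proof.
move=> [I [D [Ic Do Ds Dc]]] [J [E [Jc Eo Es Ec]]].
exists (I + J)%type, (fun q => match q with inl i => D i | inr j => E j end); split.
- by rewrite card_sum leq_add.
- by case.
- by case.
- by move=> x [/Dc[i Di]|/Ec[j Ej]]; [exists (inl i) | exists (inr j)].
Qed.

Lemma cov_0 n c : cov n set0 c.
Proof. by exists void, (fun _ => set0); split=> //; rewrite card_void. Qed.

Lemma cov_len0 K : cov 0 K 1.
Proof. by exists unit, (fun _ => setT); split=> [|_|_|x _]; [by rewrite card_unit | exact: openT | by [] | by exists tt]. Qed.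

Lemma cov_base : exists2 m, (0 < m)%N & cov 1 Gam m.
Proof.
have e2 : 0 < e / 2 by rewrite divr_gt0.
move: (Gc); rewrite compact_cover => /(_ T setT (fun x => (ball x (e / 2))^°)) [||S _ Sc].
- by move=> i _; exact: open_interior.
- by move=> x Gx; exists x => //; exact: nbhsx_ballx.
pose s : seq T := finmap.enum_fset S; exists (size s).+1 => //.
exists 'I_(size s), (fun i => (ball (tnth (in_tuple s) i) (e / 2))^°); split.
- by rewrite card_ord.
- by move=> i; exact: open_interior.
- move=> i x y /interior_subset xi /interior_subset yi [|//] _ /=.
 exact: (ball_splitr xi).
- move=> x /Sc[i /= iS ix]; have /seq_tnthP[j E] : i \in s by [].
 by exists j; rewrite -E.
Qed.

Lemma cov_pow n L c m : (forall x, L x -> L (iter n F x)) -> cov n L c -> cov (m * n) L (c ^ m).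
Proof.
move=> LF H; elim: m => [|m IH]; first exact: cov_len0.
by rewrite mulSn expnS; exact: cov_mul H IH.
Qed.

(** By compactness: if every member of the chain left the open union of the cover, the closed
    remainders would have a common point, lying in the intersection and outside the cover. *)
Lemma chain_cov (P : set (set T)) n c : (exists K, P K) -> (forall K L, P K -> P L -> K `<=` L \/ L `<=` K) ->
 (forall K, P K -> closed K /\ K `<=` Gam) -> cov n (\bigcap_(K in P) K) c -> exists2 K, P K & cov n K c.
Proof.
move=> [K0 PK0] tot cl [I [D [Ic Do Ds Dc]]]; apply: contrapT => H.
pose U := \bigcup_i D i; have Uo : open U by apply: bigcup_open.
have ne K : P K -> exists x, K x /\ ~ U x.
 move=> PK; apply: contrapT => H'; apply: H; exists K => //; exists I, D; split=> // x Kx.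
 have [[i _ Di]|nU] := pselect (U x); first by exists i.
 by case: H'; exists x.
pose FF := filter_from P (fun K => K `\` U).
have Ff : ProperFilter FF.
 apply: filter_from_proper; last by move=> K /ne[x xP]; exists x.
 apply: filter_from_filter; first by exists K0.
 move=> K L PK PL; have [KL|LK] := tot K L PK PL; [exists K => // | exists L => //] => x [h nU].
  by split; split=> //; exact: KL.
 by split; split=> //; exact: LK.
have FG : FF Gam by exists K0 => // x [/(cl K0 PK0).2].
have [x [Gx cx]] := Gc Ff FG.
have inK K : P K -> K x /\ ~ U x.
 move=> PK; have : closed (K `\` U) by rewrite setDE; apply: closedI; [exact: (cl K PK).1 | exact: open_closedC].
 move=> /(_ x); apply=> V Vx; apply: cx => //; exists K => //.
by have [i Di] := Dc x (fun K PK => (inK K PK).1); apply: (inK K0 PK0).2; exists i.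
Qed.

Variable rho : R.
Hypothesis rho1 : 1 < rho.

(** Positive entropy at scale [e] with rate log [rho], stated without a multiplicative constant: by
    submultiplicativity a single cover of some length n > 0 with fewer than rho^n pieces already
    rules out growth at this rate. *)
Definition big K := forall n c, cov n K c -> rho ^+ n <= c%:R.

Lemma not_big K : ~ big K -> exists n c, [/\ (0 < n)%N, cov n K c & c%:R < rho ^+ n].
Proof.
move=> H; apply: contrapT => H'; apply: H => n c H; rewrite leNgt; apply/negP => lt.
case: n H lt => [|n] H lt; last by apply: H'; exists n.+1, c.
(* For n = 0 a failure means c = 0: the family is empty, hence so is K, and the same empty family
   serves at length 1. *)
have c0 : c = 0%N by move: lt; rewrite expr0 ltrn1; case: (c).
apply: H'; exists 1%N, 0%N; split=> //; last by rewrite expr1 (lt_trans ltr01).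
case: H => I [D [Ic _ _ Dc]]; exists I, D; rewrite c0 in Ic *; have I0 (i : I) : False by move: Ic; rewrite leqn0 => /eqP/card0_eq/(_ i).
by split=> // [i|i|x /Dc[i]]; case: (I0 i).
Qed.

Definition good K := [/\ closed K, K `<=` Gam, forall x, K x -> K (F x) & big K].
Definition minimal K := good K /\ forall L, good L -> L `<=` K -> L = K.

(** Zorn for reverse inclusion; [big] survives intersections of chains thanks to [chain_cov]. *)
Lemma minimal_exists : big Gam -> exists K, minimal K.
Proof.
move=> Gbig; pose S := {K : set T | good K}; pose rel (s t : S) : bool := `[< sval t `<=` sval s >].
have GG : good Gam by split.
have [||||t tP] := @Zorn S rel.
- by move=> t; apply/asboolP.
- by move=> r s t /asboolP rs /asboolP s_t; apply/asboolP; exact: subset_trans s_t rs.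
- move=> [s sP] [t tP] /asboolP /= ts /asboolP /= st; have E : s = t by apply/seteqP.
 by subst t; congr exist; exact: Prop_irrelevance.
- move=> A tot; have [[s0 As0]|nA] := pselect (exists s, A s); last first.
  by exists (exist _ Gam GG) => s As; case: nA; exists s.
 pose P : set (set T) := [set sval s | s in A].
 have PT K L : P K -> P L -> K `<=` L \/ L `<=` K.
  by move=> [s As <-] [t At <-]; have [/asboolP|/asboolP] := tot s t As At; [right|left].
 have Pcl K : P K -> closed K /\ K `<=` Gam by move=> [s As <-]; have [] := svalP s.
 have HG : good (\bigcap_(K in P) K).
  split.
  - by apply: closed_bigI => K /Pcl[].
  - move=> x Kx; have [_ sub _ _] := svalP s0; apply: sub; apply: Kx; by exists s0.
  - move=> x Kx K PK; have := Kx K PK; case: PK => s As <-; have [_ _ LF _] := svalP s; exact: LF.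
  - move=> n c H; have PS : exists K, P K by exists (sval s0), s0.
   have [K [s As <-] HK] := chain_cov PS PT Pcl H.
   by have [_ _ _ Lb] := svalP s; exact: Lb HK.
 exists (exist _ _ HG) => s As; apply/asboolP => /= x xP; apply: xP; exists s => //.
- exists (sval t); split; first by case: (t).
 move=> L gL Lt; have := tP (exist _ L gL) ltac:(by apply/asboolP).
 by move=> <-.
Qed.


Section transitivity.
Variable K : set T.
Hypothesis Km : minimal K.

Let Kg : good K. Proof. by case: Km. Qed.
Let Kcl : closed K. Proof. by case: Kg. Qed.
Let KG : K `<=` Gam. Proof. by case: Kg. Qed.
Let KF x : K x -> K (F x). Proof. by case: Kg => _ _ + _; apply. Qed.
Let Kb : big K. Proof. by case: Kg. Qed.
Let Kit n x : K x -> K (iter n F x). Proof. exact: iter_stable. Qed.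

Definition avoid (O : set T) : set T := [set x | K x /\ forall k, ~ O (iter k F x)].
Definition seg (O : set T) j : set T := [set x | K x /\ forall i, (i < j)%N -> ~ O (iter i F x)].

Lemma seg_closed (O : set T) j : open O -> closed (seg O j).
Proof.
move=> Oo; rewrite (_ : seg O j = K `&` \bigcap_(i in [set i | (i < j)%N]) (iter i F @^-1` (~` O))).
 apply: closedI => //; apply: closed_bigI => i _; apply: closed_comp; first by move=> x _; exact: iter_cts.
 exact: open_closedC.
by apply/seteqP; split=> x [Kx H]; split.
Qed.

Lemma avoidE (O : set T) : avoid O = \bigcap_(L in [set seg O j | j in setT]) L.
Proof.
apply/seteqP; split=> [x [Kx H] _ [j _ <-]|x H]; first by split=> // i _; exact: H.
split; first by have [] := H _ (ex_intro2 _ _ 0%N I erefl).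
by move=> k; have [_] := H _ (ex_intro2 _ _ k.+1 I erefl); apply.
Qed.

(** The orbits that never meet O form a closed forward invariant set different from K, so by
    minimality it cannot be [big]. *)
Lemma avoid_small (O : set T) : open O -> (exists2 x, K x & O x) -> exists n c, [/\ (0 < n)%N, cov n (avoid O) c & c%:R < rho ^+ n].
Proof.
move=> Oo [x Kx Ox]; apply: not_big => bg; have E : avoid O = K; last first.
 by move: Kx; rewrite -E => -[_ /(_ 0%N)]; apply.
have [_ mn] := Km; apply: mn; last by move=> y [].
- split.
 + by rewrite avoidE; apply: closed_bigI => _ [j _ <-]; exact: seg_closed.
 + by move=> y [/KG].
 + by move=> y [Ky H]; split=> [|k]; [exact: KF | rewrite -iterSr; exact: H].
 + exact: bg.
Qed.

Lemma avoid_pow (O : set T) n c m : cov n (avoid O) c -> cov (m * n) (avoid O) (c ^ m).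
Proof. by apply: cov_pow => x [Kx H]; split=> [|k]; [exact: Kit | rewrite -iterD; exact: H]. Qed.

Lemma power_lt n c m : c%:R < rho ^+ n -> (0 < m)%N -> (c ^ m)%N%:R < rho ^+ (m * n).
Proof. by move=> H m0; rewrite mulnC exprM natrX ltrXn2r ?nnegrE ?exprn_ge0 ?(ltW (lt_trans ltr01 rho1))// -lt0n. Qed.

(** If no orbit went from O1 to O2 after at least p steps, each orbit of K would avoid O1 until a
    first hit and, from p steps later, avoid O2 forever. Both avoiding sets grow more slowly than
    rho^n, and the block of the first hit can be chosen in linearly many ways only, so K itself
    would grow more slowly. *)
Lemma minimal_transitive (O1 O2 : set T) p : open O1 -> open O2 -> (exists2 x, K x & O1 x) -> (exists2 x, K x & O2 x) ->
 exists x k, [/\ K x, O1 x, (p <= k)%N & O2 (iter k F x)].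
Proof.
move=> o1 o2 n1 n2; apply: contrapT => H.
have {}H x k : K x -> O1 x -> (p <= k)%N -> ~ O2 (iter k F x) by move=> Kx Ox pk O2x; apply: H; exists x, k.
have [N1 [c1 [N10 C1 l1]]] := avoid_small o1 n1; have [N2 [c2 [N20 C2 l2]]] := avoid_small o2 n2.
(* A common block length for the two avoiding sets: each is covered by B pieces, with B < rho^N. *)
pose N := (N1 * N2)%N; pose B := maxn 1 (maxn (c1 ^ N2) (c2 ^ N1)).
have N0 : (0 < N)%N by rewrite muln_gt0 N10.
have B0 : (0 < B)%N by rewrite leq_maxl.
have rN : 1 < rho ^+ N by rewrite exprn_egt1// -lt0n.
have BN : B%:R < rho ^+ N.
 have h1 := power_lt l1 N20; have h2 := power_lt l2 N10; rewrite mulnC -/N in h1; rewrite -/N in h2.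
 by rewrite /B /maxn; case: ifP => _; [case: ifP | exact: rN].
have C1' : cov N (avoid O1) B.
 have := avoid_pow N2 C1; rewrite mulnC; apply: cov_sub => //.
 by rewrite /B !leq_max leqnn !orbT.
have C2' : cov N (avoid O2) B.
 by have := avoid_pow N1 C2; apply: cov_sub => //; rewrite /B !leq_max leqnn !orbT.
have [m m0 Cm] := cov_base.
have CG n L : L `<=` Gam -> cov n L (m ^ n).
 move=> LG; apply: (cov_sub LG (leqnn _)); rewrite -[n in cov n]muln1; exact: cov_pow.
(* By compactness the cover of [avoid O1] already covers the points that avoid O1 during l blocks, a
   condition on finite orbit segments. *)
have [l Cl] : exists l, cov N (seg O1 (l * N)) B.
 pose P := [set seg O1 j | j in setT].
 have seg_mono i j : (i <= j)%N -> seg O1 j `<=` seg O1 i.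
  by move=> ij x [Kx h]; split=> // k ki; apply: h; exact: leq_trans ij.
 have [||||_ [j _ <-] Cj] := @chain_cov P N B.
 - by exists (seg O1 0), 0%N.
 - by move=> _ _ [i _ <-] [j _ <-]; case: (leqP i j) => h; [right | left]; apply: seg_mono => //; exact: ltnW.
 - by move=> _ [j _ <-]; split; [exact: seg_closed | move=> x [/KG]].
 - by rewrite -avoidE.
 by exists j; apply: cov_sub Cj => //; apply: seg_mono; exact: leq_pmulr.
have segF O i j n x : seg O (i + j) x -> (n <= i)%N -> seg O j (iter n F x).
 move=> [Kx h] ni; split; first exact: Kit.
 by move=> k kj; rewrite -iterD; apply: h; have := leq_add ni kj; rewrite addnS [(n + k)%N]addnC.
have Cseg b : cov (b * N) (seg O1 (b * N + l * N)) (B ^ b).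
 elim: b => [|b IH]; first exact: cov_len0.
 rewrite mulSn expnS; apply: (@cov_mul _ _ _ (seg O1 (b * N + l * N))) IH.
  by move=> x; rewrite -addnA => h; exact: segF h (leqnn _).
 apply: cov_sub (Cl) => // x [Kx h]; split=> // i il; apply: h; apply: leq_trans il _.
 by rewrite -addnA addnA leq_addl.
pose Q := (m ^ ((l + 1 + p) * N))%N.
have Cseg' a : cov (a * N) (seg O1 (a * N)) (B ^ a * m ^ (l * N)).
 have [al|la] := leqP a l.
  apply: cov_sub (CG _ (seg O1 (a * N)) _) => //; last by move=> x [/KG].
  apply: leq_trans (_ : 1 * m ^ (l * N) <= _)%N; last by rewrite leq_mul2r expn_gt0 B0 orbT.
  by rewrite mul1n leq_pexp2l// leq_mul2r al orbT.
 have -> : (a * N = (a - l) * N + l * N)%N by rewrite -mulnDl subnK// ltnW.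
 apply: cov_sub (cov_mul (L := Gam) _ (Cseg (a - l)%N) (CG (l * N)%N Gam (fun _ h => h))) => //.
  by rewrite leq_mul2r leq_pexp2l ?leq_subr ?orbT.
 by move=> x [Kx _]; exact: KG (Kit _ Kx).
(* Points whose first visit to O1 falls in block a; after (a + 1 + p) N steps their orbits lie in
   [avoid O2]. *)
pose cls a : set T := [set x | seg O1 (a * N) x /\ exists2 r, (r < N)%N & O1 (iter (a * N + r) F x)].
have Ccls i a : (a <= i)%N -> cov (i * N) (cls a) (Q * B ^ i).
 move=> ai; apply: (@cov_len _ ((a * N + (1 + p) * N) + (i - a) * N)).
  by rewrite -!mulnDl leq_mul2r; apply/orP; right; lia.
 have H2 : cov (a * N + (1 + p) * N) (cls a) (B ^ a * m ^ (l * N) * m ^ ((1 + p) * N)).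
  apply: (@cov_mul _ _ _ Gam); last exact: CG.
   by move=> x [[Kx _] _]; exact: KG (Kit _ Kx).
  by apply: cov_sub (Cseg' a) => // x [].
 apply: cov_sub (cov_mul (L := avoid O2) _ H2 (avoid_pow (i - a) C2')) => //.
  rewrite /Q !mulnDl !expnD -[X in (_ <= _ * B ^ X)%N](subnK ai).
  rewrite leq_eqVlt; apply/orP; left; rewrite [(B ^ (_ + _))%N]expnD; apply/eqP.
  clear; move: (B ^ a)%N (B ^ _)%N (m ^ (l * N))%N (m ^ (1 * N))%N (m ^ _)%N => x1 x2 x3 x4 x5; ring.
 move=> x [[Kx _] [r rN' Ox]]; split; first exact: Kit.
 move=> k; rewrite -iterD (_ : k + (a * N + (1 + p) * N) = (k + (1 + p) * N - r) + (a * N + r))%N; last first.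
  by rewrite mulnDl mul1n; lia.
 rewrite iterD; apply: H => //; first exact: Kit.
 by rewrite mulnDl mul1n; have := leq_pmulr p N0; lia.
(* This i gives (i + 1) Q B^i < rho^(N i), against the cover of K by the i classes and the points
   that avoid O1 during i blocks. *)
have [i iP] := @linear_lt_power R (rho ^+ N / B%:R) Q%:R ltac:(by rewrite ltr_pdivlMr ?ltr0n// mul1r).
have CU j : (j <= i)%N -> cov (i * N) (\bigcup_(a in [set a | (a < j)%N]) cls a) (j * (Q * B ^ i)).
 elim: j => [|j IH] ji; first by apply: cov_sub (cov_0 (i * N) 0) => // x [a].
 apply: cov_sub (cov_U (IH (ltnW ji)) (Ccls i j (ltnW ji))) => //; last by rewrite mulSn addnC.
 move=> x [a /= aj cx]; move: aj; rewrite ltnS leq_eqVlt => /orP[/eqP aj|aj]; first by right; rewrite -aj.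
 by left; exists a.
have Q1 : (B ^ i * m ^ (l * N) <= Q * B ^ i)%N.
 by rewrite mulnC leq_mul2r leq_pexp2l ?orbT// leq_mul2r; apply/orP; right; lia.
have CK : cov (i * N) K (i.+1 * (Q * B ^ i)).
 apply: cov_sub (cov_U (CU i (leqnn _)) (Cseg' i)) => //; last by rewrite mulSn addnC leq_add2r.
 move=> x Kx; have [hit|nhit] := pselect (exists j, (j < i * N)%N && `[< O1 (iter j F x) >]); last first.
  by right; split=> // j ji O1x; apply: nhit; exists j; rewrite ji; apply/asboolP.
 case: (ex_minnP hit) => j /andP[ji /asboolP Ox] jmin.
 left; exists (j %/ N)%N; first by rewrite /= ltn_divLR.
 split; last by exists (j %% N)%N; [rewrite ltn_mod | rewrite -divn_eq].
 split=> // k kj O1x; have kj' : (k < j)%N by apply: leq_trans kj (leq_divM _ _).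
 have := jmin k; rewrite (ltn_trans kj' ji) leqNgt kj' => /(_ _) h.
 by have := h ltac:(by apply/asboolP).
have := Kb CK; rewrite leNgt => /negP; apply.
rewrite natrM natrM natrX mulrA -ltr_pdivlMr ?exprn_gt0 ?ltr0n//.
by rewrite mulnC exprM -expr_div_n.
Qed.

Lemma finite_net (d : R) : 0 < d -> exists s : seq T, (forall w, w \in s -> K w) /\ forall x, K x -> exists2 w, w \in s & ball w d x.
Proof.
move=> d0; have Kc : compact K by exact: (subclosed_compact Kcl Gc KG).
move: Kc; rewrite compact_cover => /(_ T K (fun x => (ball x d)^°)) [||S SK Sc].
- by move=> i _; exact: open_interior.
- by move=> x Kx; exists x => //; exact: nbhsx_ballx.
pose s : seq T := finmap.enum_fset S; exists s; split=> [w ws|x /Sc[w /= wS /interior_subset wx]]; last by exists w.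
by have := SK w ws; rewrite inE.
Qed.

(** One stage of a Baire category construction: transitivity is used once for each point of the
    list, shrinking the ball each time. The conclusion holds on the ball of twice the radius, so
    that limits of later centres still satisfy it. *)
Lemma visit (s : seq T) (d : R) p (c : T) (r : R) : 0 < d -> 0 < r -> K c -> (forall w, w \in s -> K w) ->
 exists q : T * R, [/\ 0 < q.2, K q.1 & forall y, ball q.1 (2 * q.2) y -> ball c r y /\
  (K y -> forall w, w \in s -> exists2 k, (p <= k)%N & ball w d (iter k F y))].
Proof.
move=> d0; elim: s c r => [|w s IH] c r r0 Kc sK.
 exists (c, r / 2); split=> //=; first by rewrite divr_gt0.
 by move=> y; rewrite mulrC divfK// => cy; split.
have Kw : K w by apply: sK; rewrite inE eqxx.
have [x [k [Kx cx pk wx]]] := @minimal_transitive (ball c r)^° (ball w d)^° p (open_interior _) (open_interior _)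
 (ex_intro2 _ _ c Kc (nbhsx_ballx c r r0)) (ex_intro2 _ _ w Kw (nbhsx_ballx w d d0)).
have : nbhs x (ball c r `&` (iter k F @^-1` ball w d)).
 by apply: filterI; [exact: cx | apply: (@iter_cts k x); exact: wx].
move=> /nbhs_ballP[h h0 hP].
have [q [q0 Kq qP]] := IH x h h0 Kx (fun v vs => sK v ltac:(by rewrite inE vs orbT)).
exists q; split=> // y qy; have [xy H] := qP y qy; have [cy wy] := hP y xy; split=> // Ky v.
by rewrite inE => /orP[/eqP ->|/(H Ky)//]; exists k.
Qed.

Lemma dense_orbit : (exists x, K x) -> exists2 v, K v &
 forall w (d : R) p, K w -> 0 < d -> exists2 k, (p <= k)%N & ball w d (iter k F v).
Proof.
move=> [x0 Kx0].
have netP n := @finite_net n.+1%:R^-1 ltac:(by rewrite invr_gt0 ltr0n).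
have [net netK] := choice netP.
have step (z : nat * (T * R)) : exists q : T * R, K z.2.1 -> 0 < z.2.2 -> [/\ 0 < q.2, K q.1 & forall y, ball q.1 (2 * q.2) y -> ball z.2.1 z.2.2 y /\
  (K y -> forall w, w \in net z.1 -> exists2 k, (z.1 <= k)%N & ball w z.1.+1%:R^-1 (iter k F y))].
 case: z => n [c r] /=; have [[Kc r0]|nK] := pselect (K c /\ 0 < r); last by exists (c, r) => Kc r0; case: nK.
 have [q qP] := @visit (net n) n.+1%:R^-1 n c r ltac:(by rewrite invr_gt0 ltr0n) r0 Kc (netK n).1.
 by exists q.
have [nx nxP] := choice step.
pose q := fix q n : T * R := if n is m.+1 then nx (m, q m) else (x0, 1).
have qK n : K (q n).1 /\ 0 < (q n).2.
 by elim: n => [|n [Kn rn]]; [split=> //=; exact: ltr01 | have [] := nxP (n, q n) Kn rn].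
have qS n y : ball (q n.+1).1 (2 * (q n.+1).2) y -> ball (q n).1 (q n).2 y /\
  (K y -> forall w, w \in net n -> exists2 k, (n <= k)%N & ball w n.+1%:R^-1 (iter k F y)).
 by have [Kn rn] := qK n; have [_ _] := nxP (n, q n) Kn rn; apply.
have tail n j : ball (q n).1 (q n).2 (q (n + j)%N).1.
 have [j0|j0] := posnP j; first by rewrite j0 addn0; apply: ballxx; exact: (qK n).2.
 case: j j0 => // j _; elim: j n => [|j IH] n.
  rewrite addn1; have [Kn rn] := qK n.+1; apply: (qS n _ _).1; apply: ballxx; exact: mulr_gt0.
 have [Kn rn] := qK n.+1; apply: (qS n _ _).1; rewrite -addSnnS; apply: le_ball (IH n.+1).
 by rewrite ler_peMl ?ltW// ltr1n.
have Kc : compact K by exact: (subclosed_compact Kcl Gc KG).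
have [v Kv [phi phiP vP]] := compact_seq Kc (fun n => (qK n).1).
have vin n : ball (q n).1 (2 * (q n).2) v.
 have [Kn rn] := qK n.
 have [k kr] : exists k : nat, k.+1%:R^-1 < (q n).2.
  exists (Num.truncn (q n).2^-1); rewrite invf_plt ?posrE ?ltr0n//; exact: truncnS_gt.
 pose j := phi (maxn k n).
 have nj : (n <= j)%N by apply: leq_trans (phiP _); exact: leq_maxr.
 rewrite mulr2n mulrDl mul1r; apply: (@ball_triangle _ _ (q j).1).
  by rewrite -(subnKC nj); exact: tail.
 apply: ball_sym; apply: le_ball (vP (maxn k n)); apply: le_trans (ltW kr).
 by rewrite inv_le ?leq_maxl.
exists v => // w d p Kw d0.
have [k kd] : exists k : nat, k.+1%:R^-1 < d / 2.
 exists (Num.truncn (d / 2)^-1); rewrite invf_plt ?posrE ?ltr0n ?divr_gt0//; exact: truncnS_gt.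
pose n := maxn k p; have [_ /(_ Kv)H] := qS n v (vin n.+1).
have [w' w's ww'] := (netK n).2 w Kw; have [i ni wi] := H w' w's.
exists i; first by apply: leq_trans ni; exact: leq_maxr.
have nd : n.+1%:R^-1 <= d / 2.
 by apply: le_trans (ltW kd); rewrite inv_le ?leq_maxl.
rewrite [d]splitr; apply: (@ball_triangle _ _ w'); first by apply: ball_sym; exact: le_ball nd _ ww'.
exact: le_ball nd _ wi.
Qed.

End transitivity.

(** A dense orbit of a minimal [big] set is recurrent, and the closed set L attached to it then
    contains the whole minimal set; M pieces for every length contradict exponential growth. *)
Lemma not_big_attractor :
 (forall v, Gam v -> (forall (d : R) p, 0 < d -> exists2 k, (p <= k)%N & ball v d (iter k F v)) ->
  exists L M, [/\ closed L, forall k, L (iter k F v) & forall n, cov n L M]) -> ~ big Gam.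
Proof.
move=> H bg; have [K Km] := minimal_exists bg.
have [[Kcl KG KF Kb] _] := Km.
have neK : exists x, K x.
 apply: contrapT => nK; have : cov 0 K 0 by apply: cov_sub (cov_0 0 0) => // x Kx; case: nK; exists x.
 by move/Kb; rewrite expr0 ler10.
have [v Kv vP] := dense_orbit Km neK.
have [L [M [Lcl vL LM]]] := H v (KG v Kv) (fun d p d0 => vP v d p Kv d0).
have KL : K `<=` L.
 move=> w Kw; apply: Lcl => V /nbhs_ballP[d d0 dV].
 by have [k _ wk] := vP w d 0%N Kw d0; exists (iter k F v); split; [exact: vL | exact: dV].
have [n nP] := linear_lt_power M%:R rho1.
have := Kb _ _ (cov_sub KL (leqnn _) (LM n)); rewrite leNgt => /negP; apply.
by apply: le_lt_trans nP; rewrite -[X in X <= _]mul1r ler_wpM2r// ler1n.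
Qed.

End covers.

(** * From covering numbers to Bowen entropy *)

Section entropy.
Context {R : realType} {T : pseudoPMetricType R}.
Variables (F : T -> T) (Gam : set T).
Hypotheses (Fc : continuous F) (Gc : compact Gam) (Gcl : closed Gam) (GF : forall x, Gam x -> Gam (F x)) (Gne : Gam !=set0).

(** Two points of a separated set cannot share a piece of the cover, so choosing a piece for each
    point is injective. *)
Lemma separated_size n c (e : R) (s : seq T) : Defs.separated F n e s -> (forall x, x \in s -> Gam x) -> cov F e n Gam c -> (size s <= c)%N.
Proof.
case: s => [//|x0 s0]; set s := x0 :: s0 => -[us sep] sG [I [D [Ic Do Ds Dc]]]; apply: leq_trans Ic.
have [i0 _] := Dc x0 (sG x0 (mem_head _ _)).
have ex (x : T) : exists i, Gam x -> D i x.
 by have [/Dc[i Di]|nG] := pselect (Gam x); [exists i | exists i0].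
have [g gP] := choice ex.
have gi : {in s &, injective g}.
 move=> x y xs ys E; apply/eqP/negPn/negP => xy; have [k kn] := sep x y xs ys xy; apply.
 by apply: (Ds (g x)) => //; [exact: gP (sG x xs) | rewrite E; exact: gP (sG y ys)].
have u : uniq (map g s) by rewrite map_inj_in_uniq.
by rewrite -(size_map g) -(card_uniqP u) max_card.
Qed.

Local Open Scope ereal_scope.

Lemma max_separated_le n c (e : R) : cov F e n Gam c -> max_separated F Gam n e <= c%:R%:E.
Proof.
move=> H; apply: ge_ereal_sup => _ [s [sep sG] <-]; rewrite lee_fin ler_nat; exact: separated_size sep sG H.
Qed.

Lemma max_separated_ge1 n (e : R) : 1 <= max_separated F Gam n e.
Proof.
case: Gne => x Gx; apply: le_ereal_sup_tmp; exists 1%R%:E => //; exists [:: x] => //; split; last by move=> y; rewrite inE => /eqP ->.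
by split=> // y z; rewrite !inE => /eqP -> /eqP ->; rewrite eqxx.
Qed.

Lemma entropy_zero : (forall e rho : R, (0 < e)%R -> (1 < rho)%R -> ~ big F e rho Gam) -> topological_entropy F Gam = 0.
Proof.
move=> H; pose u e n := (n%:R^-1)%:E * lne (max_separated F Gam n e).
have u0 e n : 0 <= u e n by rewrite mule_ge0 ?lee_fin ?invr_ge0 ?ler0n// lne_ge0 max_separated_ge1.
apply/eqP; rewrite eq_le; apply/andP; split; last first.
 apply: le_ereal_sup_tmp; exists (limn_esup (u 1%R)); first by exists 1%R => //=; exact: ltr01.
 rewrite limn_esup_lim; apply: lime_ge; first exact: is_cvg_esups.
 by apply: nearW => n; apply: le_ereal_sup_tmp; exists (u 1%R n) => //; exists n => /=.
apply: ge_ereal_sup => _ [e /= e0 <-]; apply/lee_addgt0Pr => d d0; rewrite add0e.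
have d2 : (0 < d / 2)%R by rewrite divr_gt0.
(* Half of the rate [d] is taken because the j blocks of length [n0] that cover k >= n0 steps
   satisfy j n0 <= 2 k. *)
have r1 : (1 < expR (d / 2) :> R)%R by rewrite expR_gt1.
have [n0 [c0 [n00 C l]]] := not_big r1 (H e (expR (d / 2)) e0 r1).
rewrite -/(u e) limn_esup_lim; apply: lime_le; first exact: is_cvg_esups.
exists n0 => // n /= n0n; apply: ge_ereal_sup => _ [k /= nk <-].
have k0 : (0 < k)%N by apply: leq_trans n00 (leq_trans n0n nk).
pose j := (k %/ n0).+1.
have Cj : cov F e k Gam (c0 ^ j).
 apply: (@cov_len _ _ _ _ _ (j * n0)); first by rewrite ltnW// ltn_ceil.
 by apply: (cov_pow Fc) C => x; exact: iter_stable.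
have cj : ((c0 ^ j)%N%:R <= expR (d * k%:R) :> R)%R.
 rewrite natrX; apply: le_trans (_ : (expR (d / 2) ^+ n0) ^+ j <= _)%R.
  by apply: lerXn2r; rewrite ?nnegrE ?exprn_ge0 ?expR_ge0// ltW.
 rewrite -!expRM_natl ler_expR (_ : (d * k%:R)%R = ((k%:R + k%:R) * (d / 2))%R); last by field.
 rewrite mulrA -natrM -natrD; apply: ler_wpM2r; [exact: ltW | rewrite ler_nat mulSn].
 by apply: leq_add; [exact: leq_trans n0n nk | exact: leq_divM].
have k1 : (0 < k%:R :> R)%R by rewrite ltr0n.
have -> : d%:E = (k%:R^-1)%:E * (k%:R * d)%:E by rewrite -EFinM mulrA mulVf ?mul1r// gt_eqF.
apply: lee_wpmul2l; first by rewrite lee_fin invr_ge0 ltW.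
apply: le_trans (_ : lne (expR (d * k%:R))%:E <= _); last by rewrite lne_EFin ?expR_gt0// expRK mulrC.
rewrite lee_lne ?in_itv /= ?leey ?andbT ?lee_fin ?expR_ge0//.
 by apply: le_trans (max_separated_le Cj) _; rewrite lee_fin.
exact: le_trans lee01 (max_separated_ge1 _ _).
Qed.

End entropy.

(** * Winding angles and recurrent plane curves *)

Section planar.
Context {R : realType}.
Implicit Types (x y z t s e : R) (n i : nat).

(* The signed angle from (x, y) to (x', y'), meaningful when their scalar product is positive. *)
Definition angle x y x' y' : R := atan ((x * y' - y * x') / (x * x' + y * y')).

Lemma angle_rot x y x' y' : 0 < x * x' + y * y' -> exists2 k, 0 < k &
 x' = k * (cos (angle x y x' y') * x - sin (angle x y x' y') * y) /\
 y' = k * (sin (angle x y x' y') * x + cos (angle x y x' y') * y).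
Proof.
move=> d0; rewrite /angle; set q := _ / _; have c0 : 0 < cos (atan q) by apply: cos_gt0_pihalf; rewrite atan_gtNpi2 atan_ltpi2.
have s : sin (atan q) = q * cos (atan q) by rewrite -[X in X * _](atanK q) /tan divfK// gt_eqF.
have n0 : 0 < x ^+ 2 + y ^+ 2.
 rewrite lt_neqAle addr_ge0 ?sqr_ge0// andbT eq_sym paddr_eq0 ?sqr_ge0// !sqrf_eq0.
 by apply/negP => /andP[/eqP x0 /eqP y0]; move: d0; rewrite x0 y0 !mul0r addr0 ltxx.
exists ((x * x' + y * y') / ((x ^+ 2 + y ^+ 2) * cos (atan q))); first by rewrite divr_gt0 ?mulr_gt0.
move: c0; rewrite s; move: (cos _) => c c0; rewrite /q.
by split; field; rewrite !gt_eqF.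
Qed.

Section polygon.
Variables (p1 p2 : nat -> R).

(** The angle swept by the polygon as seen from z, summed edge by edge: a real-valued lift that is
    continuous in z as long as consecutive vertices are seen at acute angles. *)
Fixpoint turn n z1 z2 : R := if n is m.+1 then
 turn m z1 z2 + angle (p1 m - z1) (p2 m - z2) (p1 n - z1) (p2 n - z2) else 0.

Lemma turn_rot n z1 z2 : (forall i, (i < n)%N -> 0 < (p1 i - z1) * (p1 i.+1 - z1) + (p2 i - z2) * (p2 i.+1 - z2)) ->
 exists2 k, 0 < k & p1 n - z1 = k * (cos (turn n z1 z2) * (p1 0%N - z1) - sin (turn n z1 z2) * (p2 0%N - z2)) /\
  p2 n - z2 = k * (sin (turn n z1 z2) * (p1 0%N - z1) + cos (turn n z1 z2) * (p2 0%N - z2)).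
Proof.
elim: n => [|n IH] H /=.
 by exists 1 => //; rewrite cos0 sin0 !mul0r !mul1r subr0 add0r.
have [|k k0 [e1 e2]] := IH; first by move=> i ni; apply: H; apply: ltnW.
have [h h0 [f1 f2]] := angle_rot (H n (leqnn _)).
exists (h * k); first exact: mulr_gt0.
set A := turn n z1 z2 in e1 e2 *; set B := angle _ _ _ _ in f1 f2 *.
rewrite cosD sinD f1 f2 e1 e2; split; ring.
Qed.

Lemma turn_cross n z1 z2 : (forall i, (i < n)%N -> 0 < (p1 i - z1) * (p1 i.+1 - z1) + (p2 i - z2) * (p2 i.+1 - z2)) ->
 exists2 k, 0 < k &
 (p1 0%N - z1) * (p2 n - z2) - (p2 0%N - z2) * (p1 n - z1) = k * (((p1 0%N - z1) ^+ 2 + (p2 0%N - z2) ^+ 2) * sin (turn n z1 z2)) /\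
 (p1 0%N - z1) * (p1 n - z1) + (p2 0%N - z2) * (p2 n - z2) = k * (((p1 0%N - z1) ^+ 2 + (p2 0%N - z2) ^+ 2) * cos (turn n z1 z2)).
Proof.
move=> H; have [k k0 [e1 e2]] := turn_rot H; exists k => //; rewrite e1 e2; split; ring.
Qed.

Lemma turn_cts n (z1 z2 : R -> R) : continuous z1 -> continuous z2 -> forall t,
 (forall i, (i < n)%N -> 0 < (p1 i - z1 t) * (p1 i.+1 - z1 t) + (p2 i - z2 t) * (p2 i.+1 - z2 t)) ->
 {for t, continuous (fun t => turn n (z1 t) (z2 t))}.
Proof.
move=> c1 c2 t; elim: n => [|n IH] H; first exact: cvg_cst.
apply: cvgD; first by apply: IH => i ni; apply: H; exact: ltnW.
rewrite /angle; apply: (@continuous_comp _ _ _ (fun t => ((p1 n - z1 t) * (p2 n.+1 - z2 t) - (p2 n - z2 t) * (p1 n.+1 - z1 t)) /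
 ((p1 n - z1 t) * (p1 n.+1 - z1 t) + (p2 n - z2 t) * (p2 n.+1 - z2 t))) (@atan R)); last exact: continuous_atan.
have cc (h : R -> R) (p : R) : continuous h -> continuous (fun t => p - h t) by move=> ch; apply: ctsB; [exact: ctsC|].
apply: cvgM.
 by apply: (ctsB (f := fun t => (p1 n - z1 t) * (p2 n.+1 - z2 t)) (g := fun t => (p2 n - z2 t) * (p1 n.+1 - z1 t))); apply: ctsM; exact: cc.
apply: cvgV; first by rewrite gt_eqF// H.
by apply: (ctsD (f := fun t => (p1 n - z1 t) * (p1 n.+1 - z1 t)) (g := fun t => (p2 n - z2 t) * (p2 n.+1 - z2 t))); apply: ctsM; exact: cc.
Qed.

End polygon.

Lemma last_ge (B : R -> R) (l s t : R) : s < t -> (forall x, s <= x <= t -> {for x, continuous B}) -> l <= B s -> B t < l ->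
 exists2 x, s <= x < t & B x = l /\ forall y, x < y <= t -> B y < l.
Proof.
move=> st cB Bs Bt; pose S := [set x | s <= x <= t /\ l <= B x].
have Ss : S s by split=> //; rewrite lexx ltW.
have hs : has_sup S by split; [exists s | exists t => x [/andP[]]].
pose x := sup S; have sx : s <= x := ub_le_sup hs.2 Ss.
have xt : x <= t by apply: sup_le_ub; [exists s | move=> y [/andP[]]].
have Bx : l <= B x.
 rewrite leNgt; apply/negP => lt; have e0 : 0 < l - B x by lra.
 have /cvgrPdist_lt/(_ _ e0)/nbhs_ballP[d d0 dP] := cB x ltac:(by rewrite sx xt).
 have [y [yI yB] yx] := sup_adherent d0 hs; have Sy : S y by split. have yx' : y <= x := ub_le_sup hs.2 Sy.
 have := dP y; rewrite /ball /= -/x in yx *.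
 by rewrite ger0_norm ?subr_ge0// => /(_ ltac:(lra)); rewrite ltr_norml; lra.
have after y : x < y <= t -> B y < l.
 move=> yI; rewrite ltNge; apply/negP => lB; have Sy : S y by split=> //; lra. have : y <= x := ub_le_sup hs.2 Sy.
 by lra.
have xt' : x < t by rewrite lt_neqAle xt andbT; apply/eqP => e; move: Bt; rewrite -e; lra.
exists x; first by rewrite sx.
split=> //; apply/eqP; rewrite eq_le Bx andbT leNgt; apply/negP => lt.
have e0 : 0 < B x - l by lra.
have /cvgrPdist_lt/(_ _ e0)/nbhs_ballP[d d0 dP] := cB x ltac:(by rewrite sx xt).
have [h [h0 hd ht]] := below2 d0 (ltac:(lra) : 0 < t - x).
have := dP (x + h); rewrite /ball /= opprD addrA subrr add0r normrN gtr0_norm// => /(_ hd).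
by have := after (x + h) ltac:(lra); rewrite ltr_norml; lra.
Qed.

(** Mesh condition, in the l^1 norm, ensuring that two consecutive vertices are seen at an acute
    angle, as [angle] requires. *)
Lemma dot_pos (a1 a2 b1 b2 : R) : `|b1 - a1| + `|b2 - a2| < (`|a1| + `|a2|) / 2 -> 0 < a1 * b1 + a2 * b2.
Proof.
move=> H; have -> : a1 * b1 + a2 * b2 = a1 ^+ 2 + a2 ^+ 2 + (a1 * (b1 - a1) + a2 * (b2 - a2)) by ring.
have h1 : - (`|a1| * `|b1 - a1|) <= a1 * (b1 - a1) by rewrite -normrM; have := ler_norm (- (a1 * (b1 - a1))); rewrite normrN; lra.
have h2 : - (`|a2| * `|b2 - a2|) <= a2 * (b2 - a2) by rewrite -normrM; have := ler_norm (- (a2 * (b2 - a2))); rewrite normrN; lra.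
rewrite -[a1 ^+ 2]real_normK ?num_real// -[a2 ^+ 2]real_normK ?num_real//.
move: H h1 h2 (normr_ge0 a1) (normr_ge0 a2) (normr_ge0 (b1 - a1)) (normr_ge0 (b2 - a2)).
move: `|a1| `|a2| `|b1 - a1| `|b2 - a2| (a1 * _) (a2 * _) => A B D E p q H h1 h2 A0 B0 D0 E0.
have s : 0 < A + B by lra.
have m : A * D + B * E <= (A + B) / 2 * (A + B) - (A * E + B * D).
 have : (A + B) * (D + E) <= (A + B) * ((A + B) / 2) by rewrite ler_pM2l// ltW.
 by lra.
have [AB|AB] := lerP A B.
 have : B * (D + E) < B * ((A + B) / 2) by rewrite ltr_pM2l//; lra.
 have : 0 <= D * (B - A) by rewrite mulr_ge0// subr_ge0.
 by have := sqr_ge0 (A - B / 4); rewrite !expr2; nra.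
have : A * (D + E) < A * ((A + B) / 2) by rewrite ltr_pM2l//; lra.
have : 0 <= E * (A - B) by rewrite mulr_ge0// subr_ge0 ltW.
by have := sqr_ge0 (B - A / 4); rewrite !expr2; nra.
Qed.

Lemma unif_cts (g : R -> R) (T e : R) : continuous g -> 0 < e -> exists2 d, 0 < d & forall x y, 0 <= x <= T -> 0 <= y <= T ->
 `|x - y| < d -> `|g x - g y| < e.
Proof.
move=> cg e0; apply: contrapT => H.
have ex (k : nat) : exists q : R * R, [/\ 0 <= q.1 <= T, `|q.1 - q.2| < k.+1%:R^-1 & e <= `|g q.1 - g q.2|].
 apply: contrapT => H'; apply: H; exists k.+1%:R^-1 => [|x y xI yI xy]; first by rewrite invr_gt0 ltr0n.
 by rewrite ltNge; apply/negP => le; apply: H'; exists (x, y).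
have [q qP] := choice ex.
have [|s sI [phi phiP sP]] := @compact_seq R R `[0, T]%classic (fun k => (q k).1) (@segment_compact R 0 T).
 by move=> k; have [] := qP k; rewrite /= in_itv.
have /cvgrPdist_lt/(_ _ (ltac:(lra) : 0 < e / 2))/nbhs_ballP[d d0 dP] := cg s.
pose n := Num.truncn (d / 2)^-1.
have nd : n.+1%:R^-1 < d / 2 by rewrite invf_plt ?posrE ?ltr0n ?divr_gt0//; exact: truncnS_gt.
have [_ xy le_e] := qP (phi n); have sq := sP n; rewrite /ball /= in sq.
have pn : (phi n).+1%:R^-1 <= n.+1%:R^-1 :> R by rewrite inv_le ?phiP.
have h1 := dP (q (phi n)).1; have h2 := dP (q (phi n)).2; rewrite /ball /= in h1 h2.
have sq' : `|s - (q (phi n)).1| < d / 2 by move: sq; move: (phi n) => m sq; apply: lt_trans nd; first exact sq.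
have {}h1 : `|g s - g (q (phi n)).1| < e / 2 by apply: h1; apply: lt_trans sq' _; rewrite ltr_pdivrMr// ltr_pMr// ltr1n.
have {}h2 : `|g s - g (q (phi n)).2| < e / 2.
 apply: h2; apply: le_lt_trans (ler_distD (q (phi n)).1 _ _) _; rewrite [d]splitr; apply: ltrD => //.
 exact: lt_le_trans xy (le_trans pn (ltW nd)).
move: h1 h2 le_e; move: (g s) (g _) (g _) => x1 x2 x3; rewrite !ltr_norml ler_normr; clear; lra.
Qed.

Definition crosses_up (g1 : R -> R) c t := exists2 h, 0 < h & forall s, `|s - t| < h -> (s < t -> g1 s < c) /\ (t < s -> c < g1 s).

(** Models t |-> (u(t, x0), u_x(t, x0)) for a recurrent solution that is not periodic. The vertical
    line through the starting point, near that point, plays the role of a Poincare section crossed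
    in one direction only. *)
Definition recurrent_curve (g1 g2 : R -> R) rho := [/\ continuous g1 /\ continuous g2,
 forall s t, 0 <= s -> 0 <= t -> g1 s = g1 t -> g2 s = g2 t -> s = t,
 forall s e T, 0 <= s -> 0 < e -> exists2 t, T <= t & 0 <= t /\ (`|g1 t - g1 s| < e /\ `|g2 t - g2 s| < e) &
 forall t, 0 <= t -> g1 t = g1 0 -> `|g2 t - g2 0| < rho -> crosses_up g1 (g1 0) t].

(* A(z) is the angle subtended at z by the arc g([0, t1]); it crosses odd multiples of pi exactly when z
  crosses the segment from g(0) to g(t1), always in the same direction, which recurrence forbids. *)
Lemma no_later_crossing g1 g2 rho t1 ts : recurrent_curve g1 g2 rho -> 0 < t1 -> t1 < ts -> g1 t1 = g1 0 -> `|g2 t1 - g2 0| < rho ->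
 g1 ts = g1 0 -> 0 < (g2 ts - g2 0) * (g2 t1 - g2 ts) -> False.
Proof.
move=> [[cg1 cg2] inj rec up] t10 t1s g1t1 r1 g1ts between.
pose c := g1 0; pose y0 := g2 0; pose y1 := g2 t1; pose d := y1 - y0.
have d0 : d != 0.
 apply/eqP => e; have := inj _ _ (lexx 0) (ltW t10) (esym g1t1) ltac:(move: e; rewrite /d /y1 /y0; lraR).
 by move=> e'; move: t10; rewrite -e' ltxx.
have closer z : 0 < (z - y0) * (y1 - z) -> `|z - y0| < rho.
 move=> H; apply: le_lt_trans r1; rewrite -/y1 -/y0.
 have [y|y] := lerP y0 z.
  have z1 : z <= y1 by rewrite leNgt; apply/negP => k; move: H; rewrite nmulr_lgt0; lraR.
  by rewrite !ger0_norm; lraR.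
 have z1 : y1 <= z by rewrite leNgt; apply/negP => k; move: H; rewrite pmulr_lgt0; lraR.
 by rewrite !ler0_norm; lraR.
have ts0 : 0 < ts by lraR.
have [h h0 hP] := up _ (ltW ts0) g1ts (closer _ between).
have [k [k0 kh kt]] := below2 h0 (ltac:(lraR) : 0 < ts - t1).
pose ta := ts - k; have taI : t1 < ta < ts by rewrite /ta; lraR.
have ga : g1 ta < c.
 have [] := hP ta; first by rewrite /ta addrAC subrr add0r normrN gtr0_norm.
 by move=> H _; apply: H; lraR.
have dist_pos s t : 0 <= s <= t1 -> ta <= t -> 0 < `|g1 s - g1 t| + `|g2 s - g2 t|.
 move=> sI tt; rewrite lt_neqAle addr_ge0// andbT eq_sym paddr_eq0// !normr_eq0 !subr_eq0.
 apply/negP => /andP[/eqP e1 /eqP e2]; have s0 : 0 <= s by case/andP: sI.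
 have t0 : 0 <= t by clear -tt taI t10; lra.
 by have := inj _ _ s0 t0 e1 e2; clear -sI tt taI; lra.
have cd t : continuous (fun s => `|g1 s - g1 t| + `|g2 s - g2 t|).
 by apply: ctsD; apply: cts_abs; apply: ctsB => //; exact: ctsC.
have [sm smI smP] := @EVT_min R (fun s => `|g1 s - g1 ta| + `|g2 s - g2 ta|) 0 t1 (ltW t10) (continuous_subspaceT (cd ta)).
set m := `|g1 sm - _| + _ in smP; have m0 : 0 < m by apply: dist_pos; [move: smI; rewrite in_itv | exact: lexx].
(* Small enough for the segment from g(tb) back to g(ta) to stay away from the arc and on the side
   g1 < c. *)
have [e [e0 em ec]] := below2 (ltac:(lraR) : 0 < m / 4) (ltac:(lraR) : 0 < c - g1 ta).
have [tb tbs [tb0 [r1b r2b]]] := rec ta e (ts + 1) ltac:(lraR) e0.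
have tab : ta <= tb by lraR.
pose KK := (`[0, t1]%classic `*` `[ta, tb]%classic) : set (R * R).
have cK : compact KK by apply: compact_setX; exact: segment_compact.
have cD : continuous (fun p : R * R => `|g1 p.1 - g1 p.2| + `|g2 p.1 - g2 p.2|).
 by apply: ctsD; apply: cts_abs; apply: ctsB; apply: cts_comp => //; [exact: cts_fst | exact: cts_snd | exact: cts_fst | exact: cts_snd].
have K0 : KK !=set0 by exists (0, ta); split; rewrite /= in_itv/= lexx ?tab ?(ltW t10).
have [pm pmK pmP] := compact_EVT_min K0 cK (continuous_subspaceT cD).
set m1 := `|_| + `|_| in pmP; have m10 : 0 < m1.
 by move: pmK; rewrite inE => -[]; rewrite /= !in_itv/= => h1 h2; apply: dist_pos => //; case/andP: h2.
have [dl [dl0 dl1 dl2]] := below2 m10 (ltac:(lraR) : 0 < m / 2).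
have [w1 w10 w1P] := unif_cts t1 cg1 (ltac:(lraR) : 0 < dl / 4).
have [w2 w20 w2P] := unif_cts t1 cg2 (ltac:(lraR) : 0 < dl / 4).
have [w [w0 ww1 ww2]] := below2 w10 w20.
pose n := (Num.truncn (t1 / w)).+1; have n0 : 0 < n%:R :> R by rewrite ltr0n.
have nw : t1 / n%:R < w.
 by rewrite ltr_pdivrMr// mulrC -ltr_pdivrMr//; exact: truncnS_gt.
pose p1 i := g1 (t1 * (i%:R / n%:R)); pose p2 i := g2 (t1 * (i%:R / n%:R)).
have pI i : (i <= n)%N -> 0 <= t1 * (i%:R / n%:R) <= t1.
 move=> ni; have i0 : 0 <= i%:R / n%:R :> R by rewrite divr_ge0 ?ler0n.
 have i1 : i%:R / n%:R <= 1 :> R by rewrite ler_pdivrMr// mul1r ler_nat.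
 by rewrite mulr_ge0 ?(ltW t10)//= ler_piMr ?(ltW t10).
have p10 : p1 0%N = c by rewrite /p1 mul0r mulr0.
have p20 : p2 0%N = y0 by rewrite /p2 mul0r mulr0.
have p1n : p1 n = c by rewrite /p1 divff ?gt_eqF// mulr1.
have p2n : p2 n = y1 by rewrite /p2 divff ?gt_eqF// mulr1.
pose ok z1 z2 := forall s, 0 <= s <= t1 -> dl <= `|g1 s - z1| + `|g2 s - z2|.
have okdot z1 z2 : ok z1 z2 -> forall i, (i < n)%N -> 0 < (p1 i - z1) * (p1 i.+1 - z1) + (p2 i - z2) * (p2 i.+1 - z2).
 move=> oz i ni; apply: dot_pos;
 have -> : p1 i.+1 - z1 - (p1 i - z1) = p1 i.+1 - p1 i by ring.
 have -> : p2 i.+1 - z2 - (p2 i - z2) = p2 i.+1 - p2 i by ring.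
 have st : `|t1 * (i.+1%:R / n%:R) - t1 * (i%:R / n%:R)| < w.
  have -> : t1 * (i.+1%:R / n%:R) - t1 * (i%:R / n%:R) = t1 / n%:R.
   by rewrite -mulrBr -mulrBl -[i.+1%:R]natr1 addrAC subrr add0r mul1r.
  by rewrite ger0_norm// divr_ge0 ?ltW.
 have h1 := w1P _ _ (pI _ ni) (pI _ (ltnW ni)) (lt_trans st ww1).
 have h2 := w2P _ _ (pI _ ni) (pI _ (ltnW ni)) (lt_trans st ww2).
 have h3 := oz _ (pI _ (ltnW ni)); rewrite -/(p1 i) -/(p2 i) in h1 h2 h3.
 rewrite -/(p1 i.+1) in h1; rewrite -/(p2 i.+1) in h2.
 move: h1 h2 h3; move: `|_| `|_| (`|_| + `|_|) => q1 q2 q3; clear; lra.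
have okg t : ta <= t <= tb -> ok (g1 t) (g2 t).
 move=> tI s sI; apply: le_trans (ltW dl1) _.
 by apply: (pmP (s, t)); rewrite inE; split; rewrite /= in_itv.
have okl th : 0 <= th <= 1 -> ok (g1 tb + th * (g1 ta - g1 tb)) (g2 tb + th * (g2 ta - g2 tb)).
 move=> thI s sI; have := smP s; rewrite in_itv/= => /(_ sI) hm.
 have q1 : `|(1 - th) * (g1 tb - g1 ta)| <= e.
  rewrite normrM -[e]mul1r; apply: ler_pM => //; [rewrite ler_norml; clear -thI; lra | exact: ltW].
 have q2 : `|(1 - th) * (g2 tb - g2 ta)| <= e.
  rewrite normrM -[e]mul1r; apply: ler_pM => //; [rewrite ler_norml; clear -thI; lra | exact: ltW].
 have E1 : g1 s - (g1 tb + th * (g1 ta - g1 tb)) = (g1 s - g1 ta) - (1 - th) * (g1 tb - g1 ta) by ring.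
 have E2 : g2 s - (g2 tb + th * (g2 ta - g2 tb)) = (g2 s - g2 ta) - (1 - th) * (g2 tb - g2 ta) by ring.
 rewrite E1 E2.
 have t1' := ler_distD 0 (g1 s - g1 ta) ((1 - th) * (g1 tb - g1 ta)).
 have a1 := lerB_dist (g1 s - g1 ta) ((1 - th) * (g1 tb - g1 ta)).
 have a2 := lerB_dist (g2 s - g2 ta) ((1 - th) * (g2 tb - g2 ta)).
 by move: hm q1 q2 a1 a2 em dl2; rewrite -/m; move: `|_| `|_| `|_| `|_| `|_| `|_| => A1 A2 A3 A4 A5 A6; clear; lra.
pose A z1 z2 := turn p1 p2 n z1 z2.
(* Both ends of the arc lie on the line g1 = c, so the sine of the swept angle vanishes only on that
   line, and there its cosine is negative exactly between the two ends. *)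
have crossE z1 z2 : ok z1 z2 -> exists2 k, 0 < k & (c - z1) * d = k * sin (A z1 z2) /\ (c - z1) ^+ 2 + (y0 - z2) * (y1 - z2) = k * cos (A z1 z2).
 move=> oz; have [k' k'0 [E1 E2]] := turn_cross (okdot _ _ oz).
 rewrite p10 p20 p1n p2n in E1 E2.
 have N0 : 0 < (c - z1) ^+ 2 + (y0 - z2) ^+ 2.
  rewrite lt_neqAle addr_ge0 ?sqr_ge0// andbT eq_sym paddr_eq0 ?sqr_ge0// !sqrf_eq0.
  apply/negP => /andP[/eqP z10 /eqP z20]; have := oz 0; rewrite lexx (ltW t10) => /(_ isT).
  by rewrite -/c -/y0 z10 z20 normr0 addr0 leNgt dl0.
 exists (k' * ((c - z1) ^+ 2 + (y0 - z2) ^+ 2)); first exact: mulr_gt0.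
 by rewrite -!mulrA -/(A z1 z2) -E1 -E2 /d; split; ring.
pose F t := A (g1 t) (g2 t).
have cF t : ta <= t <= tb -> {for t, continuous F} by move=> tI; apply: turn_cts => //; exact: okdot (okg t tI).
pose l := F ts.
have tsI : ta <= ts <= tb by clear -taI tbs; lra.
have [sl cl] : sin l = 0 /\ cos l < 0.
 have [k' k'0 []] := crossE _ _ (okg ts tsI); rewrite -/(F ts) -/l g1ts -/c subrr mul0r expr0n add0r => E1 E2; split.
  by apply/eqP; move/eqP: E1; rewrite eq_sym mulf_eq0 (gt_eqF k'0).
 have : (y0 - g2 ts) * (y1 - g2 ts) < 0 by move: between; rewrite -/y0 -/y1; clear; lra.
 by rewrite E2 pmulr_rlt0.
have sd z1 z2 : ok z1 z2 -> A z1 z2 = l -> z1 = c /\ 0 < (z2 - y0) * (y1 - z2).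
 move=> oz Al; have [k' k'0 [E1 E2]] := crossE _ _ oz; rewrite Al sl mulr0 in E1; rewrite Al in E2.
 have z1c : z1 = c by move/eqP: E1; rewrite mulf_eq0 (negbTE d0) orbF subr_eq0 => /eqP.
 split=> //; move: E2; rewrite z1c subrr expr0n add0r.
 by have : k' * cos l < 0 by [rewrite pmulr_rlt0]; move: (k' * cos l) => q; clear; lra.
pose b := d < 0; pose sg : R := (-1) ^+ b.
have sgd : 0 < sg * d.
 rewrite /sg /b; case: (ltrP d 0) => dd /=; first by rewrite expr1 mulN1r oppr_gt0.
 by rewrite expr0 mul1r lt_neqAle eq_sym d0.
have sg2 : sg * sg = 1 by rewrite -expr2 sqrr_sign.
(* near a zero of F - l, the sign of sg * (F - l) is that of g1 - c *)
have loc x : ta <= x <= tb -> F x = l -> exists2 h', 0 < h' & forall t, ta <= t <= tb -> `|t - x| < h' ->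
  (t < x -> sg * F t < sg * l) /\ (x < t -> sg * l < sg * F t).
 move=> xI Fx; have x0 : 0 <= x by clear -xI taI t10; lra.
 have [g1x g2x] := sd _ _ (okg x xI) Fx.
 have [h1 h10 h1P] := up _ x0 g1x (closer _ g2x).
 have /cvgrPdist_lt/(_ _ (@pi_gt0 R))/nbhs_ballP[h2 h20 h2P] := cF x xI.
 have [h' [h'0 hh1 hh2]] := below2 h10 h20; exists h' => // t tI tx.
 have near_ : `|F t - l| < pi by have := h2P t; rewrite /ball /= distrC => /(_ (lt_trans tx hh2)); rewrite Fx distrC.
 have [k' k'0 [E1 _]] := crossE _ _ (okg t tI).
 have sF : sin (F t) = cos l * sin (F t - l) by have := sinD (F t - l) l; rewrite subrK sl mulr0 addr0 mulrC.
 rewrite -/(A (g1 t) (g2 t)) -/(F t) sF in E1.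
 have E3 : (c - g1 t) * (sg * d) = k' * cos l * sin (sg * (F t - l)).
  have -> : sin (sg * (F t - l)) = sg * sin (F t - l).
   by rewrite /sg; case: (b); rewrite ?expr0 ?expr1 ?mul1r ?mulN1r ?sinN.
  by rewrite mulrCA E1; ring.
 have kc : k' * cos l < 0 by rewrite pmulr_rlt0.
 have nb : - pi < sg * (F t - l) < pi by rewrite -ltr_norml normrMsign.
 have [u1 u2] := h1P t (lt_trans tx hh1).
 set q := sg * (F t - l) in E3 nb; have qE : sg * F t - sg * l = q by rewrite /q mulrBr.
 split=> tt.
  have P : 0 < (c - g1 t) * (sg * d) by rewrite mulr_gt0// subr_gt0 u1.
  rewrite -subr_lt0 qE ltNge; apply/negP => q0; move: P; rewrite E3 nmulr_rgt0// ltNge.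
  by rewrite sin_ge0_pi//; clear -q0 nb; lra.
 have P : (c - g1 t) * (sg * d) < 0 by rewrite pmulr_llt0// subr_lt0 u2.
 rewrite -subr_gt0 qE ltNge; apply/negP => q0; move: P; rewrite E3 nmulr_rlt0// ltNge.
 have : 0 <= sin (- q) by apply: sin_ge0_pi; clear -q0 nb; lra.
 by rewrite sinN oppr_ge0 => ->.
pose B t := sg * F t.
have cB t : ta <= t <= tb -> {for t, continuous B} by move=> tI; apply: cvgM; [exact: cvg_cst | exact: cF].
have Bl t : ta <= t <= tb -> B t = sg * l -> F t = l.
 by move=> _ e'; rewrite -[F t]mul1r -[l]mul1r -sg2 -!mulrA -/(B t) e'.
have gbc : g1 tb != c by apply/eqP => gb; move: r1b ec; rewrite gb ltr_norml; clear; lra.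
have tbI : ta <= tb <= tb by rewrite tab lexx.
have taI' : ta <= ta <= tb by rewrite tab lexx.
(* By [loc] every passage through the level [sg * l] is upward, so B cannot have a last time on the
   level before ending below it. The claim [Ba] is the same argument with time reversed. *)
have Bb : sg * l < B tb.
 rewrite lt_neqAle; apply/andP; split.
  apply/eqP => e'; have [gb _] := sd _ _ (okg tb tbI) (Bl tb tbI (esym e')).
  by rewrite gb eqxx in gbc.
 rewrite leNgt; apply/negP => lt.
 have tstb : ts < tb by clear -tbs; lra.
 have [x xI [Bx after]] := @last_ge B (sg * l) _ _ tstb (fun t tI => cB t ltac:(clear -tI tsI; lra)) (lexx _) lt.
 have xI' : ta <= x <= tb by clear -xI tsI; lra.
 have [h' h'0 h'P] := loc x xI' (Bl x xI' Bx).
 have [q [q0 qh qt]] := below2 h'0 (ltac:(clear -xI; lra) : 0 < tb - x).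
 have [_ H] := h'P (x + q) ltac:(clear -xI' q0 qt; lra) ltac:(by rewrite addrAC subrr add0r gtr0_norm).
 have := after (x + q) ltac:(clear -q0 qt; lra); have := H ltac:(clear -q0; lra).
 by rewrite -/(B (x + q)); clear; lra.
have Ba : B ta < sg * l.
 rewrite lt_neqAle; apply/andP; split.
  apply/eqP => e'; have [gb _] := sd _ _ (okg ta taI') (Bl ta taI' e').
  by move: ga; rewrite gb ltxx.
 rewrite leNgt; apply/negP => lt.
 have tsta : - ts < - ta by clear -taI; lra.
 have cBN t : - ts <= t <= - ta -> {for t, continuous (fun t => - B (- t))}.
  move=> tI; apply: cvgN; apply: (@continuous_comp _ _ _ (fun t : R => - t) B); first exact: opp_continuous.
  by apply: cB; clear -tI tsI; lra.
 have [||x xI [Bx after]] := @last_ge (fun t => - B (- t)) (- (sg * l)) _ _ tsta cBN.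
 - by rewrite opprK.
 - by rewrite opprK ltrN2.
 have Bx' : B (- x) = sg * l by move: Bx; clear; lra.
 have xI' : ta <= - x <= tb by clear -xI tsI; lra.
 have [h' h'0 h'P] := loc (- x) xI' (Bl (- x) xI' Bx').
 have [q [q0 qh qt]] := below2 h'0 (ltac:(clear -xI; lra) : 0 < - ta - x).
 have [H _] := h'P (- x - q) ltac:(clear -xI' q0 qt; lra) ltac:(by rewrite addrAC subrr add0r normrN gtr0_norm).
 have := after (x + q) ltac:(clear -q0 qt; lra); have := H ltac:(clear -q0; lra).
 by rewrite opprD -/(B (- x - q)); clear; lra.
(* Along the closing segment the angle goes back from above the level to below it, so it takes the
   value l there and the segment meets the line g1 = c, against the choice of [e]. *)
pose z1 th := g1 tb + th * (g1 ta - g1 tb); pose z2 th := g2 tb + th * (g2 ta - g2 tb).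
have cz1 : continuous z1 by apply: ctsD; [exact: ctsC | apply: ctsM; [exact: cts_id | exact: ctsC]].
have cz2 : continuous z2 by apply: ctsD; [exact: ctsC | apply: ctsM; [exact: cts_id | exact: ctsC]].
pose L th := sg * A (z1 th) (z2 th).
have cL : {within `[0, 1], continuous L}.
 apply: continuous_in_subspaceT => th; rewrite inE /= in_itv/= => thI.
 by apply: cvgM; [exact: cvg_cst | apply: turn_cts => //; exact: okdot (okl th thI)].
have L0 : L 0 = B tb by rewrite /L /z1 /z2 !mul0r !addr0.
have L1 : L 1 = B ta by rewrite /L /z1 /z2 !mul1r [g1 tb + _]addrC [g2 tb + _]addrC !subrK.
have [|th thI Lth] := IVT ler01 cL (v := sg * l).
 by rewrite L0 L1 ge_min le_max (ltW Ba) (ltW Bb) orbT.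
have thI' : 0 <= th <= 1 by move: thI; rewrite in_itv.
have Al : A (z1 th) (z2 th) = l by rewrite -[LHS]mul1r -[RHS]mul1r -sg2 -!mulrA -/(L th) Lth.
have [zc _] := sd _ _ (okl th thI') Al.
have : `|(1 - th) * (g1 tb - g1 ta)| <= e.
 rewrite normrM -[e]mul1r; apply: ler_pM => //; [rewrite ler_norml; clear -thI'; lra | exact: ltW].
have -> : (1 - th) * (g1 tb - g1 ta) = c - g1 ta by rewrite -zc; ring.
by rewrite ger0_norm; clear -ga ec; lra.
Qed.

(** Among three returns at decreasing distances from the starting point two lie on the same side of
    it, and then the later one falls between the start and the earlier one. *)
Lemma recurrent_curve_absurd g1 g2 rho : recurrent_curve g1 g2 rho -> 0 < rho ->
 (forall e T, 0 < e -> exists2 t, T <= t & 0 < t /\ (g1 t = g1 0 /\ `|g2 t - g2 0| < e)) -> False.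
Proof.
move=> RC rho0 cr; have [_ inj _ _] := RC.
have ne t : 0 < t -> g1 t = g1 0 -> g2 t != g2 0.
 move=> t0 e1; apply/eqP => e2; have := inj _ _ (ltW t0) (lexx 0) e1 e2; lra.
have [t1 _ [t10 [c1 r1]]] := cr rho 0 rho0.
have n1 := ne t1 t10 c1; have e1 : 0 < `|g2 t1 - g2 0| by rewrite normr_gt0 subr_eq0.
have [t2 t12 [t20 [c2 r2]]] := cr _ (t1 + 1) e1.
have n2 := ne t2 t20 c2; have e2 : 0 < `|g2 t2 - g2 0| by rewrite normr_gt0 subr_eq0.
have [t3 t23 [t30 [c3 r3]]] := cr _ (t2 + 1) e2.
have n3 := ne t3 t30 c3.
have k1 := @no_later_crossing g1 g2 rho t1 t2 RC t10 ltac:(lra) c1 r1 c2.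
have k2 := @no_later_crossing g1 g2 rho t1 t3 RC t10 ltac:(lra) c1 r1 c3.
have k3 := @no_later_crossing g1 g2 rho t2 t3 RC t20 ltac:(lra) c2 (lt_trans r2 r1) c3.
move: n1 n2 n3; rewrite -![g2 _ == g2 0]subr_eq0.
have E (x y : R) : x - y = (x - g2 0) - (y - g2 0) by ring.
move: k1 k2 k3 r1 r2 r3; rewrite (E (g2 t1) (g2 t2)) (E (g2 t1) (g2 t3)) (E (g2 t2) (g2 t3)).
move: (g2 t1 - g2 0) (g2 t2 - g2 0) (g2 t3 - g2 0) => a b c k1 k2 k3 r1 r2 r3 a0 b0 c0.
have sgn (x : R) : x != 0 -> 0 < x \/ x < 0 by rewrite neq_lt => /orP[]; [right|left].
have pp (x y : R) : 0 < x -> x < y -> 0 < x * (y - x) by move=> x0 xy; rewrite mulr_gt0// subr_gt0.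
have mm (x y : R) : x < 0 -> y < x -> 0 < x * (y - x) by move=> x0 xy; rewrite nmulr_rgt0// subr_lt0.
have [ap|an] := sgn a a0; have [bp|bn] := sgn b b0; have [cp|cn] := sgn c c0;
 move: r2 r3; rewrite ?(gtr0_norm ap) ?(ltr0_norm an) ?(gtr0_norm bp) ?(ltr0_norm bn) ?(gtr0_norm cp) ?(ltr0_norm cn) => r2 r3;
 first [by apply: k1; apply: pp | by apply: k1; apply: mm; rewrite // -ltrN2 | by apply: k2; apply: pp => //; lra
  | by apply: k2; apply: mm => //; lra | by apply: k3; apply: pp | by apply: k3; apply: mm; rewrite // -ltrN2].
Qed.

End planar.

(** * Configurations of points on the circle and their alternation weight *)

Section configurations.
Context {R : realType} (n : nat).
Implicit Types (v : 'rV[R]_n) (i k : 'I_n) (w : R -> R) (M y : R).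

(** Configurations are lifts to the line of n points in cyclic order; the successor of the last
    point is the first one, a period later. *)
Definition nxt v i : R := v ord0 (ordS i) + (if i.+1 == n then 2 * pi else 0).
Definition prv v i : R := v ord0 (ord_pred i) - (if i == 0%N :> nat then 2 * pi else 0).
Definition gap v i : R := nxt v i - v ord0 i.
Definition upd v i y : 'rV[R]_n := \row_k (if k == i then y else v ord0 k).
Definition shiftv v (c : R) : 'rV[R]_n := \row_k (v ord0 k + c).
Definition gaps2 v : R := \sum_i gap v i ^+ 2.
(** The positive part, in a closed form whose continuity is immediate. *)
Definition posp (x : R) : R := (`|x| + x) / 2.

(* Positive exactly at the configurations along which w alternates in sign. *)
Definition alt_weight M w (v : 'rV[R]_n) : R :=
 (\prod_(i < n) posp ((-1) ^+ i * w (v ord0 i))) * expR (M / 2 * gaps2 v).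

(** Every ordered configuration has a translate by a multiple of the period whose first point is in
    [0, 2 pi]; the others then lie below 4 pi. The bounds make the space compact. *)
Definition alt_config : set 'rV[R]_n :=
 [set v : 'rV[R]_n | (forall i, 0 <= v ord0 i <= 4 * pi) /\ forall i, 0 <= gap v i].

Lemma gap_pred v i : gap v (ord_pred i) = v ord0 i - prv v i.
Proof.
rewrite /gap /nxt /prv ord_predK; have -> : ((ord_pred i).+1 == n) = (i == 0%N :> nat).
 case: i => [[|j] jn] /=; first by rewrite add0n modn_small ?prednK ?eqxx.
 by rewrite modnDr modn_small ?(ltnW jn)// ltn_eqF.
by case: ifP => _; ring.
Qed.

Lemma sum_gap v : (0 < n)%N -> \sum_i gap v i = 2 * pi.
Proof.
move=> n0; rewrite /gap /nxt big_split /= big_split /= sumrN.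
have -> : \sum_(i < n) v ord0 (ordS i) = \sum_(i < n) v ord0 i.
 by rewrite [RHS](reindex (@ordS n)) //=; apply/onW_bij/ordS_bij.
rewrite addrAC subrr add0r -big_mkcond /=.
case: (n) n0 => // m _.
rewrite (big_pred1 ord_max) // => i; rewrite eqSS.
Qed.

Lemma ordS_neq i : (1 < n)%N -> ordS i != i.
Proof.
move=> n1; apply/eqP => /(congr1 val) /=.
have := ltn_ord i; rewrite leq_eqVlt => /orP[/eqP e|lt].
 by rewrite e modnn => e0; move: e; rewrite -e0; lia.
by rewrite modn_small//; lia.
Qed.

Lemma ord_pred_neq i : (1 < n)%N -> ord_pred i != i.
Proof. by move=> n1; rewrite eq_sym -{1}(ord_predK i) ordS_neq. Qed.

Lemma gap_upd v i y : (1 < n)%N -> gap (upd v i y) i = nxt v i - y.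
Proof. by move=> n1; rewrite /gap /nxt !mxE eqxx (negbTE (ordS_neq _ n1)). Qed.

Lemma gap_upd_pred v i y : (1 < n)%N -> gap (upd v i y) (ord_pred i) = y - prv v i.
Proof. by move=> n1; rewrite gap_pred /prv !mxE eqxx (negbTE (ord_pred_neq _ n1)). Qed.

Lemma gap_upd_other v i k y : k != i -> k != ord_pred i -> gap (upd v i y) k = gap v k.
Proof.
move=> ki kp; rewrite /gap /nxt !mxE (negbTE ki).
by case: (ordS k =P i) kp => // <-; rewrite ordSK eqxx.
Qed.

Lemma gaps2_upd v i y : (1 < n)%N -> gaps2 (upd v i y) =
 (nxt v i - y) ^+ 2 + (y - prv v i) ^+ 2
 + \sum_(k | (k != i) && (k != ord_pred i)) gap v k ^+ 2.
Proof.
move=> n1; rewrite /gaps2 (bigD1 i)//= (bigD1 (ord_pred i)) ?ord_pred_neq//=.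
rewrite gap_upd// gap_upd_pred// addrA; congr (_ + _).
by apply: eq_bigr => k /andP[? ?]; rewrite gap_upd_other.
Qed.

Lemma upd_id v i : upd v i (v ord0 i) = v.
Proof. by apply/rowP => k; rewrite mxE; case: eqP => // ->. Qed.

Lemma gap_shift v c i : gap (shiftv v c) i = gap v i.
Proof. by rewrite /gap /nxt !mxE; ring. Qed.

Lemma posp_ge0 (x : R) : 0 <= posp x.
Proof. by rewrite /posp; have := ler_norm (- x); rewrite normrN; lra. Qed.

Lemma posp_gt0 (x : R) : (0 < posp x) = (0 < x).
Proof. by rewrite /posp; case: (ltrP 0 x) => x0; [rewrite gtr0_norm|rewrite ler0_norm]; lra. Qed.

Lemma pospE (x : R) : 0 < x -> posp x = x.
Proof. by move=> x0; rewrite /posp gtr0_norm//; lra. Qed.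

Lemma posp_ge (x : R) : x <= posp x.
Proof. by rewrite /posp; have := ler_norm x; lra. Qed.

Lemma alt_weight_gt0 M w v :
 reflect (forall i, 0 < (-1) ^+ i * w (v ord0 i)) (0 < alt_weight M w v).
Proof.
rewrite /alt_weight pmulr_lgt0 ?expR_gt0//; apply: (iffP idP) => [H i|H].
 rewrite -posp_gt0 lt_neqAle posp_ge0 andbT eq_sym; apply/eqP => e.
 by move: H; rewrite (bigD1 i)//= e mul0r ltxx.
by apply: prodr_gt0 => i _; rewrite posp_gt0.
Qed.

Lemma coord_cts i : continuous (fun v : 'rV[R]_n => v ord0 i).
Proof. exact: coord_continuous. Qed.

Lemma gap_cts i : continuous (fun v : 'rV[R]_n => gap v i).
Proof. by apply: ctsB; [apply: ctsD; [|exact: ctsC] |]; exact: coord_cts. Qed.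

Lemma compact_alt_config : compact alt_config.
Proof.
have -> : alt_config = [set v : 'rV[R]_n | forall i, `[0, 4 * pi]%classic (v ord0 i)] `&`
  \bigcap_(i in [set: 'I_n]) [set v : 'rV[R]_n | 0 <= gap v i].
 apply/seteqP; split => v /=.
 - by move=> [H1 H2]; split => [i|i _] /=; [rewrite in_itv/=; exact: H1 | exact: H2].
 - by move=> [H1 H2]; split => i; [have := H1 i; rewrite /= in_itv | exact: H2].
apply: compact_closedI.
 exact: (@rV_compact _ n (fun=> `[0, 4 * pi : R]%classic) (fun=> @segment_compact R 0 (4 * pi))).
apply: closed_bigI => i _; have -> : [set v : 'rV[R]_n | 0 <= gap v i] = (gap^~ i) @^-1` [set x | 0 <= x] by [].
by apply: preimage_closed => [v _|]; [exact: gap_cts | exact: closed_ge].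
Qed.

Lemma posp_cts : continuous posp.
Proof. by apply: ctsM (@ctsC _ _ _); apply: ctsD; [apply: cts_abs|]; exact: cts_id. Qed.

Lemma gaps2_cts : continuous gaps2.
Proof.
apply: continuous_big => [x|i _]; first exact: add_continuous.
exact/cts_exp/gap_cts.
Qed.

Lemma alt_weight_cts M (w : R -> R -> R) : continuous (fun p : R * R => w p.1 p.2) ->
 continuous (fun p : R * 'rV[R]_n => alt_weight M (w p.1) p.2).
Proof.
move=> cw; apply: ctsM.
 apply: continuous_big => [x|i _]; first exact: mul_continuous.
 apply: (cts_comp (f := fun q : R * 'rV[R]_n => (-1) ^+ i * w q.1 (q.2 ord0 i)) _ posp_cts).
 apply: ctsZ.
 apply: (cts_comp (f := fun q : R * 'rV[R]_n => (q.1, q.2 ord0 i)) _ cw).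
 apply: cts_pair; first exact: cts_fst.
 exact: (cts_comp (g := fun v : 'rV[R]_n => v ord0 i) (@cts_snd R _) (@coord_cts i)).
apply: (cts_comp (f := fun q : R * 'rV[R]_n => M / 2 * gaps2 q.2) _ (@continuous_expR R)).
apply: ctsZ.
exact: (cts_comp (g := gaps2) (@cts_snd R _) gaps2_cts).
Qed.

Lemma alt_config_ge v : (forall i, 0 <= gap v i) -> forall i k, (i <= k)%N -> v ord0 i <= v ord0 k.
Proof.
move=> H i [k kn]; rewrite [nat_of_ord (Ordinal _)]/=; elim: k kn => [|k IH] kn ik.
 have -> : i = Ordinal kn by apply/val_inj => /=; lia.
 by [].
have [e|ik'] := eqVneq (nat_of_ord i) k.+1.
 by have -> : i = Ordinal kn by apply/val_inj.
have kn' : (k < n)%N by lia.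
apply: (le_trans (IH kn' ltac:(lia))).
have := H (Ordinal kn'); rewrite /gap /nxt /=.
have -> : ordS (Ordinal kn') = Ordinal kn by apply/val_inj; rewrite /= modn_small.
by rewrite ltn_eqF//; lra.
Qed.

Lemma alt_config_in v : (forall i, 0 <= gap v i) ->
 (forall i, i = 0%N :> nat -> 0 <= v ord0 i <= 2 * pi) -> alt_config v.
Proof.
move=> H H0; split => // i.
have n0 : (0 < n)%N by apply: leq_ltn_trans (ltn_ord i).
pose z := Ordinal n0; have z0 : v ord0 z <= v ord0 i by apply: alt_config_ge.
have := H0 z erefl.
have n1 : (n.-1 < n)%N by rewrite prednK.
have : v ord0 i <= v ord0 (Ordinal n1) by apply: alt_config_ge => //=; have := ltn_ord i; lia.
have := H (Ordinal n1); rewrite /gap /nxt /= prednK// eqxx.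
have -> : ordS (Ordinal n1) = z by apply/val_inj; rewrite /= prednK// modnn.
by lra.
Qed.

End configurations.

(** The difference of two solutions solves a linear equation with bounded coefficients; only the
    resulting inequality is recorded, so no coefficient has to be constructed. The equation holds
    for 0 < t <= T, whereas w and w_x are continuous everywhere, the initial time included. *)
Record parabolic (R : realType) (C T : R) (w wx wxx wt : R -> R -> R) : Prop := Parabolic {
 par_cont : continuous (fun p : R * R => w p.1 p.2);
 par_contx : continuous (fun p : R * R => wx p.1 p.2);
 par_per : forall t x, w t (x + 2 * pi) = w t x;
 par_perx : forall t x, wx t (x + 2 * pi) = wx t x;
 par_dx : forall t x : R, is_derive x 1 (w t) (wx t x);
 par_dxx : forall t x : R, 0 < t <= T -> is_derive x 1 (wx t) (wxx t x);
 par_dt : forall t x : R, 0 < t <= T -> is_derive t 1 (w^~ x) (wt t x);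
 par_ineq : forall t x : R, 0 < t <= T ->
  `|wt t x - wxx t x| <= C * (`|w t x| + `|wx t x|) }.

Section periodic.
Context {R : realType}.

Lemma periodic_nat (w : R -> R) k x : (forall x, w (x + 2 * pi) = w x) ->
 w (x + 2 * pi * k%:R) = w x.
Proof.
move=> wp; elim: k => [|k IH]; first by rewrite mulr0 addr0.
have -> : x + 2 * pi * k.+1%:R = x + 2 * pi * k%:R + 2 * pi by rewrite -[k.+1%:R]natr1; ring.
by rewrite wp.
Qed.

Lemma perZ (w : R -> R) (k : int) x : (forall x, w (x + 2 * pi) = w x) ->
 w (x + 2 * pi * k%:~R) = w x.
Proof.
move=> wp; case: k => k; first exact: periodic_nat.
rewrite NegzE mulrNz -[in RHS](subrK (2 * pi * k.+1%:R) x).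
by rewrite (periodic_nat k.+1 _ wp) mulrN.
Qed.

Lemma period_shift (x : R) : exists k : int, 0 <= x + 2 * pi * k%:~R < 2 * pi.
Proof.
have p0 : 0 < 2 * pi :> R by rewrite mulr_gt0 ?pi_gt0.
exists (- Num.floor (x / (2 * pi))).
have := floor_itv (x / (2 * pi)).
rewrite ler_pdivlMr// ltr_pdivrMr// intrD mulrNz; set k := (Num.floor _)%:~R => /andP[H1 H2].
by rewrite mulrN (mulrC _ k); move: H2; rewrite mulrDl mul1r; lra.
Qed.

End periodic.

Lemma ln_prodr (R : realType) (I : finType) (f : I -> R) : (forall i, 0 < f i) ->
 ln (\prod_i f i) = \sum_i ln (f i).
Proof.
move=> f0; elim: (index_enum I) => [|i l IH]; first by rewrite !big_nil ln1.
by rewrite !big_cons lnM ?posrE// ?IH//; apply: prodr_gt0.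
Qed.

(** * Maximum principle for the alternation weight *)

Section alternation_decay.
Context {R : realType} (n : nat).
Hypotheses (n1 : (1 < n)%N) (n_even : ~~ odd n).
Implicit Types (v : 'rV[R]_n) (w : R -> R).

Let n0 : (0 < n)%N. Proof. exact: ltnW. Qed.

Lemma alt_weight_shift_int M w v (k : int) : (forall x, w (x + 2 * pi) = w x) ->
 alt_weight M w (shiftv v (2 * pi * k%:~R)) = alt_weight M w v.
Proof.
move=> wp; rewrite /alt_weight; congr (_ * expR (_ * _)).
 by apply: eq_bigr => i _; rewrite mxE perZ.
by apply: eq_bigr => i _; rewrite gap_shift.
Qed.

Lemma alt_config_shift v : (forall i, 0 <= gap v i) -> exists2 v' : 'rV[R]_n, alt_config v' &
 forall M w, (forall x, w (x + 2 * pi) = w x) -> alt_weight M w v' = alt_weight M w v.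
Proof.
move=> H; have [k Hk] := period_shift (v ord0 (Ordinal n0)).
exists (shiftv v (2 * pi * k%:~R)); last by move=> M w; exact: alt_weight_shift_int.
apply: alt_config_in => [i|i i0]; first by rewrite gap_shift.
by rewrite mxE; have -> : i = Ordinal n0 by [apply/val_inj]; lra.
Qed.

(** Consecutive points carry opposite signs, also across the period because n is even, so they
    cannot coincide. *)
Lemma alt_gap_gt0 w v : (forall x, w (x + 2 * pi) = w x) -> (forall i, 0 <= gap v i) ->
 (forall i : 'I_n, 0 < (-1) ^+ i * w (v ord0 i)) -> forall i, 0 < gap v i.
Proof.
move=> wp g0 H i; rewrite lt_neqAle g0 andbT; apply/eqP => e.
have := H i; have := H (ordS i).
have -> : w (v ord0 (ordS i)) = w (v ord0 i).
 move: e; rewrite /gap /nxt; case: ifP => _ e.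
  by rewrite -wp; congr w; lra.
 by congr w; lra.
have -> : (-1) ^+ ordS i = - (-1) ^+ i :> R.
 rewrite -signr_odd -[in RHS]signr_odd -signrN; congr ((-1) ^+ nat_of_bool _) => /=.
 have := ltn_ord i; rewrite leq_eqVlt => /orP[/eqP e1|lt]; last by rewrite modn_small.
 by rewrite e1 modnn /=; have : ~~ odd i.+1 by [rewrite e1]; rewrite /= negbK => ->.
by lra.
Qed.

(** The two derivative tests for the logarithm of s w(y) plus (M / 2) ((nx - y)^2 + (y - pr)^2),
    multiplied by s w(a). *)
Lemma alt_spatial (s M a nx pr : R) (w w1 : R -> R) (w2 r : R) : 0 < r -> 0 < s * w a ->
 (forall y : R, is_derive y 1 w (w1 y)) -> is_derive a 1 w1 w2 ->
 let e y := expR (M / 2 * ((nx - y) ^+ 2 + (y - pr) ^+ 2)) in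
 (forall y : R, `|y - a| < r -> s * w y * e y <= s * w a * e a) ->
 let d := 2 * a - nx - pr in
 s * w1 a = - (s * w a * (M * d)) /\ s * w2 <= s * w a * ((M * d) ^+ 2 - 2 * M).
Proof.
move=> r0 wa d1 d2 e H d.
have de (y : R) : is_derive y 1 e (e y * (M * (2 * y - nx - pr))).
 apply: dexp; apply: deq (dcM (M / 2) (dD (dsq (dB (dcst nx y) (did y)))
  (dsq (dB (did y) (dcst pr y))))) _; by field.
have dg (y : R) : is_derive y 1 (fun y => s * w y * e y)
  (s * w1 y * e y + s * w y * (e y * (M * (2 * y - nx - pr)))).
 exact: dM (dcM s (d1 y)) (de y).
have e0 : 0 < e a by exact: expR_gt0.
have g1 := max_derive_eq0 r0 (dg a) H.
have E1 : s * w1 a = - (s * w a * (M * d)).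
 by apply: (mulIf (lt0r_neq0 e0)); apply/eqP; rewrite -subr_eq0 -[X in _ == X]g1 /d; apply/eqP; ring.
split => //.
have lin (y : R) : is_derive y 1 (fun y => M * (2 * y - nx - pr)) (2 * M).
 apply: deq (dcM M (dB (dB (dcM 2 (did y)) (dcst nx y)) (dcst pr y))) _; by ring.
have := max_derive2_le0 r0 (fun y _ => dg y)
 (dD (dM (dcM s d2) (de a)) (dM (dcM s (d1 a)) (dM (de a) (lin a)))) H.
rewrite E1 => HH.
have : e a * (s * w2 - s * w a * ((M * d) ^+ 2 - 2 * M)) <= 0.
 by apply: le_trans HH; rewrite le_eqVlt /d; apply/orP; left; apply/eqP; ring.
by rewrite pmulr_rle0//; lra.
Qed.

Lemma alt_weight_upd (M : R) w v i (y : R) : alt_weight M w (upd v i y) =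
 posp ((-1) ^+ i * w y) * expR (M / 2 * ((nxt v i - y) ^+ 2 + (y - prv v i) ^+ 2))
 * ((\prod_(k < n | k != i) posp ((-1) ^+ k * w (v ord0 k)))
   * expR (M / 2 * \sum_(k | (k != i) && (k != ord_pred i)) gap v k ^+ 2)).
Proof.
rewrite /alt_weight gaps2_upd// (bigD1 i)//= mxE eqxx mulrDr expRD.
rewrite [in LHS](eq_bigr (fun k : 'I_n => posp ((-1) ^+ k * w (v ord0 k)))); last first.
 by move=> k ki; rewrite mxE (negbTE ki).
by ring.
Qed.

Lemma alt_weight_max (M : R) w w1 v i (w2 : R) : (forall x, w (x + 2 * pi) = w x) ->
 (forall y : R, is_derive y 1 w (w1 y)) -> is_derive (v ord0 i) 1 w1 w2 ->
 alt_config v -> 0 < alt_weight M w v ->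
 (forall v' : 'rV[R]_n, alt_config v' -> alt_weight M w v' <= alt_weight M w v) ->
 let d := gap v (ord_pred i) - gap v i in
 let s := (-1) ^+ i * w (v ord0 i) in
 (-1) ^+ i * w1 (v ord0 i) = - (s * (M * d)) /\
 (-1) ^+ i * w2 <= s * ((M * d) ^+ 2 - 2 * M).
Proof.
move=> wp d1 d2 [_ g0] wv0 vmax d s.
have pos := elimT (alt_weight_gt0 M w v) wv0.
have gp := alt_gap_gt0 wp g0 pos.
have s0 : 0 < s by exact: pos.
have -> : d = 2 * v ord0 i - nxt v i - prv v i by rewrite /d gap_pred /gap; ring.
pose r := Num.min (gap v i) (gap v (ord_pred i)).
have r0 : 0 < r by rewrite lt_min !gp.
apply: (alt_spatial (r := r)) => // y; rewrite ltr_norml lt_min => /andP[].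
rewrite ltrNl lt_min => /andP[_ y1] /andP[y2 _].
have g0' k : 0 <= gap (upd v i y) k.
 have [->|ki] := eqVneq k i; first by rewrite gap_upd//; move: y2; rewrite /gap; lra.
 have [->|kp] := eqVneq k (ord_pred i).
  by rewrite gap_upd_pred//; move: y1; rewrite gap_pred; lra.
 by rewrite gap_upd_other.
have [v' Kv' v'E] := alt_config_shift g0'.
have := vmax _ Kv'; rewrite v'E// -[in X in _ <= X](upd_id v i) !alt_weight_upd.
rewrite ler_pM2r; last first.
 by rewrite mulr_gt0 ?expR_gt0//; apply: prodr_gt0 => k _; rewrite posp_gt0.
rewrite [X in _ <= X * _]pospE//; apply: le_trans.
by apply: ler_wpM2r; [exact: expR_ge0 | exact: posp_ge].
Qed.

(* At a maximizing configuration each alternation point is critical for w times a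
  Gaussian in the neighbouring gaps; this makes w_xx/w <= (M d)^2 - 2M there, and
  the differences d of consecutive gaps have sum at most 4 pi. *)
Lemma alt_weight_decay (C T M B rho : R) (w wx wxx wt : R -> R -> R) :
 0 <= C -> 0 <= M -> 0 < B -> parabolic C T w wx wxx wt ->
 n%:R * (C - 2 * M) + 16 * pi ^+ 2 * M ^+ 2 + 4 * pi * C * M < rho ->
 (forall v, alt_config v -> alt_weight M (w 0) v < B) ->
 forall (t : R) v, 0 <= t <= T -> alt_config v -> alt_weight M (w t) v < B * expR (rho * t).
Proof.
move=> C0 M0 B0 pw rhoP H0 t v tT Kv; rewrite -subr_lt0.
(* The weight is compared with B exp(rho t); at a first contact the configuration is a maximizer, so
   [alt_weight_max] applies to each of its points. *)
pose z (p : R * 'rV[R]_n) := alt_weight M (w p.1) p.2 - B * expR (rho * p.1).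
have cz : continuous z.
 apply: ctsB; first exact/alt_weight_cts/(par_cont pw).
 apply: ctsZ.
 apply: (cts_comp (f := fun p : R * 'rV[R]_n => rho * p.1) _ (@continuous_expR R)).
 by apply: ctsZ; exact: cts_fst.
apply: (first_touch (z := z) (@compact_alt_config R n) cz _ _ tT Kv) => [u Ku|{t v tT Kv}t v tT Kv zt zle].
 by rewrite /z /= mulr0 expR0 mulr1 subr_lt0; exact: H0.
have BE : alt_weight M (w t) v = B * expR (rho * t) by move: zt; rewrite /z /=; lra.
have wv0 : 0 < alt_weight M (w t) v by rewrite BE mulr_gt0 ?expR_gt0.
have pos := elimT (alt_weight_gt0 M (w t) v) wv0.
pose s (i : 'I_n) := (-1) ^+ i * w t (v ord0 i).
pose d i := gap v (ord_pred i) - gap v i.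
have tt : 0 <= t <= t by lra.
have step (i : 'I_n) : (-1) ^+ i * wt t (v ord0 i) <= s i * ((M * d i) ^+ 2 - 2 * M + C * (1 + M * `|d i|)).
 have [] := @alt_weight_max M (w t) (wx t) v i (wxx t (v ord0 i)).
 - exact: (par_per pw).
 - by move=> y; exact: (par_dx pw).
 - exact: (par_dxx pw).
 - by [].
 - by [].
 - by move=> v' Kv'; have := zle t v' tt Kv'; rewrite /z /= -BE; lra.
 rewrite -/(s i) -/(d i) => E1 E2.
 have := par_ineq pw (v ord0 i) tT.
 have sgn1 : `|(-1) ^+ i| = 1 :> R by rewrite normrX normrN1 expr1n.
 have abss x : `|x| = `|(-1) ^+ i * x| :> R by rewrite normrM sgn1 mul1r.
 rewrite (abss (wt _ _ - _)) (abss (w _ _)) (abss (wx _ _)) E1 -/(s i) normrN (normrM (s i)).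
 have si : 0 < s i by exact: pos.
 rewrite (gtr0_norm si) (normrM M) (ger0_norm M0) mulrBr => H1.
 have := le_trans (ler_norm _) H1; lra.
(* Each gap enters two of the differences, and the gaps add up to 2 pi. *)
have [d0 dS] : (forall i : 'I_n, `|d i| <= 4 * pi) /\ \sum_i `|d i| <= 4 * pi.
 have [_ g0] := Kv.
 have E : \sum_i `|d i| <= 4 * pi.
  apply: (@le_trans _ _ (\sum_i (gap v (ord_pred i) + gap v i))).
   by apply: ler_sum => i _; have := ler_normB (gap v (ord_pred i)) (gap v i); rewrite !(ger0_norm (g0 _)).
  have pE : \sum_i gap v (ord_pred i) = \sum_i gap v i.
   rewrite [RHS](reindex (@ord_pred n)) //=.
   by exists (@ordS n) => i _; [exact: ord_predK | exact: ordSK].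
  rewrite big_split /= pE.
  by rewrite !sum_gap//; lra.
 split => // i; apply: le_trans E; rewrite (bigD1 i)//= lerDl.
 by apply: sumr_ge0 => k _.
pose g (i : 'I_n) (y : R) := ln ((-1) ^+ i * w y (v ord0 i)).
have dg (i : 'I_n) : is_derive t 1 (g i) ((s i)^-1 * ((-1) ^+ i * wt t (v ord0 i))).
 apply: (@dcomp _ (@ln R) (fun y => (-1) ^+ i * w y (v ord0 i))).
  by apply: is_derive1_ln; exact: pos.
 by apply: dcM; exact: (par_dt pw).
have lnE y : 0 < alt_weight M (w y) v ->
  ln (alt_weight M (w y) v) = \sum_i g i y + M / 2 * gaps2 v.
 move=> /alt_weight_gt0 posy; rewrite /alt_weight lnM ?posrE ?expR_gt0//; last first.
  by apply: prodr_gt0 => i _; rewrite posp_gt0.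
 rewrite expRK ln_prodr => [|i]; last by rewrite posp_gt0.
 by congr (_ + _); apply: eq_bigr => i _; rewrite pospE.
(* Near t the weight is still positive, so its logarithm can be compared from the left with that of
   the exponential. *)
have [r r0 rP] : exists2 r, 0 < r & forall y, `|t - y| < r -> 0 < alt_weight M (w y) v.
 have := @alt_weight_cts R n M w (par_cont pw) (t, v); rewrite /continuous_at /=.
 move/cvgrPdist_lt => /(_ _ wv0)[[A1 A2] /= [/nbhs_ballP[r /= r0 rA] B']] AB.
 exists r => // y yr; have /AB : (A1 `*` A2) (y, v).
  by split => /=; [exact: rA | exact: (nbhs_singleton B')].
 by rewrite /= ltr_norml; lra.
have r0' : 0 < Num.min r t by rewrite lt_min r0; lra.
have /(left_max_derive_ge0 r0' (dB (dsum dg) (dcM rho (did t)))) :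
  forall y, t - Num.min r t < y <= t -> \sum_i g i y - rho * y <= \sum_i g i t - rho * t.
 move=> y; have [rm1 rm2] : Num.min r t <= r /\ Num.min r t <= t.
  by split; rewrite ge_min lexx ?orbT.
 move=> yt; have wy : 0 < alt_weight M (w y) v by apply: rP; rewrite ltr_norml; lra.
 have := zle y v ltac:(lra) Kv; rewrite /z /= subr_le0 => H1.
 have : ln (alt_weight M (w y) v) <= ln (B * expR (rho * y)).
  by rewrite ler_ln// posrE// mulr_gt0 ?expR_gt0.
 have : ln (alt_weight M (w t) v) = ln (B * expR (rho * t)) by rewrite BE.
 have lnB (x : R) : ln (B * expR x) = ln B + x by rewrite lnM ?posrE ?expR_gt0// expRK.
 by rewrite !lnB !lnE//; lra.
have : \sum_i (s i)^-1 * ((-1) ^+ i * wt t (v ord0 i)) <=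
  \sum_i ((M * d i) ^+ 2 - 2 * M + C * (1 + M * `|d i|)).
 apply: ler_sum => i _; have si : 0 < s i by exact: pos.
 by rewrite ler_pdivrMl//; exact: step.
have : \sum_i ((M * d i) ^+ 2 - 2 * M + C * (1 + M * `|d i|)) <=
  \sum_i ((4 * pi * M ^+ 2 + C * M) * `|d i| + (C - 2 * M)).
 apply: ler_sum => i _; rewrite exprMn -[d i ^+ 2]real_normK ?num_real//.
 have H2 : M ^+ 2 * `|d i| ^+ 2 <= M ^+ 2 * (4 * pi * `|d i|).
  by rewrite ler_wpM2l ?sqr_ge0// expr2 ler_wpM2r.
 lra.
have -> : \sum_i ((4 * pi * M ^+ 2 + C * M) * `|d i| + (C - 2 * M)) =
  (4 * pi * M ^+ 2 + C * M) * \sum_i `|d i| + n%:R * (C - 2 * M).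
 by rewrite big_split /= -mulr_sumr sumr_const card_ord -[(C - 2 * M) *+ n]mulr_natl.
have : (4 * pi * M ^+ 2 + C * M) * \sum_i `|d i| <= (4 * pi * M ^+ 2 + C * M) * (4 * pi).
 apply: ler_wpM2l => //; by rewrite addr_ge0 ?mulr_ge0 ?sqr_ge0 ?pi_ge0.
by lra.
Qed.

End alternation_decay.

(** At least n sign changes around the circle when n is even; [s] leaves the first sign free. As a
    finite set of strict inequalities it survives uniform perturbations. *)
Definition alternates (R : realType) (n : nat) (w : R -> R) :=
 exists (s : nat) (v : 'rV[R]_n), (forall i, 0 <= gap v i) /\
  forall i : 'I_n, 0 < (-1) ^+ (i + s) * w (v ord0 i).

Section parabolic_basics.
Context {R : realType}.
Implicit Types w wx wxx wt : R -> R -> R.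

Lemma parabolic_opp (C T : R) w wx wxx wt : parabolic C T w wx wxx wt ->
 parabolic C T (fun t x => - w t x) (fun t x => - wx t x)
  (fun t x => - wxx t x) (fun t x => - wt t x).
Proof.
case=> H1 H2 H3 H4 H5 H6 H7 H8; split => [||t x|t x|t x|t x tT|t x tT|t x tT].
- exact: ctsN.
- exact: ctsN.
- by rewrite H3.
- by rewrite H4.
- exact: dN.
- by apply: dN; exact: H6.
- by apply: dN; exact: H7.
- by rewrite !normrN -opprD normrN; have := H8 t x tT; rewrite -normrN opprB addrC.
Qed.

Lemma finite_lb (I : finType) (f : I -> R) : (forall i, 0 < f i) ->
 exists2 e, 0 < e & forall i, e <= f i.
Proof.
move=> f0; suff [e e0 H] : exists2 e, 0 < e & forall i, i \in index_enum I -> e <= f i.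
 by exists e => // i; apply: H; rewrite mem_index_enum.
elim: (index_enum I) => [|i l [e e0 IH]]; first by exists 1.
exists (Num.min e (f i)); first by rewrite lt_min e0 f0.
move=> k; rewrite inE => /orP[/eqP->|kl]; first by rewrite ge_min lexx orbT.
by rewrite ge_min IH.
Qed.

End parabolic_basics.

Section alternates.
Context {R : realType}.

Lemma alternates_opp n (w : R -> R) : alternates n w -> alternates n (fun x => - w x).
Proof.
move=> [s [v [g0 H]]]; exists s.+1, v; split => // i.
by rewrite addnS exprS mulrN mulN1r mulNr opprK.
Qed.

Lemma alternates_open n (w : R -> R) : alternates n w ->
 exists2 e, 0 < e & forall w', (forall x, `|w' x - w x| < e) -> alternates n w'.
Proof.
move=> [s [v [g0 H]]]; have [e e0 He] := finite_lb H; exists e => // w' ww'.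
exists s, v; split => // i; have := He i; have := ww' (v ord0 i).
have -> : `|w' (v ord0 i) - w (v ord0 i)| = `|(-1) ^+ (i + s) * (w' (v ord0 i) - w (v ord0 i))|.
 by rewrite normrM normrX normrN1 expr1n mul1r.
by rewrite ltr_norml mulrBr; lra.
Qed.

Lemma alternates_of n (w : R -> R) (x : nat -> R) s : (0 < n)%N ->
 (forall k, (k.+1 < n)%N -> x k <= x k.+1) -> x n.-1 <= x 0%N + 2 * pi ->
 (forall k, (k < n)%N -> 0 < (-1) ^+ (k + s) * w (x k)) -> alternates n w.
Proof.
move=> n0 xi xn H; exists s, (\row_i x i); split => [i|i]; last by rewrite mxE; exact: H.
rewrite /gap /nxt !mxE /=.
have := ltn_ord i; rewrite leq_eqVlt => /orP[/eqP e|lt].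
 by rewrite e eqxx modnn; have -> : nat_of_ord i = n.-1 by [lia]; lra.
by rewrite ltn_eqF// modn_small// addr0 subr_ge0 xi.
Qed.

(** Without the Gaussian factor (M = 0) the weight grows at most exponentially. If no configuration
    alternates at time 0, the weight vanishes there, hence lies below every positive multiple of an
    exponential and cannot be positive later. *)
Lemma alternates_sub_parabolic (C T : R) n (w wx wxx wt : R -> R -> R) : 0 <= C ->
 (1 < n)%N -> ~~ odd n -> parabolic C T w wx wxx wt ->
 forall t : R, 0 <= t <= T -> alternates n (w t) -> alternates n (w 0).
Proof.
move=> C0 n1 ne; suff key w' wx' wxx' wt' : parabolic C T w' wx' wxx' wt' ->
  forall (t : R) (v : 'rV[R]_n), 0 <= t <= T -> (forall i, 0 <= gap v i) ->
  (forall i : 'I_n, 0 < (-1) ^+ i * w' t (v ord0 i)) -> alternates n (w' 0).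
 move=> pw t tT [s [v [g0 H]]]; have [es|os] := boolP (~~ odd s).
  apply: (key _ _ _ _ pw t v) => // i; have := H i.
  by rewrite exprD -signr_odd -(signr_odd _ s) (negbTE es) mulr1 signr_odd.
 have := key _ _ _ _ (parabolic_opp pw) t v tT g0 _.
 move=> /(_ _)/alternates_opp; under eq_fun do rewrite opprK; apply => i; have := H i.
 by rewrite exprD -(signr_odd _ s); move: os; rewrite negbK => -> /=; rewrite expr1 mulrN1 mulNr mulrN.
move=> pw t v tT g0 H; apply: contrapT => H0.
have [v' Kv' v'E] := alt_config_shift n1 g0.
have p0 : 0 < alt_weight 0 (w' t) v by apply/alt_weight_gt0.
pose rho := n%:R * C + 1.
have B0 : 0 < alt_weight 0 (w' t) v * expR (- (rho * t)) by rewrite mulr_gt0 ?expR_gt0.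
have := alt_weight_decay n1 ne C0 (lexx 0) B0 pw (rho := rho) _ _ tT Kv'.
rewrite (v'E _ _ (par_per pw t)); move: (alt_weight 0 (w' t) v) p0 B0 => p p0 B0.
have -> : p * expR (- (rho * t)) * expR (rho * t) = p by rewrite -mulrA -expRD addNr expR0 mulr1.
rewrite ltxx => F; suff: false by []; apply: F.
 by rewrite /rho !(mulr0, expr0n) /= !(mulr0, subr0, addr0); lra.
move=> u [_ gu]; apply: le_lt_trans B0; rewrite leNgt; apply/negP => /alt_weight_gt0 Hu.
by apply: H0; exists 0%N, u; split => // i; rewrite addn0.
Qed.

(** For M = C + 1 the rate in [alt_weight_decay] is a - n (C + 2), where a is the sum of the terms
    without n. Twice an integer larger than a + 1 brings it below -1 and keeps n even. *)
Definition alt_bound (C : R) : nat :=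
 2 * (Num.truncn (16 * pi ^+ 2 * (C + 1) ^+ 2 + 4 * pi * C * (C + 1) + 1)).+1.

Lemma alt_bound_decay (C T B : R) (w wx wxx wt : R -> R -> R) : 0 <= C -> 0 < B ->
 parabolic C T w wx wxx wt ->
 (forall v : 'rV[R]_(alt_bound C), alt_config v -> alt_weight (C + 1) (w 0) v < B) ->
 forall (t : R) (v : 'rV[R]_(alt_bound C)), 0 <= t <= T -> alt_config v ->
  alt_weight (C + 1) (w t) v < B * expR (- t).
Proof.
move=> C0 B0 pw H t v tT Kv; rewrite -mulN1r.
have n1 : (1 < alt_bound C)%N by rewrite /alt_bound; lia.
have ne : ~~ odd (alt_bound C) by rewrite /alt_bound oddM.
apply: (alt_weight_decay n1 ne C0 _ B0 pw _ H tT Kv); first by lra.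
rewrite /alt_bound natrM; set a := 16 * pi ^+ 2 * (C + 1) ^+ 2 + _.
have pi0 := @pi_gt0 R.
have a0 : 0 <= a + 1 by rewrite !addr_ge0 ?mulr_ge0 ?sqr_ge0 ?(ltW pi0)//; lra.
have := truncnS_gt (a + 1); set k := (_.+1)%:R => kgt.
have -> : 4 * pi * C * (C + 1) = a - 16 * pi ^+ 2 * (C + 1) ^+ 2 by rewrite /a; ring.
have : 0 <= k * C by rewrite mulr_ge0// ler0n.
have : 0 <= k by rewrite ler0n.
by nra.
Qed.

End alternates.

(** * Hopf lemma along a slanted line *)

Section hopf.
Context {R : realType}.

(* Hopf lemma to the right of the line x = b + m (t - t'), with the barrier
  eps (y + A y^2 - L (t' - t)) in the variable y = x - b - m (t - t'). *)
Lemma hopf (C T b m h r0 t' : R) (w wx wxx wt : R -> R -> R) : 0 <= C ->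
 parabolic C T w wx wxx wt -> 0 < h -> 0 < r0 -> h <= t' <= T ->
 (forall t y : R, t' - h <= t <= t' -> 0 <= y <= r0 -> 0 <= w t (b + m * (t - t') + y)) ->
 (forall t y : R, t' - h <= t <= t' -> 0 < y <= r0 -> 0 < w t (b + m * (t - t') + y)) ->
 w t' b = 0 -> 0 < wx t' b.
Proof.
move=> C0 pw h0 r00 t'T wge wgt w0.
(* The curvature 2 A of the barrier must dominate its speed L, the drift m of the line and the lower
   order terms in C. The width r below is chosen independently of A. *)
pose A := 2 / h + `|m| + 2 * C + 1.
have m0 : 0 <= `|m| by [].
have hh : 0 < 2 / h by rewrite divr_gt0.
have A0 : 0 < A by rewrite /A; lraR.
pose D := `|m| + C + 1.
have D0 : 0 < D by rewrite /D; lraR.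
pose r := Num.min (Num.min r0 (1 / 2)) (Num.min (h / 8) (1 / (8 * D))).
have r_gt0 : 0 < r by rewrite !lt_min r00 !divr_gt0//= mulr_gt0.
have [rr0 r1 rh rD] : [/\ r <= r0, r <= 1 / 2, r <= h / 8 & r <= 1 / (8 * D)].
 by split; rewrite /r !ge_min lexx ?orbT.
have rD' : r * D <= 1 / 8.
 have := rD; rewrite ler_pdivlMr; last by rewrite mulr_gt0.
 by nra.
(* With this L the barrier is nonpositive at the initial time t' - h for 0 <= y <= r. *)
pose L := 2 * (r + A * r ^+ 2) / h.
have LA : L <= A * (1 / 4) + 2 / h * (1 / 2).
 rewrite /L ler_pdivrMr//.
 have -> : (A * (1 / 4) + 2 / h * (1 / 2)) * h = A * h / 4 + 1 by field; rewrite gt_eqF.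
 have : r ^+ 2 <= h / 8 by rewrite expr2; nra.
 by move=> H; nra.
have L0 : 0 < L by rewrite divr_gt0// mulr_gt0// addr_gt0// mulr_gt0// exprn_gt0.
pose K : set R := `[0, r]%classic.
have cline : continuous (fun p : R * R => b + m * (p.1 - h) + p.2).
 apply: ctsD; last exact: cts_snd.
 apply: ctsD; first exact: ctsC.
 apply: ctsZ.
 by apply: ctsB; [exact: cts_fst | exact: ctsC].
have [d d0 dP] : exists2 d, 0 < d & forall t, t' - h <= t <= t' -> d <= w t (b + m * (t - t') + r).
 have cf : continuous (fun s : R => w s (b + m * (s - t') + r)).
  apply: (cts_comp (f := fun s : R => (s, b + m * (s - t') + r)) _ (par_cont pw)).
  apply: cts_pair; first exact: cts_id.
  apply: ctsD; last exact: ctsC.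
  apply: ctsD; first exact: ctsC.
  apply: ctsZ.
  by apply: ctsB; [exact: cts_id | exact: ctsC].
 have [|c cI cmin] := @EVT_min R _ (t' - h) t' _ (continuous_subspaceT cf); first by lraR.
 move: cI; rewrite in_itv/= => cI.
 exists (w c (b + m * (c - t') + r)); first by apply: wgt => //; lraR.
 by move=> t tI; apply: cmin; rewrite in_itv.
pose e := d / 2.
have r2 : r ^+ 2 <= r by rewrite expr2; nra.
have psib : r + A * r ^+ 2 <= 1 / 2 + A by have := ler_wpM2l (ltW A0) r2; nra.
pose eps := e / (1 / 2 + A).
have e0 : 0 < e by rewrite /e; lraR.
have eps0 : 0 < eps by rewrite divr_gt0//; lraR.
have epsr : eps * (r + A * r ^+ 2) <= e.
 by rewrite /eps mulrAC ler_pdivrMr; [apply: ler_wpM2l psib; exact: ltW | lraR].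
pose psi (t y : R) := eps * (y + A * y ^+ 2 - L * (t' - t)).
(* The margin eta keeps the comparison strict where w may vanish; it tends to 0 in [fin]. *)
have key (eta : R) : 0 < eta -> forall t y, t' - h <= t <= t' -> 0 <= y <= r ->
  psi t y < w t (b + m * (t - t') + y) + eta.
 move=> eta0.
 pose z (p : R * R) := psi (p.1 + (t' - h)) p.2 - w (p.1 + (t' - h)) (b + m * (p.1 - h) + p.2) - eta.
 have cz : continuous z.
  apply: ctsB; last exact: ctsC.
  apply: ctsB.
   apply: ctsZ.
   apply: ctsB.
    apply: ctsD; first exact: cts_snd.
    by apply: ctsM; [exact: ctsC | apply: cts_exp; exact: cts_snd].
   apply: ctsZ.
   apply: ctsB; first exact: ctsC.
   by apply: ctsD; [exact: cts_fst | exact: ctsC].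
  apply: cts2 cline; first exact: (par_cont pw).
  by apply: ctsD; [exact: cts_fst | exact: ctsC].
 suff H : forall (t y : R), 0 <= t <= h -> K y -> z (t, y) < 0.
  move=> t y tI yI; have := H (t - (t' - h)) y ltac:(lraR).
  rewrite /z /K /= subrK in_itv /=; have -> : t - (t' - h) - h = t - t' by ring.
  by move=> /(_ yI); lraR.
 have zE (t y : R) : z (t, y) = psi (t + (t' - h)) y - w (t + (t' - h)) (b + m * (t + (t' - h) - t') + y) - eta.
  by rewrite /z /=; have -> : t + (t' - h) - t' = t - h by ring.
 have Lh : L * h = 2 * (r + A * r ^+ 2) by rewrite /L -mulrA mulVf ?mulr1// gt_eqF.
 have psiy (y : R) : 0 <= y <= r -> y + A * y ^+ 2 <= r + A * r ^+ 2.
  move=> yr; have : y ^+ 2 <= r ^+ 2 by rewrite !expr2; nra.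
  by move/(ler_wpM2l (ltW A0)); lraR.
 apply: (@first_touch R _ K h z (@segment_compact R 0 r) cz) => [y|t y tI]; rewrite /K /= in_itv/= => yI.
  rewrite zE add0r /psi; have -> : t' - (t' - h) = h by ring.
  have := wge (t' - h) y ltac:(lraR) ltac:(lraR).
  have : eps * (y + A * y ^+ 2 - L * h) <= 0.
   by rewrite pmulr_rle0//; have := psiy y yI; rewrite Lh; have := ltW r_gt0; have := mulr_ge0 (ltW A0) (sqr_ge0 r); lraR.
  by lraR.
 move=> zt zle.
 pose s0 := t + (t' - h); pose l (s : R) := b + m * (s - t'); pose x0 := l s0 + y.
 have s0I : 0 < s0 <= T by rewrite /s0; lraR.
 have s0h : t' - h <= s0 <= t' by rewrite /s0; lraR.
 have zt' : psi s0 y - w s0 x0 - eta = 0 by rewrite -zt zE.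
 have W0 : 0 <= w s0 x0 by apply: wge => //; lraR.
 have psile : psi s0 y <= eps * (y + A * y ^+ 2).
  by rewrite /psi ler_pM2l// gerDl oppr_le0 mulr_ge0// ?(ltW L0)//; lraR.
 have y0 : 0 < y.
  rewrite lt_neqAle eq_sym; case: eqVneq yI zt' psile => [->|_ ? _ _] /=; last by lraR.
  by rewrite expr0n /= mulr0 addr0 mulr0; lraR.
 have yr : y < r.
  rewrite lt_neqAle; case: eqVneq yI zt' psile => [yE|_ ? _ _] /=; last by lraR.
  by rewrite /x0 /l yE; have := dP s0 s0h; rewrite /e in epsr; lraR.
 pose rr := Num.min y (r - y).
 have rrp : 0 < rr by rewrite lt_min y0; clear -yr; lra.
 have [rr1 rr2] : rr <= y /\ rr <= r - y by rewrite /rr !ge_min !lexx orbT.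
 have dpsi (x : R) : is_derive x 1 (fun x => psi s0 (x - l s0)) (eps * (1 + 2 * A * (x - l s0))).
  have dx := dB (did x) (dcst (l s0) x).
  by apply: deq (dcM eps (dB (dD dx (dcM A (dsq dx))) (dcst (L * (t' - s0)) x))) _; ring.
 have dpsi2 (x : R) : is_derive x 1 (fun x => eps * (1 + 2 * A * (x - l s0))) (eps * (2 * A)).
  have dx := dB (did x) (dcst (l s0) x).
  by apply: deq (dcM eps (dD (dcst 1 x) (dcM (2 * A) dx))) _; ring.
 have smax (x : R) : `|x - x0| < rr -> psi s0 (x - l s0) - w s0 x <= psi s0 (x0 - l s0) - w s0 x0.
  rewrite ltr_norml /x0 => xI; have := zle t (x - l s0) ltac:(clear -tI; lra); rewrite in_itv/= zE => /(_ ltac:(clear -xI rr1 rr2; lra)).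
  rewrite -/s0 -/(l s0); have -> : l s0 + (x - l s0) = x by ring.
  have -> : l s0 + y - l s0 = y by ring.
  by move: zt'; rewrite /x0; clear; lra.
 have x0l : x0 - l s0 = y by rewrite /x0; ring.
 have := max_derive_eq0 rrp (dB (dpsi x0) (par_dx pw s0 x0)) smax.
 have := max_derive2_le0 rrp (fun x _ => dB (dpsi x) (par_dx pw s0 x))
  (dB (dpsi2 x0) (par_dxx pw x0 s0I)) smax.
 rewrite x0l => E2 E1.
 pose r1' := Num.min t (rr / (`|m| + 1)).
 have r1'0 : 0 < r1' by rewrite lt_min divr_gt0 ?ltr_wpDl ?andbT//; clear -tI; lra.
 have [r1t r1m] : r1' <= t /\ r1' * (`|m| + 1) <= rr.
  split; first by rewrite /r1' ge_min lexx.
  by rewrite -ler_pdivlMr /r1' ?ge_min ?lexx ?orbT//; lraR.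
 have dpsit : is_derive s0 1 (fun s => psi s (x0 - l s)) (eps * (- m + A * (2 * y * - m) + L)).
  have dl : is_derive s0 1 (fun s => x0 - l s) (- m).
   by apply: deq (dB (dcst x0 s0) (dD (dcst b s0) (dcM m (dB (did s0) (dcst t' s0))))) _; ring.
  apply: deq (dcM eps (dB (dD dl (dcM A (dsq dl))) (dcM L (dB (dcst t' s0) (did s0))))) _.
  by rewrite x0l; ring.
 have /(left_max_derive_ge0 r1'0 (dB dpsit (par_dt pw x0 s0I))) E3 :
   forall s : R, s0 - r1' < s <= s0 -> psi s (x0 - l s) - w s x0 <= psi s0 (x0 - l s0) - w s0 x0.
  move=> s sI; have ys : x0 - l s = y + m * (s0 - s) by rewrite /x0 /l; ring.
  have msb : `|m * (s0 - s)| <= rr.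
   rewrite normrM (ger0_norm (x := s0 - s)); last by clear -sI; lra.
   apply: le_trans r1m; rewrite mulrC; apply: ler_pM => //.
   - by clear -sI; lra.
   - by clear -sI; lra.
   - by clear; lra.
  have := zle (s - (t' - h)) (x0 - l s) _; rewrite /s0 in sI; move=> /(_ ltac:(clear -sI r1t tI; lra)).
  rewrite in_itv/= zE subrK ys; move: msb; rewrite ler_norml => msb /(_ ltac:(clear -msb rr1 rr2; lra)).
  rewrite -/(l s); have -> : l s + (y + m * (s0 - s)) = x0 by rewrite -ys; ring.
  by move: zt'; rewrite x0l; clear; lra.
 have := par_ineq pw x0 s0I; rewrite (ger0_norm W0).
 have wxE : wx s0 x0 = eps * (1 + 2 * A * y) by move: E1; clear; lra.
 have Ay : 0 <= A * y by rewrite mulr_ge0// ltW.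
 have wx0 : 0 <= wx s0 x0 by rewrite wxE mulr_ge0 ?(ltW eps0)//; clear -Ay; lra.
 rewrite (ger0_norm wx0) ler_norml => /andP[E4 _].
 have Wle : w s0 x0 <= eps * (r + A * r ^+ 2) by have := ler_wpM2l (ltW eps0) (psiy y yI); move: psile zt' eta0; clear; lra.
 have : C * (w s0 x0 + wx s0 x0) <= C * (eps * (r + A * r ^+ 2) + eps * (1 + 2 * A * y)).
  by apply: ler_wpM2l => //; rewrite wxE; move: Wle; clear; lra.
 rewrite -mulrDr mulrCA => E5.
 have : 0 <= eps * (L + (`|m| + C) * (1 + 2 * A * y) + C * (r + A * r ^+ 2) - 2 * A).
  have : eps * (- m * (1 + 2 * A * y)) <= eps * (`|m| * (1 + 2 * A * y)).
   rewrite ler_pM2l// ler_wpM2r//; first by clear -Ay; lra.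
   by rewrite -normrN ler_norm.
  by move: E2 E3 E4 E5; clear; lra.
 rewrite pmulr_rge0// => E6.
 have F1 : A * (y * (`|m| + C)) <= A * (1 / 8).
  apply: (ler_wpM2l (ltW A0)); apply: le_trans rD'.
  by apply: ler_pM; [exact: ltW|exact: addr_ge0|exact: ltW|clear; rewrite /D; lraR].
 have rC : r * C <= 1 / 8.
  by apply: le_trans rD'; rewrite /D; apply: ler_wpM2l; [exact: ltW|clear -m0; lra].
 have F2 : A * (r * (r * C)) <= A * (1 / 8).
  by apply: (ler_wpM2l (ltW A0)); clear -rC r1 r_gt0 C0; nra.
 have AE : A = 2 / h + `|m| + 2 * C + 1 by [].
 clearbody A L; move: E6 LA AE F1 F2 rC m0 hh C0; rewrite expr2; clear; lra.
have fin (y : R) : 0 <= y <= r -> eps * y <= w t' (b + y).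
 move=> yI; have : psi t' y <= w t' (b + y).
  apply/ler_addgt0Pr => eta eta0; have := key eta eta0 t' y ltac:(lraR) yI.
  by rewrite subrr mulr0 addr0 => /ltW.
 apply: le_trans; rewrite /psi subrr mulr0 subr0 ler_pM2l// lerDl.
 by rewrite mulr_ge0 ?sqr_ge0// ltW.
rewrite ltNge; apply/negP => wxle.
have [q q0 qP] := is_derive_eps (par_dx pw t' b) (e := eps / 2) ltac:(lraR).
have [y [y0 y1 y2]] := below2 r_gt0 q0.
have := qP (b + y); have -> : b + y - b = y by ring.
rewrite gtr0_norm// => /(_ y2); rewrite w0 subr0 ler_norml => /andP[_].
have yI : 0 <= y <= r by rewrite !ltW.
have := fin y yI; clear -y0 eps0 wxle; nra.
Qed.

End hopf.

(** * Times at which all zeros are simple *)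

Section simple_zeros.
Context {R : realType}.

Lemma tube (Y : topologicalType) (K : set Y) (f : R * Y -> R) (t : R) :
 compact K -> continuous f -> (forall y, K y -> 0 < f (t, y)) ->
 exists2 d, 0 < d & forall (s : R) y, `|s - t| < d -> K y -> 0 < f (s, y).
Proof.
move=> /compact_near_coveringP cK cf f0.
have : \forall s \near t, K `<=` (fun y => 0 < f (s, y)).
 apply: (cK R (nbhs t) (fun s y => 0 < f (s, y))) => y Ky; have := cf (t, y); move/cvgrPdist_lt => /(_ _ (f0 _ Ky)).
 case=> -[A B] /= [nA nB] AB; exists (B, A) => //= -[y' s] /= [By As].
 by have /AB /= : (A `*` B) (s, y') by []; rewrite ltr_norml; lra.
move=> /nbhs_ballP[d /= d0 H]; exists d => // s y sd Ky.
by apply: H => //; rewrite /ball/= distrC.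
Qed.

Lemma pos_right_ge0 (f : R -> R) (x r : R) : continuous f -> 0 < r ->
 (forall y, x < y < x + r -> 0 < f y) -> 0 <= f x.
Proof.
move=> cf r0 H; rewrite leNgt; apply/negP => fx.
have [||d d0 P] := @tube R [set 0] (fun p => - f p.1) x (@compact_set1 R 0).
- by apply: ctsN; apply: cts_comp cf; exact: cts_fst.
- by move=> z zz /=; lra.
have [h [h0 hr hd]] := below2 r0 d0.
have := P (x + h) 0 _ erefl; have -> : x + h - x = h by ring.
rewrite gtr0_norm// => /(_ hd) /=; have := H (x + h) ltac:(lra); lra.
Qed.

Lemma parabolic_sgn (C T : R) (w wx wxx wt : R -> R -> R) k : parabolic C T w wx wxx wt ->
 parabolic C T (fun t x => (-1) ^+ k * w t x) (fun t x => (-1) ^+ k * wx t x)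
  (fun t x => (-1) ^+ k * wxx t x) (fun t x => (-1) ^+ k * wt t x).
Proof.
move=> pw; rewrite -signr_odd; case: (odd k) => /=.
 rewrite expr1.
 by have := parabolic_opp pw; congr parabolic; do 2 apply: funext => ?; rewrite mulN1r.
by move: pw; congr parabolic; do 2 apply: funext => ?; rewrite mul1r.
Qed.

Definition simple_zeros (w wx : R -> R) := forall x, w x = 0 -> wx x <> 0.

(* A chain of j + 1 points of alternating sign going left from q, together
  with the simplicity of all the zeros met on the way. *)
Definition chain (w wx : R -> R) (q : R) (s j : nat) (y : nat -> R) :=
 [/\ y 0%N = q, forall k, (k < j)%N -> y k.+1 < y k, q - 2 * pi < y j,
   forall k, (k <= j)%N -> 0 < (-1) ^+ (k + s) * w (y k) &
   forall x, y j <= x <= q -> w x = 0 -> wx x <> 0].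

Lemma chain_near (w wx : R -> R -> R) (t q : R) s j y :
 continuous (fun p : R * R => w p.1 p.2) -> continuous (fun p : R * R => wx p.1 p.2) ->
 chain (w t) (wx t) q s j y ->
 exists2 d, 0 < d & forall t', `|t' - t| < d -> chain (w t') (wx t') q s j y.
Proof.
move=> cw cwx [y0 dec yq sg sz].
have cabs : continuous (fun p : R * R => `|w p.1 p.2| + `|wx p.1 p.2|).
 by apply: ctsD; apply: cts_abs.
have [x|d1 d10 P1] := tube (t := t) (@segment_compact R (y j) q) cabs.
 rewrite /= in_itv/= => xI; rewrite lt_neqAle addr_ge0// andbT eq_sym paddr_eq0//.
 by rewrite !normr_eq0; apply/negP => /andP[/eqP w0 /eqP]; exact: sz.
have [d2 d20 P2] : exists2 d, 0 < d & forall t', `|t' - t| < d ->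
  forall k, (k <= j)%N -> 0 < (-1) ^+ (k + s) * w t' (y k).
 elim: {dec yq sz P1} j sg => [|j IH] sg.
  have [||d d0 P] := @tube R [set 0] (fun p => (-1) ^+ (0 + s) * w p.1 (y 0%N)) t (@compact_set1 R 0).
  - apply: ctsZ.
   by apply: cts2 cw _ _; [exact: cts_fst | exact: ctsC].
  - by move=> z zz; exact: sg.
  by exists d => // t' t'd k; rewrite leqn0 => /eqP->; exact: (P t' 0).
 have [|d d0 P] := IH; first by move=> k kj; apply: sg; clear -kj; lia.
 have [||d' d'0 P'] := @tube R [set 0] (fun p => (-1) ^+ (j.+1 + s) * w p.1 (y j.+1)) t (@compact_set1 R 0).
 - apply: ctsZ.
  by apply: cts2 cw _ _; [exact: cts_fst | exact: ctsC].
 - by move=> z zz; exact: sg.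
 have [h [h0 hd hd']] := below2 d0 d'0.
 exists h => // t' t'h k; rewrite leq_eqVlt => /orP[/eqP->|kj].
  by apply: (P' t' 0) => //; lra.
 by apply: P; [clear -t'h hd; lra | clear -kj; lia].
have [h [h0 hd hd']] := below2 d10 d20.
exists h => // t' t'h; split => //; first by apply: P2; lra.
move=> x xI w0 wx0; have := P1 t' x ltac:(lra) _; rewrite /= in_itv/= w0 wx0 normr0 addr0 ltxx.
by move=> /(_ xI).
Qed.

Lemma chain_alternates (w wx : R -> R) (q : R) s n y : (0 < n)%N ->
 chain w wx q s n.-1 y -> alternates n w.
Proof.
move=> n0 [y0 dec yq sg _].
apply: (@alternates_of _ n w (fun k => y (n.-1 - k)%N) (n.-1 + s)) => //.
- move=> k kn; have -> : (n.-1 - k = (n.-1 - k.+1).+1)%N by lia.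
 by apply/ltW/dec; lia.
- by rewrite subnn subn0 y0; have : q - 2 * pi < y n.-1 by []; lra.
- move=> k kn; have -> : (-1) ^+ (k + (n.-1 + s)) = (-1) ^+ (n.-1 - k + s) :> R.
  have -> : (k + (n.-1 + s) = (n.-1 - k + s) + 2 * k)%N by lia.
  by rewrite exprD exprM sqrrN expr1n expr1n mulr1.
 by apply: sg; clear -kn; lia.
Qed.

(** Either at some time the last sign persists from y j down to the end of the period, and then all
    zeros, up to periods, lie in the range already known to be simple. Or the opposite sign, or a
    zero, is met at all times; the extremal such point for a line moving quickly to the left is a
    simple zero by [hopf], and the sign changes just beyond it. *)
Lemma chain_step (C T : R) (w wx wxx wt : R -> R -> R) (a b q : R) s j y : 0 <= C ->
 parabolic C T w wx wxx wt -> 0 <= a -> a < b -> b <= T ->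
 (forall t, a <= t <= b -> chain (w t) (wx t) q s j y) ->
 (exists2 t, a <= t <= b & simple_zeros (w t) (wx t)) \/
 exists2 t, a <= t <= b & exists y', chain (w t) (wx t) q s j.+1 y'.
Proof.
move=> C0 pw a0 ab bT ch.
pose sg : R := (-1) ^+ (j + s).
pose lft := q - 2 * pi.
pose P := (`[a, b]%classic `*` `[lft, y j]%classic) `&` [set p : R * R | sg * w p.1 p.2 <= 0].
have [nex|ex] := pselect (exists2 t, a <= t <= b & forall x, lft <= x <= y j -> 0 < sg * w t x).
 have [t tI tP] := nex; left; exists t => // x w0.
 have [k kI] := period_shift (x - lft).
 have [_ _ _ _ sz] := ch t tI.
 have := sz (x + 2 * pi * k%:~R); rewrite (perZ _ _ (par_per pw t)).
 rewrite (perZ _ _ (par_perx pw t)); apply => //.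
 apply/andP; split; last by rewrite /lft in kI; lraR.
 rewrite leNgt; apply/negP => lt.
 have := tP (x + 2 * pi * k%:~R) ltac:(lraR).
 by rewrite (perZ _ _ (par_per pw t)) w0 mulr0 ltxx.
right.
have exP t : a <= t <= b -> exists2 x, lft <= x <= y j & sg * w t x <= 0.
 move=> tI; apply: contrapT => H; apply: ex; exists t => // x xI.
 by rewrite ltNge; apply/negP => xP; apply: H; exists x.
have csw : continuous (fun p : R * R => sg * w p.1 p.2).
 by apply: ctsZ; exact: (par_cont pw).
have cP : compact P.
 apply: compact_closedI; first by apply: compact_setX; exact: segment_compact.
 have -> : [set p : R * R | sg * w p.1 p.2 <= 0] = (fun p => sg * w p.1 p.2) @^-1` [set x | x <= 0] by [].
 by apply: preimage_closed => [p _|]; [exact: csw | exact: closed_le].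
have [xb xbI xbP] := exP b ltac:(lraR).
have P0 : P !=set0 by exists (b, xb); split => //; split => /=; rewrite in_itv/=; lraR.
(* So steep that any point at time b beats all points at time a; the maximum is therefore attained
   after a, which leaves a past interval for [hopf]. *)
pose m : R := - (y j - lft + 1) / (b - a).
have cg : continuous (fun p : R * R => p.2 - m * p.1).
 by apply: ctsB; [exact: cts_snd | apply: ctsZ; exact: cts_fst].
have [[t x]] := compact_EVT_max P0 cP (continuous_subspaceT cg).
rewrite inE => -[[/= tI xI] wtx] mx; move: tI xI; rewrite !in_itv/= => tI xI.
have mmax t' x' : a <= t' <= b -> lft <= x' <= y j -> x - m * t < x' - m * t' -> 0 < sg * w t' x'.
 move=> t'I x'I lt; rewrite ltNge; apply/negP => le.
 have /mx /= : (t', x') \in P by rewrite inE; split => //; split => /=; rewrite in_itv.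
 by lraR.
have [y0 dec yq sgn sz] := ch t tI.
have xy : x < y j.
 have : x <= y j by lraR.
 rewrite le_eqVlt => /orP[/eqP xE|//]; move: wtx; rewrite xE.
 by have := sgn j (leqnn j); rewrite -/sg; lraR.
have mE : m * (b - a) = - (y j - lft + 1).
 by rewrite /m -mulrA mulVf ?mulr1// gt_eqF// subr_gt0.
have ta : a < t.
 have : a <= t by lraR.
 rewrite le_eqVlt => /orP[/eqP tE|//].
 have /mx /= : (b, xb) \in P by rewrite inE; split => //; split => /=; rewrite in_itv/=; lraR.
 by rewrite -tE; lraR.
have m0 : m < 0 by rewrite /m mulNr oppr_lt0 divr_gt0//; lraR.
have w0 : sg * w t x = 0.
 apply/eqP; rewrite eq_le wtx andTb.
 apply: (@pos_right_ge0 (fun x => sg * w t x) x (y j - x)).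
 - by apply: (@cts2 _ _ (fun t x => sg * w t x)) (csw) _ _; [exact: ctsC | exact: cts_id].
 - by lraR.
 - by move=> x' x'I; apply: mmax; lraR.
have [h [h0 ht hm]] := below2 (x := t - a) (y := (y j - x) / 2 / (- m)) ltac:(lraR) ltac:(apply: divr_gt0; lraR).
have hm' : - m * h <= (y j - x) / 2 by move: hm; rewrite ltr_pdivlMr; lraR.
have wx0 : 0 < sg * wx t x.
 have line t' y' : t - h <= t' <= t -> 0 < y' <= (y j - x) / 2 ->
   0 < sg * w t' (x + m * (t' - t) + y').
  move=> t'I y'I; have : 0 <= m * (t' - t) <= - m * h.
   by apply/andP; split; [rewrite mulr_le0 ?(ltW m0)//; lraR | nra].
  by move=> mI; apply: mmax; lraR.
 apply: (hopf C0 (parabolic_sgn (j + s) pw) h0 (r0 := (y j - x) / 2) (m := m) _ _ _ _ w0).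
 - by lraR.
 - by lraR.
 - move=> t' y' t'I y'I; have [y'0|y'0] := eqVneq y' 0; last by apply/ltW/line => //; rewrite lt_neqAle eq_sym y'0.
  rewrite y'0 addr0; apply: (@pos_right_ge0 (fun x => sg * w t' x) _ ((y j - x) / 2)).
  + by apply: (@cts2 _ _ (fun t x => sg * w t x)) (csw) _ _; [exact: ctsC | exact: cts_id].
  + by lraR.
  + move=> z zI; have -> : z = x + m * (t' - t) + (z - (x + m * (t' - t))) by ring.
   by apply: line => //; lraR.
 - exact: line.
have dw : is_derive x 1 (fun x => sg * w t x) (sg * wx t x) by apply/dcM/(par_dx pw).
have wx2 : 0 < sg * wx t x / 2 by apply: divr_gt0; [exact: wx0 | exact: ltr0n].
have [r r0 rP] := is_derive_eps dw wx2.
have lx : lft < x.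
 have : lft <= x by lraR.
 rewrite le_eqVlt => /orP[/eqP xE|//]; have := sgn 0%N (leq0n j); rewrite y0.
 have -> : w t q = w t x by rewrite -xE -(par_per pw t lft) /lft subrK.
 have /eqP := w0; rewrite mulf_eq0 /sg signr_eq0 /= => /eqP->.
 by rewrite mulr0 ltxx.
have [d [d0 dr dl]] := below2 r0 (y := x - lft) ltac:(lraR).
have neg z : x - d <= z < x -> sg * w t z < 0.
 move=> zI; have := rP z; rewrite w0 subr0 ler0_norm; last by lraR.
 by move=> /(_ ltac:(lraR)); rewrite ler_norml => /andP[_]; nra.
exists t => //; exists (fun k => if (k <= j)%N then y k else x - d); split.
- by rewrite leq0n.
- move=> k; rewrite ltnS => kj; rewrite kj; case: ltnP => kj'; first exact: dec.
 have -> : k = j by clear -kj kj'; lia.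
 by lraR.
- by rewrite ltnn; rewrite /lft in dl; lraR.
- move=> k kj; case: ifPn => [kj'|kj']; first exact: sgn.
 have -> : k = j.+1 by clear -kj kj'; lia.
 by rewrite addSn exprS mulN1r mulNr; have := neg (x - d); rewrite -/sg; lraR.
- rewrite ltnn => z zI wz; have [zy|zy] := lerP (y j) z; first by apply: sz => //; lraR.
 have [xz|xz|xz] := ltrgtP x z.
 + by have := mmax t z tI ltac:(lraR) ltac:(lraR); rewrite wz mulr0 ltxx.
 + by have := neg z ltac:(lraR); rewrite wz mulr0 ltxx.
 + by rewrite -xz => wx0'; move: wx0; rewrite wx0' mulr0 ltxx.
Qed.

(** Otherwise chains could be prolonged forever inside the time interval, whereas n points of a
    chain give n alternations, which go back to time 0. *)
Lemma generic_simple_zeros (C T : R) (w wx wxx wt : R -> R -> R) n (s0 s1 : R) : 0 <= C ->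
 parabolic C T w wx wxx wt -> (1 < n)%N -> ~~ odd n -> ~ alternates n (w 0) ->
 (forall t, 0 <= t <= T -> exists x, w t x <> 0) -> 0 <= s0 -> s0 < s1 -> s1 <= T ->
 exists2 t, s0 < t < s1 & simple_zeros (w t) (wx t).
Proof.
move=> C0 pw n1 ne na nz s00 s01 s1T; apply: contrapT => H.
have key j : exists2 t, s0 < t < s1 & exists q s y, chain (w t) (wx t) q s j y.
 elim: j => [|j [t tI [q [s [y ch]]]]].
  exists ((s0 + s1) / 2); first by lra.
  have [q /eqP wq] := nz ((s0 + s1) / 2) ltac:(lra).
  have [s sP] : exists s, 0 < (-1) ^+ s * w ((s0 + s1) / 2) q.
   by move: wq; rewrite neq_lt => /orP[]; [exists 1%N; rewrite expr1 mulN1r; lra | exists 0%N; rewrite expr0 mul1r].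
  exists q, s, (fun=> q); split => //.
  - by have := @pi_gt0 R; lra.
  - by move=> k; rewrite leqn0 => /eqP->; rewrite add0n.
  - by move=> x xI w0; move: wq; have -> : q = x by [lra]; rewrite w0 eqxx.
 have [d d0 dP] := chain_near (par_cont pw) (par_contx pw) ch.
 have [h [h0 hd hs]] := below2 d0 (y := s1 - t) ltac:(lra).
 have := @chain_step C T w wx wxx wt t (t + h) q s j y C0 pw _ _ _ _.
 case; try lra.
 - by move=> t' t'I; apply: dP; rewrite ger0_norm; lra.
 - by move=> [t' t'I sz]; case: H; exists t' => //; lra.
 - by move=> [t' t'I [y' ch']]; exists t'; [lra | exists q, s, y'].
have [t tI [q [s [y ch]]]] := key n.-1.
apply: na; apply: (alternates_sub_parabolic C0 n1 ne pw (t := t)); first by lra.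
by apply: chain_alternates ch; clear -n1; lia.
Qed.

End simple_zeros.

(** * Stability of non-alternation at simple zeros *)

Section stability.
Context {R : realType}.

Lemma signr_ordS n (i : 'I_n) : ~~ odd n -> (-1) ^+ ordS i = - (-1) ^+ i :> R.
Proof.
move=> n_even; rewrite -signr_odd -[in RHS]signr_odd -signrN; congr ((-1) ^+ nat_of_bool _) => /=.
have := ltn_ord i; rewrite leq_eqVlt => /orP[/eqP e1|lt]; last by rewrite modn_small.
by rewrite e1 modnn /=; have : ~~ odd i.+1 by [rewrite e1]; rewrite /= negbK => ->.
Qed.

Lemma simple_zeros_bound (w wx : R -> R) : continuous w -> continuous wx ->
 (forall x, w (x + 2 * pi) = w x) -> (forall x, wx (x + 2 * pi) = wx x) -> simple_zeros w wx ->
 exists2 d, 0 < d & forall x, d <= `|w x| \/ d <= `|wx x|.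
Proof.
move=> cw cwx wp wxp sz.
have pi0 : 0 < 2 * pi :> R by rewrite mulr_gt0 ?pi_gt0.
have cf : continuous (fun x => `|w x| + `|wx x|) by apply: ctsD; apply: cts_abs.
have [c _ cmin] := @EVT_min R _ 0 (2 * pi) (ltW pi0) (continuous_subspaceT cf).
have m0 : 0 < `|w c| + `|wx c|.
 rewrite lt_neqAle addr_ge0// andbT eq_sym paddr_eq0//.
 by rewrite !normr_eq0; apply/negP => /andP[/eqP w0 /eqP]; exact: sz.
exists ((`|w c| + `|wx c|) / 2) => [|x]; first by rewrite divr_gt0.
have [k kI] := period_shift x.
have := cmin (x + 2 * pi * k%:~R); rewrite in_itv/= perZ// perZ//.
have -> : 0 <= x + 2 * pi * k%:~R <= 2 * pi by clear -kI; lra.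
move=> /(_ isT); clear; set a := `|w c| + _; case: (lerP (a / 2) `|w x|); [by left|right; lra].
Qed.

Lemma periodic_unif (f : R -> R) e : continuous f -> (forall x, f (x + 2 * pi) = f x) -> 0 < e ->
 exists2 r, 0 < r & forall x y, `|y - x| < r -> `|f y - f x| < e.
Proof.
move=> cf fp e0.
have cg : continuous (fun p : R * R => e - `|f (p.2 + p.1) - f p.2|).
 apply: ctsB; first exact: ctsC.
 apply: cts_abs; apply: ctsB; apply: (cts_comp _ cf); last exact: cts_snd.
 by apply: ctsD; [exact: cts_snd | exact: cts_fst].
have [y _|r r0 rP] := tube (t := 0) (@segment_compact R 0 (2 * pi)) cg.
 by rewrite /= addr0 subrr normr0 subr0.
exists r => // x y xy; have [k kI] := period_shift x.
have := rP (y - x) (x + 2 * pi * k%:~R); rewrite subr0 => /(_ xy).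
rewrite /= in_itv/=; have -> : 0 <= x + 2 * pi * k%:~R <= 2 * pi by clear -kI; lra.
have -> : x + 2 * pi * k%:~R + (y - x) = y + 2 * pi * k%:~R by ring.
by rewrite !perZ// => /(_ isT); clear; lra.
Qed.

(** From an alternation of a nearby w' one for w is built: points where |w| >= e are kept, and the
    others, where |w_x| >= d, are moved by h = 4 e / d in the direction that favours the expected
    sign. The gain is at least 3 e, against a deficit smaller than e. *)
Lemma alternates_closed n (w wx : R -> R) : ~~ odd n -> (1 < n)%N -> continuous wx ->
 (forall x : R, is_derive x 1 w (wx x)) ->
 (forall x, w (x + 2 * pi) = w x) -> (forall x, wx (x + 2 * pi) = wx x) -> simple_zeros w wx ->
 ~ alternates n w -> exists2 e, 0 < e & forall w' wx', (forall x : R, is_derive x 1 w' (wx' x)) ->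
  (forall x, w' (x + 2 * pi) = w' x) ->
  (forall x, `|w' x - w x| < e) -> (forall x, `|wx' x - wx x| < e) -> ~ alternates n w'.
Proof.
move=> ne n1 cwx dw wp wxp sz na.
have cw : continuous w by move=> x; exact: is_derive_cont (dw x).
have [d d0 dP] := simple_zeros_bound cw cwx wp wxp sz.
have [r r0 rP] := periodic_unif cwx wxp (e := d / 4) ltac:(by rewrite divr_gt0).
have [e [e0 ed er]] := below2 (x := d / 4) (y := r * d / 16)
 ltac:(by rewrite divr_gt0) ltac:(by rewrite divr_gt0// mulr_gt0).
exists e => // w' wx' dw' w'p ww wwx [s [v [g0 H]]]; apply: na.
pose h := 4 * e / d.
have h0 : 0 < h by rewrite divr_gt0// mulr_gt0.
have hd : h * d = 4 * e by rewrite /h -mulrA mulVf ?mulr1// gt_eqF.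
have rd0 : 0 < r * d by rewrite mulr_gt0.
have hr : 2 * h < r by rewrite -(ltr_pM2r d0) -mulrA hd; clear -er rd0; lra.
pose sg (i : 'I_n) : R := (-1) ^+ (i + s).
have sg1 i : sg i = 1 \/ sg i = -1.
 by rewrite /sg -signr_odd; case: (odd _); [right; rewrite expr1|left].
pose tau i : R := if e <= `|w (v ord0 i)| then 0 else if 0 < sg i * wx (v ord0 i) then h else - h.
have tauh i : - h <= tau i <= h by rewrite /tau; case: ifP => _; [|case: ifP => _]; clear -h0; lra.
have good i : 0 < sg i * w (v ord0 i + tau i).
 have wi := ww (v ord0 i); have Hi := H i; rewrite -/(sg i) in Hi.
 rewrite /tau; case: (lerP e `|w (v ord0 i)|) => we.
  rewrite addr0; move: wi we Hi; rewrite ltr_norml; clear -sg1.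
  by case: (sg1 i) => ->; case: (ger0P (w (v ord0 i))) => ?; lra.
 have dx : d <= `|wx (v ord0 i)| by case: (dP (v ord0 i)) => //; clear -we ed e0; lra.
 have sw : - e < sg i * w (v ord0 i).
  by move: we; rewrite ltr_norml; clear -sg1; case: (sg1 i) => ->; lra.
 have near (y : R) : `|y - v ord0 i| < r -> `|wx y - wx (v ord0 i)| < d / 4 by exact: rP.
 case: (ltrP 0 (sg i * wx (v ord0 i))) => [pos|neg].
  have [|z zI E] := @mvt R w wx (v ord0 i) (v ord0 i + h) _ (fun z _ => dw z); first by clear -h0; lra.
  have zr : `|z - v ord0 i| < r by rewrite ltr_norml; clear -zI hr h0; lra.
  have := near z zr; rewrite ltr_norml => nz.
  have : 3 / 4 * d <= sg i * wx z.
   by move: pos dx nz; clear -sg1 d0; case: (sg1 i) => ->; case: (ger0P (wx (v ord0 i))) => ?; lra.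
  move=> szx; have : sg i * (w (v ord0 i + h) - w (v ord0 i)) = (sg i * wx z) * h.
   by rewrite E; clear; ring.
  rewrite mulrBr; have : 3 / 4 * d * h <= sg i * wx z * h by rewrite ler_pM2r.
  by move: sw hd e0; clear; lra.
 have [|z zI E] := @mvt R w wx (v ord0 i - h) (v ord0 i) _ (fun z _ => dw z); first by clear -h0; lra.
 have zr : `|z - v ord0 i| < r by rewrite ltr_norml; clear -zI hr h0; lra.
 have := near z zr; rewrite ltr_norml => nz.
 have : sg i * wx z <= - (3 / 4 * d).
  by move: neg dx nz; clear -sg1 d0; case: (sg1 i) => ->; case: (ger0P (wx (v ord0 i))) => ?; lra.
 move=> szx; have : sg i * (w (v ord0 i) - w (v ord0 i - h)) = (sg i * wx z) * h.
  by rewrite E; clear; ring.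
 rewrite mulrBr; have : sg i * wx z * h <= - (3 / 4 * d) * h by rewrite ler_pM2r.
 by move: sw hd e0; clear; lra.
(* A point is never moved towards a neighbour closer than 2 h, as w' is monotone there. *)
have mono i (y : R) : `|y - v ord0 i| <= 2 * h -> sg i * w' y < 0 -> tau i * (y - v ord0 i) <= 0.
 move=> yh sy; have Hi := H i; rewrite -/(sg i) in Hi.
 rewrite /tau; case: (lerP e `|w (v ord0 i)|) => we; first by rewrite mul0r.
 have dx : d <= `|wx (v ord0 i)| by case: (dP (v ord0 i)) => //; clear -we ed e0; lra.
 have near (z : R) : `|z - v ord0 i| < r -> - (d / 2) < wx' z - wx (v ord0 i) < d / 2.
  by move=> /rP; have := wwx z; rewrite !ltr_norml; clear -ed; lra.
 move: yh; rewrite ler_norml => yh.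
 case: (ltrP 0 (sg i * wx (v ord0 i))) => sgx; [rewrite pmulr_rle0// | rewrite nmulr_rle0 ?oppr_lt0//].
  rewrite leNgt; apply/negP => vy.
  have [|z zI E] := @mvt R w' wx' (v ord0 i) y _ (fun z _ => dw' z); first by clear -vy; lra.
  have := near z ltac:(rewrite ltr_norml; clear -zI yh hr h0; lra) => nz.
  have : 0 < sg i * wx' z.
   by move: sgx dx nz; clear -sg1 d0; case: (sg1 i) => ->; case: (ger0P (wx (v ord0 i))) => ?; lra.
  move=> szx; have : sg i * (w' y - w' (v ord0 i)) = (sg i * wx' z) * (y - v ord0 i) by rewrite E; clear; ring.
  rewrite mulrBr; have : 0 < sg i * wx' z * (y - v ord0 i) by rewrite mulr_gt0.
  by move: sy Hi; clear; lra.
 rewrite subr_ge0 leNgt; apply/negP => vy.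
 have [|z zI E] := @mvt R w' wx' y (v ord0 i) _ (fun z _ => dw' z); first by clear -vy; lra.
 have := near z ltac:(rewrite ltr_norml; clear -zI yh hr h0; lra) => nz.
 have : sg i * wx' z < 0.
  by move: sgx dx nz; clear -sg1 d0; case: (sg1 i) => ->; case: (ger0P (wx (v ord0 i))) => ?; lra.
 move=> szx; have : sg i * (w' (v ord0 i) - w' y) = (sg i * wx' z) * (v ord0 i - y) by rewrite E; clear; ring.
 rewrite mulrBr; have : sg i * wx' z * (v ord0 i - y) < 0 by rewrite pmulr_llt0// subr_gt0.
 by move: sy Hi; clear; lra.
exists s, (\row_i (v ord0 i + tau i)); split => [i|i]; last by rewrite mxE; exact: good.
have gE : gap (\row_i (v ord0 i + tau i)) i = gap v i + (tau (ordS i) - tau i).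
 by rewrite /gap /nxt !mxE; ring.
rewrite gE; have [big|small] := lerP (2 * h) (gap v i).
 by have := tauh i; have := tauh (ordS i); clear -big; lra.
have gi := g0 i.
have sgS : sg (ordS i) = - sg i by rewrite /sg !exprD signr_ordS// mulNr.
have w'n : w' (nxt v i) = w' (v ord0 (ordS i)) by rewrite /nxt; case: ifP => _; rewrite ?w'p ?addr0.
have Hi := H i; have HS := H (ordS i); rewrite -/(sg _) in Hi; rewrite -/(sg _) sgS mulNr in HS.
have gpos : 0 < gap v i.
 rewrite lt_neqAle gi andbT; apply/eqP => g; move: w'n Hi HS.
 have -> : nxt v i = v ord0 i by move: g; rewrite /gap; clear; lra.
 by move=> ->; clear; lra.
have m1 : tau i * gap v i <= 0.
 apply: (mono i (nxt v i)); first by rewrite -/(gap v i) ger0_norm// ltW.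
 by rewrite w'n; move: HS; clear; lra.
have m2 : tau (ordS i) * (- gap v i) <= 0.
 pose c := v ord0 i - nxt v i.
 have -> : - gap v i = (v ord0 (ordS i) + c) - v ord0 (ordS i) by rewrite /gap /c; ring.
 apply: mono; first by have -> : v ord0 (ordS i) + c - v ord0 (ordS i) = - gap v i by [rewrite /gap /c; ring]; rewrite normrN ger0_norm// ltW.
 have -> : w' (v ord0 (ordS i) + c) = w' (v ord0 i).
  rewrite /c /nxt; case: ifP => _; last by congr w'; ring.
  by rewrite -w'p; congr w'; ring.
 by rewrite sgS mulNr; move: Hi; clear; lra.
have := m1; rewrite pmulr_lle0// => t1; have := m2; rewrite mulrN oppr_le0 pmulr_lge0// => t2.
by move: t1 t2 gi; clear; lra.
Qed.

End stability.

(** * Splitting a degenerate zero *)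

Section splitting.
Context {R : realType}.

(* Listing the alternation points in increasing order, starting just after a zero x0. *)
Lemma alternates_after n (w : R -> R) x0 : (1 < n)%N -> ~~ odd n ->
 (forall x, w (x + 2 * pi) = w x) -> w x0 = 0 -> alternates n w ->
 exists s (z : nat -> R), [/\ x0 < z 0%N, z n.-1 < x0 + 2 * pi,
  forall k, z k <= z k.+1 & forall k, 0 < (-1) ^+ (k + s) * w (z k)].
Proof.
move=> n1 ne wp w0 [s [v [g0 H]]].
have n0 : (0 < n)%N by exact: ltnW.
pose i0 : 'I_n := Ordinal n0.
have [q qI] := period_shift (v ord0 i0 - (x0 - 2 * pi)).
pose im k : 'I_n := Ordinal (ltn_pmod k n0).
(* Lifts of all the points as one nondecreasing sequence: n indices further is one period
   further. *)
pose e (k : nat) : R := v ord0 (im k) + 2 * pi * q%:~R + 2 * pi * (k %/ n)%:R.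
have we k : 0 < (-1) ^+ (k + s) * w (e k).
 rewrite /e periodic_nat// perZ//; have := H (im k); rewrite /=.
 have -> // : (-1) ^+ (k %% n + s) = (-1) ^+ (k + s) :> R.
 rewrite [in RHS](divn_eq k n) -addnA [RHS]exprD mulnC exprM.
 by rewrite -[in RHS](signr_odd _ n) (negbTE ne) expr1n mul1r.
have em k : e k <= e k.+1.
 have := g0 (im k); rewrite /gap /nxt /e.
 have [kn|kn] := boolP ((im k).+1 == n).
  have -> : im k.+1 = ordS (im k).
   by apply/val_inj => /=; rewrite -[k.+1]addn1 -[(k %% n).+1]addn1 modnDml.
  have -> : (k.+1 %/ n = (k %/ n).+1)%N.
   by rewrite {1}(divn_eq k n) -addnS (eqP (kn : (k %% n).+1 == n)) divnMDl// divnn n0 addn1.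
  by rewrite -[_.+1%:R]natr1; clear; lra.
 have kn' : ((k %% n).+1 < n)%N by rewrite ltn_neqAle kn ltn_pmod.
 have -> : im k.+1 = ordS (im k).
  by apply/val_inj => /=; rewrite -[k.+1]addn1 -[(k %% n).+1]addn1 modnDml.
 have -> : (k.+1 %/ n = k %/ n)%N.
  by rewrite {1}(divn_eq k n) -addnS divnMDl// (divn_small kn') addn0.
 by clear; lra.
have en k : e (k + n)%N = e k + 2 * pi.
 rewrite /e; have -> : im (k + n)%N = im k by apply/val_inj; rewrite /= modnDr.
 have -> : ((k + n) %/ n = (k %/ n).+1)%N by rewrite divnDr ?dvdnn// divnn n0 addn1.
 by rewrite -[_.+1%:R]natr1; clear; ring.
have ne0 k : e k <> x0 by move=> ek; have := we k; rewrite ek w0 mulr0 ltxx.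
have e0 : e 0%N < x0.
 rewrite /e div0n mulr0 addr0; have -> : im 0%N = i0 by apply/val_inj; rewrite /= mod0n.
 by clear -qI; lra.
have ex : exists k, x0 < e k.
 exists n; rewrite lt_neqAle; apply/andP; split; first by apply/eqP => /esym/ne0.
 rewrite -[n]add0n en /e div0n mulr0 addr0.
 have -> : im 0%N = i0 by apply/val_inj; rewrite /= mod0n.
 by clear -qI; lra.
case: (ex_minnP ex) => j ej jmin.
case: j ej jmin => [|j] ej jmin; first by move: ej; rewrite ltNge (ltW e0).
exists (j.+1 + s)%N, (fun k => e (k + j.+1)%N); split => //.
- have -> : (n.-1 + j.+1 = j + n)%N by rewrite addnS -addSn prednK// addnC.
 rewrite en ltrD2r lt_neqAle; apply/andP; split; first exact/eqP/ne0.
 by rewrite leNgt; apply/negP => /jmin; rewrite ltnn.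
- by move=> k; rewrite addnA.
Qed.

Lemma small_derive_sign (f : R -> R) (x d : R) : is_derive x 1 f d -> f x = 0 -> 0 < d ->
 exists2 r, 0 < r & forall h, 0 < h < r -> 0 < f (x + h) /\ f (x - h) < 0.
Proof.
move=> fd fx d0; have d2 : 0 < d / 2 by rewrite divr_gt0.
have [r r0 rP] := is_derive_eps fd d2; exists r => // h hI.
have := rP (x + h); have -> : x + h - x = h by ring.
have := rP (x - h); have -> : x - h - x = - h by ring.
rewrite fx !subr0 normrN ger0_norm; last by clear -hI; lra.
move=> H1 H2; have := H1 ltac:(clear -hI; lra); have := H2 ltac:(clear -hI; lra).
rewrite !ler_norml => /andP[A1 A2] /andP[B1 B2].
have : 0 < d * h by rewrite mulr_gt0//; clear -hI; lra.
by move: A1 B2; clear; lra.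
Qed.

(** The n alternations away from x0 persist for small k, while at x0 the perturbed function vanishes
    with slope - k y0. This adds one sign just after x0 and one just before x0 + 2 pi; the sign
    condition on y0 makes them alternate with the others. *)
Lemma split_zero n (w : R -> R) (x0 : R) : (1 < n)%N -> ~~ odd n ->
 (forall x, w (x + 2 * pi) = w x) -> is_derive x0 1 w 0 -> w x0 = 0 -> alternates n w ->
 exists2 s : nat, True & forall B, 0 < B -> exists2 k0, 0 < k0 & forall k (y : R -> R) (y0 : R),
  0 < k < k0 -> (forall x, y (x + 2 * pi) = y x) -> (forall x, `|y x| <= B) ->
  is_derive x0 1 y y0 -> y x0 = 0 -> 0 < (-1) ^+ s * y0 -> alternates n.+2 (fun x => w x - k * y x).
Proof.
move=> n1 ne wp dw w0 /(alternates_after n1 ne wp w0)[s [z [z0 zn zm zs]]].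
exists s => // B B0.
have [e e0 He] := finite_lb (fun i : 'I_n => zs i).
have eB : 0 < e / B by rewrite divr_gt0.
exists (e / B) => // k y y0 kI yp yB dy yx0 sy0.
have k0 : 0 < k by clear -kI; lra.
pose W x := w x - k * y x.
have dW : is_derive x0 1 (fun x => (-1) ^+ s.+1 * W x) (k * ((-1) ^+ s * y0)).
 apply: deq (dcM ((-1) ^+ s.+1) (dB dw (dcM k dy))) _.
 by rewrite exprS; clear; ring.
have Wx0 : (-1) ^+ s.+1 * W x0 = 0 by rewrite /W w0 yx0; clear; ring.
have [r r0 rP] := small_derive_sign dW Wx0 (mulr_gt0 k0 sy0).
have [r' [r'0 r'1 r'2]] := below2 (x := z 0%N - x0) (y := x0 + 2 * pi - z n.-1)
 ltac:(clear -z0; lra) ltac:(clear -zn; lra).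
have [h [h0 hr hr']] := below2 r0 r'0.
have [W1 W2] := rP h ltac:(by rewrite h0).
pose X i := if i == 0%N then x0 + h else if (i <= n)%N then z i.-1 else x0 + 2 * pi - h.
have Wp x : W (x + 2 * pi) = W x by rewrite /W wp yp.
apply: (@alternates_of _ _ W X s.+1) => //.
- move=> [_|i] /=; rewrite /X /=.
  by have -> : (1 <= n)%N by [exact: ltnW]; rewrite /=; clear -hr' r'1; lra.
 rewrite !ltnS => ii; have -> : (i < n)%N by [].
 case: ltnP => i1; first exact: zm.
 have -> : i = n.-1 by clear -ii i1; lia.
 by clear -hr' r'2; lra.
- by rewrite /X /= ltnn; clear -h0; lra.
- move=> [_|i]; rewrite /X /=; first by rewrite add0n.
 rewrite !ltnS => ii; case: ltnP => i1.
  have ib := He (Ordinal i1); rewrite /= in ib.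
  have -> : (-1) ^+ (i.+1 + s.+1) = (-1) ^+ (i + s) :> R.
   by rewrite addSn addnS !exprS; clear; ring.
  rewrite /W mulrBr subr_gt0; apply: lt_le_trans ib.
  apply: (@le_lt_trans _ _ `|(-1) ^+ (i + s) * (k * y (z i))|); first exact: ler_norm.
  rewrite normrM normrX normrN1 expr1n mul1r normrM gtr0_norm//.
  apply: (@le_lt_trans _ _ (k * B)); first by rewrite ler_pM2l.
  by rewrite -ltr_pdivlMr//; clear -kI; lra.
 have -> : i = n by clear -ii i1; lia.
 have -> : x0 + 2 * pi - h = x0 - h + 2 * pi by clear; ring.
 have -> : (-1) ^+ (n.+1 + s.+1) = (-1) ^+ s :> R.
  by rewrite addSn addnS !exprS exprD -(signr_odd _ n) (negbTE ne) /=; clear; ring.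
 by rewrite Wp; move: W2; rewrite exprS; clear; lra.
Qed.

(** Counterpart of [split_zero] when no alternation is available: a nonzero value of w somewhere and
    the value - k y at the zero have opposite signs. *)
Lemma split_zero0 (w : R -> R) x0 : (forall x, w (x + 2 * pi) = w x) -> w x0 = 0 ->
 (exists x, w x <> 0) ->
 exists2 s : nat, True & forall B, 0 < B -> exists2 k0, 0 < k0 & forall k (y : R -> R),
  0 < k < k0 -> (forall x, y (x + 2 * pi) = y x) -> (forall x, `|y x| <= B) ->
  0 < (-1) ^+ s * y x0 -> alternates 2 (fun x => w x - k * y x).
Proof.
move=> wp w0 [x1 /eqP wx1].
have [q qI] := period_shift (x1 - x0).
pose z := x1 + 2 * pi * q%:~R.
have wz : w z != 0 by rewrite /z perZ.
have [s sP] : exists s, 0 < (-1) ^+ s * w z.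
 by move: wz; rewrite neq_lt => /orP[]; [exists 1%N; rewrite expr1 mulN1r; lra | exists 0%N; rewrite expr0 mul1r].
exists s => // B B0.
have eB : 0 < (-1) ^+ s * w z / B by rewrite divr_gt0.
exists ((-1) ^+ s * w z / B) => // k y kI yp yB sy.
have k0 : 0 < k by clear -kI; lra.
apply: (@alternates_of _ _ _ (fun i => if i == 0%N then x0 else z) s.+1) => //.
- by move=> [_|//] /=; rewrite /z; clear -qI; lra.
- by rewrite /= /z; clear -qI; lra.
- move=> [_|[_|//]] /=.
  rewrite add0n w0 sub0r exprS mulN1r mulrNN mulrCA; exact: mulr_gt0.
 have -> : (-1) ^+ (1 + s.+1) = (-1) ^+ s :> R by rewrite addSn !exprS; clear; ring.
 rewrite mulrBr subr_gt0; apply: (@le_lt_trans _ _ `|(-1) ^+ s * (k * y z)|); first exact: ler_norm.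
 rewrite normrM normrX normrN1 expr1n mul1r normrM gtr0_norm//.
 apply: (@le_lt_trans _ _ (k * B)); first by rewrite ler_pM2l.
 by rewrite -ltr_pdivlMr//; clear -kI; lra.
Qed.

End splitting.

(** * Integration over the circle and the space L^2 *)

Section circle_integral.
Context {R : realType}.
Local Notation mu := (@circle_measure R).
Local Notation leb := (@lebesgue_measure R).
Implicit Types u v w : R -> R.

Definition circ u : R := \int[mu]_x u x.

Let D : set (measurableTypeR R) := `[0, 2 * pi]%classic.

Let mD : measurable D. Proof. exact: measurable_itv. Qed.

Lemma circle_measureE (A : set (measurableTypeR R)) : mu A = leb (A `&` D).
Proof. by []. Qed.

Lemma circle_integral_ge0 (f : measurableTypeR R -> \bar R) : measurable_fun [set: measurableTypeR R] f ->
 (forall x, 0 <= f x)%E -> (\int[mu]_x f x = \int[leb]_(x in D) f x)%E.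
Proof.
move=> mf f0.
have -> : (\int[mu]_x f x = \int[mu]_(x in D) f x)%E.
 have mDC : measurable (~` D) by exact: measurableC.
 rewrite (ge0_negligible_integral mDC) //; last by rewrite circle_measureE setICl measure0.
 by rewrite setDE setCK setTI.
apply: eq_measure_integral => A mA AD.
by rewrite circle_measureE setIidl.
Qed.

Lemma circle_integrable u : measurable_fun [set: measurableTypeR R] u ->
 leb.-integrable D (EFin \o u) <-> mu.-integrable [set: R] (EFin \o u).
Proof.
move=> mu_; have mabs : measurable_fun [set: measurableTypeR R] (abse \o (EFin \o u)).
 by apply: measurableT_comp => //; exact/measurable_EFinP.
split=> /integrableP[m1 m2]; apply/integrableP; split.
- exact/measurable_EFinP.
- by rewrite circle_integral_ge0// => x; exact: abse_ge0.
- by apply: measurable_funTS; exact/measurable_EFinP.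
- by move: m2; rewrite circle_integral_ge0// => x; exact: abse_ge0.
Qed.

Lemma circE u : mu.-integrable [set: R] (EFin \o u) -> circ u = \int[leb]_(x in `[0, 2 * pi]) u x.
Proof.
move=> iu; rewrite /circ /Rintegral; congr fine.
have /integrableP[mu' _] := iu.
rewrite integralE [RHS]integralE; congr (_ - _)%E; rewrite circle_integral_ge0//.
- exact: measurable_funepos.
- exact: measurable_funeneg.
Qed.

Lemma cts_measurable u : continuous u -> measurable_fun [set: measurableTypeR R] u.
Proof. exact: measurable_realfun.continuous_measurable_fun. Qed.

Lemma cts_int u : continuous u -> mu.-integrable [set: R] (EFin \o u).
Proof.
move=> cu; apply/circle_integrable; first exact: cts_measurable.
apply: continuous_compact_integrable; first exact: segment_compact.
exact: continuous_subspaceT.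
Qed.

Lemma sqr_int u : (\int[mu]_x (`|(u x)%:E| `^ 2) = \int[mu]_x (u x ^+ 2)%:E)%E.
Proof.
by apply: eq_integral => x _; rewrite /= powR_mulrn// real_normK ?num_real.
Qed.

Lemma L2P u : u \in L2 <-> measurable_fun [set: measurableTypeR R] u /\
 mu.-integrable [set: R] (EFin \o (fun x => u x ^+ 2)).
Proof.
split=> [uL|[mu' iu]].
 split; last exact: Lfun2_integrable_sqr.
 by move: uL; rewrite inE => /andP[]; rewrite inE.
rewrite inE; apply/andP; split; first by rewrite inE.
rewrite inE /finite_norm unlock; apply: poweR_lty.
rewrite sqr_int; have /integrableP[_] := iu; apply: le_lt_trans; rewrite le_eqVlt; apply/orP; left; apply/eqP.
by apply: eq_integral => x _ /=; rewrite ger0_norm ?sqr_ge0.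
Qed.

Lemma cts_L2 u : continuous u -> u \in L2.
Proof.
move=> cu; apply/L2P; split; first exact: cts_measurable.
by apply: cts_int; exact: cts_exp.
Qed.

Lemma L2_int2 u v : u \in L2 -> v \in L2 -> mu.-integrable [set: R] (EFin \o (fun x => u x * v x)).
Proof. exact: L2_integrable. Qed.

Lemma L2dotC u v : L2dot u v = L2dot v u.
Proof. by apply: eq_Rintegral => x _; rewrite mulrC. Qed.

Lemma L2dotDl u v w : u \in L2 -> v \in L2 -> w \in L2 ->
 L2dot (fun x => u x + v x) w = L2dot u w + L2dot v w.
Proof.
move=> uL vL wL; have := L2dot_linear 1 uL vL wL; rewrite mul1r => <-.
by congr L2dot; apply: funext => x; rewrite !fctE scale1r.
Qed.

Lemma L2dotZl k u w : u \in L2 -> w \in L2 -> L2dot (fun x => k * u x) w = k * L2dot u w.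
Proof.
move=> uL wL; rewrite /L2dot -RintegralZl//; last exact: L2_int2.
by apply: eq_Rintegral => x _; rewrite mulrA.
Qed.

Lemma L2D u v : u \in L2 -> v \in L2 -> (fun x => u x + v x) \in L2.
Proof.
move=> uL vL; have [_ H] := @L2_submod_closed R; have := H 1 _ _ uL vL.
by rewrite (_ : 1 *: u + v = (fun x => u x + v x))//; apply: funext => x; rewrite !fctE scale1r.
Qed.

Lemma L2Z k u : u \in L2 -> (fun x => k * u x) \in L2.
Proof.
move=> uL; have [H0 H] := @L2_submod_closed R; have := H k _ _ uL H0.
by rewrite (_ : k *: u + 0 = (fun x => k * u x))//; apply: funext => x; rewrite !fctE addr0.
Qed.

Lemma L2dot_sum (I : Type) (r : seq I) (u : I -> R -> R) w : (forall i, u i \in L2) -> w \in L2 ->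
 (fun x => \sum_(i <- r) u i x) \in L2 /\
 L2dot (fun x => \sum_(i <- r) u i x) w = \sum_(i <- r) L2dot (u i) w.
Proof.
move=> uL wL; elim: r => [|i r [IH1 IH2]].
 have -> : (fun x : R => \sum_(i <- [::]) u i x) = cst 0 by apply: funext => x; rewrite big_nil.
 split; first by apply: cts_L2; exact: cst_continuous.
 by rewrite big_nil /L2dot; under eq_Rintegral do rewrite mul0r; rewrite Rintegral_cst// mul0r.
have -> : (fun x => \sum_(j <- i :: r) u j x) = (fun x => u i x + \sum_(j <- r) u j x).
 by apply: funext => x; rewrite big_cons.
by split; [exact: L2D | rewrite big_cons L2dotDl// IH2].
Qed.

Lemma L2normE u : u \in L2 -> L2norm u = Num.sqrt (L2dot u u).
Proof.
move=> uL; rewrite /L2norm unlock sqr_int.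
have /L2P[_ iu] := uL.
have -> : (\int[mu]_x (u x ^+ 2)%:E = (L2dot u u)%:E)%E.
 rewrite /L2dot /Rintegral fineK; last exact: integrable_fin_num.
 by apply: eq_integral => x _; rewrite expr2.
by rewrite poweR_EFin /= powR12_sqrt//; apply: Rintegral_ge0 => x _; rewrite -expr2 sqr_ge0.
Qed.

Lemma L2dot_ge0 u : 0 <= L2dot u u.
Proof. by apply: Rintegral_ge0 => x _; rewrite -expr2 sqr_ge0. Qed.

Lemma L2_CS u v : u \in L2 -> v \in L2 -> L2dot u v ^+ 2 <= L2dot u u * L2dot v v.
Proof.
move=> uL vL; set A := L2dot u u; set B := L2dot u v; set C := L2dot v v.
have q k : 0 <= A + k * (2 * B) + k ^+ 2 * C.
 have kvL := L2Z k vL; have sL := L2D uL kvL.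
 have := L2dot_ge0 (fun x => u x + k * v x).
 have -> : L2dot (fun x => u x + k * v x) (fun x => u x + k * v x) = A + k * (2 * B) + k ^+ 2 * C.
  rewrite (L2dotDl uL kvL sL) (L2dotC u) (L2dotC (fun x => k * v x)).
  rewrite (L2dotDl uL kvL uL) (L2dotDl uL kvL kvL) (L2dotC u (fun x => k * v x)).
  rewrite (L2dotZl k vL uL) (L2dotZl k vL kvL) (L2dotC v (fun x => k * v x)) (L2dotZl k vL vL) (L2dotC v u).
  by rewrite -/A -/B -/C; ring.
 by [].
have A0 : 0 <= A by exact: L2dot_ge0.
have C0 : 0 <= C by exact: L2dot_ge0.
have [C0'|C0'] := eqVneq C 0.
 have [B0|B0] := eqVneq B 0; first by rewrite B0 expr0n /= mulr_ge0.
 have := q (- (A + 1) / (2 * B)); rewrite C0' mulr0 addr0.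
 have -> : - (A + 1) / (2 * B) * (2 * B) = - (A + 1) by field.
 by lra.
have Cp : 0 < C by rewrite lt_neqAle eq_sym C0'.
have := q (- B / C).
have -> : A + - B / C * (2 * B) + (- B / C) ^+ 2 * C = (A * C - B ^+ 2) / C by field.
by rewrite pmulr_lge0 ?invr_gt0// subr_ge0.
Qed.

Lemma circ_deriv u v : (forall x : R, is_derive x 1 u (v x)) -> continuous v ->
 circ v = u (2 * pi) - u 0.
Proof.
move=> du cv; rewrite circE; last exact: cts_int.
have cu : continuous u by move=> x; exact: is_derive_cont (du x).
have p0 : 0 < 2 * pi :> R by rewrite mulr_gt0 ?pi_gt0.
rewrite /Rintegral (@continuous_FTC2 _ v u 0 (2 * pi))//.
- exact: continuous_subspaceT.
- split => [x _||]; first exact: (@ex_derive _ _ _ _ _ _ _ (du x)).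
 + exact/cvg_at_right_filter/cu.
 + exact/cvg_at_left_filter/cu.
- by move=> x _; rewrite derive1E; exact: derive_val.
Qed.

Lemma circ_ibp u v u' v' : (forall x : R, is_derive x 1 u (u' x)) -> (forall x : R, is_derive x 1 v (v' x)) ->
 continuous u' -> continuous v' -> u (2 * pi) = u 0 -> v (2 * pi) = v 0 ->
 L2dot u v' = - L2dot u' v.
Proof.
move=> du dv cu' cv' up vp.
have cu : continuous u by move=> x; exact: is_derive_cont (du x).
have cv : continuous v by move=> x; exact: is_derive_cont (dv x).
have := @circ_deriv (fun x => u x * v x) (fun x => u' x * v x + u x * v' x)
 (fun x => dM (du x) (dv x)) (ctsD (ctsM cu' cv) (ctsM cu cv')).
rewrite up vp subrr /circ RintegralD//; last 2 first.
- by apply: (@cts_int (fun x => u' x * v x)); exact: ctsM.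
- by apply: (@cts_int (fun x => u x * v' x)); exact: ctsM.
by rewrite /L2dot; lra.
Qed.

End circle_integral.

(** * Trigonometric orthonormal system *)

Section trigonometric.
Context {R : realType}.
Implicit Types (k m n : nat) (A B C D x : R).

(** Sine and cosine of one frequency together: the family is closed under differentiation, so
    orthogonality and eigenvalues are computed once for both. *)
Definition tp k A B x : R := A * cos (k%:R * x) + B * sin (k%:R * x).

Lemma sin_period x : sin (x + 2 * pi) = sin x.
Proof. by rewrite mulr_natl sinD sin2pi cos2pi mulr1 mulr0 addr0. Qed.

Lemma cos_period x : cos (x + 2 * pi) = cos x.
Proof. by rewrite mulr_natl cosD sin2pi cos2pi mulr1 mulr0 subr0. Qed.

Lemma tp_period k A B x : tp k A B (x + 2 * pi) = tp k A B x.
Proof.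
rewrite /tp mulrDr [_%:R * (2 * pi)]mulrC.
by rewrite (periodic_nat k _ cos_period) (periodic_nat k _ sin_period).
Qed.

Lemma tp_derive k A B x : is_derive x 1 (tp k A B) (tp k (k%:R * B) (- (k%:R * A)) x).
Proof.
have dk := dcM k%:R (did x).
apply: deq (dD (dcM A (dcomp (is_derive_cos (k%:R * x)) dk))
 (dcM B (dcomp (is_derive_sin (k%:R * x)) dk))) _.
by rewrite /tp; ring.
Qed.

Lemma tp_cts k A B : continuous (tp k A B).
Proof. by move=> x; exact: is_derive_cont (tp_derive k A B x). Qed.

Lemma tp_derive1 k A B : derive1 (tp k A B) = tp k (k%:R * B) (- (k%:R * A)).
Proof. by apply: funext => x; rewrite derive1E; have [] := tp_derive k A B x. Qed.

Lemma tp_smooth k A B : smooth (tp k A B).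
Proof.
move=> n; suff [A' [B' ->]] : exists A' B', derive1n n (tp k A B) = tp k A' B'.
 by move=> x; have [] := tp_derive k A' B' x.
elim: n => [|n [A' [B' IH]]]; first by exists A, B; rewrite derive1n0.
by rewrite derive1nS IH tp_derive1; do 2 eexists.
Qed.

Lemma tp_at0 k A B : tp k A B 0 = A.
Proof. by rewrite /tp mulr0 cos0 sin0 mulr1 mulr0 addr0. Qed.

Lemma tp_2pi k A B : tp k A B (2 * pi) = A.
Proof. by rewrite -[2 * pi]add0r tp_period tp_at0. Qed.

Lemma tp_L2 k A B : tp k A B \in L2.
Proof. exact/cts_L2/tp_cts. Qed.

Lemma tpZ k A B c x : c * tp k A B x = tp k (c * A) (c * B) x.
Proof. by rewrite /tp; ring. Qed.

(** Integration by parts moves the second derivative from one factor to the other, and the two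
    eigenvalues differ. *)
Lemma tp_dot_neq k m A B C D : k <> m -> L2dot (tp k A B) (tp m C D) = 0.
Proof.
move=> /eqP km.
have E := @circ_ibp R (tp k A B) (tp m (m%:R * D) (- (m%:R * C))) _ _ (tp_derive k A B)
 (tp_derive m (m%:R * D) (- (m%:R * C))) (@tp_cts _ _ _) (@tp_cts _ _ _).
have F := @circ_ibp R (tp m C D) (tp k (k%:R * B) (- (k%:R * A))) _ _ (tp_derive m C D)
 (tp_derive k (k%:R * B) (- (k%:R * A))) (@tp_cts _ _ _) (@tp_cts _ _ _).
move: E F; rewrite !tp_at0 !tp_2pi => /(_ erefl erefl) E /(_ erefl erefl) F.
have E' : tp m (m%:R * - (m%:R * C)) (- (m%:R * (m%:R * D))) = (fun x => - m%:R ^+ 2 * tp m C D x).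
 by apply: funext => x; rewrite tpZ; congr tp; ring.
have F' : tp k (k%:R * - (k%:R * A)) (- (k%:R * (k%:R * B))) = (fun x => - k%:R ^+ 2 * tp k A B x).
 by apply: funext => x; rewrite tpZ; congr tp; ring.
move: E F; rewrite E' F' (L2dotC _ (fun x => _ * _)) (L2dotC (tp m C D) (fun x => _ * _)).
rewrite !L2dotZl ?tp_L2// (L2dotC (tp m C D)) (L2dotC (tp m _ _)) => E F.
have : (k%:R ^+ 2 - m%:R ^+ 2 : R) * L2dot (tp k A B) (tp m C D) = 0.
 by move: E F; clear; lra.
move/eqP; rewrite mulf_eq0 subr_eq0 eqrXn2 ?ler0n// eqr_nat (negbTE km) /= => /eqP//.
Qed.

Lemma tp_dot_eq k A B C D : (0 < k)%N -> L2dot (tp k A B) (tp k C D) = pi * (A * C + B * D).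
Proof.
move=> k0; have kn : k%:R != 0 :> R by rewrite pnatr_eq0 -lt0n.
(* A primitive of the product, written with sin cos and sin^2 so that it is checked by cos^2 + sin^2
   = 1. *)
pose F x := (A * C + B * D) / 2 * x + (A * C - B * D) / (2 * k%:R) * (tp k 0 1 x * tp k 1 0 x)
 + (A * D + B * C) / (2 * k%:R) * (tp k 0 1 x * tp k 0 1 x).
have dF x : is_derive x 1 F (tp k A B x * tp k C D x).
 apply: deq (dD (dD (dcM _ (did x)) (dcM _ (dM (tp_derive k 0 1 x) (tp_derive k 1 0 x))))
  (dcM _ (dM (tp_derive k 0 1 x) (tp_derive k 0 1 x)))) _.
 have := cos2Dsin2 (k%:R * x); rewrite /tp; set c := cos _; set s := sin _ => cs.
 have -> : (A * C + B * D) / 2 * 1 = (A * C + B * D) / 2 * (c ^+ 2 + s ^+ 2) by rewrite cs.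
 by field.
have := circ_deriv dF (ctsM (@tp_cts _ _ _) (@tp_cts _ _ _)).
by rewrite /F !tp_at0 !tp_2pi /L2dot /circ => ->; field.
Qed.

Lemma circ_cst A : circ (fun _ : R => A) = 2 * pi * A.
Proof.
have d x : is_derive x 1 (fun x => A * x) A by apply: deq (dcM A (did x)) _; ring.
by rewrite (circ_deriv d (@ctsC _ _ A)); ring.
Qed.

Lemma tp0E A B x : tp 0 A B x = A.
Proof. by rewrite /tp mul0r cos0 sin0 mulr1 mulr0 addr0. Qed.

Lemma tp_dot0 A B C D : L2dot (tp 0 A B) (tp 0 C D) = 2 * pi * (A * C).
Proof. by rewrite /L2dot -circ_cst; apply: eq_Rintegral => x _; rewrite !tp0E. Qed.

(* The orthonormal basis: constants, then sine and cosine of each frequency. *)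
Definition bas n : R -> R :=
 if n is 0 then tp 0 (Num.sqrt (2 * pi))^-1 0
 else if odd n then tp (uphalf n) 0 (Num.sqrt pi)^-1 else tp (uphalf n) (Num.sqrt pi)^-1 0.

Definition dbas n : R -> R :=
 if n is 0 then tp 0 0 0
 else if odd n then tp (uphalf n) ((uphalf n)%:R * (Num.sqrt pi)^-1) 0
 else tp (uphalf n) 0 (- ((uphalf n)%:R * (Num.sqrt pi)^-1)).

Lemma basP n : exists A B, [/\ bas n = tp (uphalf n) A B,
 dbas n = tp (uphalf n) ((uphalf n)%:R * B) (- ((uphalf n)%:R * A)), `|A| <= 1 & `|B| <= 1].
Proof.
have pi1 : 1 <= pi :> R by have := @pihalf_ge1 R; lra.
have inv1 (y : R) : 1 <= y -> (Num.sqrt y)^-1 <= 1.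
 move=> y1; have : Num.sqrt 1 <= Num.sqrt y by rewrite ler_sqrt//; lra.
 by rewrite sqrtr1 => s1; rewrite invf_le1//; lra.
have s1 := inv1 _ pi1; have s2 := inv1 (2 * pi) ltac:(lra).
case: n => [|n]; first by do 2 eexists; split; [reflexivity | | |]; rewrite ?normr0 ?ger0_norm ?mul0r ?oppr0.
rewrite /bas /dbas; case: odd; do 2 eexists; split; try reflexivity; rewrite ?normr0 ?ger0_norm//.
- by rewrite mulr0 oppr0.
- by rewrite mulr0.
Qed.

Lemma bas_derive n x : is_derive x 1 (bas n) (dbas n x).
Proof. by have [A [B [-> -> _ _]]] := basP n; exact: tp_derive. Qed.

Lemma bas_period n x : bas n (x + 2 * pi) = bas n x.
Proof. by have [A [B [-> _ _ _]]] := basP n; exact: tp_period. Qed.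

Lemma dbas_cts n : continuous (dbas n).
Proof. by have [A [B [_ -> _ _]]] := basP n; exact: tp_cts. Qed.

Lemma bas_cts n : continuous (bas n).
Proof. by have [A [B [-> _ _ _]]] := basP n; exact: tp_cts. Qed.

Lemma bas_L2 n : bas n \in L2. Proof. exact/cts_L2/bas_cts. Qed.

Lemma tp_le k A B x : `|tp k A B x| <= `|A| + `|B|.
Proof.
rewrite /tp; apply: le_trans (ler_normD _ _) _; rewrite !normrM.
by apply: lerD; apply: ler_piMr => //; [exact: cos_max | exact: sin_max].
Qed.

Lemma bas_le n x : `|bas n x| <= 2.
Proof. by have [A [B [-> _ A1 B1]]] := basP n; have := tp_le (uphalf n) A B x; lra. Qed.

Lemma dbas_le n x : `|dbas n x| <= 2 * (uphalf n)%:R.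
Proof.
have [A [B [_ -> A1 B1]]] := basP n; apply: le_trans (tp_le _ _ _ _) _.
rewrite normrN !normrM ger0_norm ?ler0n//.
have : (uphalf n)%:R * `|B| <= (uphalf n)%:R * 1 :> R by rewrite ler_wpM2l ?ler0n.
have : (uphalf n)%:R * `|A| <= (uphalf n)%:R * 1 :> R by rewrite ler_wpM2l ?ler0n.
by lra.
Qed.

Lemma bas_orth m n : L2dot (bas m) (bas n) = (m == n)%:R.
Proof.
have p0 := @pi_gt0 R.
have sp : Num.sqrt pi != 0 :> R by rewrite gt_eqF// sqrtr_gt0.
have sE : Num.sqrt pi ^+ 2 = pi :> R by rewrite sqr_sqrtr// ltW.
have one : pi * ((Num.sqrt pi)^-1 * (Num.sqrt pi)^-1) = 1 :> R by rewrite -invfM -expr2 sE mulfV// gt_eqF.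
have [e|ne] := eqVneq (uphalf m) (uphalf n); last first.
 have [A [B [-> _ _ _]]] := basP m; have [C [D [-> _ _ _]]] := basP n.
 rewrite tp_dot_neq; last exact/eqP.
 by case: (eqVneq m n) ne => // ->; rewrite eqxx.
case: m n e => [|m] [|n] e //.
- rewrite /bas tp_dot0 eqxx.
 have s2 : Num.sqrt (2 * pi) != 0 :> R by rewrite gt_eqF// sqrtr_gt0 mulr_gt0.
 have s2E : Num.sqrt (2 * pi) ^+ 2 = 2 * pi :> R by rewrite sqr_sqrtr// mulr_ge0// ltW.
 by rewrite -invfM -expr2 s2E mulfV// gt_eqF// mulr_gt0.
- have mn : (m.+1 == n.+1) = (odd m.+1 == odd n.+1).
  by apply/eqP/eqP => [->//|o]; move: e o; clear; lia.
 rewrite mn /bas -e; have k0 : (0 < uphalf m.+1)%N by [].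
 by case: odd; case: odd; rewrite tp_dot_eq// ?mul0r ?mulr0 ?addr0 ?add0r ?mulr0.
Qed.

Definition coef (u : R -> R) n : R := L2dot u (bas n).
Definition psum (c : nat -> R) N x : R := \sum_(n < N) c n * bas n x.

Lemma psum_cts c N : continuous (psum c N).
Proof.
apply: continuous_big => [x|i _]; first exact: add_continuous.
by apply: ctsZ; exact: bas_cts.
Qed.

Lemma psum_L2 c N : psum c N \in L2. Proof. exact/cts_L2/psum_cts. Qed.

Lemma psum_dot c N w : w \in L2 -> L2dot (psum c N) w = \sum_(n < N) c n * coef w n.
Proof.
move=> wL; have [_ ->] := L2dot_sum (index_enum 'I_N) (u := fun (i : 'I_N) x => c i * bas i x)
 (fun i => L2Z (c i) (bas_L2 i)) wL.
by apply: eq_bigr => i _; rewrite L2dotZl ?bas_L2// L2dotC.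
Qed.

Lemma psum_coef c N m : coef (psum c N) m = if (m < N)%N then c m else 0.
Proof.
rewrite /coef psum_dot ?bas_L2//; case: ifPn => mN.
 rewrite (bigD1 (Ordinal mN))//= /coef bas_orth eqxx mulr1 big1 ?addr0// => i im.
 rewrite bas_orth; have -> : (m == i) = false; last by rewrite mulr0.
 by apply/negbTE; rewrite eq_sym; apply: contra im => /eqP im; apply/eqP/val_inj.
rewrite big1// => i _; rewrite /coef bas_orth; have -> : (m == i) = false; last by rewrite mulr0.
by apply/negbTE; apply: contra mN => /eqP ->.
Qed.

Lemma psum_norm c N : L2dot (psum c N) (psum c N) = \sum_(n < N) c n ^+ 2.
Proof.
by rewrite psum_dot ?psum_L2//; apply: eq_bigr => i _; rewrite psum_coef ltn_ord expr2.
Qed.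

Lemma psum_defect c w N : w \in L2 -> L2dot (fun x => w x - psum c N x) (fun x => w x - psum c N x) =
 L2dot w w - 2 * (\sum_(n < N) c n * coef w n) + \sum_(n < N) c n ^+ 2.
Proof.
move=> wL; have sL := psum_L2 c N; have s'L := L2Z (-1) sL.
have -> : (fun x => w x - psum c N x) = (fun x => w x + -1 * psum c N x) by apply: funext => x; rewrite mulN1r.
rewrite (L2dotDl wL s'L (L2D wL s'L)) (L2dotC w) (L2dotC (fun x => -1 * _)) (L2dotDl wL s'L wL) (L2dotDl wL s'L s'L).
rewrite (L2dotC w (fun x => -1 * _)) (L2dotZl _ sL wL) (L2dotZl _ sL s'L).
by rewrite (L2dotC _ (fun x => -1 * _)) (L2dotZl _ sL sL) psum_norm psum_dot//; lra.
Qed.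

Lemma bessel w N : w \in L2 -> \sum_(n < N) coef w n ^+ 2 <= L2dot w w.
Proof.
move=> wL; have := L2dot_ge0 (fun x => w x - psum (coef w) N x); rewrite psum_defect//.
by under eq_bigr do rewrite -expr2; lra.
Qed.

End trigonometric.

(** * Eigenfunctions of G *)

Section eigenfunctions.
Context {R : realType} (a : R).
Implicit Types (phi u : R -> R) (n k : nat).

Definition lam n : R := a + (uphalf n)%:R ^+ 2.

Lemma smooth_derive (psi : R -> R) : smooth psi ->
 (forall x : R, is_derive x 1 psi (derive1 psi x)) /\ continuous (derive1 psi).
Proof.
move=> sp; split=> x.
 by apply: DeriveDef; [exact: (sp 0%N x) | rewrite derive1E].
by apply: differentiable_continuous; apply/derivable1_diffP; exact: (sp 1%N x).
Qed.

Lemma opG_bas n : opG a (bas n) (lam n *: bas n).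
Proof.
have [A [B [bE dE _ _]]] := @basP R n.
have E : lam n *: bas n - a *: bas n = (fun x => (uphalf n)%:R ^+ 2 * bas n x).
 by apply: funext => x; rewrite !fctE /lam /GRing.scale /=; ring.
rewrite /opG E; split; [exact: bas_L2 | exact/L2Z/bas_L2 |].
exists (dbas n); split; first exact/cts_L2/dbas_cts.
- move=> psi sp pp; have [dp cp] := smooth_derive sp.
 apply: (circ_ibp (@bas_derive R n) dp (@dbas_cts R n) cp).
  by rewrite -[2 * pi]add0r bas_period.
 by rewrite -[2 * pi]add0r pp.
- move=> psi sp pp; have [dp cp] := smooth_derive sp.
 have -> : - (fun x => (uphalf n)%:R ^+ 2 * bas n x) =
   tp (uphalf n) ((uphalf n)%:R * - ((uphalf n)%:R * A)) (- ((uphalf n)%:R * ((uphalf n)%:R * B))).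
  by apply: funext => x; rewrite !fctE bE tpZ -mulN1r tpZ; congr tp; ring.
 rewrite dE; apply: (circ_ibp (tp_derive _ _ _) dp (@tp_cts _ _ _ _) cp).
  by rewrite tp_2pi tp_at0.
 by rewrite -[2 * pi]add0r pp.
Qed.

(** The domain of G^alpha quantifies over all weak eigenpairs. Testing an arbitrary one against the
    smooth functions [tp] gives (a + k^2 - l) times the scalar product equal to 0, which reduces the
    matter to trigonometric functions. *)
Lemma eigen_orth (l : R) phi k A B : phi \in L2 -> opG a phi (l *: phi) -> l <> a + k%:R ^+ 2 ->
 L2dot phi (tp k A B) = 0.
Proof.
move=> pL [_ wL [v [vL w1 w2]]] ne.
have := w1 (tp k (k%:R * B) (- (k%:R * A))) (@tp_smooth _ _ _ _) (@tp_period _ _ _ _).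
have := w2 (tp k A B) (@tp_smooth _ _ _ _) (@tp_period _ _ _ _).
rewrite !tp_derive1.
have -> : - (l *: phi - a *: phi) = (fun x => (a - l) * phi x).
 by apply: funext => x; rewrite !fctE /GRing.scale /=; ring.
have -> : tp k (k%:R * - (k%:R * A)) (- (k%:R * (k%:R * B))) = (fun x => - k%:R ^+ 2 * tp k A B x).
 by apply: funext => x; rewrite tpZ; congr tp; ring.
rewrite L2dotZl ?tp_L2// => ->; rewrite (L2dotC phi (fun x => _ * _)) L2dotZl ?tp_L2// (L2dotC (tp _ _ _)).
move=> E; have : (a + k%:R ^+ 2 - l) * L2dot phi (tp k A B) = 0 by move: E; clear; lra.
move/eqP; rewrite mulf_eq0 subr_eq0 => /orP[/eqP e|/eqP//].
by case: ne.
Qed.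

Lemma eigen_orth_bas (l : R) phi n : phi \in L2 -> opG a phi (l *: phi) -> l <> lam n ->
 L2dot (bas n) phi = 0.
Proof. by move=> pL Gp ne; have [A [B [-> _ _ _]]] := @basP R n; rewrite L2dotC; exact: (eigen_orth _ _ pL Gp). Qed.

End eigenfunctions.

(** * Uniqueness of Fourier coefficients by Fejer kernels *)

Section uniqueness.
Context {R : realType}.
Implicit Types f : R -> R.

Lemma cos_eq1 (y : R) : cos y = 1 -> exists k : int, y = 2 * pi * k%:~R.
Proof.
move=> cy; have [k kI] := period_shift y; exists (- k).
suff : y + 2 * pi * k%:~R = 0 by rewrite mulrNz; lra.
have : cos (y + 2 * pi * k%:~R) = 1 by rewrite perZ//; exact: cos_period.
move: (y + _) kI => z zI cz; apply: contrapT => z0.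
have p0 := @pi_gt0 R.
have zpos : 0 < z by rewrite lt_neqAle eq_sym; move/eqP: z0 => ->; lra.
have key (w : R) : 0 < w <= pi -> cos w < 1.
 move=> wI; have : cos w < cos 0 by rewrite ltr_cos ?in_itv/=; lra.
 by rewrite cos0.
have [zp|zp] := lerP z pi; first by have := key z ltac:(lra); lra.
have := key (2 * pi - z) ltac:(lra); have -> : 2 * pi - z = - z + 2 * pi by ring.
by rewrite cos_period cosN; lra.
Qed.

Lemma basS n : @bas R n.+1 =
 if odd n.+1 then tp (uphalf n.+1) 0 (Num.sqrt pi)^-1 else tp (uphalf n.+1) (Num.sqrt pi)^-1 0.
Proof. by []. Qed.

(** The kernels are nonnegative, have mass 2 pi n and are bounded, uniformly in n, off any
    neighbourhood of x0 modulo the period. If f did not vanish at x0, their scalar products with f,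
    which are all 0, would grow linearly in absolute value. *)
Lemma fejer f : continuous f -> (forall x, f (x + 2 * pi) = f x) ->
 (forall n, coef f n = 0) -> forall x, f x = 0.
Proof.
move=> cf fp f0 x0; apply: contrapT => /eqP fx0.
have p0 := @pi_gt0 R.
have fL := cts_L2 cf.
have f0' k A B : L2dot f (tp k A B) = 0.
 have sp : Num.sqrt pi != 0 :> R by rewrite gt_eqF// sqrtr_gt0.
 have s2 : Num.sqrt (2 * pi) != 0 :> R by rewrite gt_eqF// sqrtr_gt0 mulr_gt0.
 rewrite L2dotC; case: k => [|k].
  have -> : tp 0 A B = (fun x => A * Num.sqrt (2 * pi) * bas 0 x).
   by apply: funext => x; rewrite /bas !tp0E; field.
  by rewrite L2dotZl ?bas_L2// L2dotC -/(coef f 0%N) f0 mulr0.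
 have b1 : bas k.+1.*2 = tp k.+1 (Num.sqrt pi)^-1 0 :> (R -> R).
  by rewrite doubleS basS -doubleS odd_double uphalf_double.
 have b2 : bas k.*2.+1 = tp k.+1 0 (Num.sqrt pi)^-1 :> (R -> R).
  by rewrite basS [odd _]/= odd_double [uphalf _]/= doubleK.
 have -> : tp k.+1 A B = (fun x => A * Num.sqrt pi * bas k.+1.*2 x + B * Num.sqrt pi * bas k.*2.+1 x).
  by apply: funext => x; rewrite b1 b2 /tp; field.
 by rewrite L2dotDl ?L2Z ?bas_L2// !L2dotZl ?bas_L2// !(L2dotC (bas _)) -![L2dot f (bas _)]/(coef f _) !f0 !mulr0 addr0.
pose cs k := tp k (cos (k%:R * x0)) (sin (k%:R * x0)).
have csE k x : cs k x = cos (k%:R * (x - x0)) by rewrite /cs /tp mulrBr cosB; ring.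
(* Dirichlet kernels centred at [x0], and then their sums, the unnormalized Fejer kernels; all are
   orthogonal to f. *)
pose D := fix D j : R -> R := if j is i.+1 then fun x => D i x + 2 * cs i.+1 x else fun _ => 1.
pose S := fix S n : R -> R := if n is i.+1 then fun x => S i x + D i x else fun _ => 0.
have oneL : (fun _ : R => 1) \in L2 by apply: cts_L2; exact: ctsC.
have csL k : cs k \in L2 by exact: tp_L2.
have cs1 k : L2dot (cs k.+1) (fun _ => 1) = 0.
 pose A := cos (k.+1%:R * x0); pose B := sin (k.+1%:R * x0).
 have dc (x : R) : is_derive x 1 (tp k.+1 (- (B / k.+1%:R)) (A / k.+1%:R)) (cs k.+1 x).
  by apply: deq (tp_derive _ _ _ _) _; rewrite /cs; congr (tp _ _ _ _); rewrite -/A -/B; field.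
 have := circ_deriv dc (@tp_cts _ _ _ _); rewrite tp_2pi tp_at0 subrr => <-.
 by apply: eq_Rintegral => x _; rewrite mulr1.
have DL j : [/\ continuous (D j), L2dot (D j) f = 0 & L2dot (D j) (fun _ => 1) = 2 * pi].
 elim: j => [|j [cD D0 D1]] /=.
  split; [exact: ctsC | by have := f0' 0%N 1 0; rewrite L2dotC (_ : tp 0 1 0 = fun _ => 1)//; apply: funext => x; rewrite tp0E |].
  by rewrite -[RHS]mulr1 -circ_cst /circ; apply: eq_Rintegral => x _; rewrite mulr1.
 split; first by apply: ctsD => //; apply: ctsZ; exact: tp_cts.
  by rewrite (L2dotDl (cts_L2 cD) (L2Z 2 (csL j.+1)) fL) (L2dotZl 2 (csL j.+1) fL) D0 (L2dotC (cs _)) f0' mulr0 addr0.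
 by rewrite (L2dotDl (cts_L2 cD) (L2Z 2 (csL j.+1)) oneL) (L2dotZl 2 (csL j.+1) oneL) D1 cs1 mulr0 addr0.
have SL n : [/\ continuous (S n), L2dot (S n) f = 0 & L2dot (S n) (fun _ => 1) = n%:R * (2 * pi)].
 elim: n => [|n [cS S0 S1]] /=.
  split; first exact: ctsC.
   by rewrite -[RHS](mul0r (L2dot f f)) -(L2dotZl 0 fL fL); apply: eq_Rintegral => x _; rewrite !mul0r.
  by rewrite mul0r -[RHS](mulr0 (2 * pi)) -circ_cst /circ; apply: eq_Rintegral => x _; rewrite mulr1.
 have [cD D0 D1] := DL n; split; first exact: ctsD.
  by rewrite (L2dotDl (cts_L2 cS) (cts_L2 cD) fL) S0 D0 addr0.
 by rewrite (L2dotDl (cts_L2 cS) (cts_L2 cD) oneL) S1 D1 -natr1; ring.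
pose T x := cos (x - x0).
have DE j x : (1 - T x) * D j x = cos (j%:R * (x - x0)) - cos (j.+1%:R * (x - x0)).
 elim: j => [|j IH] /=; first by rewrite mul0r mul1r cos0 mulr1.
 rewrite mulrDr IH csE; have -> : j%:R * (x - x0) = j.+1%:R * (x - x0) - (x - x0) by rewrite -natr1; ring.
 have -> : j.+2%:R * (x - x0) = j.+1%:R * (x - x0) + (x - x0) by rewrite -[j.+2%:R]natr1; ring.
 by rewrite /T; move: (x - x0) => y; rewrite cosB cosD; ring.
have SE n x : (1 - T x) * S n x = 1 - cos (n%:R * (x - x0)).
 by elim: n => [|n IH] /=; [rewrite mul0r cos0 subrr mulr0 | rewrite mulrDr IH DE; ring].
have T1 x : T x <= 1 by have := cos_max (x - x0); rewrite ler_norml => /andP[].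
have S0 n x : 0 <= S n x.
 have [lt|ge] := ltrP (T x) 1.
  rewrite -(pmulr_rge0 _ (_ : 0 < 1 - T x)) ?subr_gt0// SE subr_ge0.
  by have := cos_max (n%:R * (x - x0)); rewrite ler_norml => /andP[].
 have Tx : cos (x - x0) = 1 by apply/eqP; rewrite eq_le ge T1.
 have sx : sin (x - x0) = 0.
  apply/eqP; rewrite -sqrf_eq0; apply/eqP; have := cos2Dsin2 (x - x0); rewrite Tx expr1n.
  by move: (_ ^+ 2) => q; clear; lra.
 have c1 k : cs k x = 1.
  rewrite csE; elim: k => [|k IH]; first by rewrite mul0r cos0.
  by rewrite -natr1 mulrDl mul1r cosD IH Tx sx mulr0 subr0 mulr1.
 have D0 j : 0 <= D j x by elim: j => [|j IH] //=; rewrite c1 addr_ge0.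
 by elim: n => [|n IH] //=; rewrite addr_ge0.
pose s := f x0; have s0 : 0 < s ^+ 2 by rewrite lt_neqAle sqr_ge0 andbT eq_sym sqrf_eq0.
pose g x := s * f x.
have cg : continuous g by apply: ctsM (@ctsC _ _ _) cf.
have gp x : g (x + 2 * pi) = g x by rewrite /g fp.
pose m := s ^+ 2 / 2; have m0 : 0 < m by rewrite divr_gt0.
have gx0 : g x0 = 2 * m by rewrite /g /m -/s; field.
have pp0 : 0 <= 2 * pi :> R by lra.
have [c _ cM] := @EVT_min R g 0 (2 * pi) pp0 (continuous_subspaceT cg).
pose M := `|g c|.
have gM x : - M <= g x.
 have [k kI] := period_shift x; have := cM (x + 2 * pi * k%:~R).
 rewrite in_itv/= perZ//; have -> : 0 <= x + 2 * pi * k%:~R <= 2 * pi by clear -kI; lra.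
 by move=> /(_ isT); rewrite /M; have := ler_norm (- g c); rewrite normrN; lra.
have cT : continuous T.
 have -> : T = cs 1%N by apply: funext => x; rewrite csE mul1r.
 exact: tp_cts.
have [rho rhoI rhoP] : exists2 rho, rho < 1 & forall x, g x < m -> T x <= rho.
 pose K := `[0, 2 * pi]%classic `&` [set x | g x <= m].
 have cK : compact K.
  apply: compact_closedI; first exact: segment_compact.
  have -> : [set x | g x <= m] = g @^-1` [set y | y <= m] by [].
  by apply: preimage_closed => [x _|]; [exact: cg | exact: closed_le].
 have inK x : g x < m -> exists2 z, K z & T z = T x.
  move=> gx; have [k kI] := period_shift x; exists (x + 2 * pi * k%:~R).
   by split; [rewrite /= in_itv/=; clear -kI; lra | rewrite /= (perZ _ _ gp) ltW].
  by rewrite (perZ (w := T))// => z; rewrite /T addrAC cos_period.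
 have [K0|K0] := pselect (K !=set0); last first.
  by exists 0 => [|x /inK[z Kz _]]; [exact: ltr01 | case: K0; exists z].
 have [z] := compact_EVT_max K0 cK (continuous_subspaceT cT).
 rewrite inE => -[_ /= gz] zM; exists (T z).
  have := T1 z; rewrite le_eqVlt => /orP[/eqP/cos_eq1[k kE]|//].
  by move: gz; have -> : z = x0 + 2 * pi * k%:~R by [lra]; rewrite (perZ _ _ gp) gx0; lra.
 by move=> x /inK[y Ky <-]; apply: zM; rewrite inE.
have mM : 0 < m + M by have := normr_ge0 (g c); rewrite -/M; lra.
have r1 : 0 < 1 - rho by rewrite subr_gt0.
(* Where g < m the kernel is at most 2 / (1 - rho), so the loss there is a constant independent of
   n. *)
pose b := (m + M) * (2 / (1 - rho)).
have pt n x : m * S n x + - b <= g x * S n x.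
 have s_0 := S0 n x; have [gm|gm] := lerP m (g x).
  have : m * S n x <= g x * S n x by rewrite ler_wpM2r.
  by have : 0 <= b by [rewrite mulr_ge0 ?divr_ge0// ltW]; lra.
 have Sb : S n x <= 2 / (1 - rho).
  rewrite ler_pdivlMr// mulrC; apply: le_trans (_ : (1 - T x) * S n x <= _).
   by rewrite ler_wpM2r// lerD2l lerN2 rhoP.
  by rewrite SE; have := cos_max (n%:R * (x - x0)); rewrite ler_norml; lra.
 have := ler_wpM2l (ltW mM) Sb; rewrite -/b => H.
 by have : - M * S n x <= g x * S n x by [rewrite ler_wpM2r]; move: H; clear; lra.
have key n : m * n%:R <= b.
 have [cS Sf S1] := SL n.
 have : circ (fun x => m * S n x + - b) <= circ (fun x => g x * S n x).
  apply: le_Rintegral => //; apply: cts_int; last exact: ctsM.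
  by apply: ctsD; [apply: ctsM => //; exact: ctsC | exact: ctsC].
 have -> : circ (fun x => g x * S n x) = 0.
  rewrite -[RHS](mulr0 s) -Sf L2dotC -L2dotZl ?cts_L2//.
 have -> : circ (fun x => m * S n x + - b) = m * (n%:R * (2 * pi)) + 2 * pi * - b.
  have <- : circ (fun _ : R => - b) = 2 * pi * - b := circ_cst _.
  have <- : circ (fun x => m * S n x) = m * (n%:R * (2 * pi)).
   by rewrite -S1 -(L2dotZl m (cts_L2 cS) oneL); apply: eq_Rintegral => x _; rewrite mulr1.
  rewrite /circ RintegralD//.
  - by apply: (@cts_int _ (fun x => _ * _)); apply: ctsM => //; exact: ctsC.
  - by apply: (@cts_int _ (fun x => _)); exact: ctsC.
 move=> H; rewrite -(ler_pM2r (_ : 0 < 2 * pi)); first by move: H; clear; lra.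
 by rewrite mulr_gt0.
have := key (Num.truncn (b / m)).+1; rewrite mulrC -ler_pdivlMr// leNgt => /negP; apply; exact: truncnS_gt.
Qed.

End uniqueness.

(** * Functions with prescribed square summable coefficients *)

Section riesz_fischer.
Context {R : realType}.
Implicit Types (c : nat -> R) (N M n m : nat).
Local Notation mu := (@circle_measure R).

Definition sqsum c N : R := \sum_(n < N) c n ^+ 2.

Lemma sqsum_mono c N M : (N <= M)%N -> sqsum c N <= sqsum c M.
Proof.
move=> /subnKC <-; elim: (M - N)%N => [|k IH]; first by rewrite addn0.
by rewrite addnS /sqsum big_ord_recr/=; apply: le_trans IH _; rewrite lerDl sqr_ge0.
Qed.

Lemma sqsum_tail c (L e : R) : (forall N, sqsum c N <= L) -> 0 < e ->
 exists N0, forall N M, (N0 <= N)%N -> (N <= M)%N -> sqsum c M - sqsum c N <= e.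
Proof.
move=> cL e0.
have hs : has_sup (range (sqsum c)).
 by split; [exists (sqsum c 0), 0%N | exists L => _ [N _ <-]].
have [_ [N0 _ <-] N0P] := sup_adherent e0 hs.
exists N0 => N M NN MN; have := sqsum_mono c NN.
have : sqsum c M <= sup (range (sqsum c)) by apply: ub_le_sup; [exact: hs.2 | exists M].
by move: N0P; clear; lra.
Qed.

Lemma psum_sub c N M x : (N <= M)%N ->
 psum c M x - psum c N x = psum (fun n => if (N <= n)%N then c n else 0) M x.
Proof.
move=> NM; rewrite /psum -!(big_mkord xpredT (fun n => c n * bas n x)).
rewrite -(big_mkord xpredT (fun n => (if (N <= n)%N then c n else 0) * bas n x)).
rewrite !(@big_cat_nat _ _ _ N 0 M)//= addrAC subrr add0r.
rewrite [X in _ = X + _]big_nat [X in _ = X + _]big1 ?add0r; last first.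
 by move=> i /andP[_ iN]; rewrite leqNgt iN mul0r.
by rewrite !big_nat; apply: eq_bigr => i /andP[-> _].
Qed.

Lemma psum_dist c N M : (N <= M)%N ->
 L2dot (fun x => psum c M x - psum c N x) (fun x => psum c M x - psum c N x) = sqsum c M - sqsum c N.
Proof.
move=> NM.
have -> : (fun x : R => psum c M x - psum c N x) = psum (fun n => if (N <= n)%N then c n else 0) M.
 by apply: funext => x; exact: psum_sub.
rewrite psum_norm /sqsum -!(big_mkord xpredT (fun n => c n ^+ 2)).
rewrite -(big_mkord xpredT (fun n => (if (N <= n)%N then c n else 0) ^+ 2)).
rewrite !(@big_cat_nat _ _ _ N 0 M)//= addrAC subrr add0r.
rewrite [X in X + _ = _]big_nat [X in X + _ = _]big1 ?add0r; last first.
 by move=> i /andP[_ iN]; rewrite leqNgt iN expr0n.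
by rewrite !big_nat; apply: eq_bigr => i /andP[-> _].
Qed.

Lemma psum_distC c N M : L2dot (fun x => psum c M x - psum c N x) (fun x => psum c M x - psum c N x) =
 L2dot (fun x => psum c N x - psum c M x) (fun x => psum c N x - psum c M x).
Proof. by apply: eq_Rintegral => x _; rewrite -mulrNN !opprB. Qed.

Lemma limn_einf_le (u : (\bar R)^nat) (e : \bar R) : (forall n, (u n <= e)%E) -> (limn_einf u <= e)%E.
Proof.
move=> ue; apply: le_trans (limn_einf_sup u) _; rewrite limn_esup_lim.
apply: lime_le; first exact: is_cvg_esups.
by apply: nearW => n; apply: ge_ereal_sup => _ [m _ <-].
Qed.

(** A subsequence of the partial sums has increments summable in L^1, hence converges almost
    everywhere; Fatou's lemma then turns the pointwise limit into a limit in L^2. *)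
Lemma riesz_fischer c (L : R) : (forall N, sqsum c N <= L) ->
 exists w, [/\ w \in L2, forall n, coef w n = c n & L2dot w w <= L].
Proof.
move=> cL; pose h j : R := (2 ^ (j + 1))%:R^-1.
have h0 j : 0 < h j by rewrite invr_gt0 ltr0n expn_gt0.
have hS j : h j.+1 <= h j by rewrite lef_pV2 ?posrE ?ltr0n ?expn_gt0// ler_nat leq_exp2l//; lia.
have h_le i j : (i <= j)%N -> h j <= h i.
 by move=> /subnKC <-; elim: (j - i)%N => [|k IH]; rewrite ?addn0// addnS; apply: le_trans IH.
have [nu nuP] := choice (fun j => sqsum_tail cL (exprn_gt0 2 (h0 j))).
pose S j := psum c (nu j).
have cS j : continuous (S j) by exact: psum_cts.
have SN j N : (nu j <= N)%N -> L2dot (fun x => psum c N x - S j x) (fun x => psum c N x - S j x) <= h j ^+ 2.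
 by move=> jN; rewrite psum_dist//; exact: nuP.
pose g j x := S j.+1 x - S j x.
have cg j : continuous (g j) by apply: ctsB.
have gL j : L2dot (g j) (g j) <= h j ^+ 2.
 have [jj|/ltnW jj] := leqP (nu j) (nu j.+1); first exact: SN.
 rewrite /g psum_distC; apply: le_trans (SN j.+1 (nu j) jj) _.
 by rewrite lerXn2r ?nnegrE ?(ltW (h0 _)) ?hS.
pose F x := (\sum_(0 <= j <oo) `|g j x|%:E)%E.
have mg j : measurable_fun [set: measurableTypeR R] (fun x => `|g j x|%:E).
 by apply/measurable_EFinP; apply: cts_measurable; apply: cts_abs.
have mF : measurable_fun [set: measurableTypeR R] F by apply: ge0_emeasurable_sum => // k x _ _; rewrite lee_fin.
have intg j : (\int[mu]_x `|g j x|%:E <= ((pi + 1) / (2 ^ (j + 1))%:R)%:E)%E.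
 have ig : mu.-integrable setT (EFin \o (fun x => `|g j x|)) by apply: cts_int; exact: cts_abs.
 have -> : (\int[mu]_x `|g j x|%:E = (circ (fun x => `|g j x|))%:E)%E.
  by rewrite /circ fineK//; exact: integrable_fin_num.
 rewrite lee_fin -[X in _ <= X]/((pi + 1) * h j).
 have cq : continuous (fun x => h j / 2 + (2 * h j)^-1 * (g j x * g j x)).
  by apply: ctsD; [exact: ctsC | apply: ctsZ; exact: ctsM].
 (* Pointwise |g| <= h / 2 + g^2 / (2 h), which bounds the L^1 norm of the increment by a multiple
    of h. *)
 have : circ (fun x => `|g j x|) <= circ (fun x => h j / 2 + (2 * h j)^-1 * (g j x * g j x)).
  apply: le_Rintegral => //; first exact: cts_int.
  move=> x _ /=; rewrite -(ler_pM2l (_ : 0 < 2 * h j)) ?mulr_gt0//.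
  have -> : 2 * h j * (h j / 2 + (2 * h j)^-1 * (g j x * g j x)) = h j ^+ 2 + g j x ^+ 2.
   by field; rewrite gt_eqF.
  have := sqr_ge0 (h j - `|g j x|); rewrite sqrrB real_normK ?num_real//.
  by set X := h j ^+ 2; set Y := g j x ^+ 2; set Z := `|_|; rewrite -mulrA -mulr_natl; lra.
 have -> : circ (fun x => h j / 2 + (2 * h j)^-1 * (g j x * g j x)) = 2 * pi * (h j / 2) + (2 * h j)^-1 * L2dot (g j) (g j).
  rewrite /circ RintegralD//; last 2 first.
  - by apply: (@cts_int _ (fun x => _)); exact: ctsC.
  - by apply: (@cts_int _ (fun x => _ * _)); apply: ctsM (@ctsC _ _ _) _; exact: ctsM.
  by rewrite -[X in X + _]/(circ _) circ_cst RintegralZl//; exact: (cts_int (ctsM (cg j) (cg j))).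
 move=> /le_trans; apply.
 have : (2 * h j)^-1 * L2dot (g j) (g j) <= (2 * h j)^-1 * h j ^+ 2.
  by rewrite ler_wpM2l// invr_ge0 mulr_ge0// ltW.
 have -> : (2 * h j)^-1 * h j ^+ 2 = h j / 2 by field; rewrite gt_eqF.
 by have := h0 j; set A := _ * L2dot _ _; clear; lra.
have Ffin : \forall x \ae mu, F x \is a fin_num.
 have iF : mu.-integrable setT F.
  apply/integrableP; split => //.
  under eq_integral => x _ do rewrite gee0_abs ?nneseries_ge0//.
  rewrite integral_nneseries//.
  apply: le_lt_trans (_ : ((pi + 1) / 2 ^+ 0 : R)%:E < +oo)%E; last exact: ltry.
  have /cvg_lim <-// := @cvg_geometric_eseries_half R (pi + 1) 0.
  by apply: lee_nneseries => [j _ _|j _]; [exact: integral_ge0 | exact: intg].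
 by have := integrable_ae measurableT iF; apply: filterS => x; apply.
(* An upper limit is defined and measurable everywhere; it is the limit wherever the increments are
   summable. *)
pose w x : R := fine (limn_esup (fun j => (S j x)%:E)).
have Sw : \forall x \ae mu, S ^~ x @ \oo --> w x.
 apply: (@filterS _ _ (ae_filter_ringOfSetsType mu)) Ffin => x Fx.
 have cs : cvgn (series (fun j => `|g j x|)).
  apply: nondecreasing_is_cvgn; first by apply: nondecreasing_series.
  exists (fine (F x)) => _ [n _ <-]; rewrite -lee_fin fineK// /F.
  rewrite /series /= -sumEFin; apply: nneseries_lim_ge => k _ _; by rewrite lee_fin.
 have cg' : cvgn (series (fun j => g j x)) by exact: normed_cvg.
 have SE n : S n x = S 0%N x + series (fun j => g j x) n.
  by rewrite /series /= telescope_sumr// addrC subrK.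
 have cS' : S ^~ x @ \oo --> S 0%N x + limn (series (fun j => g j x)).
  rewrite (_ : S^~ x = fun n => S 0%N x + series (fun j => g j x) n); last by apply: funext.
  by apply: cvgD; [exact: cvg_cst | exact: cg'].
 have -> : w x = S 0%N x + limn (series (fun j => g j x)).
  have : (fun j => (S j x)%:E) @ \oo --> (S 0%N x + limn (series (fun j => g j x)))%:E by apply: cvg_EFin => //; exact: nearW.
  by rewrite /w => /cvg_limn_einf_sup[_ ->].
 exact: cS'.
have mw : measurable_fun [set: measurableTypeR R] w.
 apply: measurableT_comp => //; apply: measurable_fun_limn_esup => n.
 by apply/measurable_EFinP; exact: cts_measurable.
have dist e : 0 < e -> exists N0, forall N, (N0 <= N)%N -> 
  (\int[mu]_x ((w x - psum c N x) * (w x - psum c N x))%:E <= e%:E)%E.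
 move=> e0; have [N0 N0P] := sqsum_tail cL e0.
 have [J hJ] : exists J, h J ^+ 2 <= e.
  have [J] : exists J, forall j, (J <= j)%N -> h j ^+ 2 <= e.
   have := cvg_geometric 1 (_ : `|2^-1 : R| < 1) => /(_ _)/cvgrPdist_le/(_ (Num.min 1 e)).
   rewrite ger0_norm; last by lra.
   have m0 : 0 < Num.min 1 e by rewrite lt_min ltr01.
   case=> [|//|J _ JP]; first by lra.
   exists J => j Jj; have := JP j Jj; rewrite /= mul1r sub0r normrN ger0_norm ?exprn_ge0// => H1.
   have H2 : h j <= Num.min 1 e.
    apply: le_trans H1; rewrite /h natrX exprVn lef_pV2 ?posrE ?exprn_gt0//.
    by rewrite ler_eXn2l ?ltr1n//; lia.
   have := h0 j; move: H2; rewrite le_min => /andP[H2 H3] H4; rewrite expr2.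
   by apply: le_trans H3; rewrite ler_piMl// ltW.
  by exists J; exact: p.
 exists N0 => N NN.
 pose f n x := ((S (J + n)%N x - psum c N x) * (S (J + n)%N x - psum c N x))%:E.
 have f0 n x : (0 <= f n x)%E by rewrite lee_fin -expr2 sqr_ge0.
 have mf n : measurable_fun [set: measurableTypeR R] (f n).
  apply/measurable_EFinP; apply: cts_measurable; apply: ctsM; apply: ctsB => //; exact: psum_cts.
 have -> : (\int[mu]_x ((w x - psum c N x) * (w x - psum c N x))%:E = \int[mu]_x limn_einf (f ^~ x))%E.
  apply: ge0_ae_eq_integral => //.
  - by apply/measurable_EFinP; apply: measurable_funM; apply: measurable_funB => //; apply: cts_measurable; exact: psum_cts.
  - by apply: measurableT_comp => //; apply: measurable_fun_limn_esup => n; exact: measurableT_comp.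
  - by move=> x _; rewrite lee_fin -expr2 sqr_ge0.
  - move=> x _; rewrite limn_einf_lim; apply: lime_ge; first exact: is_cvg_einfs.
   by apply: nearW => n; apply: le_ereal_inf_tmp => _ [m _ <-].
  apply: (@filterS _ _ (ae_filter_ringOfSetsType mu)) Sw => x Sx _; apply/esym.
  suff : f ^~ x @ \oo --> ((w x - psum c N x) * (w x - psum c N x))%:E by move/cvg_limn_einf_sup => [].
  apply: cvg_EFin; first exact: nearW.
  have H : (fun n => S (J + n)%N x - psum c N x) @ \oo --> w x - psum c N x.
   apply: cvgB; last exact: cvg_cst.
   have -> : (fun n => S (J + n)%N x) = (fun n => (S ^~ x) (n + J)%N) by apply: funext => n; rewrite addnC.
   by move: Sx; rewrite -(cvg_shiftn J (S ^~ x)).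
  exact: cvgM.
 apply: le_trans (@fatou _ _ _ mu setT measurableT f mf (fun n x _ => f0 n x)) _.
 apply: limn_einf_le => n.
 have -> : (\int[mu]_x f n x = (L2dot (fun x => S (J + n)%N x - psum c N x) (fun x => S (J + n)%N x - psum c N x))%:E)%E.
  rewrite /L2dot fineK//; apply: integrable_fin_num => //.
  by apply: (@cts_int _ (fun x => _ * _)); apply: ctsM; apply: ctsB => //; exact: psum_cts.
 rewrite lee_fin; have [jN|/ltnW jN] := leqP (nu (J + n)%N) N; last by rewrite psum_dist//; exact: N0P.
 rewrite psum_distC; apply: le_trans (SN _ _ jN) _; apply: le_trans hJ.
 by rewrite lerXn2r ?nnegrE ?(ltW (h0 _))// h_le// leq_addr.
have wpL N : (exists2 e, 0 < e & (\int[mu]_x ((w x - psum c N x) * (w x - psum c N x))%:E <= e%:E)%E) ->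
  (fun x => w x - psum c N x) \in L2.
 move=> [e e0 le_e]; apply/L2P.
 have mwp : measurable_fun [set: measurableTypeR R] (fun x => w x - psum c N x).
  by apply: measurable_funB => //; apply: cts_measurable; exact: psum_cts.
 split=> //; apply/integrableP; split.
  by apply/measurable_EFinP; apply: measurable_funX.
 apply: le_lt_trans (ltry e); apply: le_trans le_e.
 rewrite le_eqVlt; apply/orP; left; apply/eqP; apply: eq_integral => x _ /=.
 by rewrite ger0_norm ?sqr_ge0.
have wL : w \in L2.
 have [N0 N0P] := dist 1 ltr01.
 have -> : w = (fun x => (w x - psum c N0 x) + psum c N0 x) by apply: funext => x; rewrite subrK.
 exact: (L2D (wpL N0 (ex_intro2 _ _ 1 ltr01 (N0P N0 (leqnn _)))) (psum_L2 c N0)).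
have wpL' N : (fun x => w x - psum c N x) \in L2.
 have -> : (fun x => w x - psum c N x) = (fun x => w x + -1 * psum c N x) by apply: funext => x; rewrite mulN1r.
 exact: (L2D wL (L2Z (-1) (psum_L2 c N))).
have dist' e : 0 < e -> exists N0, forall N, (N0 <= N)%N -> L2dot (fun x => w x - psum c N x) (fun x => w x - psum c N x) <= e.
 move=> e0; have [N0 N0P] := dist e e0; exists N0 => N NN.
 rewrite -lee_fin /L2dot fineK; first exact: N0P.
 apply: integrable_fin_num => //; exact: L2_int2.
have wc n : coef w n = c n.
 apply/eqP; rewrite -subr_eq0 -sqrf_eq0 eq_le sqr_ge0 andbT leNgt; apply/negP => e0.
 have [N0 N0P] := dist' _ (divr_gt0 e0 (ltr0n _ 2)).
 have := N0P (maxn N0 n.+1) (leq_maxl _ _); set N := maxn _ _ => le_e.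
 have cd : coef (fun x => w x - psum c N x) n = coef w n - c n.
  rewrite /coef; have -> : (fun x => w x - psum c N x) = (fun x => w x + -1 * psum c N x).
   by apply: funext => x; rewrite mulN1r.
  rewrite L2dotDl ?L2Z ?psum_L2 ?bas_L2// L2dotZl ?psum_L2 ?bas_L2// -[L2dot (psum _ _) _]/(coef _ _) psum_coef.
  by rewrite leq_maxr mulN1r.
 have := L2_CS (wpL' N) (@bas_L2 R n); rewrite -[L2dot _ _ ^+ 2]/(coef _ _ ^+ 2) cd bas_orth eqxx mulr1.
 by move: le_e e0; clear; set X := (_ ^+ 2); lra.
exists w; split=> //.
rewrite leNgt; apply/negP => LW; have d0 : 0 < L2dot w w - L by rewrite subr_gt0.
have [N0 N0P] := dist' _ (divr_gt0 d0 (ltr0n _ 2)).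
have := N0P N0 (leqnn _); rewrite psum_defect//.
have -> : \sum_(n < N0) c n * coef w n = \sum_(n < N0) c n ^+ 2.
 by apply: eq_bigr => i _; rewrite wc expr2.
by have := cL N0; rewrite /sqsum; move: LW; clear; lra.
Qed.

End riesz_fischer.

(** * Termwise differentiation, sums and uniform series *)

Section generalities.
Context {R : realType}.
Implicit Types (f g : R -> R) (x y d : R).

Lemma eps_is_derive f x d :
 (forall e, 0 < e -> exists2 r, 0 < r & forall y, `|y - x| < r -> `|f y - f x - d * (y - x)| <= e * `|y - x|) ->
 is_derive x 1 f d.
Proof.
move=> H; have fd : (fun h : R => h^-1 *: (f (h *: 1 + x) - f x)) @ 0^' --> d.
 apply/cvgrPdist_le => e e0; have [r r0 rH] := H e e0.
 near=> h; have h0 : h != 0 by near: h; exact: nbhs_dnbhs_neq.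
 have hr : `|h| < r.
  near: h; apply: dnbhs0_lt => //.
 have := rH (h *: 1 + x); rewrite addrK /GRing.scale /= mulr1 => /(_ hr) K.
 have -> : d - h^-1 * (f (h + x) - f x) = - (h^-1 * (f (h + x) - f x - d * h)) by field.
 rewrite normrN normrM normfV mulrC ler_pdivrMr ?normr_gt0//.
by apply: DeriveDef; [apply: cvgP fd | rewrite /derive; exact: cvg_lim fd].
Unshelve. all: by end_near.
Qed.

Lemma uniform_derive (P dP : nat -> R -> R) (F D : R -> R) :
 (forall N x, is_derive x 1 (P N) (dP N x)) ->
 (forall e, 0 < e -> exists N0, forall N, (N0 <= N)%N -> forall x, `|F x - P N x| <= e) ->
 (forall e, 0 < e -> exists N0, forall N, (N0 <= N)%N -> forall x, `|D x - dP N x| <= e) ->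
 continuous D -> forall x, is_derive x 1 F (D x).
Proof.
move=> dPP PF PD cD x; apply: eps_is_derive => e e0.
have e3 : 0 < e / 3 by lra.
have /cvgrPdist_lt/(_ _ e3)/nbhs_ballP[r r0 rP] := cD x.
exists r => // y yr; apply/ler_addgt0Pr => k k0.
have [N1 N1P] := PD _ e3; have k3 : 0 < k / 3 by lra.
have [N2 N2P] := PF _ k3.
pose N := maxn N1 N2.
have HN z : `|F z - P N z| <= k / 3 by apply: N2P; exact: leq_maxr.
have HD z : `|D z - dP N z| <= e / 3 by apply: N1P; exact: leq_maxl.
have near_ z : `|z - x| < r -> `|D x - D z| < e / 3 by move=> zr; apply: rP; rewrite /ball /= distrC.
have key u v : u < v -> (`|u - x| < r) -> (`|v - x| < r) -> `|P N v - P N u - D x * (v - u)| <= e * (v - u).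
 move=> uv ur vr; have [z zI ->] := mvt uv (fun z _ => dPP N z).
 rewrite -mulrBl normrM [`|v - u|]gtr0_norm ?subr_gt0//; apply: ler_wpM2r; first by rewrite subr_ge0 ltW.
 have zr : `|z - x| < r by move: ur vr zI; rewrite !ltr_norml; clear; lra.
 have := HD z; have := near_ z zr; rewrite ler_norml ltr_norml => A B.
 by rewrite ler_norml; move: A B e0; clear; lra.
have xr : `|x - x| < r by rewrite subrr normr0.
have fin : `|P N y - P N x - D x * (y - x)| <= e * `|y - x|.
 have [xy|xy|->] := ltrgtP x y.
 - exact: key.
 - have -> : P N y - P N x - D x * (y - x) = - (P N x - P N y - D x * (x - y)) by ring.
  by rewrite normrN key.
 - by rewrite !subrr mulr0 subrr !normr0 mulr0.
have := HN x; have := HN y; move: fin; set E := e * _; set B := D x * _.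
by rewrite !ler_norml; move: k0; clear; lra.
Qed.

(** Arithmetic-geometric inequality with weight (B + k) / (A + k); the parameter k > 0 avoids a
    division by 0 and then tends to 0. *)
Lemma sum_CS (N : nat) (x y : nat -> R) (A B : R) : 0 <= A -> 0 <= B ->
 sqsum x N <= A ^+ 2 -> sqsum y N <= B ^+ 2 -> `|\sum_(n < N) x n * y n| <= A * B.
Proof.
move=> A0 B0 xA yB.
have key t : 0 < t -> `|\sum_(n < N) x n * y n| <= t / 2 * A ^+ 2 + (2 * t)^-1 * B ^+ 2.
 move=> t0; apply: le_trans (ler_norm_sum _ _ _) _.
 apply: le_trans (_ : t / 2 * sqsum x N + (2 * t)^-1 * sqsum y N <= _); last first.
  by apply: lerD; apply: ler_wpM2l => //; rewrite ?invr_ge0 ?divr_ge0 ?mulr_ge0// ltW.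
 rewrite /sqsum !mulr_sumr -big_split/=; apply: ler_sum => i _; rewrite normrM.
 rewrite -(ler_pM2l (_ : 0 < 2 * t)) ?mulr_gt0//.
 have -> : 2 * t * (t / 2 * x i ^+ 2 + (2 * t)^-1 * y i ^+ 2) = (t * `|x i|) ^+ 2 + `|y i| ^+ 2.
  by rewrite exprMn !real_normK ?num_real//; field; rewrite gt_eqF.
 by have := sqr_ge0 (t * `|x i| - `|y i|); rewrite sqrrB -[_ *+ 2]mulr_natl; lra.
have lim (k : R) : 0 < k -> `|\sum_(n < N) x n * y n| <= (A + k) * (B + k).
 move=> k0; have Ak : 0 < A + k by lra. have Bk : 0 < B + k by lra.
 apply: le_trans (key ((B + k) / (A + k)) (divr_gt0 Bk Ak)) _.
 have H1 : (B + k) / (A + k) / 2 * A ^+ 2 <= (B + k) / (A + k) / 2 * (A + k) ^+ 2.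
  by apply: ler_wpM2l; [rewrite !divr_ge0// ltW | rewrite lerXn2r ?nnegrE//; lra].
 have H2 : (2 * ((B + k) / (A + k)))^-1 * B ^+ 2 <= (2 * ((B + k) / (A + k)))^-1 * (B + k) ^+ 2.
  apply: ler_wpM2l; first by rewrite invr_ge0 mulr_ge0// divr_ge0// ltW.
  by rewrite lerXn2r ?nnegrE//; lra.
 apply: le_trans (lerD H1 H2) _; rewrite le_eqVlt; apply/orP; left; apply/eqP.
 by field; rewrite !gt_eqF.
apply/ler_addgt0Pr => e e0.
have [k [k0 k1 ke]] := below2 (ltr01 : 0 < 1 :> R) (divr_gt0 e0 (ltac:(lra) : 0 < A + B + 1)).
move: ke; rewrite ltr_pdivlMr; last by lra.
by have := lim k k0; move: k0 k1; clear; nra.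
Qed.

(** Each term is compared, by the mean value theorem, with an increment of x^(1 - p). *)
Lemma zeta_bound (p : R) N : 1 < p -> \sum_(n < N) n.+1%:R `^ (- p) <= 1 + (p - 1)^-1.
Proof.
move=> p1; have q0 : 0 < p - 1 by lra.
have key M : \sum_(n < M.+1) n.+1%:R `^ (- p) <= 1 + (p - 1)^-1 * (1 - M.+1%:R `^ (- (p - 1))).
 elim: M => [|M IH]; first by rewrite big_ord1 !powR1 subrr mulr0; lra.
 rewrite big_ord_recr/=; apply: le_trans (lerD IH (lexx _)) _.
 have M0 : 0 < M.+1%:R :> R by rewrite ltr0n.
 have MM : M.+1%:R < M.+2%:R :> R by rewrite ltr_nat.
 have [z|z zI e] := @mvt R (fun x => x `^ (- (p - 1))) (fun x => - (p - 1) * x `^ (- (p - 1) - 1)) _ _ MM.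
  by move=> zI; apply: is_derive1_powR; lra.
 have E : M.+2%:R - M.+1%:R = 1 :> R by rewrite -[M.+2%:R]natr1; ring.
 move: e; rewrite E mulr1 => e.
 have z0 : 0 < z by lra.
 have : M.+2%:R `^ (- p) <= z `^ (- p).
  by rewrite !powRN lef_pV2 ?posrE ?powR_gt0// ge0_ler_powR ?nnegrE; lra.
 have -> : z `^ (- p) = (p - 1)^-1 * (M.+1%:R `^ (- (p - 1)) - M.+2%:R `^ (- (p - 1))).
  have -> : M.+1%:R `^ (- (p - 1)) - M.+2%:R `^ (- (p - 1)) = (p - 1) * z `^ (- (p - 1) - 1) by lra.
  by rewrite mulKf ?gt_eqF//; congr (_ `^ _); ring.
 by set X := _ `^ (- p); set Y := _ `^ (- (p - 1)); set Z := M.+2%:R `^ _; move=> H; move: H; clear; set i := _^-1; lra.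
case: N => [|M]; first by rewrite big_ord0 addr_ge0// invr_ge0 ltW.
apply: le_trans (key M) _; rewrite lerD2l ler_piMr ?invr_ge0 1?ltW//.
Qed.

(** The index [N0] depends on the majorant y alone: by Cauchy-Schwarz on the tails of y, convergence
    is uniform in x and over all coefficient sequences in a ball of l^2. *)
Lemma series_unif (b : nat -> R -> R) (y : nat -> R) (S : R) :
 (forall n x, `|b n x| <= y n) -> (forall N, sqsum y N <= S) ->
 forall e : R, 0 < e -> exists N0 : nat, forall (d : nat -> R) (L : R), 0 <= L -> (forall N, sqsum d N <= L ^+ 2) ->
  forall N, (N0 <= N)%N -> forall x,
  `|limn (fun N => \sum_(n < N) d n * b n x) - \sum_(n < N) d n * b n x| <= e * L.
Proof.
move=> by_ yS; have y0 n : 0 <= y n by apply: le_trans (normr_ge0 _) (by_ n 0).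
have key (e : R) : 0 < e -> exists N0 : nat, forall (d : nat -> R) (L : R), 0 <= L -> (forall N, sqsum d N <= L ^+ 2) ->
  forall N M, (N0 <= N)%N -> (N <= M)%N -> forall x,
  `|\sum_(n < M) d n * b n x - \sum_(n < N) d n * b n x| <= e * L.
 move=> e0; have [N0 N0P] := sqsum_tail yS (exprn_gt0 2 e0).
 exists N0 => d L L0 dL N M NN NM x.
 rewrite -!(big_mkord xpredT (fun n => d n * b n x)) (@big_cat_nat _ _ _ N 0 M)//= addrAC subrr add0r.
 pose c n := if (N <= n)%N then y n else 0.
 have cE : sqsum c M <= e ^+ 2.
  apply: le_trans (N0P N M NN NM); rewrite /sqsum.
  rewrite -!(big_mkord xpredT (fun n => y n ^+ 2)) -(big_mkord xpredT (fun n => c n ^+ 2)).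
  rewrite !(@big_cat_nat _ _ _ N 0 M)//= addrAC subrr add0r.
  rewrite [X in X + _]big_nat [X in X + _]big1 ?add0r; last first.
   by move=> i /andP[_ iN]; rewrite /c leqNgt iN expr0n.
  by rewrite !big_nat; apply: ler_sum => i /andP[Ni _]; rewrite /c Ni.
 have dd : sqsum (fun n => `|d n|) M <= L ^+ 2.
  by apply: le_trans (dL M); apply: ler_sum => i _; rewrite real_normK ?num_real.
 have := sum_CS (ltW e0) L0 cE dd; apply: le_trans.
 apply: le_trans (ler_norm_sum _ _ _) _.
 rewrite ger0_norm; last by apply: sumr_ge0 => i _; rewrite mulr_ge0// /c; case: ifP.
 rewrite -(big_mkord xpredT (fun n => c n * `|d n|)) (@big_cat_nat _ _ _ N 0 M)//=.
 rewrite [X in _ <= X + _]big_nat [X in _ <= X + _]big1 ?add0r; last first.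
  by move=> i /andP[_ iN]; rewrite /c leqNgt iN mul0r.
 rewrite !big_nat; apply: ler_sum => i /andP[Ni _]; rewrite /c Ni normrM mulrC.
 by rewrite ler_wpM2r.
move=> e e0; have [N0 N0P] := key e e0; exists N0 => d L L0 dL N NN x.
have cv : cvgn (fun N => \sum_(n < N) d n * b n x).
 apply/cauchy_cvgP/cauchyP => k k0.
 have [N1 N1P] := key (k / (L + 1) / 2) ltac:(by rewrite !divr_gt0//; lra).
 exists (\sum_(n < N1) d n * b n x); exists N1 => // M NM; rewrite /ball /= distrC.
 apply: le_lt_trans (N1P d L L0 dL N1 M (leqnn _) NM x) _.
 have q0 : 0 < k / (L + 1) by rewrite divr_gt0//; lra.
 have : k / (L + 1) * (L + 1) = k by rewrite divfK//; lra.
 by rewrite mulrDr mulr1; move: q0; set q := k / _; clear -k0; lra.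
rewrite ler_norml; apply/andP; split.
- rewrite lerBrDr addrC; apply: limr_ge => //; exists N => // M NM.
 by have := N0P d L L0 dL N M NN NM x; rewrite ler_norml; lra.
- rewrite lerBlDr; apply: limr_le => //; exists N => // M NM.
 by have := N0P d L L0 dL N M NN NM x; rewrite ler_norml; lra.
Qed.

End generalities.

(** * The domains of the powers of G in Fourier coordinates *)

Section coordinates.
Context {R : realType} (a : R).
Hypothesis a_gt0 : 0 < a.
Implicit Types (b g : R) (c : nat -> R) (n N : nat) (L e x : R).
Local Notation lam := (lam a).

Lemma lam_ge n : a <= lam n.
Proof. by rewrite lerDl sqr_ge0. Qed.

Lemma lam_gt0 n : 0 < lam n.
Proof. exact: lt_le_trans a_gt0 (lam_ge n). Qed.

Lemma lam_freq n : (uphalf n)%:R <= lam n `^ (1 / 2).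
Proof.
have -> : (uphalf n)%:R = ((uphalf n)%:R ^+ 2) `^ (1 / 2) :> R.
 by rewrite -powR_mulrn ?ler0n// -powRrM mulrCA divff// mulr1 powRr1 ?ler0n.
apply: (@ge0_ler_powR _ (1 / 2) ltac:(lra)); rewrite ?nnegrE ?sqr_ge0 ?(ltW (lam_gt0 _))//.
by rewrite lerDr ltW.
Qed.

Lemma lam_lb : exists2 k, 0 < k & forall n, k * n.+1%:R ^+ 2 <= lam n.
Proof.
(* From uphalf n >= n / 2 one gets lam n >= m (1 + n^2) with m = min(a, 1/4), and (n + 1)^2 <= 2 (1
   + n^2). *)
pose k := Num.min a (1 / 4) / 2; have k0 : 0 < Num.min a (1 / 4) by rewrite lt_min a_gt0; lra.
have ka : Num.min a (1 / 4) <= a by rewrite ge_min lexx.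
have k4 : Num.min a (1 / 4) <= 1 / 4 by rewrite ge_min lexx orbT.
exists k => [|n]; first by rewrite /k; lra.
rewrite /lam /k -[n.+1%:R]natr1; set m := Num.min _ _ in k0 ka k4 *.
have h : n%:R <= 2 * (uphalf n)%:R :> R by rewrite -natrM ler_nat; clear; lia.
have n0 : 0 <= n%:R :> R by exact: ler0n.
apply: le_trans (_ : a + (n%:R / 2) ^+ 2 <= _); last first.
 by rewrite lerD2l lerXn2r ?nnegrE; lra.
apply: le_trans (_ : m + m * n%:R ^+ 2 <= _).
 have := sqr_ge0 (n%:R - 1 : R); rewrite !expr2 => H.
 have := mulr_ge0 (ltW k0) H; clear; lra.
have := mulr_ge0 (sqr_ge0 (n%:R : R)) (_ : 0 <= 1 / 4 - m); rewrite subr_ge0 => /(_ k4).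
by move: ka; rewrite !expr2; clear; lra.
Qed.

(** Since lam n grows like n^2, the squares decay like n^(-4 g) with 4 g > 1. This is the origin of
    the threshold 1/4 for values and, as a derivative costs 1/2, of 3/4 for derivatives. *)
Lemma lam_summable g : 1 / 4 < g -> exists2 B, 0 <= B & forall N, sqsum (fun n => 2 * lam n `^ (- g)) N <= B ^+ 2.
Proof.
move=> g4; have [k k0 kP] := lam_lb.
pose p := 4 * g; have p1 : 1 < p by rewrite /p; lra.
have t n : (2 * lam n `^ (- g)) ^+ 2 <= 4 * k `^ (- (2 * g)) * n.+1%:R `^ (- p).
 rewrite exprMn -mulrA (_ : 2 ^+ 2 = 4); last by ring.
 rewrite ler_pM2l//.
 have -> : (lam n `^ (- g)) ^+ 2 = lam n `^ (- (2 * g)).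
  by rewrite -powR_mulrn ?powR_ge0// -powRrM; congr (_ `^ _); ring.
 have -> : k `^ (- (2 * g)) * n.+1%:R `^ (- p) = (k * n.+1%:R ^+ 2) `^ (- (2 * g)).
  rewrite powRM ?sqr_ge0 ?(ltW k0)//; congr (_ * _).
  by rewrite -powR_mulrn ?ler0n// -powRrM /p; congr (_ `^ _); ring.
 rewrite !powRN lef_pV2 ?posrE ?powR_gt0 ?lam_gt0 ?mulr_gt0 ?exprn_gt0 ?ltr0n//.
 by apply: ge0_ler_powR; rewrite ?nnegrE ?(ltW (lam_gt0 _)) ?mulr_ge0 ?sqr_ge0 ?(ltW k0)//; lra.
pose S := 4 * k `^ (- (2 * g)) * (1 + (p - 1)^-1).
have S0 : 0 <= S.
 by rewrite /S mulr_ge0 ?mulr_ge0 ?powR_ge0// addr_ge0// invr_ge0; lra.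
exists (Num.sqrt S) => [|N]; first exact: sqrtr_ge0.
rewrite sqr_sqrtr//; apply: le_trans (_ : \sum_(n < N) 4 * k `^ (- (2 * g)) * n.+1%:R `^ (- p) <= _).
 by apply: ler_sum => i _; exact: t.
rewrite -mulr_sumr; apply: ler_wpM2l; first by rewrite mulr_ge0 ?powR_ge0.
exact: zeta_bound.
Qed.

(** The bound |G^b u| <= L for the function with coefficients c, stated on partial sums so that no
    infinite series has to be formed. *)
Definition hbd b c L := 0 <= L /\ forall N, sqsum (fun n => lam n `^ b * c n) N <= L ^+ 2.

Lemma hbd_mono b b' c L : b' <= b -> hbd b c L -> hbd b' c (a `^ (b' - b) * L).
Proof.
move=> bb [L0 H]; split=> [|N]; first by rewrite mulr_ge0 ?powR_ge0.
rewrite exprMn; apply: le_trans (ler_wpM2l (sqr_ge0 _) (H N)).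
rewrite /sqsum mulr_sumr; apply: ler_sum => i _.
have -> : lam i `^ b' = lam i `^ (b' - b) * lam i `^ b.
 by rewrite -powRD ?subrK// (gt_eqF (lam_gt0 i)) implybT.
rewrite -mulrA exprMn; apply: ler_wpM2r; first exact: sqr_ge0.
rewrite lerXn2r ?nnegrE ?powR_ge0//.
have -> : b' - b = - (b - b') by ring.
rewrite !powRN lef_pV2 ?posrE ?powR_gt0 ?lam_gt0//.
by apply: ge0_ler_powR; rewrite ?nnegrE ?subr_ge0 ?(ltW (lam_gt0 _)) ?(ltW a_gt0) ?lam_ge.
Qed.

Lemma hbd_le b c L L' : L <= L' -> hbd b c L -> hbd b c L'.
Proof.
move=> LL [L0 H]; split=> [|N]; first exact: le_trans LL.
by apply: le_trans (H N) _; rewrite lerXn2r ?nnegrE// (le_trans L0).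
Qed.

Lemma hbdZ b c L k : hbd b c L -> hbd b (fun n => k * c n) (`|k| * L).
Proof.
move=> [L0 H]; split=> [|N]; first by rewrite mulr_ge0.
rewrite exprMn real_normK ?num_real//; apply: le_trans (ler_wpM2l (sqr_ge0 _) (H N)).
by rewrite /sqsum mulr_sumr; apply: ler_sum => i _; rewrite mulrCA exprMn.
Qed.

Lemma sqsumD c d N A B : 0 <= A -> 0 <= B -> sqsum c N <= A ^+ 2 -> sqsum d N <= B ^+ 2 ->
 sqsum (fun n => c n + d n) N <= (A + B) ^+ 2.
Proof.
move=> A0 B0 cA dB; have := sum_CS A0 B0 cA dB; rewrite ler_norml => /andP[_ cd].
have -> : sqsum (fun n => c n + d n) N = sqsum c N + 2 * (\sum_(n < N) c n * d n) + sqsum d N.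
 rewrite /sqsum mulr_sumr -!big_split/=; apply: eq_bigr => i _; ring.
by rewrite sqrrD -mulr_natl; move: cA dB cd; clear; lra.
Qed.

Lemma hbdD b c d A B : hbd b c A -> hbd b d B -> hbd b (fun n => c n + d n) (A + B).
Proof.
move=> [A0 cA] [B0 dB]; split=> [|N]; first exact: addr_ge0.
apply: le_trans (sqsumD A0 B0 (cA N) (dB N)).
by apply: ler_sum => i _; rewrite mulrDr.
Qed.

Definition fser c x : R := limn (fun N => psum c N x).
Definition dpsum c N x : R := \sum_(n < N) c n * dbas n x.
Definition dfser c x : R := limn (fun N => dpsum c N x).

Lemma dpsum_derive c N x : is_derive x 1 (psum c N) (dpsum c N x).
Proof. by apply: dsum => i; exact/dcM/bas_derive. Qed.

Lemma dpsum_cts c N : continuous (dpsum c N).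
Proof.
apply: continuous_big => [x|i _]; first exact: add_continuous.
by apply: ctsZ; exact: dbas_cts.
Qed.

(** Sobolev embedding for a system [bs] growing like lam^(b - g): after division by lam^b it is
    majorized by 2 lam^(-g), which is square summable. It serves for the basis, with b = g, and for
    its derivatives, with g = b - 1/2. *)
Lemma gen_unif (bs : nat -> R -> R) g b : (forall n x, `|bs n x| <= 2 * lam n `^ (b - g)) -> 1 / 4 < g ->
 forall e, 0 < e -> exists N0, forall c L, hbd b c L -> forall N, (N0 <= N)%N -> forall x,
 `|limn (fun N => \sum_(n < N) c n * bs n x) - \sum_(n < N) c n * bs n x| <= e * L.
Proof.
move=> bsP g4 e e0; have [B B0 BP] := lam_summable g4.
have [|N0 N0P] := @series_unif _ (fun n x => lam n `^ (- b) * bs n x) _ _ _ BP _ e0.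
 move=> n x; rewrite normrM ger0_norm ?powR_ge0//.
 apply: le_trans (ler_wpM2l (powR_ge0 _ _) (bsP n x)) _; rewrite mulrCA -powRD ?(gt_eqF (lam_gt0 n)) ?implybT//.
 by rewrite addrA addNr add0r.
exists N0 => c L [L0 cL] N NN x.
have E M : \sum_(n < M) c n * bs n x = \sum_(n < M) (lam n `^ b * c n) * (lam n `^ (- b) * bs n x).
 apply: eq_bigr => i _; rewrite mulrCA !mulrA -powRD ?(gt_eqF (lam_gt0 _)) ?implybT// addNr.
 by rewrite powRr0 mul1r.
rewrite E; have -> : (fun N => \sum_(n < N) c n * bs n x) = (fun N => \sum_(n < N) (lam n `^ b * c n) * (lam n `^ (- b) * bs n x)).
 by apply: funext => M; exact: E.
exact: (N0P (fun n => lam n `^ b * c n) L L0 cL N NN x).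
Qed.

Lemma gen_bound (bs : nat -> R -> R) g b : (forall n x, `|bs n x| <= 2 * lam n `^ (b - g)) -> 1 / 4 < g ->
 exists2 C, 0 < C & forall c L, hbd b c L -> forall x, `|limn (fun N => \sum_(n < N) c n * bs n x)| <= C * L.
Proof.
move=> bsP g4; have [B B0 BP] := lam_summable g4.
have [N0 N0P] := gen_unif bsP g4 ltr01.
exists (B + 1) => [|c L [L0 cL] x]; first by lra.
have := N0P c L (conj L0 cL) N0 (leqnn _) x; rewrite mul1r.
have : `|\sum_(n < N0) c n * bs n x| <= B * L.
 have -> : \sum_(n < N0) c n * bs n x = \sum_(n < N0) (lam n `^ (- b) * bs n x) * (lam n `^ b * c n).
  apply: eq_bigr => i _; rewrite mulrACA -powRD ?(gt_eqF (lam_gt0 _)) ?implybT// addNr.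
  by rewrite powRr0 mul1r mulrC.
 apply: (@sum_CS _ N0 (fun n => lam n `^ (- b) * bs n x) (fun n => lam n `^ b * c n)) => //.
 apply: le_trans (BP N0); apply: ler_sum => i _.
 rewrite -[X in X <= _]real_normK ?num_real// lerXn2r ?nnegrE ?mulr_ge0 ?powR_ge0//.
 rewrite normrM ger0_norm ?powR_ge0//; apply: le_trans (ler_wpM2l (powR_ge0 _ _) (bsP i x)) _.
 by rewrite mulrCA -powRD ?(gt_eqF (lam_gt0 _)) ?implybT// addrA addNr add0r.
by set X := limn _; set Y := \sum_(_ < _) _; rewrite !ler_norml; lra.
Qed.

Lemma bas_lam g n x : `|bas n x| <= 2 * lam n `^ (g - g).
Proof. by rewrite subrr powRr0 mulr1 bas_le. Qed.

Lemma dbas_lam b n x : `|dbas n x| <= 2 * lam n `^ (b - (b - 1 / 2)).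
Proof. by apply: le_trans (dbas_le n x) _; rewrite ler_pM2l// opprB addrC subrK lam_freq. Qed.

Lemma fser_unif g : 1 / 4 < g -> forall e, 0 < e -> exists N0, forall c L, hbd g c L ->
 forall N, (N0 <= N)%N -> forall x, `|fser c x - psum c N x| <= e * L.
Proof. exact: (gen_unif (@bas_lam g)). Qed.

Lemma fser_bound g : 1 / 4 < g -> exists2 C, 0 < C & forall c L, hbd g c L -> forall x, `|fser c x| <= C * L.
Proof. exact: (gen_bound (@bas_lam g)). Qed.

Lemma dfser_unif b : 3 / 4 < b -> forall e, 0 < e -> exists N0, forall c L, hbd b c L ->
 forall N, (N0 <= N)%N -> forall x, `|dfser c x - dpsum c N x| <= e * L.
Proof. by move=> b4; apply: (gen_unif (@dbas_lam b)); lra. Qed.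

Lemma dfser_bound b : 3 / 4 < b -> exists2 C, 0 < C & forall c L, hbd b c L -> forall x, `|dfser c x| <= C * L.
Proof. by move=> b4; apply: (gen_bound (@dbas_lam b)); lra. Qed.

Lemma uniform_cts (P : nat -> R -> R) (F : R -> R) : (forall N, continuous (P N)) ->
 (forall e, 0 < e -> exists N0, forall N, (N0 <= N)%N -> forall x, `|F x - P N x| <= e) -> continuous F.
Proof.
move=> cP H x; apply/cvgrPdist_le => e e0.
have [N NP] := H (e / 3) (divr_gt0 e0 (ltr0n _ 3)).
have /cvgrPdist_le/(_ (e / 3) (divr_gt0 e0 (ltr0n _ 3))) := cP N x.
apply: filterS => y; have := NP N (leqnn _) x; have := NP N (leqnn _) y.
by rewrite !ler_norml; lra.
Qed.

Lemma scaled_unif (F : R -> R) (P : nat -> R -> R) L : 0 <= L ->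
 (forall e, 0 < e -> exists N0, forall N, (N0 <= N)%N -> forall x, `|F x - P N x| <= e * L) ->
 forall e, 0 < e -> exists N0, forall N, (N0 <= N)%N -> forall x, `|F x - P N x| <= e.
Proof.
move=> L0 H e e0; have L1 : 0 < L + 1 by lra.
have [N0 NP] := H (e / (L + 1)) (divr_gt0 e0 L1); exists N0 => N NN x.
apply: le_trans (NP N NN x) _; rewrite mulrAC ler_pdivrMr// ler_pM2l//; lra.
Qed.

Section one_series.
Variables (g : R) (c : nat -> R) (L : R).
Hypotheses (g4 : 1 / 4 < g) (cL : hbd g c L).

Lemma fser_lim : forall e, 0 < e -> exists N0, forall N, (N0 <= N)%N -> forall x, `|fser c x - psum c N x| <= e.
Proof.
apply: (scaled_unif cL.1) => e e0; have [N0 NP] := fser_unif g4 e0.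
by exists N0 => N NN x; exact: NP.
Qed.

Lemma fser_cts : continuous (fser c).
Proof. exact: (@uniform_cts (psum c) (fser c) (fun N => @psum_cts _ c N) fser_lim). Qed.

Lemma fser_period x : fser c (x + 2 * pi) = fser c x.
Proof.
rewrite /fser; have -> // : (fun N => psum c N (x + 2 * pi)) = (fun N => psum c N x).
apply: funext => N; by apply: eq_bigr => i _; rewrite bas_period.
Qed.

Lemma fser_coef n : coef (fser c) n = c n.
Proof.
apply/eqP; rewrite -subr_eq0 -sqrf_eq0 eq_le sqr_ge0 andbT leNgt; apply/negP => e0.
have p0 := @pi_gt0 R.
have [e [e_0 e1 e2]] := below2 (ltr01 : 0 < 1 :> R) (divr_gt0 e0 (ltac:(lra) : 0 < 2 * pi)).
have [N0 NP] := fser_lim e_0; pose N := maxn N0 n.+1.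
have NPN := NP N (leq_maxl _ _).
have fL := cts_L2 fser_cts; have sL := psum_L2 c N.
pose w x := fser c x + -1 * psum c N x.
have cw : continuous w by apply: ctsD fser_cts _; apply: ctsZ; exact: psum_cts.
have cd : coef w n = coef (fser c) n - c n.
 rewrite /coef L2dotDl ?L2Z ?bas_L2// L2dotZl ?bas_L2// -[L2dot (psum _ _) _]/(coef _ _) psum_coef.
 by rewrite leq_maxr mulN1r.
have := L2_CS (cts_L2 cw) (@bas_L2 R n); rewrite -[L2dot _ _ ^+ 2]/(coef _ _ ^+ 2) cd bas_orth eqxx mulr1.
have : L2dot w w <= circ (fun _ => e ^+ 2).
 apply: le_Rintegral => //.
 - exact: (cts_int (ctsM cw cw)).
 - by apply: cts_int; exact: ctsC.
 - move=> x _ /=; rewrite -expr2 -[X in X <= _]real_normK ?num_real// lerXn2r ?nnegrE ?(ltW e_0)//.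
  by rewrite /w mulN1r.
rewrite circ_cst; move: e2; rewrite ltr_pdivlMr; last by lra.
move=> H1 H2 H3; have : 2 * pi * e ^+ 2 <= 2 * pi * e.
 by apply: ler_wpM2l; [lra | rewrite expr2 ler_piMr// ltW].
by move: H1 H2 H3; clear; set X := _ ^+ 2; set Y := L2dot _ _; set Z := _ * e ^+ 2; lra.
Qed.

End one_series.

Section smooth_series.
Variables (b : R) (c : nat -> R) (L : R).
Hypotheses (b4 : 3 / 4 < b) (cL : hbd b c L).

Lemma dfser_lim : forall e, 0 < e -> exists N0, forall N, (N0 <= N)%N -> forall x, `|dfser c x - dpsum c N x| <= e.
Proof.
apply: (scaled_unif cL.1) => e e0; have [N0 NP] := dfser_unif b4 e0.
by exists N0 => N NN x; exact: NP.
Qed.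

Lemma dfser_cts : continuous (dfser c).
Proof. exact: (@uniform_cts (dpsum c) (dfser c) (fun N => @dpsum_cts c N) dfser_lim). Qed.

Lemma fser_derive x : is_derive x 1 (fser c) (dfser c x).
Proof.
have b4' : 1 / 4 < b by apply: lt_trans b4; lra.
apply: (uniform_derive (dpsum_derive c)) dfser_cts x; last exact: dfser_lim.
exact: (fser_lim b4' cL).
Qed.

End smooth_series.

Lemma fser_uniq g (u : R -> R) L : 1 / 4 < g -> continuous u -> (forall x, u (x + 2 * pi) = u x) ->
 hbd g (coef u) L -> forall x, u x = fser (coef u) x.
Proof.
move=> g4 cu pu uL x.
have cf := fser_cts g4 uL.
have cw : continuous (fun x => u x + -1 * fser (coef u) x).
 by apply: ctsD cu _; apply: ctsM => //; exact: ctsC.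
suff : u x + -1 * fser (coef u) x = 0 by rewrite mulN1r; lra.
apply: (fejer cw).
 by move=> y; rewrite pu fser_period.
move=> n; rewrite /coef L2dotDl ?L2Z ?bas_L2 ?cts_L2// L2dotZl ?bas_L2 ?cts_L2//.
by rewrite -[L2dot (fser _) _]/(coef _ _) (fser_coef g4 uL) mulN1r subrr.
Qed.

End coordinates.

(** * Parseval identities *)

Section completeness.
Context {R : realType}.
Implicit Types (u w phi : R -> R) (N : nat).

Lemma psum_coef_defect w N : w \in L2 ->
 L2dot (fun x => w x - psum (coef w) N x) (fun x => w x - psum (coef w) N x) = L2dot w w - sqsum (coef w) N.
Proof.
move=> wL; rewrite psum_defect//; under eq_bigr do rewrite -expr2.
by rewrite /sqsum; lra.
Qed.

(** Completeness of the basis is a property to be checked for each w: it is proved for uniformly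
    convergent series and for the functions produced by [riesz_fischer]. *)
Definition psum_complete w := forall e, 0 < e -> exists N0, forall N, (N0 <= N)%N ->
 L2dot (fun x => w x - psum (coef w) N x) (fun x => w x - psum (coef w) N x) <= e.

Lemma complete_dot w phi : w \in L2 -> phi \in L2 -> psum_complete w -> forall e, 0 < e ->
 exists N0, forall N, (N0 <= N)%N -> `|L2dot w phi - \sum_(n < N) coef w n * coef phi n| <= e.
Proof.
move=> wL pL wc e e0; have P0 := L2dot_ge0 phi.
have P1 : 0 < L2dot phi phi + 1 by apply: ltr_wpDl.
have [N0 NP] := wc (e ^+ 2 / (L2dot phi phi + 1)) (divr_gt0 (exprn_gt0 2 e0) P1).
exists N0 => N NN; have {}NP := NP N NN.
have sL := psum_L2 (coef w) N; have s'L := L2Z (-1) sL; have wsL := L2D wL s'L.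
have E : (fun x => w x - psum (coef w) N x) = (fun x => w x + -1 * psum (coef w) N x).
 by apply: funext => x; rewrite mulN1r.
rewrite E in NP; have := L2_CS wsL pL.
rewrite (L2dotDl wL s'L pL) L2dotZl// psum_dot// mulN1r => H.
rewrite -[X in _ <= X]gtr0_norm// -ler_sqr ?nnegrE// real_normK ?num_real// [X in _ <= X]real_normK ?num_real//.
apply: le_trans H _; apply: le_trans (ler_wpM2r P0 NP) _.
by rewrite mulrAC ler_pdivrMr// ler_wpM2l ?sqr_ge0// lerDl.
Qed.

Lemma unif_complete u : continuous u ->
 (forall e, 0 < e -> exists N0, forall N, (N0 <= N)%N -> forall x, `|u x - psum (coef u) N x| <= e) ->
 psum_complete u.
Proof.
move=> cu H e e0; have p0 := @pi_gt0 R.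
have [k [k0 k1 k2]] := below2 (ltr01 : 0 < 1 :> R) (divr_gt0 e0 (ltac:(lra) : 0 < 2 * pi)).
have [N0 NP] := H k k0; exists N0 => N NN; have {}NP := NP N NN.
have cw : continuous (fun x => u x - psum (coef u) N x) by apply: ctsB cu _; exact: psum_cts.
apply: le_trans (_ : circ (fun _ => k ^+ 2) <= _).
 apply: le_Rintegral => //.
 - exact: (cts_int (ctsM cw cw)).
 - by apply: cts_int; exact: ctsC.
 - by move=> x _ /=; rewrite -expr2 -[X in X <= _]real_normK ?num_real// lerXn2r ?nnegrE ?(ltW k0).
rewrite circ_cst; move: k2; rewrite ltr_pdivlMr; last by lra.
have : 2 * pi * k ^+ 2 <= 2 * pi * k.
 by apply: ler_wpM2l; [lra | rewrite expr2 ler_piMr// ltW].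
by clear; set Z := _ * k ^+ 2; lra.
Qed.

End completeness.

(** * Fourier description of the phase space *)

Section phase.
Context {R : realType} (a alpha : R).
Hypotheses (a_gt0 : 0 < a) (alpha_gt : 3 / 4 < alpha).
Local Notation X := (phase_space a alpha).
Implicit Types (u v : X) (x e L : R) (c : nat -> R) (n N : nat).
Local Notation lam := (lam a).
Local Notation hbd := (hbd a).

Let alpha4 : 1 / 4 < alpha. Proof. by apply: lt_trans alpha_gt; lra. Qed.

(** [riesz_fischer] gives w with coefficients lam^alpha times those of u. Parseval for u and w
    reduces the pairing with an arbitrary eigenfunction phi to coefficients, and phi has nonzero
    coefficients at its own eigenvalue only. *)
Lemma power_of_hbd (u : R -> R) L : continuous u -> (forall x, u (x + 2 * pi) = u x) ->
 hbd alpha (coef u) L -> exists2 w, opG_power a alpha u w & L2norm w <= L.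
Proof.
move=> cu pu uL; pose c n := lam n `^ alpha * coef u n.
have hs : has_sup (range (sqsum c)).
 by split; [exists (sqsum c 0), 0%N | exists (L ^+ 2) => _ [N _ <-]; exact: uL.2].
have cS N : sqsum c N <= sup (range (sqsum c)) by apply: ub_le_sup; [exact: hs.2 | exists N].
have [w [wL wc wS]] := riesz_fischer cS.
have wcomp : psum_complete w.
 move=> e e0; have [_ [N0 _ <-] N0P] := sup_adherent e0 hs.
 exists N0 => N NN; rewrite psum_coef_defect//.
 have -> : sqsum (coef w) N = sqsum c N by apply: eq_bigr => i _; rewrite wc.
 by have := sqsum_mono c NN; lra.
have uL2 := cts_L2 cu.
have ucomp : psum_complete u.
 apply: unif_complete => // e e0; have [N0 NP] := fser_lim a_gt0 alpha4 uL e0.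
 by exists N0 => N NN x; rewrite (fser_uniq a_gt0 alpha4 cu pu uL); exact: NP.
exists w; last first.
 rewrite L2normE// -[X in _ <= X]ger0_norm ?uL.1// -sqrtr_sqr ler_wsqrtr//.
 by apply: le_trans wS _; apply: sup_le_ub => [|_ [N _ <-]]; [exists (sqsum c 0), 0%N | exact: uL.2].
split=> // l phi pL Gp; apply/eqP; rewrite -subr_eq0 -normr_le0; apply/ler_addgt0Pr => e e0; rewrite add0r.
pose q := l `^ alpha; have q0 : 0 <= q by exact: powR_ge0.
have k0 : 0 < e / (1 + q) by rewrite divr_gt0//; lra.
have [N1 N1P] := complete_dot wL pL wcomp k0.
have [N2 N2P] := complete_dot uL2 pL ucomp k0.
have := N1P (maxn N1 N2) (leq_maxl _ _); have := N2P (maxn N1 N2) (leq_maxr _ _).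
set N := maxn _ _.
have -> : \sum_(n < N) coef w n * coef phi n = q * \sum_(n < N) coef u n * coef phi n.
 rewrite mulr_sumr; apply: eq_bigr => i _; rewrite wc /c mulrA.
 have [le|/eqP ne] := eqVneq l (lam i); first by rewrite /q le.
 by rewrite /(coef phi) L2dotC (eigen_orth_bas pL Gp ne) !mulr0.
set S := \sum_(_ < _) _; set A := L2dot u phi; set B := L2dot w phi; set k := e / _ => H1 H2.
have -> : B - q * A = (B - q * S) - q * (A - S) by ring.
apply: le_trans (ler_normB _ _) _; rewrite normrM (ger0_norm q0).
apply: le_trans (lerD H2 (ler_wpM2l q0 H1)) _.
have : k * (1 + q) = e by rewrite divfK//; lra.
by lra.
Qed.

Lemma Xcts u : continuous u.
Proof. by have := phase_funP u; rewrite inE => -[]. Qed.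

Lemma Xper u x : u (x + 2 * pi) = u x.
Proof. by have := phase_funP u; rewrite inE => -[_ + _]; apply. Qed.

Let vals u := [set L2norm w | w in [set w | opG_power a alpha u w]].

Let vals_inf u : has_inf (vals u).
Proof.
split; last by exists 0 => _ [w _ <-]; exact/fine_ge0/Lnorm_ge0.
have := phase_funP u; rewrite inE => -[_ _ [w uw]].
by exists (L2norm w); exists w.
Qed.

Lemma Xnorm_ge0 u : 0 <= Xnorm u.
Proof.
apply: lb_le_inf; first by case: (vals_inf u).
by move=> _ [w _ <-]; exact/fine_ge0/Lnorm_ge0.
Qed.

Lemma Xhbd u : hbd alpha (coef u) (Xnorm u).
Proof.
split=> [|N]; first exact: Xnorm_ge0.
rewrite -[X in X <= _]sqr_sqrtr; last by apply: sumr_ge0 => i _; exact: sqr_ge0.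
rewrite lerXn2r ?nnegrE ?sqrtr_ge0 ?Xnorm_ge0//.
apply: lb_le_inf; first by case: (vals_inf u).
move=> _ [w [uL wL uw] <-]; rewrite L2normE// ler_wsqrtr//.
apply: le_trans (bessel N wL); apply: ler_sum => i _.
by rewrite {2}/coef (uw _ _ (bas_L2 i) (opG_bas a i)).
Qed.

(** Together with [Xhbd] this identifies the norm, defined as an infimum, with the least L such that
    [hbd alpha (coef u) L]; later norm estimates go through these two facts. *)
Lemma Xnorm_le u L : hbd alpha (coef u) L -> Xnorm u <= L.
Proof.
move=> uL; have [w uw wL] := power_of_hbd (@Xcts u) (Xper u) uL.
by apply: le_trans wL; apply: ge_inf; [case: (vals_inf u) | exists w].
Qed.

Lemma X_of c L : hbd alpha c L -> exists u : X, forall n, coef u n = c n.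
Proof.
move=> cL; have cc := fser_coef a_gt0 alpha4 cL.
have cf := fser_cts a_gt0 alpha4 cL.
have H : fser c \in phase_pred a alpha.
 rewrite inE; split=> //; first exact: fser_period.
 have [|w uw _] := @power_of_hbd (fser c) L cf (fser_period c); last by exists w.
 by rewrite (_ : coef (fser c) = c)//; apply: funext.
by exists (PhaseSpace H).
Qed.

Lemma X_eq u v : (forall x, u x = v x) -> u = v.
Proof. by move=> uv; apply: val_inj; apply: funext. Qed.

Lemma XE u x : u x = fser (coef u) x.
Proof. exact: (fser_uniq a_gt0 alpha4 (@Xcts u) (Xper u) (Xhbd u)). Qed.

Lemma XD u v x : (u + v) x = u x + v x. Proof. by []. Qed.
Lemma XB u v x : (u - v) x = u x - v x. Proof. by []. Qed.
Lemma XZ k u x : (k *: u) x = k * u x. Proof. by []. Qed.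

Lemma coefD u v n : coef (u + v) n = coef u n + coef v n.
Proof. by rewrite /coef -L2dotDl ?bas_L2 ?cts_L2//; exact: Xcts. Qed.

Lemma coefZ k u n : coef (k *: u) n = k * coef u n.
Proof. by rewrite /coef -L2dotZl ?bas_L2 ?cts_L2//; exact: Xcts. Qed.

Lemma coefB u v n : coef (u - v) n = coef u n - coef v n.
Proof. by rewrite coefD -scaleN1r coefZ mulN1r. Qed.

Lemma XnormZ k u : Xnorm (k *: u) <= `|k| * Xnorm u.
Proof.
apply: Xnorm_le; have := hbdZ k (Xhbd u).
by congr (hbd _ _ _); apply: funext => n; rewrite coefZ.
Qed.

Lemma Xnorm_eq0 u : Xnorm u = 0 -> u = 0.
Proof.
move=> u0; have [C C0 CP] := fser_bound a_gt0 alpha4; apply: X_eq => x.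
apply/eqP; rewrite -normr_le0 XE; apply: le_trans (CP _ _ (Xhbd u) x) _.
by rewrite u0 mulr0.
Qed.

Lemma Xball_ u v e : ball u e v = (Xnorm (u - v) < e) :> Prop.
Proof. by []. Qed.

Definition dX u x : R := dfser (coef u) x.

Lemma X_derive u x : is_derive x 1 u (dX u x).
Proof.
rewrite (_ : phase_fun u = fser (coef u)); last by apply: funext => y; exact: XE.
exact: (fser_derive a_gt0 alpha_gt (Xhbd u)).
Qed.

Lemma dX_cts u : continuous (dX u).
Proof. exact: (dfser_cts a_gt0 alpha_gt (Xhbd u)). Qed.

Lemma dX_uniq u x d : is_derive x 1 u d -> dX u x = d.
Proof. by move=> [_ <-]; have [_ <-] := X_derive u x. Qed.

Lemma dX_per u x : dX u (x + 2 * pi) = dX u x.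
Proof.
apply/esym/dX_uniq; have := dshift (X_derive u (x + 2 * pi)).
by rewrite (_ : (fun y => u (y + 2 * pi)) = u)//; apply: funext => y; rewrite Xper.
Qed.

Lemma dXB u v x : dX (u - v) x = dX u x - dX v x.
Proof. by apply: dX_uniq; exact: (dB (X_derive u x) (X_derive v x)). Qed.

Lemma dXD u v x : dX (u + v) x = dX u x + dX v x.
Proof. by apply: dX_uniq; exact: (dD (X_derive u x) (X_derive v x)). Qed.

Lemma dXZ k u x : dX (k *: u) x = k * dX u x.
Proof. by apply: dX_uniq; exact: (dcM k (X_derive u x)). Qed.

Lemma X_C1 : exists2 C, 0 < C & forall u x, `|u x| <= C * Xnorm u /\ `|dX u x| <= C * Xnorm u.
Proof.
have [C1 C10 C1P] := fser_bound a_gt0 alpha4; have [C2 C20 C2P] := dfser_bound a_gt0 alpha_gt.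
exists (C1 + C2) => [|u x]; first exact: addr_gt0.
have u0 := Xnorm_ge0 u; rewrite !mulrDl; split.
- rewrite XE; apply: le_trans (C1P _ _ (Xhbd u) x) _; rewrite lerDl mulr_ge0// ltW//.
- apply: le_trans (C2P _ _ (Xhbd u) x) _; rewrite lerDr mulr_ge0// ltW//.
Qed.

Lemma tp_in_X k A B : exists u : X, forall x, u x = tp k A B x.
Proof.
have H : tp k A B \in phase_pred a alpha.
 rewrite inE; split; [exact: tp_cts | exact: tp_period |].
 exists (fun x => (a + k%:R ^+ 2) `^ alpha * tp k A B x); split; [exact: tp_L2 | exact/L2Z/tp_L2 |].
 move=> l phi pL Gp; rewrite L2dotZl ?tp_L2//.
 have [->//|/eqP ne] := eqVneq l (a + k%:R ^+ 2).
 by rewrite L2dotC (eigen_orth A B pL Gp ne) !mulr0.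
by exists (PhaseSpace H).
Qed.

End phase.

(** * Heat semigroup estimates and variation of constants *)

Section duhamel.
Context {R : realType} (a : R).
Hypothesis a_gt0 : 0 < a.
Ltac lraA := rel_lra a.
Implicit Types (b x t L M : R) (c : nat -> R) (n N : nat).
Local Notation lam := (lam a).
Local Notation hbd := (hbd a).

Lemma powR_le_exp x b : 0 <= x -> 0 <= b <= 1 -> x `^ b <= expR x.
Proof.
move=> x0 b01; have e1 := expR_ge1Dx x.
have [x1|x1] := lerP x 1.
 apply: le_trans (_ : 1 <= _); last by lra.
 have -> : 1 = 1 `^ b :> R by rewrite powR1.
 by apply: ge0_ler_powR; rewrite ?nnegrE//; lra.
apply: le_trans (_ : x <= _); last by lra.
by rewrite -[X in _ <= X]powRr1//; apply: ler_powR; lra.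
Qed.

(** Equivalent to (l t)^b <= exp(l t), which holds for exponents in [0, 1]. *)
Lemma exp_smooth b l t : 0 <= b <= 1 -> 0 < l -> 0 < t -> l `^ b * expR (- (l * t)) <= t `^ (- b).
Proof.
move=> b01 l0 t0; have lt0 : 0 <= l * t by rewrite mulr_ge0 ?ltW.
have -> : l `^ b = (l * t) `^ b * t `^ (- b).
 by rewrite powRM ?ltW// -mulrA -powRD ?(gt_eqF t0) ?implybT// subrr powRr0 mulr1.
rewrite mulrAC -[X in _ <= X]mul1r; apply: ler_wpM2r; first exact: powR_ge0.
by rewrite expRN ler_pdivrMr ?expR_gt0// mul1r powR_le_exp.
Qed.

Lemma exp_cont b x : 0 <= b <= 1 -> 0 < x -> 1 - expR (- x) <= x `^ b.
Proof.
move=> b01 x0; have e0 := expR_gt0 (- x); have e1 := expR_ge1Dx (- x).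
have [x1|x1] := lerP x 1.
 apply: le_trans (_ : x <= _); first by lra.
 by apply: ger1_powR; lra.
apply: le_trans (_ : 1 <= _); first by lra.
by rewrite -[X in X <= _](powRr0 x); apply: ler_powR; lra.
Qed.

Lemma hbd_mul b b' c L (w : nat -> R) q : 0 <= q -> (forall n, `|lam n `^ b' * w n| <= q * lam n `^ b) ->
 hbd b c L -> hbd b' (fun n => w n * c n) (q * L).
Proof.
move=> q0 wP [L0 cL]; split=> [|N]; first exact: mulr_ge0.
rewrite exprMn; apply: le_trans (ler_wpM2l (sqr_ge0 _) (cL N)).
rewrite /sqsum mulr_sumr; apply: ler_sum => i _.
rewrite -[X in X <= _]real_normK ?num_real// -[X in _ <= X]exprMn.
rewrite -[X in _ <= X]real_normK ?num_real// lerXn2r ?nnegrE// mulrA mulrA !normrM.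
apply: ler_wpM2r => //; rewrite (ger0_norm q0) (ger0_norm (powR_ge0 _ b)).
by rewrite -normrM.
Qed.

Lemma semi_smooth b b' c L t : b' <= b <= b' + 1 -> 0 < t -> hbd b' c L ->
 hbd b (fun n => expR (- (lam n * t)) * c n) (t `^ (- (b - b')) * L).
Proof.
move=> bb t0; apply: hbd_mul; first exact: powR_ge0.
move=> n; have l0 := lam_gt0 a_gt0 n.
rewrite ger0_norm ?mulr_ge0 ?powR_ge0 ?expR_ge0//.
have -> : lam n `^ b = lam n `^ (b - b') * lam n `^ b' by rewrite -powRD ?subrK// (gt_eqF l0) implybT.
by rewrite mulrAC; apply: ler_wpM2r; [exact: powR_ge0 | apply: exp_smooth => //; lra].
Qed.

Lemma semi_cont b b' c L t : b' <= b <= b' + 1 -> 0 < t -> hbd b c L ->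
 hbd b' (fun n => (expR (- (lam n * t)) - 1) * c n) (t `^ (b - b') * L).
Proof.
move=> bb t0; apply: hbd_mul; first exact: powR_ge0.
move=> n; have l0 := lam_gt0 a_gt0 n.
rewrite normrM ger0_norm ?powR_ge0// distrC ger0_norm; last first.
 by rewrite subr_ge0 -[X in _ <= X]expR0 ler_expR oppr_le0 mulr_ge0 ?ltW.
have -> : lam n `^ b = lam n `^ (b - b') * lam n `^ b' by rewrite -powRD ?subrK// (gt_eqF l0) implybT.
rewrite mulrC mulrA; apply: ler_wpM2r; first exact: powR_ge0.
rewrite -powRM ?(ltW l0) ?(ltW t0)// [t * _]mulrC.
by apply: exp_cont; [lra | rewrite mulr_gt0].
Qed.

Lemma hbd_closed b c L : (forall e, 0 < e -> hbd b c (L + e)) -> hbd b c L.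
Proof.
move=> H; have L0 : 0 <= L by apply/ler_addgt0Pr => e /H[].
split=> // N; apply/ler_addgt0Pr => e e0.
have [k [k0 k1 k2]] := below2 (ltr01 : 0 < 1 :> R) (divr_gt0 e0 (ltac:(lra) : 0 < 2 * L + 1)).
have [_ /(_ N)] := H k k0; move: k2; rewrite ltr_pdivlMr; last by lra.
set S := sqsum _ _; rewrite sqrrD => A B; apply: le_trans B _; rewrite -addrA lerD2l -mulr_natl.
by have : k ^+ 2 <= k by [rewrite expr2 ler_piMr// ltW]; move: A; clear; set X := k ^+ 2; lra.
Qed.

(** In the application the derivative of the majorant may blow up at the ends, so increments are
    controlled strictly inside the interval only. *)
Lemma cts_endpoints (h : R -> R) (S T B : R) : S < T -> continuous h ->
 (forall s t : R, S < s -> s < t -> t < T -> h t - h s <= B) -> h T - h S <= B.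
Proof.
move=> ST ch H; apply/ler_addgt0Pr => e e0.
have e2 : 0 < e / 2 by lra.
have /cvgrPdist_lt/(_ _ e2)/nbhs_ballP[r r0 rP] := ch S.
have /cvgrPdist_lt/(_ _ e2)/nbhs_ballP[q q0 qP] := ch T.
have [k [k0 k1 k2]] := below2 r0 (ltac:(lra) : 0 < (T - S) / 2).
have [j [j0 j1 j2]] := below2 q0 (ltac:(lra) : 0 < (T - S) / 2).
have /rP : ball S r (S + k) by rewrite /ball /= ltr_norml; lra.
have /qP : ball T q (T - j) by rewrite /ball /= ltr_norml; lra.
have := H (S + k) (T - j) ltac:(lra) ltac:(lra) ltac:(lra).
by rewrite /= !ltr_norml; lra.
Qed.

(** The equation z' + G z = g read on each Fourier coefficient: continuity on the whole line, the
    differential equation inside the interval. *)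
Definition coef_ode (S T : R) (z g : R -> nat -> R) :=
 (forall n, continuous (fun t : R => z t n)) /\
 forall n (t : R), S < t < T -> is_derive t 1 (fun t => z t n) (- lam n * z t n + g t n).

(** Duality replaces vector-valued integration. With y the truncated and weighted left-hand side and
    A its norm, the scalar function h pairing y with the evolved state increases by A^2, while h' <=
    A k because lam^b exp(- lam (T - s)) <= (T - s)^(-b). Comparison with the primitive K gives A^2
    <= A B. *)
Lemma duhamel b (S T B : R) (z g : R -> nat -> R) (m K k : R -> R) :
 0 <= b <= 1 -> S < T -> coef_ode S T z g -> 0 <= B ->
 (forall t, S < t < T -> 0 <= m t /\ forall N, sqsum (g t) N <= m t ^+ 2) ->
 (forall t, S < t < T -> is_derive t 1 K (k t)) ->
 (forall t, S < t < T -> (T - t) `^ (- b) * m t <= k t) ->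
 (forall s t : R, S < s -> s < t -> t < T -> K t - K s <= B) ->
 hbd b (fun n => z T n - expR (- (lam n * (T - S))) * z S n) B.
Proof.
move=> b01 ST [cz dz] B0 mP dK kP KB; split=> // N.
pose y n := lam n `^ b * (z T n - expR (- (lam n * (T - S))) * z S n).
pose A := Num.sqrt (sqsum y N).
have A0 : 0 <= A by exact: sqrtr_ge0.
have AE : A ^+ 2 = sqsum y N by rewrite sqr_sqrtr//; apply: sumr_ge0 => i _; exact: sqr_ge0.
pose w n s := lam n `^ b * expR (- (lam n * (T - s))).
pose h s := \sum_(n < N) y n * (w n s * z s n).
have dw n (s : R) : is_derive s 1 (w n) (lam n * w n s).
 apply: deq (dcM (lam n `^ b) (dexp (dN (dcM (lam n) (dB (dcst T s) (did s)))))) _.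
 by rewrite /w; ring.
have cw n : continuous (w n) by move=> s; exact: is_derive_cont (dw n s).
have dh s : S < s < T -> is_derive s 1 h (\sum_(n < N) y n * (w n s * g s n)).
 move=> sI; apply: dsum => i; apply: deq (dcM (y i) (dM (dw i s) (dz i s sI))) _.
 by congr (_ * _); ring.
have ch : continuous h.
 apply: continuous_big => [x|i _]; first exact: add_continuous.
 by apply: ctsZ; exact: ctsM.
have hd s : S < s < T -> \sum_(n < N) y n * (w n s * g s n) <= A * k s.
 move=> sI; have [m0 gP] := mP s sI.
 have Ts : 0 < T - s by lra.
 have q0 : 0 <= (T - s) `^ (- b) * m s by rewrite mulr_ge0 ?powR_ge0.
 apply: le_trans (ler_norm _) _; apply: le_trans (_ : A * ((T - s) `^ (- b) * m s) <= _); last first.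
  by rewrite ler_wpM2l ?kP.
 apply: (@sum_CS _ N y (fun n => w n s * g s n)) => //; first by rewrite AE.
 rewrite exprMn; apply: le_trans (ler_wpM2l (sqr_ge0 _) (gP N)).
 rewrite /sqsum mulr_sumr; apply: ler_sum => i _; rewrite exprMn.
 apply: ler_wpM2r; first exact: sqr_ge0.
 by rewrite lerXn2r ?nnegrE ?mulr_ge0 ?powR_ge0 ?expR_ge0// exp_smooth// (lam_gt0 a_gt0).
have : h T - h S <= A * B.
 apply: cts_endpoints => // s t Ss st tT.
 have [x xI|x xI e] := @mvt R (fun x => h x - A * K x) (fun x => \sum_(n < N) y n * (w n x * g x n) - A * k x) _ _ st.
  by apply: dB; [apply: dh | apply/dcM/dK]; lra.
 have H1 := hd x ltac:(lra); have H2 := ler_wpM2l A0 (KB s t Ss st tT).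
 have : (\sum_(n < N) y n * (w n x * g x n) - A * k x) * (t - s) <= 0.
  by rewrite mulr_le0_ge0 ?subr_le0// subr_ge0 ltW.
 rewrite -e; move: H2; rewrite mulrBr; clear; set a1 := A * K t; set a2 := A * K s; set a3 := A * B; lra.
have -> : h T - h S = A ^+ 2.
 rewrite AE /h -sumrB; apply: eq_bigr => i _; rewrite /w subrr mulr0 oppr0 expR0 mulr1 expr2 -mulrBr.
 by congr (_ * _); rewrite /y; ring.
rewrite -[sqsum _ _]/(sqsum y N) -AE => H.
rewrite lerXn2r ?nnegrE//; have [->//|An] := eqVneq A 0.
by move: H; rewrite expr2 ler_pM2l// lt_def An.
Qed.

Lemma powR_int_derive (q x : R) : 0 < x -> q != 0 -> is_derive x 1 (fun x => q^-1 * x `^ q) (x `^ (q - 1)).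
Proof.
move=> x0 q0; apply: deq (dcM q^-1 (is_derive1_powR q x0)) _.
by rewrite mulKf.
Qed.

Lemma powR_back_derive (q T x : R) : x < T -> q != 0 ->
 is_derive x 1 (fun x => - (q^-1 * (T - x) `^ q)) ((T - x) `^ (q - 1)).
Proof.
move=> xT q0; have xT' : 0 < T - x by rewrite subr_gt0.
apply: deq (dN (@dcomp _ (fun x => q^-1 * x `^ q) (fun x => T - x) x _ _ (powR_int_derive xT' q0) (dB (dcst T x) (did x)))) _.
by ring.
Qed.

Lemma powR_mono (q x y : R) : 0 <= q -> 0 <= x -> x <= y -> x `^ q <= y `^ q.
Proof. by move=> q0 x0 xy; apply: ge0_ler_powR => //; rewrite nnegrE// (le_trans x0). Qed.

Lemma duhamel_const b (S T M : R) (z g : R -> nat -> R) :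
 0 <= b < 1 -> S < T -> coef_ode S T z g -> 0 <= M ->
 (forall t N, S < t < T -> sqsum (g t) N <= M ^+ 2) ->
 hbd b (fun n => z T n - expR (- (lam n * (T - S))) * z S n) (M * (T - S) `^ (1 - b) / (1 - b)).
Proof.
move=> b01 ST ode M0 gP; have q0 : 1 - b != 0 by lra.
have qp : 0 < 1 - b by lra.
have B0 : 0 <= M * (T - S) `^ (1 - b) / (1 - b) by rewrite divr_ge0 ?mulr_ge0 ?powR_ge0// ltW.
have b01' : 0 <= b <= 1 by lra.
apply: (@duhamel b S T _ z g (fun _ => M) (fun s => M * - ((1 - b)^-1 * (T - s) `^ (1 - b)))
 (fun s => M * (T - s) `^ (1 - b - 1)) b01' ST ode B0).
- by move=> t tI; split=> // N; exact: gP.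
- by move=> t tI; apply: dcM; apply: powR_back_derive => //; lra.
- by move=> t tI; rewrite mulrC; have -> : 1 - b - 1 = - b by ring.
- move=> s t Ss st tT; rewrite -mulrBr -mulrA; apply: ler_wpM2l => //.
 have : (T - s) `^ (1 - b) <= (T - S) `^ (1 - b) by apply: powR_mono; lra.
 have : 0 <= (T - t) `^ (1 - b) by exact: powR_ge0.
 move=> H1 H2; rewrite opprK addrC -mulrBr mulrC; apply: ler_wpM2r; first by rewrite invr_ge0 ltW.
 by lra.
Qed.

(** A bound t^(-alpha) m on z improves to t^(-alpha) (D' + m / 2) by [duhamel] on a short interval.
    Iteration forgets the a priori bound [m0], whose role is to start it, so the constant does not
    depend on [m0]. *)
Lemma smoothing alpha (A : R) : 0 < alpha < 1 -> 0 <= A -> exists tau C, [/\ 0 < tau < 1, 0 < C &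
 forall (z g : R -> nat -> R) (D S m0 : R), coef_ode 0 1 z g -> 0 <= S -> hbd 0 (z 0) D ->
 (forall t, 0 < t < 1 -> hbd alpha (z t) m0) ->
 (forall t m, 0 < t < 1 -> hbd alpha (z t) m -> forall N, sqsum (g t) N <= (A * m + S) ^+ 2) ->
 hbd alpha (z tau) (C * (D + S))].
Proof.
move=> al A0; pose q := 1 - alpha; have q0 : 0 < q by rewrite /q; lraA.
(* With tau^q <= r one has 4 A tau^q / q <= 1/2, the contraction factor of the iteration. *)
pose r := q / (8 * A + 8); have A8 : 0 < 8 * A + 8 by lraA.
have r0 : 0 < r by rewrite divr_gt0.
pose tau := Num.min (1 / 2) (r `^ q^-1).
have tau0 : 0 < tau by rewrite lt_min powR_gt0// andbT; lraA.
have tau1 : tau <= 1 / 2 by rewrite ge_min lexx.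
have taur : tau `^ q <= r.
 have -> : r = (r `^ q^-1) `^ q by rewrite -powRrM mulVf ?gt_eqF// powRr1 ?ltW.
 by apply: powR_mono; [exact: ltW | exact: ltW | rewrite ge_min lexx orbT].
exists tau, (tau `^ (- alpha) * (2 * (1 + q^-1))); split=> [|//|].
- by lraA.
- by rewrite mulr_gt0 ?powR_gt0// mulr_gt0// addr_gt0// invr_gt0.
move=> z g D S m0 ode S0 zD zm gP.
have D0 : 0 <= D by exact: zD.1.
pose D' := D + S / q.
have D'0 : 0 <= D' by rewrite addr_ge0// divr_ge0// ltW.
pose P m := 0 <= m /\ forall t, 0 < t <= tau -> hbd alpha (z t) (t `^ (- alpha) * m).
have step m : P m -> P (D' + m / 2).
 move=> [m_0 Pm]; split=> [|t tI]; first by lraA.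
 have t0 : 0 < t by lraA. have t1 : t < 1 by lraA.
 have t20 : 0 < t / 2 by lraA.
 pose ct := (t / 2) `^ (- alpha).
 have ct0 : 0 <= ct by exact: powR_ge0.
 pose w := t `^ q.
 have w0 : 0 <= w by exact: powR_ge0.
 pose B := A * m * ct * (q^-1 * (2 * w)) + S * (q^-1 * w).
 have Am0 : 0 <= A * m * ct by rewrite !mulr_ge0.
 have qi0 : 0 <= q^-1 by rewrite invr_ge0 ltW.
 have qm : q - 1 = - alpha by rewrite /q; ring.
 have H : hbd alpha (fun n => z t n - expR (- (lam n * (t - 0))) * z 0 n) B.
  have al' : 0 <= alpha <= 1 by lraA.
  have ode' : coef_ode 0 t z g by split; [exact: ode.1 | move=> n s sI; apply: ode.2; lraA].
  have B0 : 0 <= B by rewrite addr_ge0 ?mulr_ge0.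
  apply: (@duhamel alpha 0 t B z g (fun s => A * (s `^ (- alpha) * m) + S)
   (fun s => A * m * ct * (q^-1 * s `^ q + - (q^-1 * (t - s) `^ q)) + S * - (q^-1 * (t - s) `^ q))
   (fun s => A * m * ct * (s `^ (q - 1) + (t - s) `^ (q - 1)) + S * (t - s) `^ (q - 1)) al' t0 ode' B0).
  - move=> s sI; split=> [|N]; first by rewrite addr_ge0// !mulr_ge0 ?powR_ge0.
   by apply: gP; [lraA | apply: Pm; lraA].
  - move=> s sI; apply: dD; last by apply/dcM/powR_back_derive; rewrite ?gt_eqF//; lraA.
   apply: dcM; apply: dD; first by apply: powR_int_derive; rewrite ?gt_eqF//; lraA.
   by apply: powR_back_derive; rewrite ?gt_eqF//; lraA.
  - move=> s sI; rewrite qm.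
   have s_0 : 0 < s by lraA. have ts0 : 0 < t - s by lraA.
   (* One of s and t - s is at least t / 2, so the product of the two singularities is at most (t /
      2)^(-alpha) times their sum, which is integrable. *)
   have : (t - s) `^ (- alpha) * s `^ (- alpha) <= ct * (s `^ (- alpha) + (t - s) `^ (- alpha)).
    have anti x : t / 2 <= x -> x `^ (- alpha) <= ct.
     move=> tx; rewrite /ct !powRN lef_pV2 ?posrE ?powR_gt0//; last by lraA.
     by apply: powR_mono; lraA.
    have p1 := powR_ge0 s (- alpha); have p2 := powR_ge0 (t - s) (- alpha).
    have [ss|ss] := lerP (t / 2) s.
     by move: (ler_wpM2r p2 (anti s ss)) (mulr_ge0 ct0 p1); clear; lra.
    have ss' : t / 2 <= t - s by lraA.
    by move: (ler_wpM2r p1 (anti (t - s) ss')) (mulr_ge0 ct0 p2); clear; lra.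
   move=> H; have := ler_wpM2l (mulr_ge0 A0 m_0) H.
   set X := _ `^ (- alpha); set Y := s `^ (- alpha) => H1.
   have -> : X * (A * (Y * m) + S) = A * m * (X * Y) + S * X by ring.
   by move: H1; rewrite !mulrA; lraA.
  - move=> s t' s_0 st t't.
   have H1 : t' `^ q <= w by apply: powR_mono; lraA.
   have H2 : (t - s) `^ q <= w by apply: powR_mono; lraA.
   have p1 := powR_ge0 s q; have p2 := powR_ge0 (t - t') q.
   have K1 : A * m * ct * (q^-1 * (t' `^ q - s `^ q + (t - s) `^ q - (t - t') `^ q)) <= A * m * ct * (q^-1 * (2 * w)).
    by do 2 apply: ler_wpM2l => //; move: H1 H2 p1 p2; clear; lra.
   have K2 : S * (q^-1 * ((t - s) `^ q - (t - t') `^ q)) <= S * (q^-1 * w).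
    by do 2 apply: ler_wpM2l => //; move: H2 p2; clear; lra.
   by move: K1 K2; rewrite /B; clear; lra.
 have H0 : hbd alpha (fun n => expR (- (lam n * (t - 0))) * z 0 n) (t `^ (- alpha) * D).
  rewrite -[X in _ `^ (- X)]subr0 subr0; have := @semi_smooth alpha 0 (z 0) D t _ t0 zD.
  by rewrite !subr0; apply; lraA.
 have := hbdD H H0; rewrite (_ : (fun n => _ + _) = z t); last by apply: funext => n; rewrite subrK.
 apply: hbd_le.
 have tw : w = t `^ (- alpha) * t.
  by rewrite /w -[X in _ = _ * X]powRr1 ?ltW// -powRD ?(gt_eqF t0) ?implybT// /q addrC.
 have tal : 0 <= t `^ (- alpha) by exact: powR_ge0.
 have cte : ct <= 2 * t `^ (- alpha).
  rewrite /ct powRM ?(ltW t0)//.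
  rewrite [X in X <= _]mulrC ler_pM2r ?powR_gt0//.
  rewrite -powR_inv1// -powRrM mulN1r opprK -[X in _ <= X]powRr1//.
  by apply: ler_powR; lraA.
 have wr : w <= r by apply: le_trans taur; apply: powR_mono; lraA.
 have Aw : A * (q^-1 * (4 * w)) <= 1 / 2.
  apply: le_trans (_ : A * (q^-1 * (4 * r)) <= _).
   by do 2 apply: ler_wpM2l => //; rewrite ler_pM2l.
  rewrite /r; have -> : A * (q^-1 * (4 * (q / (8 * A + 8)))) = (4 * A) / (8 * A + 8) by field; lraA.
  by rewrite ler_pdivrMr//; lraA.
 have B1 : B <= t `^ (- alpha) * (m / 2 + S / q).
  rewrite mulrDr /B; apply: lerD.
   apply: le_trans (_ : A * m * (2 * t `^ (- alpha)) * (q^-1 * (2 * w)) <= _).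
    apply: ler_wpM2r; first by rewrite !mulr_ge0.
    by apply: ler_wpM2l => //; rewrite mulr_ge0.
   have := ler_wpM2l (mulr_ge0 tal m_0) Aw.
   by set X := t `^ _; set Y := q^-1; clear; nra.
  rewrite tw (_ : S * (q^-1 * (t `^ (- alpha) * t)) = t `^ (- alpha) * (S / q) * t); last by ring.
  by rewrite ler_piMr ?mulr_ge0 ?divr_ge0// ltW.
 apply: le_trans (lerD B1 (lexx _)) _; rewrite -mulrDr; apply: ler_wpM2l => //.
 by rewrite /D'; lraA.
have P0 : P (2 * D' + m0).
 have m00 : 0 <= m0 by have [] := zm (1 / 2) ltac:(lraA).
 split=> [|t tI]; first by lraA.
 apply: hbd_le (zm t ltac:(lraA)).
 have : 1 <= t `^ (- alpha).
  rewrite powRN invf_ge1 ?powR_gt0//; last by lraA.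
  have <- : 1 `^ alpha = 1 :> R by rewrite powR1.
  by apply: powR_mono; lraA.
 move=> H; have := ler_wpM2r (ltac:(lraA) : 0 <= 2 * D' + m0) H; rewrite mul1r; lraA.
have Pk k : P (2 * D' + m0 / 2 ^+ k).
 elim: k => [|k IH]; first by rewrite expr0 divr1.
 have := step _ IH; congr P; rewrite exprS invfM; lraA.
have tt : 0 < tau <= tau by rewrite tau0 lexx.
have := hbd_closed (b := alpha) (c := z tau) (L := tau `^ (- alpha) * (2 * D')).
move=> /(_ _)/hbd_le; apply.
 rewrite -mulrA; apply: ler_wpM2l; first exact: powR_ge0.
 rewrite -mulrA ler_pM2l// /D' mulrDl mul1r mulrDr [q^-1 * S]mulrC.
 by have := mulr_ge0 (ltW (_ : 0 < q^-1)) D0; rewrite invr_gt0 => /(_ q0); lraA.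
move=> e e0; have tp : 0 < tau `^ (- alpha) by exact: powR_gt0.
(* Enough iterations make the remaining trace m0 / 2^k of the a priori bound smaller than e. *)
have [k ke] : exists k, tau `^ (- alpha) * (m0 / 2 ^+ k) <= e.
 have m00 : 0 <= m0 by have [] := zm (1 / 2) ltac:(lraA).
 exists (Num.truncn (tau `^ (- alpha) * m0 / e)).+1; set k := _.+1.
 have := truncnS_gt (tau `^ (- alpha) * m0 / e); rewrite -/k ltr_pdivrMr// => H.
 rewrite mulrA ler_pdivrMr ?exprn_gt0//; apply: ltW; apply: lt_le_trans H _.
 rewrite mulrC ler_pM2l// -natrX ler_nat; exact/ltnW/ltn_expl.
by have [_ /(_ tau tt)] := Pk k; apply: hbd_le; rewrite mulrDr; lraA.
Qed.

End duhamel.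

(** * Local bounds for the nonlinearity *)

Section nonlinearity.
Context {R : realType}.
Implicit Types (h : R * R * R -> R) (x y p q r : R).

Lemma directional h (v P : R * R * R) (g : R -> R) t : derivable h P v ->
 (forall s, g (s + t) = h (s *: v + P)) -> is_derive t 1 g ('D_v h P).
Proof.
move=> dh gh; have E : (fun s => s^-1 *: ((g \o shift t) (s *: 1) - g t)) = (fun s => s^-1 *: ((h \o shift P) (s *: v) - h P)).
 apply: funext => s; rewrite /= gh; have := gh 0; rewrite add0r scale0r add0r => ->.
 by rewrite /GRing.scale /= mulr1.
apply: DeriveDef; first by rewrite /derivable E.
by rewrite /derive E.
Qed.

Definition C1_partials h (hu hp : R * R * R -> R) := [/\ continuous hu, continuous hp,
 forall x y p, is_derive y 1 (fun y => h (x, y, p)) (hu (x, y, p)) &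
 forall x y p, is_derive p 1 (fun p => h (x, y, p)) (hp (x, y, p))].

Lemma class_C_partials k h : class_C k.+1 h -> exists hu hp, [/\ C1_partials h hu hp, class_C k hu & class_C k hp].
Proof.
move=> [ch dh]; have [d1 c1] := dh (0, 1, 0); have [d2 c2] := dh (0, 0, 1).
have cc g : class_C k g -> continuous g by case: k {dh c1 c2} => [|k] //= -[].
exists (fun P => 'D_(0, 1, 0) h P), (fun P => 'D_(0, 0, 1) h P); (split; [split | exact: c1 | exact: c2]).
- exact: cc.
- exact: cc.
- move=> x y p; apply: directional => // s; congr h.
 by rewrite -[RHS]/(s * 0 + x, s * 1 + y, s * 0 + p) !mulr0 mulr1 !add0r.
- move=> x y p; apply: directional => // s; congr h.
 by rewrite -[RHS]/(s * 0 + x, s * 0 + y, s * 1 + p) !mulr0 mulr1 !add0r.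
Qed.

Definition inbox r x y p := [/\ 0 <= x <= 2 * pi, `|y| <= r & `|p| <= r].

Lemma box_bound h r : continuous h -> 0 <= r -> exists2 M, 0 <= M & forall x y p, inbox r x y p -> `|h (x, y, p)| <= M.
Proof.
move=> ch r0; pose K := (`[0, 2 * pi]%classic `*` `[- r, r]%classic `*` `[- r, r]%classic) : set (R * R * R).
have cK : compact K by apply: compact_setX; [apply: compact_setX|]; exact: segment_compact.
have p0 := @pi_gt0 R.
have K0 : K !=set0 by exists (0, 0, 0); split => [|]; [split|]; rewrite /= in_itv/=; lra.
have [P _ PM] := compact_EVT_max K0 cK (continuous_subspaceT (cts_abs ch)).
exists `|h P| => // x y p [xI yr pr]; apply: PM; rewrite inE.
by split; [split|]; rewrite /= in_itv/= -?ler_norml.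
Qed.

Lemma mvt_le (g dg : R -> R) (M x y : R) : (forall z : R, is_derive z 1 g (dg z)) ->
 (forall z, (x <= z <= y) || (y <= z <= x) -> `|dg z| <= M) -> `|g x - g y| <= M * `|x - y|.
Proof.
move=> dgP gM; have key u v : u < v -> (forall z, u <= z <= v -> `|dg z| <= M) -> `|g v - g u| <= M * (v - u).
 move=> uv H; have [z zI ->] := mvt uv (fun z _ => dgP z).
 by rewrite normrM [`|v - u|]gtr0_norm ?subr_gt0//; apply: ler_wpM2r; [lra | apply: H; lra].
have [xy|xy|->] := ltrgtP x y.
- by rewrite distrC; apply: key => // z zI; apply: gM; rewrite zI.
- by apply: key => // z zI; apply: gM; rewrite zI orbT.
- by rewrite !subrr normr0 mulr0.
Qed.

Lemma mvt_ex (g dg : R -> R) (x y : R) : (forall z : R, is_derive z 1 g (dg z)) ->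
 exists2 z, (x <= z <= y) || (y <= z <= x) & g y - g x = dg z * (y - x).
Proof.
move=> dgP; have [xy|xy|->] := ltrgtP x y.
- by have [z zI e] := mvt xy (fun z _ => dgP z); exists z => //; apply/orP; left; lra.
- by have [z zI e] := mvt xy (fun z _ => dgP z); exists z; [apply/orP; right; lra | lra].
- by exists y; rewrite ?lexx// !subrr mulr0.
Qed.

Lemma between_bound r x y z : (x <= z <= y) || (y <= z <= x) -> `|x| <= r -> `|y| <= r -> `|z| <= r.
Proof. by rewrite !ler_norml => /orP[]; lra. Qed.

Lemma lip_box h hu hp r : C1_partials h hu hp -> 0 <= r -> exists2 L, 0 <= L & forall x y y' p p',
 inbox r x y p -> inbox r x y' p' -> `|h (x, y, p) - h (x, y', p')| <= L * (`|y - y'| + `|p - p'|).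
Proof.
move=> [cu cp du dp] r0.
have [M1 M10 M1P] := box_bound cu r0; have [M2 M20 M2P] := box_bound cp r0.
exists (M1 + M2) => [|x y y' p p' [xI yr pr] [_ y'r p'r]]; first by rewrite addr_ge0.
have H1 : `|h (x, y, p) - h (x, y', p)| <= M1 * `|y - y'|.
 apply: (mvt_le (fun z => du x z p)) => z zI; apply: M1P; split=> //; exact: (between_bound zI).
have H2 : `|h (x, y', p) - h (x, y', p')| <= M2 * `|p - p'|.
 apply: (mvt_le (fun z => dp x y' z)) => z zI; apply: M2P; split=> //; exact: (between_bound zI).
have -> : h (x, y, p) - h (x, y', p') = (h (x, y, p) - h (x, y', p)) + (h (x, y', p) - h (x, y', p')) by ring.
apply: le_trans (ler_normD _ _) _; apply: le_trans (lerD H1 H2) _.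
rewrite mulrDl !mulrDr; have := mulr_ge0 M10 (normr_ge0 (p - p')); have := mulr_ge0 M20 (normr_ge0 (y - y')); lra.
Qed.

(** Mean value theorem in each variable over both steps: the second increments multiply first
    derivatives, and the change of these derivatives from one step to the next is Lipschitz, which
    produces the squares of first increments. *)
Lemma second_diff h r : class_C 2 h -> 0 <= r -> exists2 L, 0 <= L & forall x y0 y1 y2 p0 p1 p2,
 inbox r x y0 p0 -> inbox r x y1 p1 -> inbox r x y2 p2 ->
 `|h (x, y2, p2) - 2 * h (x, y1, p1) + h (x, y0, p0)| <=
 L * (`|y2 - 2 * y1 + y0| + `|p2 - 2 * p1 + p0|) + L * (`|y2 - y1| + `|y1 - y0| + `|p2 - p1| + `|p1 - p0|) ^+ 2.
Proof.
move=> /class_C_partials[hu [hp [[cu cp du dp] /class_C_partials[huu [hup [hu1 _ _]]] /class_C_partials[hpu [hpp [hp1 _ _]]]]]] r0.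
have [M1 M10 M1P] := box_bound cu r0; have [M2 M20 M2P] := box_bound cp r0.
have [L1 L10 L1P] := lip_box hu1 r0; have [L2 L20 L2P] := lip_box hp1 r0.
exists (M1 + M2 + 2 * L1 + 2 * L2) => [|x y0 y1 y2 p0 p1 p2 [xI y0r p0r] [_ y1r p1r] [_ y2r p2r]].
 by rewrite !addr_ge0 ?mulr_ge0.
have [a1 a1I e1] := mvt_ex y1 y2 (fun z => du x z p2).
have [b1 b1I f1] := mvt_ex p1 p2 (fun z => dp x y1 z).
have [a0 a0I e0] := mvt_ex y0 y1 (fun z => du x z p1).
have [b0 b0I f0] := mvt_ex p0 p1 (fun z => dp x y0 z).
have a1r := between_bound a1I y1r y2r; have a0r := between_bound a0I y0r y1r.
have b1r := between_bound b1I p1r p2r; have b0r := between_bound b0I p0r p1r.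
pose D := `|y2 - y1| + `|y1 - y0| + `|p2 - p1| + `|p1 - p0|.
have -> : h (x, y2, p2) - 2 * h (x, y1, p1) + h (x, y0, p0) =
  hu (x, a1, p2) * (y2 - 2 * y1 + y0) + hp (x, y1, b1) * (p2 - 2 * p1 + p0) +
  ((hu (x, a1, p2) - hu (x, a0, p1)) * (y1 - y0) + (hp (x, y1, b1) - hp (x, y0, b0)) * (p1 - p0)).
 transitivity ((h (x, y2, p2) - h (x, y1, p2)) + (h (x, y1, p2) - h (x, y1, p1))
  - ((h (x, y1, p1) - h (x, y0, p1)) + (h (x, y0, p1) - h (x, y0, p0)))); first by ring.
 by rewrite e1 f1 e0 f0; ring.
have d0 := normr_ge0 (y2 - y1); have d1 := normr_ge0 (y1 - y0); have d2 := normr_ge0 (p2 - p1); have d3 := normr_ge0 (p1 - p0).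
have A1 : `|a1 - a0| <= D.
 have := ler_norm (y2 - y1); have := ler_norm (y1 - y2); have := ler_norm (y1 - y0); have := ler_norm (y0 - y1).
 rewrite [`|y1 - y2|]distrC [`|y0 - y1|]distrC ler_norml /D.
 by move: d0 d1 d2 d3; case/orP: a1I; case/orP: a0I; clear; lra.
have B1 : `|b1 - b0| <= D.
 have := ler_norm (p2 - p1); have := ler_norm (p1 - p2); have := ler_norm (p1 - p0); have := ler_norm (p0 - p1).
 rewrite [`|p1 - p2|]distrC [`|p0 - p1|]distrC ler_norml /D.
 by move: d0 d1 d2 d3; case/orP: b1I; case/orP: b0I; clear; lra.
have D0 : 0 <= D by rewrite !addr_ge0.
have [Dy Dp Dq] : [/\ `|y1 - y0| <= D, `|p1 - p0| <= D & `|p2 - p1| <= D] by rewrite /D; split; clear -d0 d1 d2 d3; lra.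
have T1 : `|hu (x, a1, p2) * (y2 - 2 * y1 + y0)| <= M1 * `|y2 - 2 * y1 + y0|.
 by rewrite normrM; apply: ler_wpM2r => //; exact: M1P.
have T2 : `|hp (x, y1, b1) * (p2 - 2 * p1 + p0)| <= M2 * `|p2 - 2 * p1 + p0|.
 by rewrite normrM; apply: ler_wpM2r => //; exact: M2P.
have T3 : `|(hu (x, a1, p2) - hu (x, a0, p1)) * (y1 - y0)| <= L1 * (D + D) * D.
 rewrite normrM; apply: ler_pM => //; apply: le_trans (L1P x a1 a0 p2 p1 _ _) _ => //.
 by apply: ler_wpM2l => //; exact: lerD.
have T4 : `|(hp (x, y1, b1) - hp (x, y0, b0)) * (p1 - p0)| <= L2 * (D + D) * D.
 rewrite normrM; apply: ler_pM => //; apply: le_trans (L2P x y1 y0 b1 b0 _ _) _ => //.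
 by apply: ler_wpM2l => //; exact: lerD.
apply: le_trans (ler_normD _ _) _; apply: le_trans (lerD (ler_normD _ _) (ler_normD _ _)) _.
apply: le_trans (lerD (lerD T1 T2) (lerD T3 T4)) _.
set P := `|y2 - 2 * y1 + y0|; set Q := `|p2 - 2 * p1 + p0|; rewrite -/D.
have [P0 Q0] : 0 <= P /\ 0 <= Q by split; exact: normr_ge0.
have N1 := mulr_ge0 M10 Q0; have N2 := mulr_ge0 M20 P0.
have N3 := mulr_ge0 (addr_ge0 L10 L20) (addr_ge0 P0 Q0).
have N4 := mulr_ge0 (addr_ge0 M10 M20) (sqr_ge0 D).
by move: N1 N2 N3 N4; rewrite !expr2; clear; lra.
Qed.

End nonlinearity.

(** * Compact embeddings and separation *)

Section compactness.
Context {R : realType} (a alpha : R).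
Hypotheses (a_gt0 : 0 < a) (alpha_gt : 3 / 4 < alpha).
Local Notation X := (phase_space a alpha).
Implicit Types (u v : X) (e L : R) (c : nat -> R) (n N : nat).
Local Notation lam := (lam a).
Local Notation hbd := (hbd a).

(** The limit is the supremum of those y for which y <= g holds on a member of the ultrafilter. *)
Lemma ultra_real (T : Type) (F : set_system T) (g : T -> R) (M : R) : UltraFilter F ->
 F [set v | `|g v| <= M] -> exists c : R, forall e : R, 0 < e -> F [set v | `|g v - c| < e].
Proof.
move=> FU FM; pose S := [set y | F [set v | y <= g v]].
have ne (A : set T) : F A -> A !=set0 by move=> FA; apply: (@filter_ex _ F).
have hs : has_sup S.
 split; first by exists (- M); apply: filterS FM => v /=; rewrite ler_norml => /andP[].
 by exists M => y Sy; have [v [/= vM yv]] := ne _ (filterI FM Sy); move: vM; rewrite ler_norml; lra.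
exists (sup S) => e e0.
have [y Sy ye] := sup_adherent e0 hs.
have [|nS] := in_ultra_setVsetC [set v | sup S + e / 2 <= g v] FU.
 by move=> H; have := ub_le_sup hs.2 H; lra.
apply: filterS (filterI Sy nS) => v /= [yv /negP]; rewrite -ltNge ltr_norml; lra.
Qed.

Lemma lam_mono n N : (n <= N)%N -> lam n <= lam N.
Proof.
move=> nN; rewrite lerD2l lerXn2r ?nnegrE ?ler0n// ler_nat; lia.
Qed.

Lemma sqsum_support c N M : (forall n, (N <= n)%N -> c n = 0) -> sqsum c M <= sqsum c N.
Proof.
move=> c0; have [/sqsum_mono->//|/ltnW NM] := leqP M N.
rewrite /sqsum -!(big_mkord xpredT (fun n => c n ^+ 2)) (@big_cat_nat _ _ _ N 0 M)//=.
rewrite [X in _ + X]big_nat [X in _ + X]big1 ?addr0// => i /andP[iN _]; by rewrite c0// expr0n.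
Qed.

(** From index N on lam^alpha is at most q lam^b, so the b-bound makes the high modes small;
    finitely many low modes remain, controlled one by one. *)
Lemma tail_small b L : alpha < b -> 0 <= L -> forall e, 0 < e -> exists N, exists2 d, 0 < d &
 forall c, hbd b c L -> (forall n, (n < N)%N -> `|c n| <= d) -> hbd alpha c e.
Proof.
move=> ab L0 e e0; have [k k0 kP] := lam_lb a_gt0.
have g0 : 0 < b - alpha by lra.
pose q := e / 2 / (L + 1); have q0 : 0 < q by rewrite !divr_gt0//; lra.
pose Q := q^-1 `^ (b - alpha)^-1.
pose N := Num.truncn (Q / k).
have QN : Q <= lam N.
 apply: le_trans (kP N); have := truncnS_gt (Q / k); rewrite -/N ltr_pdivrMr// => /ltW H.
 apply: le_trans H _; rewrite mulrC ler_pM2l// expr2 ler_peMr ?ler0n// ler1n.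
 by [].
have tl n : (N <= n)%N -> lam n `^ alpha <= q * lam n `^ b.
 move=> Nn; have ln := lam_gt0 a_gt0 n.
 have -> : lam n `^ b = lam n `^ (b - alpha) * lam n `^ alpha by rewrite -powRD ?subrK// (gt_eqF ln) implybT.
 rewrite mulrA ler_peMl ?powR_ge0// -ler_pdivrMl// mulr1.
 have -> : q^-1 = Q `^ (b - alpha) by rewrite /Q -powRrM mulVf ?gt_eqF// powRr1// invr_ge0 ltW.
 by apply: powR_mono; rewrite ?powR_ge0 ?(ltW g0)//; exact: le_trans QN (lam_mono Nn).
pose S := sqsum (fun n => lam n `^ alpha) N.
have S0 : 0 <= S by apply: sumr_ge0 => i _; exact: sqr_ge0.
pose d := e / 2 / (Num.sqrt S + 1).
have sS : 0 <= Num.sqrt S by exact: sqrtr_ge0.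
have d0 : 0 < d by rewrite !divr_gt0//; lra.
exists N, d => // c cb cd.
pose c1 n := if (n < N)%N then c n else 0; pose c2 n := if (n < N)%N then 0 else c n.
have -> : c = (fun n => c1 n + c2 n) by apply: funext => n; rewrite /c1 /c2; case: ifP; rewrite ?addr0 ?add0r.
rewrite (splitr e); apply: hbdD.
 split=> [|M]; first by lra.
 apply: le_trans (@sqsum_support _ N M _) _; first by move=> n Nn; rewrite /c1 ltnNge Nn mulr0.
 apply: le_trans (_ : d ^+ 2 * S <= _).
  rewrite /S /sqsum mulr_sumr; apply: ler_sum => i _; rewrite exprMn mulrC; apply: ler_wpM2r; first exact: sqr_ge0.
  by rewrite /c1 ltn_ord -[X in X <= _]real_normK ?num_real// lerXn2r ?nnegrE ?(ltW d0) ?cd.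
 have dS : d * Num.sqrt S <= e / 2.
  by rewrite /d mulrAC ler_pdivrMr; [apply: ler_wpM2l; lra | lra].
 by rewrite -[X in _ * X](sqr_sqrtr S0) -exprMn lerXn2r ?nnegrE ?mulr_ge0 ?(ltW d0)//; lra.
have := @hbd_mul _ a b alpha c L (fun n => if (n < N)%N then 0 else 1) q (ltW q0) _ cb.
rewrite (_ : (fun n => _ * c n) = c2); last by apply: funext => n; rewrite /c2; case: ifP; rewrite ?mul0r ?mul1r.
move=> H; apply: (hbd_le (L := q * L)); last apply: H.
 by rewrite /q mulrAC ler_pdivrMr; [apply: ler_wpM2l; lra | lra].
move=> n; case: ltnP => nN; first by rewrite mulr0 normr0 mulr_ge0 ?powR_ge0// ltW.
by rewrite mulr1 ger0_norm ?powR_ge0// tl.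
Qed.

(** Along an ultrafilter each coefficient converges and the limit sequence inherits the bound L;
    [tail_small] upgrades coefficientwise convergence to convergence in [X]. *)
Lemma hbd_compact b L : alpha < b -> 0 <= L -> compact [set u : X | hbd b (coef u) L].
Proof.
move=> ab L0; rewrite compact_ultra => F FU FB.
have cb n : exists c : R, forall e, 0 < e -> F [set u : X | `|coef u n - c| < e].
 apply: (@ultra_real _ _ (fun u : X => coef u n) (lam n `^ (- b) * L)) => //.
 apply: filterS FB => u [_ /(_ n.+1)] /=; rewrite /sqsum big_ord_recr/= => H.
 have {H} : (lam n `^ b * coef u n) ^+ 2 <= L ^+ 2.
  by apply: le_trans H; rewrite lerDr; apply: sumr_ge0 => i _; exact: sqr_ge0.
 rewrite -[X in X <= _]real_normK ?num_real// ler_sqr ?nnegrE// normrM ger0_norm ?powR_ge0// => H.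
 by rewrite powRN mulrC ler_pdivlMr ?powR_gt0 ?lam_gt0// mulrC.
have [c cP] := choice cb.
have near N e : 0 < e -> F [set u : X | forall n, (n < N)%N -> `|coef u n - c n| < e].
 move=> e0; elim: N => [|N IH]; first by apply: filterS FB => u _.
 apply: filterS (filterI IH (cP N e e0)) => u /= [H1 H2] n; rewrite ltnS leq_eqVlt => /orP[/eqP->//|]; exact: H1.
have ne (A : set X) : F A -> A !=set0 by move=> FA; apply: (@filter_ex _ F).
have cL : hbd b c L.
 split=> // N; have H e : 0 < e -> sqsum (fun n => lam n `^ b * c n) N <= (L + e) ^+ 2.
  move=> e0; pose S := sqsum (fun n => lam n `^ b) N.
  have S0 : 0 <= S by apply: sumr_ge0 => i _; exact: sqr_ge0.
  have sS : 0 <= Num.sqrt S by exact: sqrtr_ge0.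
  pose d := e / (Num.sqrt S + 1); have d0 : 0 < d by rewrite divr_gt0//; lra.
  have [u [/= [_ uL] ud]] := ne _ (filterI FB (near N d d0)).
  have -> : sqsum (fun n => lam n `^ b * c n) N = sqsum (fun n => lam n `^ b * coef u n + lam n `^ b * (c n - coef u n)) N.
   by apply: eq_bigr => i _; rewrite -mulrDr; congr ((_ * _) ^+ 2); ring.
  apply: sqsumD => //; first exact: ltW.
  apply: le_trans (_ : d ^+ 2 * S <= _).
   rewrite /S /sqsum mulr_sumr; apply: ler_sum => i _; rewrite exprMn mulrC; apply: ler_wpM2r; first exact: sqr_ge0.
   by rewrite -[X in X <= _]real_normK ?num_real// lerXn2r ?nnegrE ?(ltW d0)// distrC ltW// ud.
  rewrite -[X in _ * X](sqr_sqrtr S0) -exprMn lerXn2r ?nnegrE ?mulr_ge0 ?(ltW d0) ?(ltW e0)//.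
  by rewrite /d mulrAC ler_pdivrMr; [apply: ler_wpM2l; lra | lra].
 apply/ler_addgt0Pr => e e0.
 have [k [k0 k1 k2]] := below2 (ltr01 : 0 < 1 :> R) (divr_gt0 e0 (ltac:(lra) : 0 < 2 * L + 1)).
 have := H k k0; move: k2; rewrite ltr_pdivlMr; last by lra.
 set Q := sqsum _ _; rewrite sqrrD => A B; apply: le_trans B _; rewrite -addrA lerD2l -mulr_natl.
 by have : k ^+ 2 <= k by [rewrite expr2 ler_piMr// ltW]; move: A; set Y := k ^+ 2; lra.
have cLa : hbd alpha c (a `^ (alpha - b) * L) by apply: hbd_mono => //; exact: ltW.
have [u uc] := X_of a_gt0 alpha_gt cLa.
have uL : hbd b (coef u) L by rewrite (_ : coef u = c)//; apply: funext.
exists u; split=> //; apply/cvg_ballP => e e0.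
have L20 : 0 <= L + L by lra.
have [N [d d0 H]] := tail_small ab L20 (divr_gt0 e0 (ltr0n _ 2)).
apply: filterS (filterI FB (near N d d0)) => v /= [vL vd].
apply: (@le_lt_trans _ _ (e / 2)); last by lra.
apply: (Xnorm_le a_gt0 alpha_gt).
have -> : coef (u - v) = (fun n => coef u n + -1 * coef v n) by apply: funext => n; rewrite coefB mulN1r.
apply: H => [|n nN]; last by rewrite mulN1r uc distrC ltW// vd.
have -> : L + L = L + `|-1| * L by rewrite normrN1 mul1r.
by apply: hbdD => //; exact: hbdZ.
Qed.

Lemma Xnorm_lim u v : (forall e, 0 < e -> Xnorm (u - v) < e) -> u = v.
Proof.
move=> H; apply/eqP; rewrite -subr_eq0; apply/eqP; apply: (Xnorm_eq0 a_gt0 alpha_gt).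
apply/eqP; rewrite eq_le Xnorm_ge0 andbT leNgt; apply/negP => p.
by have := H _ p; rewrite ltxx.
Qed.

Lemma XnormC u v : Xnorm (u - v) = Xnorm (v - u).
Proof. by rewrite -XnormN opprB. Qed.

Lemma Xtri u v (w : X) : Xnorm (u - w) <= Xnorm (u - v) + Xnorm (v - w).
Proof. by apply: le_trans (XnormD _ _); rewrite addrA subrK. Qed.

Lemma X_separated (u v : X) : cluster (nbhs u) v -> u = v.
Proof.
move=> H; apply: Xnorm_lim => e e0.
have e2 : 0 < e / 2 by lra.
have [w [uw vw]] := H (ball u (e / 2)) (ball v (e / 2)) (nbhsx_ballx _ _ e2) (nbhsx_ballx _ _ e2).
rewrite Xball_ in uw; rewrite Xball_ in vw.
have := Xtri u w v; rewrite (XnormC w v) => H1; apply: le_lt_trans H1 _.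
rewrite [X in _ < X](splitr e); exact: (ltrD uw vw).
Qed.

Lemma X_hausdorff : hausdorff_space X. Proof. exact: X_separated. Qed.

Lemma compact_lim (K : set X) u : compact K -> (forall e, 0 < e -> exists2 v, K v & Xnorm (u - v) < e) -> K u.
Proof.
move=> /(compact_closed X_hausdorff) cK H; apply: cK => A /nbhs_ballP[e e0 eA].
by have [v Kv uv] := H e e0; exists v; split=> //; exact: eA.
Qed.

End compactness.

(** * Continuity in terms of balls, and common multiples of two periods *)

Section topology.
Context {R : realType}.

Lemma within_open_cts (T U : topologicalType) (A : set T) (g : T -> U) :
 open A -> {within A, continuous g} -> forall x, A x -> {for x, continuous g}.
Proof.
move=> oA /subspace_continuousP cg x Ax; have := cg x Ax.
by rewrite within_interior//; rewrite /interior; exact: open_nbhs_nbhs (conj oA Ax).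
Qed.

Lemma eps_cts (S T : pseudoMetricType R) (g : S -> T) x : {for x, continuous g} <->
 forall e, 0 < e -> exists2 d, 0 < d & forall y, ball x d y -> ball (g x) e (g y).
Proof.
split=> [cg e e0|H].
 by have /cvg_ballP/(_ e e0)/nbhs_ballP[d d0 dP] := cg; exists d.
by apply/cvg_ballP => e e0; apply/nbhs_ballP; have [d d0 dP] := H e e0; exists d.
Qed.

Lemma eps_within (S T : pseudoMetricType R) (A : set S) (g : S -> T) : {within A, continuous g} ->
 forall x, A x -> forall e, 0 < e -> exists2 d, 0 < d & forall y, A y -> ball x d y -> ball (g x) e (g y).
Proof.
move=> /subspace_continuousP cg x Ax e e0.
have /cvg_ballP/(_ e e0) := cg x Ax; rewrite /within /= => /nbhs_ballP[d d0 dP].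
by exists d => // y Ay xy; exact: dP.
Qed.

Lemma circ_le (u v : R -> R) : continuous u -> continuous v ->
 (forall x, 0 <= x <= 2 * pi -> u x <= v x) -> circ u <= circ v.
Proof.
move=> cu cv uv; have iu := cts_int cu; have iv := cts_int cv.
rewrite (circE iu) (circE iv).
apply: le_Rintegral; [exact: measurable_itv | | |].
- by apply/(circle_integrable (cts_measurable cu)).
- by apply/(circle_integrable (cts_measurable cv)).
- by move=> x; rewrite /= in_itv/=; exact: uv.
Qed.

End topology.

Record setting (R : realType) (a alpha : R) (f : R * R * R -> R)
  (Phi : R -> phase_space a alpha -> phase_space a alpha) : Prop := Setting {
 st_a : 0 < a; st_al : 3 / 4 < alpha < 1; st_A : hypothesis_A f; st_B : hypothesis_B f;
 st_sf : continuous_semiflow Phi; st_gen : generated_by Phi f }.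

Lemma within_eps (R : realType) (S T : pseudoMetricType R) (A : set S) (g : S -> T) :
 (forall x, A x -> forall e : R, 0 < e -> exists2 d : R, 0 < d & forall y, A y -> ball x d y -> ball (g x) e (g y)) ->
 {within A, continuous g}.
Proof.
move=> H; apply/subspace_continuousP => x Ax; apply/cvg_ballP => e e0.
have [d d0 dP] := H x Ax e e0; rewrite /= /within /=.
by apply: filterS (nbhsx_ballx x d d0) => y xy Ay; exact: dP.
Qed.

(** The fractional parts of n T1 / T2 accumulate in [0, 1]. Two indices with nearly equal fractional
    parts differ by the wanted n, and the integer parts differ by m. *)
Lemma simultaneous_multiples (R : realType) (T1 T2 d T : R) : 0 < T1 -> 0 < T2 -> 0 < d ->
 exists n m : nat, [/\ T <= n%:R * T1, T <= m%:R * T2 & `|n%:R * T1 - m%:R * T2| < d].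
Proof.
move=> t1 t2 d0; pose x (n : nat) : R := n%:R * T1 / T2; pose tr n := Num.truncn (x n).
have x0 n : 0 <= x n by rewrite divr_ge0 ?mulr_ge0 ?(ltW t1) ?(ltW t2).
have xP n : (tr n)%:R <= x n < (tr n).+1%:R by apply: truncn_itv.
have [|s sI [phi phiP sP]] := @compact_seq R R `[0, 1]%classic (fun n => x n - (tr n)%:R) (@segment_compact R 0 1).
 by move=> n; have /andP[h1 h2] := xP n; rewrite /= in_itv /= subr_ge0 h1 lerBlDl ltW// natr1.
have d2 : 0 < d / (2 * T2) by rewrite divr_gt0 ?mulr_gt0.
(* N steps of length T1 exceed T + d, which puts both multiples beyond T. *)
have [k kd] := inv_small d2; pose N := (Num.truncn ((T + d) / T1)).+1.
pose i := phi k; pose j := phi (maxn k (i + N)).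
have ij : (i + N <= j)%N by apply: leq_trans (phiP _); exact: leq_maxr.
have ij' : (i <= j)%N := leq_trans (leq_addr _ _) ij.
have xij : x i <= x j by rewrite ler_pM2r ?invr_gt0// ler_pM2r// ler_nat.
have trij : (tr i <= tr j)%N by apply: le_truncn.
have si : `|s - (x i - (tr i)%:R)| < d / (2 * T2) := lt_trans (sP k) kd.
have sj : `|s - (x j - (tr j)%:R)| < d / (2 * T2).
 apply: lt_trans (sP _) (le_lt_trans _ kd); by rewrite inv_le ?leq_maxl.
have E : (j - i)%:R * T1 - (tr j - tr i)%:R * T2 = T2 * ((x j - (tr j)%:R) - (x i - (tr i)%:R)).
 by rewrite !natrB// /x; field; rewrite gt_eqF.
have close : `|(j - i)%:R * T1 - (tr j - tr i)%:R * T2| < d.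
 rewrite E normrM (gtr0_norm t2) mulrC -ltr_pdivlMr//; apply: le_lt_trans (ler_distD s _ _) _.
 rewrite [X in X + _]distrC [d / T2](_ : _ = d / (2 * T2) + d / (2 * T2)); first exact: ltrD.
 by field; rewrite gt_eqF.
have big : T + d <= (j - i)%:R * T1.
 rewrite -ler_pdivrMr//; apply: ltW; apply: lt_le_trans (truncnS_gt _) _.
 by rewrite ler_nat -/N leq_subRL.
exists (j - i)%N, (tr j - tr i)%N; split=> //; first by apply: le_trans big; rewrite lerDl ltW.
by move: close big; rewrite ltr_norml; lra.
Qed.

Section semiflow.
Context (R : realType) (a alpha : R) (f : R * R * R -> R) (Phi : R -> phase_space a alpha -> phase_space a alpha).
Hypothesis st : setting f Phi.
Local Notation X := (phase_space a alpha).
Implicit Types (u v : X) (t s e d : R) (n N : nat).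

Ltac lraS := rel_lra (setting f Phi).

Lemma params : [/\ 0 < a, 3 / 4 < alpha & alpha < 1].
Proof. by split; [exact: st_a st | |]; case/andP: (st_al st). Qed.

(** * The equation in Fourier coordinates *)

Section solutions.
Implicit Types (x y : R).

Let a0 := st_a st.
Let al := st_al st.
Let al1 : 3 / 4 < alpha. Proof. by case/andP: al. Qed.

Lemma Phi0 u : Phi 0 u = u.
Proof. by have [] := st_sf st. Qed.

Lemma PhiD s t u : 0 <= s -> 0 <= t -> Phi (s + t) u = Phi s (Phi t u).
Proof. by have [_ _] := st_sf st; apply. Qed.

Lemma Phi_cts t u : 0 <= t -> forall e, 0 < e -> exists2 d, 0 < d &
 forall s v, 0 <= s -> `|t - s| < d -> Xnorm (u - v) < d -> Xnorm (Phi t u - Phi s v) < e.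
Proof.
move=> t0 e e0; have [c _ _] := st_sf st.
have [d d0 dP] := @eps_within R (R * X)%type X _ _ c (t, u) t0 e e0.
by exists d => // s v s0 ts uv; apply: (dP (s, v)).
Qed.

Definition Pt u t x : R := derive1 (fun s => Phi s u x) t.
Definition Pxx u t x : R := derive1n 2 (Phi t u) x.

Lemma derive1_dX u : derive1 u = dX u.
Proof. by apply: funext => x; rewrite derive1E; have [_ ->] := X_derive a0 al1 u x. Qed.

Lemma Pt_derive u t x : 0 < t -> is_derive t 1 (fun s => Phi s u x) (Pt u t x).
Proof.
move=> t0; have [[_ _ [H _ _ _ _]] _] := st_gen st u; have [d _ _] := H t x t0.
by apply: DeriveDef => //; rewrite /Pt derive1E.
Qed.

Lemma Pxx_derive u t x : 0 < t -> is_derive x 1 (dX (Phi t u)) (Pxx u t x).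
Proof.
move=> t0; have [[_ _ [H _ _ _ _]] _] := st_gen st u; have [_ _ d] := H t x t0.
rewrite derive1_dX in d; apply: DeriveDef => //.
by change (Pxx u t x) with (derive1 (derive1 (Phi t u)) x); rewrite derive1_dX derive1E.
Qed.

Lemma Peq u t x : 0 < t -> Pt u t x = Pxx u t x + f (x, Phi t u x, dX (Phi t u) x).
Proof.
move=> t0; have [[_ _ [_ _ _ _ H]] _] := st_gen st u; have := H t x t0.
by rewrite /Pt /Pxx /= derive1_dX.
Qed.

Let open_pos : open [set p : R * R | 0 < p.1].
Proof.
have -> : [set p : R * R | 0 < p.1] = fst @^-1` [set y | 0 < y] by [].
by apply: open_comp => [p _|]; [exact: cvg_fst | exact: open_gt].
Qed.

Lemma Pt_cts u (p : R * R) : 0 < p.1 -> {for p, continuous (fun p : R * R => Pt u p.1 p.2)}.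
Proof.
by move=> p0; have [[_ _ [_ H _ _ _]] _] := st_gen st u; exact: (within_open_cts open_pos H).
Qed.

Lemma Pxx_cts u (p : R * R) : 0 < p.1 -> {for p, continuous (fun p : R * R => Pxx u p.1 p.2)}.
Proof.
by move=> p0; have [[_ _ [_ _ _ H _]] _] := st_gen st u; exact: (within_open_cts open_pos H).
Qed.

Lemma cts_max0 (c : R) : continuous (fun t : R => Num.max t c).
Proof.
have -> : (fun t : R => Num.max t c) = (fun t => (t + c + `|t - c|) / 2).
 apply: funext => t; rewrite maxr_absE //.
by apply: ctsM (@ctsC _ _ _); apply: ctsD; [apply: ctsD (@cts_id _) (@ctsC _ _ _) | apply: cts_abs; apply: ctsB (@cts_id _) (@ctsC _ _ _)].
Qed.

(** Time is clamped at 0 so that u and u_x are continuous on the whole plane, as [parabolic] and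
    [first_touch] require. *)
Definition Phi' u t := Phi (Num.max t 0) u.

Lemma Phi'E u t : 0 <= t -> Phi' u t = Phi t u.
Proof. by move=> t0; rewrite /Phi'; congr Phi; apply/max_idPl. Qed.

Lemma Phi'_cts u t e : 0 < e -> exists2 d, 0 < d & forall s, `|t - s| < d -> Xnorm (Phi' u t - Phi' u s) < e.
Proof.
move=> e0; have m0 s : 0 <= Num.max s 0 by rewrite le_max lexx orbT.
have [d d0 dP] := Phi_cts u (m0 t) e0.
have /cvgrPdist_lt/(_ _ d0)/nbhs_ballP[r r0 rP] := @cts_max0 0 t.
exists r => // s sr; apply: dP => //; first exact: rP.
by rewrite subrr Xnorm0.
Qed.

Lemma X_path_joint (U : R -> X) :
 (forall t e, 0 < e -> exists2 d, 0 < d & forall s, `|t - s| < d -> Xnorm (U t - U s) < e) ->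
 continuous (fun p : R * R => U p.1 p.2) /\ continuous (fun p : R * R => dX (U p.1) p.2).
Proof.
move=> cU; have [C C0 CP] := X_C1 a0 al1.
have key (q : X -> R -> R) : (forall u, continuous (q u)) ->
  (forall u v x, `|q u x - q v x| <= C * Xnorm (u - v)) -> continuous (fun p : R * R => q (U p.1) p.2).
 move=> cq qC [t x]; apply/eps_cts => e e0 /=.
 have e2 : 0 < e / 2 by lra.
 have [d d0 dP] := cU t (e / 2 / C) (divr_gt0 e2 C0).
 have /cvgrPdist_lt/(_ _ e2)/nbhs_ballP[r r0 rP] := cq (U t) x.
 have [h [h0 hd hr]] := below2 d0 r0.
 exists h => // -[s y] /= [ts xy].
 have H1 := dP s (lt_trans ts hd); move: H1; rewrite ltr_pdivlMr// mulrC => H1.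
 have H2 := rP y (lt_trans xy hr); have H3 := qC (U t) (U s) y.
 move: H1 H2 H3; rewrite /ball /= !ltr_norml !ler_norml; lra.
split; apply: key => [u|u v x].
- exact: Xcts.
- by have [H _] := CP (u - v) x; move: H; rewrite XB.
- exact: dX_cts.
- by have [_ H] := CP (u - v) x; move: H; rewrite (dXB a0 al1).
Qed.

Lemma Phi'_joint u : continuous (fun p : R * R => Phi' u p.1 p.2) /\ continuous (fun p : R * R => dX (Phi' u p.1) p.2).
Proof. by apply: X_path_joint => t e; exact: Phi'_cts. Qed.

Lemma f_cts : continuous f.
Proof. by have [_ []] := st_A st. Qed.

Lemma f_per x xi p : f (x + 2 * pi, xi, p) = f (x, xi, p).
Proof. by have [H _] := st_A st; exact: (H xi p x). Qed.

Lemma cts_triple (T : topologicalType) (g h k : T -> R) : continuous g -> continuous h -> continuous k ->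
 continuous (fun z => f (g z, h z, k z)).
Proof.
move=> cg ch ck; apply: (cts_comp (f := fun z => (g z, h z, k z)) _ f_cts).
by apply: cts_pair => //; exact: cts_pair.
Qed.

(** The nonlinearity for the shifted operator: u_t = u_xx + f becomes u_t + G u = F(u). *)
Definition Fu u x : R := f (x, u x, dX u x) + a * u x.

Lemma Fu_cts u : continuous (Fu u).
Proof.
apply: ctsD; first by apply: cts_triple; [exact: cts_id | exact: Xcts | exact: dX_cts].
by apply: ctsZ; exact: Xcts.
Qed.

Lemma coef_le u n : `|coef u n| <= lam a n `^ (- alpha) * Xnorm u.
Proof.
have l0 := lam_gt0 a0 n; have [_ /(_ n.+1)] := Xhbd u; rewrite /sqsum big_ord_recr/= => H.
have {H} : (lam a n `^ alpha * coef u n) ^+ 2 <= Xnorm u ^+ 2.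
 by apply: le_trans H; rewrite lerDr; apply: sumr_ge0 => i _; exact: sqr_ge0.
rewrite -[X in X <= _]real_normK ?num_real// ler_sqr ?nnegrE ?Xnorm_ge0// normrM ger0_norm ?powR_ge0// => H.
by rewrite powRN mulrC ler_pdivlMr ?powR_gt0// mulrC.
Qed.

Lemma coef_cts u n : continuous (fun t => coef (Phi' u t) n).
Proof.
move=> t; apply/cvgrPdist_lt => e e0.
have k0 : 0 < lam a n `^ (- alpha) by rewrite powR_gt0// (lam_gt0 a0).
have [d d0 dP] := Phi'_cts u t (divr_gt0 e0 k0).
apply/nbhs_ballP; exists d => // s ts /=; rewrite -coefB.
apply: le_lt_trans (coef_le _ _) _; rewrite mulrC -ltr_pdivlMr//; exact: dP.
Qed.

Lemma Pt_unif u t e : 0 < t -> 0 < e -> exists2 d, 0 < d & forall s, `|s - t| < d ->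
 0 < s /\ forall x, 0 <= x <= 2 * pi -> `|Pt u s x - Pt u t x| < e.
Proof.
move=> t0 e0; have t2 : 0 < t / 2 by lra.
pose q p := Pt u (Num.max p.1 (t / 2)) p.2.
have cq : continuous q.
 move=> p; have m0 : 0 < Num.max p.1 (t / 2) by rewrite lt_max t2 orbT.
 have cp : continuous (fun p : R * R => (Num.max p.1 (t / 2), p.2)).
  by apply: cts_pair (@cts_snd _ _); apply: cts_comp (@cts_fst _ _) (@cts_max0 _).
 apply: (@continuous_comp _ _ _ (fun p : R * R => (Num.max p.1 (t / 2), p.2)) (fun p => Pt u p.1 p.2) p (cp p)).
 exact: (@Pt_cts u (Num.max p.1 (t / 2), p.2)).
have [||d d0 dP] := @tube R _ `[0, 2 * pi]%classic (fun p => e - `|q p - Pt u t p.2|) t (@segment_compact _ _ _).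
- apply: ctsB; first exact: ctsC.
 apply: cts_abs; apply: ctsB => // p.
 have cp : continuous (fun p : R * R => (t, p.2)) by apply: cts_pair; [exact: ctsC | exact: cts_snd].
 apply: (@continuous_comp _ _ _ (fun p : R * R => (t, p.2)) (fun p => Pt u p.1 p.2) p (cp p)).
 exact: (@Pt_cts u (t, p.2)).
- move=> x _; rewrite /q /= (_ : Num.max t (t / 2) = t) ?subrr ?normr0 ?subr0//.
 by apply/max_idPl; lra.
have [h [h0 hd ht]] := below2 d0 t2.
exists h => // s sh; have [s1 s2] : t / 2 < s /\ 0 < s by move: sh; rewrite ltr_norml; lra.
split=> // x xI; have := dP s x (lt_trans sh hd); rewrite /q /= in_itv/= => /(_ xI).
by rewrite (_ : Num.max s (t / 2) = s) ?subr_gt0//; apply/max_idPl/ltW.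
Qed.

Lemma Pt_slice_cts u t : 0 < t -> continuous (Pt u t).
Proof.
move=> t0 x; have cp : continuous (fun x : R => (t, x)) by apply: cts_pair; [exact: ctsC | exact: cts_id].
apply: (@continuous_comp _ _ _ (fun x : R => (t, x)) (fun p => Pt u p.1 p.2) x (cp x)).
exact: (@Pt_cts u (t, x)).
Qed.

Lemma Pxx_slice_cts u t : 0 < t -> continuous (Pxx u t).
Proof.
move=> t0 x; have cp : continuous (fun x : R => (t, x)) by apply: cts_pair; [exact: ctsC | exact: cts_id].
apply: (@continuous_comp _ _ _ (fun x : R => (t, x)) (fun p => Pxx u p.1 p.2) x (cp x)).
exact: (@Pxx_cts u (t, x)).
Qed.

Lemma Pt_coef_derive u t n : 0 < t -> is_derive t 1 (fun s => coef (Phi s u) n) (coef (Pt u t) n).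
Proof.
move=> t0; apply: eps_is_derive => e e0; have p0 := @pi_gt0 R.
(* The basis functions are bounded by 2 and the circle has length 2 pi, hence the factor 4 pi. *)
have p8 : 0 < 4 * pi + 1 :> R by lra.
have [r r0 rP] := Pt_unif u t0 (divr_gt0 e0 p8).
exists r => // s sr; set k := e / _ in rP *.
have k0 : 0 < k by rewrite divr_gt0.
pose w x := Phi s u x - Phi t u x - (s - t) * Pt u t x.
have cw : continuous w.
 by apply: ctsB; [apply: ctsB; exact: Xcts | apply: ctsZ; exact: Pt_slice_cts].
have -> : coef (Phi s u) n - coef (Phi t u) n - coef (Pt u t) n * (s - t) = circ (fun x => w x * bas n x).
 have -> : (fun x => w x * bas n x) = (fun x => (Phi s u x + -1 * Phi t u x + (t - s) * Pt u t x) * bas n x).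
  by apply: funext => x; rewrite /w; ring.
 have L1 := cts_L2 (@Xcts _ _ _ (Phi s u)); have L2_ := cts_L2 (@Xcts _ _ _ (Phi t u)).
 have L3 := cts_L2 (Pt_slice_cts (u := u) t0); have Lb := @bas_L2 R n.
 rewrite -[circ _]/(L2dot _ (bas n)).
 rewrite (L2dotDl (L2D L1 (L2Z (-1) L2_)) (L2Z (t - s) L3) Lb) (L2dotDl L1 (L2Z (-1) L2_) Lb) !L2dotZl//.
 by rewrite /coef; ring.
have wk x : 0 <= x <= 2 * pi -> `|w x| <= k * `|s - t|.
 move=> xI.
 have main p q : p < q -> `|p - t| < r -> `|q - t| < r ->
   `|Phi q u x - Phi p u x - (q - p) * Pt u t x| <= k * (q - p).
  move=> pq pr qr; have [z zI|z zI ->] := @mvt R (fun s => Phi s u x) (fun s => Pt u s x) _ _ pq.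
   by apply: Pt_derive; have [] := rP z _; [move: pr qr; rewrite !ltr_norml; lra |].
  rewrite [(q - p) * _]mulrC -mulrBl normrM [`|q - p|]gtr0_norm ?subr_gt0//.
  apply: ler_wpM2r; first by rewrite subr_ge0 ltW.
  by apply: ltW; have [_] := rP z ltac:(move: pr qr; rewrite !ltr_norml; lra); apply.
 have tr : `|t - t| < r by rewrite subrr normr0.
 rewrite /w; have [ts|ts|->] := ltrgtP s t.
 - have -> : Phi s u x - Phi t u x - (s - t) * Pt u t x = - (Phi t u x - Phi s u x - (t - s) * Pt u t x) by ring.
  by rewrite normrN; exact: main.
 - exact: main.
 - by rewrite !subrr mul0r subrr normr0 mulr0.
apply: le_trans (_ : circ (fun x => k * `|s - t| * 2) <= _); last first.
 rewrite circ_cst; have := normr_ge0 (s - t); set q := `|_|.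
 have : k * (4 * pi + 1) = e by rewrite divfK// gt_eqF.
 by move=> <- q0; have := mulr_ge0 (ltW k0) q0; lra.
have cwb : continuous (fun x => w x * bas n x) by apply: ctsM => //; exact: bas_cts.
rewrite /circ; apply: le_trans (le_normr_Rintegral _ (cts_int cwb)) _ => //.
apply: circ_le; [exact: cts_abs | exact: ctsC |].
move=> x xI; rewrite normrM; apply: ler_pM => //; [exact: wk | exact: bas_le].
Qed.

Lemma coef_Pxx u t n : 0 < t -> coef (Pxx u t) n = - (uphalf n)%:R ^+ 2 * coef (Phi t u) n.
Proof.
move=> t0; have [A [B [bE dE _ _]]] := @basP R n.
have dp : dX (Phi t u) (2 * pi) = dX (Phi t u) 0 by rewrite -[2 * pi]add0r (dX_per a0 al1).
have up : Phi t u (2 * pi) = Phi t u 0 by rewrite -[2 * pi]add0r Xper.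
have bp : bas n (2 * pi) = bas n 0 :> R by rewrite -[2 * pi]add0r bas_period.
have db : forall x : R, is_derive x 1 (dbas n) (- (uphalf n)%:R ^+ 2 * bas n x).
 by move=> x; rewrite dE bE; apply: deq (tp_derive _ _ _ _) _; rewrite tpZ; congr tp; ring.
have dbp : dbas n (2 * pi) = dbas n 0 :> R by rewrite dE tp_2pi tp_at0.
have c1 : continuous (fun x : R => - (uphalf n)%:R ^+ 2 * bas n x) by apply: ctsZ; exact: bas_cts.
have E1 := circ_ibp (fun x => Pxx_derive u x t0) (@bas_derive R n) (Pxx_slice_cts (u := u) t0) (@dbas_cts R n) dp bp.
have E2 := circ_ibp (X_derive a0 al1 (Phi t u)) db (@dX_cts _ _ _ a0 al1 (Phi t u)) c1 up dbp.
rewrite /coef -[LHS]opprK -E1 -E2 L2dotC L2dotZl ?bas_L2 ?cts_L2//; last exact: Xcts.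
by rewrite L2dotC.
Qed.

Lemma sol_coef_derive u t n : 0 < t ->
 is_derive t 1 (fun s => coef (Phi s u) n) (- lam a n * coef (Phi t u) n + coef (Fu (Phi t u)) n).
Proof.
move=> t0; apply: deq (Pt_coef_derive u n t0) _.
have -> : Pt u t = (fun x => Pxx u t x + (Fu (Phi t u) x + - a * Phi t u x)).
 by apply: funext => x; rewrite Peq// /Fu; ring.
have L1 := cts_L2 (@Xcts _ _ _ (Phi t u)); have L2_ := cts_L2 (@Fu_cts (Phi t u)).
have L3 := cts_L2 (Pxx_slice_cts (u := u) t0).
have Lb := @bas_L2 R n.
rewrite /coef (L2dotDl L3 (L2D L2_ (L2Z (- a) L1)) Lb) (L2dotDl L2_ (L2Z (- a) L1) Lb) (L2dotZl _ L1 Lb).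
rewrite -![L2dot _ (bas n)]/(coef _ n).
by rewrite coef_Pxx// /lam; ring.
Qed.

Lemma sol_ode u S T : 0 <= S -> coef_ode a S T (fun t n => coef (Phi' u t) n) (fun t n => coef (Fu (Phi' u t)) n).
Proof.
move=> S0; split=> [n|n t tI]; first exact: coef_cts.
have t0 : 0 < t by lra.
rewrite Phi'E ?ltW//; apply: near_eq_is_derive (sol_coef_derive u n t0).
near=> r; rewrite Phi'E//; apply: ltW; near: r; exact: lt_nbhsr.
Unshelve. all: by end_near.
Qed.

End solutions.

(** * Differences of solutions and sup-norm bounds *)

Section bounds.
Implicit Types (x y : R).

Let a0 := st_a st.
Let al := st_al st.
Let al1 : 3 / 4 < alpha. Proof. by case/andP: al. Qed.

Lemma f_lip r : 0 <= r -> exists2 L, 0 <= L & forall x y y' p p',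
 `|y| <= r -> `|p| <= r -> `|y'| <= r -> `|p'| <= r ->
 `|f (x, y, p) - f (x, y', p')| <= L * (`|y - y'| + `|p - p'|).
Proof.
move=> r0; have [_ /class_C_partials[hu [hp [h1 _ _]]]] := st_A st.
have [L L0 LP] := lip_box h1 r0; exists L => // x y y' p p' yr pr y'r p'r.
have [k kI] := period_shift x.
have fE q z : f (x, q, z) = f (x + 2 * pi * k%:~R, q, z).
 by apply/esym; apply: (perZ k x (w := fun x => f (x, q, z))) => w; exact: f_per.
by rewrite !fE; apply: LP; split=> //; lra.
Qed.

Lemma Phi'_derive u t x : 0 < t -> is_derive t 1 (fun s => Phi' u s x) (Pt u t x).
Proof.
move=> t0; apply: near_eq_is_derive (Pt_derive u x t0).
near=> r; rewrite Phi'E//; apply: ltW; near: r; exact: lt_nbhsr.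
Unshelve. all: by end_near.
Qed.

Definition pdiff u v t x : R := Phi' u t x - Phi' v t x.
Definition pdiffx u v t x : R := dX (Phi' u t) x - dX (Phi' v t) x.

(** The constant C depends on the C^1 radius r only, so one bound on the number of alternations will
    serve for all pairs of the attractor. *)
Lemma pair_parabolic r : 0 <= r -> exists2 C, 0 <= C & forall T u v,
 (forall t x, 0 < t <= T -> `|Phi t u x| <= r /\ `|dX (Phi t u) x| <= r) ->
 (forall t x, 0 < t <= T -> `|Phi t v x| <= r /\ `|dX (Phi t v) x| <= r) ->
 parabolic C T (pdiff u v) (pdiffx u v) (fun t x => Pxx u t x - Pxx v t x) (fun t x => Pt u t x - Pt v t x).
Proof.
move=> r0; have [L L0 LP] := f_lip r0; exists L => // T u v uB vB.
have [cu cux] := Phi'_joint u; have [cv cvx] := Phi'_joint v.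
split.
- exact: ctsB cu cv.
- exact: ctsB cux cvx.
- by move=> t x; rewrite /pdiff !Xper.
- by move=> t x; rewrite /pdiffx !(dX_per a0 al1).
- by move=> t x; exact: (dB (X_derive a0 al1 _ x) (X_derive a0 al1 _ x)).
- move=> t x /andP[t0 _]; rewrite /pdiffx !Phi'E ?ltW//.
 exact: (dB (Pxx_derive u x t0) (Pxx_derive v x t0)).
- by move=> t x /andP[t0 _]; exact: (dB (Phi'_derive u x t0) (Phi'_derive v x t0)).
- move=> t x tI; have t0 : 0 < t by case/andP: tI.
 have [u1 u2] := uB t x tI; have [v1 v2] := vB t x tI.
 rewrite /pdiff /pdiffx !Phi'E ?(ltW t0)//= !Peq//.
 have := LP x _ _ _ _ u1 u2 v1 v2; set F := f _; set G := f _ => H.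
 set p := Pxx _ _ _; set q := Pxx _ _ _.
 by have -> : p + F - (q + G) - (p - q) = F - G by ring.
Qed.

Lemma touch_derive (z : R -> R) t d : 0 < t -> is_derive t 1 z d -> z t = 0 ->
 (forall s, 0 <= s <= t -> z s <= 0) -> 0 <= d.
Proof.
move=> t0 dz z0 H; apply: (left_max_derive_ge0 t0 dz) => s sI; rewrite z0; apply: H; lra.
Qed.

Definition delta_ok d := 0 < d /\ forall x xi, d < `|xi| -> xi * f (x, xi, 0) < 0.

Lemma delta_ex : exists d, delta_ok d.
Proof. by have [K [eps [d [_ _ d0 _ H]]]] := st_B st; exists d. Qed.

Lemma f_sign d b x xi : delta_ok d -> d < (-1) ^+ b * xi -> (-1) ^+ b * f (x, xi, 0) < 0.
Proof.
move=> [d0 H] dx; have x0 : 0 < (-1) ^+ b * xi by lra.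
have dn : d < `|xi| by apply: lt_le_trans dx _; rewrite -[X in _ <= X](normrMsign b); exact: ler_norm.
have := H x xi dn; have -> : xi * f (x, xi, 0) = ((-1) ^+ b * xi) * ((-1) ^+ b * f (x, xi, 0)).
 by rewrite mulrACA -expr2 sqrr_sign mul1r.
by rewrite pmulr_rlt0.
Qed.

(* Comparison with the spatially constant supersolutions M - c t + eta. *)
Lemma sup_bound d M c T u : delta_ok d -> 0 <= c -> d <= M - c * T -> 0 <= T ->
 (forall (x : R) (b : bool) (xi : R), 0 < (-1) ^+ b * xi - (M - c * T) -> (-1) ^+ b * xi <= M + 1 -> (-1) ^+ b * f (x, xi, 0) < - c) ->
 (forall x, `|u x| <= M) -> forall t x, 0 <= t <= T -> `|Phi t u x| <= M - c * t.
Proof.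
move=> dok c0 dM T0 fc uM.
(* The sign (-1)^b treats the upper and the lower bound at once; the margin e makes the inequality
   strict at time 0. *)
have main (b : bool) e : 0 < e <= 1 -> forall t x, 0 <= t <= T -> 0 <= x <= 2 * pi -> (-1) ^+ b * Phi t u x < M - c * t + e.
 move=> eI; pose z (p : R * R) := (-1) ^+ b * Phi' u p.1 p.2 - (M - c * p.1 + e).
 have cz : continuous z.
  apply: ctsB; first by apply: ctsM; [exact: ctsC | have [] := Phi'_joint u].
  apply: ctsD; last exact: ctsC.
  apply: ctsB; first exact: ctsC.
  by apply: ctsZ; exact: cts_fst.
 have absM (y : R) : (-1) ^+ b * y <= `|y| by rewrite -[X in _ <= X](normrMsign b) ler_norm.
 have H : forall t x, 0 <= t <= T -> `[0, 2 * pi]%classic x -> z (t, x) < 0.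
  apply: (@first_touch R _ `[0, 2 * pi]%classic T z (@segment_compact _ _ _) cz).
 - move=> x _; rewrite /z /= Phi'E// Phi0 mulr0 subr0; have := absM (u x); have := uM x; clear -eI; lra.
 - move=> t x tI xI zt zs; have t0 : 0 < t by case/andP: tI.
  have zall s y : 0 <= s <= t -> z (s, y) <= 0.
   move=> sI; have [k kI] := period_shift y.
   have -> : z (s, y) = z (s, y + 2 * pi * k%:~R).
    rewrite /z /=; congr (_ * _ - _); apply/esym; apply: perZ => w; exact: Xper.
   by apply: zs => //; rewrite /= in_itv/=; lra.
  have dm : is_derive t 1 (fun s => M - c * s + e) (- c).
   by apply: deq (dD (dB (dcst M t) (dcM c (did t))) (dcst e t)) _; ring.
  have dt : is_derive t 1 (fun s => z (s, x)) ((-1) ^+ b * Pt u t x - (- c)).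
   exact: (dB (dcM _ (Phi'_derive u x t0)) dm).
  have H1 := touch_derive t0 dt zt (fun s sI => zall s x sI).
  have dx y : is_derive y 1 (fun y => z (t, y)) ((-1) ^+ b * dX (Phi' u t) y).
   by apply: deq (dB (dcM ((-1) ^+ b) (X_derive a0 al1 (Phi' u t) y)) (dcst (M - c * t + e) y)) _; rewrite subr0.
  have tt : 0 <= t <= t by rewrite lexx ltW.
  have mx y : z (t, y) <= z (t, x) by rewrite zt; exact: zall.
  have g1 := max_derive_eq0 ltr01 (dx x) (fun y _ => mx y).
  have dxx : is_derive x 1 (fun y => (-1) ^+ b * dX (Phi' u t) y) ((-1) ^+ b * Pxx u t x).
   by rewrite Phi'E ?ltW//; exact: dcM (Pxx_derive u x t0).
  have g2 := max_derive2_le0 ltr01 (fun y _ => dx y) dxx (fun y _ => mx y).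
  have g3 : dX (Phi t u) x = 0.
   by move/eqP: g1; rewrite Phi'E ?ltW// mulf_eq0 signr_eq0 => /eqP.
  move: H1; rewrite Peq// g3 mulrDr => H1.
  have ct : c * t <= c * T by apply: ler_wpM2l => //; case/andP: tI.
  have ct0 : 0 <= c * t by rewrite mulr_ge0 // ltW.
  move: zt; rewrite /z /= Phi'E ?ltW// => zt.
  have := fc x b (Phi t u x) ltac:(clear -zt ct eI; lra) ltac:(clear -zt ct0 eI; lra).
  by move: H1 g2; clear; lra.
 move=> t x tI xI; have t0 : 0 <= t by case/andP: tI.
 have := H t x tI; rewrite /z /= Phi'E// in_itv/= => /(_ xI); lra.
move=> t x tI; have [k kI] := period_shift x.
have -> : Phi t u x = Phi t u (x + 2 * pi * k%:~R) by apply/esym; apply: perZ => w; exact: Xper.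
set x' := x + _; have x'I : 0 <= x' <= 2 * pi by rewrite /x'; lra.
apply/ler_addgt0Pr => e e0; pose k' := Num.min e 1.
have kI' : 0 < k' <= 1 by rewrite lt_min e0 ltr01 ge_min lexx orbT.
have ke : k' <= e by rewrite ge_min lexx.
have := main false k' kI' t x' tI x'I; have := main true k' kI' t x' tI x'I.
by rewrite expr0 expr1 mul1r mulN1r ler_norml; move: ke; clear; lra.
Qed.

Lemma sup_stays d M u : delta_ok d -> d <= M -> (forall x, `|u x| <= M) ->
 forall t x, 0 <= t -> `|Phi t u x| <= M.
Proof.
move=> dok dM uM t x t0; have := @sup_bound d M 0 t u dok; rewrite !mul0r subr0.
move=> /(_ _ dM t0 _ uM t x); rewrite mul0r subr0; apply=> //; last by rewrite lexx t0.
by move=> y b xi H _; rewrite oppr0; apply: (f_sign y dok); lra.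
Qed.

(** For M > d + 1, compactness gives a speed c > 0 at which f pushes constants xi with d + 1 <= |xi|
    <= M + 1 inwards. The bound M - c t sinks to d + 1 in time (M - d - 1) / c, and d + 1 is then
    kept. *)
Lemma sup_absorb d M : delta_ok d -> exists2 T, 0 <= T & forall u, (forall x, `|u x| <= M) ->
 forall t x, T <= t -> `|Phi t u x| <= d + 1.
Proof.
move=> dok; have d0 := dok.1.
have [Md|Md] := lerP M (d + 1).
 exists 0 => // u uM t x t0; apply: (@sup_stays d (d + 1) u dok _ _ t x t0) => [|y]; first by lra.
 exact: le_trans (uM y) Md.
have [c c0 cP] : exists2 c, 0 < c & forall (x : R) (b : bool) (xi : R), d + 1 <= (-1) ^+ b * xi <= M + 1 -> (-1) ^+ b * f (x, xi, 0) < - c.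
 have half (b : bool) : exists2 c, 0 < c & forall (x xi : R), d + 1 <= (-1) ^+ b * xi <= M + 1 -> (-1) ^+ b * f (x, xi, 0) < - c.
  pose K := (`[0, 2 * pi]%classic `*` `[d + 1, M + 1]%classic) : set (R * R).
  have cK : compact K by apply: compact_setX; exact: segment_compact.
  have p0 := @pi_gt0 R.
  have K0 : K !=set0 by exists (0, d + 1); split; rewrite /= in_itv/=; lra.
  pose g (P : R * R) := (-1) ^+ b * f (P.1, (-1) ^+ b * P.2, 0).
  have cg : continuous g.
   apply: ctsZ.
   apply: cts_triple; [exact: cts_fst | | exact: ctsC].
   by apply: ctsZ; exact: cts_snd.
  have [P PK PM] := compact_EVT_max K0 cK (continuous_subspaceT cg).
  have gP : g P < 0.
   apply: (f_sign _ dok); rewrite mulrA -expr2 sqrr_sign mul1r.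
   by move: PK; rewrite inE => -[_]; rewrite /= in_itv/=; lra.
  exists (- g P / 2) => [|x xi xiI]; first by lra.
  have [k kI] := period_shift x.
  have -> : f (x, xi, 0) = f (x + 2 * pi * k%:~R, xi, 0).
   by apply/esym; apply: (perZ k x (w := fun x => f (x, xi, 0))) => w; exact: f_per.
  have := PM (x + 2 * pi * k%:~R, (-1) ^+ b * xi); rewrite inE {1 2}/g /= mulrA -expr2 sqrr_sign mul1r.
  move=> H; apply: le_lt_trans (H _) _; last by rewrite -/(g P); lra.
  by split; rewrite /= in_itv/=; [lra | done].
 have [c1 c10 c1P] := half true; have [c2 c20 c2P] := half false.
 have [c [c_0 cc1 cc2]] := below2 c10 c20; exists c => // x [] xi xiI.
  by have := c1P x xi xiI; lra.
 by have := c2P x xi xiI; lra.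
pose T := (M - d - 1) / c; have T0 : 0 <= T by rewrite divr_ge0; lra.
have cT : c * T = M - d - 1 by rewrite /T mulrC divfK ?gt_eqF.
have dM : d <= M - c * T by lra.
have fcP : forall (x : R) (b : bool) (xi : R), 0 < (-1) ^+ b * xi - (M - c * T) -> (-1) ^+ b * xi <= M + 1 -> (-1) ^+ b * f (x, xi, 0) < - c.
 by move=> x b xi h1 h2; apply: cP; lra.
exists T => // u uM t x Tt.
have HT y : `|Phi T u y| <= d + 1.
 have := @sup_bound d M c T u dok (ltW c0) dM T0 fcP uM T y; rewrite lexx T0 cT => /(_ isT).
 by have -> : M - (M - d - 1) = d + 1 by ring.
have -> : Phi t u = Phi (t - T) (Phi T u) by rewrite -PhiD ?subrK// subr_ge0.
by apply: (sup_stays dok _ HT); [lra | rewrite subr_ge0].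
Qed.

End bounds.

(** * Gradient bounds by doubling of variables *)

Section gradient.
Implicit Types (x y : R).

(** The exponent eps < 2 is replaced by 2: the doubling argument tolerates quadratic growth, because
    the exponential change of variable uses the same constant K. *)
Lemma f_growth r : 0 < r -> exists2 K, 0 < K & forall x xi p, `|xi| <= r -> `|f (x, xi, p)| <= K * (2 + p ^+ 2).
Proof.
move=> r0; have [K [eps [d [[_ K0] epsI d0 KP _]]]] := st_B st.
have Kr := K0 r (ltW r0); exists (K r + 1) => [|x xi p xir]; first by lra.
have := KP r x xi p r0; rewrite -ler_norml => /(_ xir) H; apply: le_trans H _.
have : `|p| `^ eps <= 1 + p ^+ 2.
 rewrite -[p ^+ 2]real_normK ?num_real//; have := normr_ge0 p; set q := `|p| => q0.
 have [q1|q1] := lerP q 1.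
  have -> : 1 = 1 `^ eps :> R by rewrite powR1.
  have : q `^ eps <= 1 `^ eps by apply: powR_mono => //; lra.
  by have := sqr_ge0 q; rewrite powR1; lra.
 have : q `^ eps <= q `^ 2%:R by apply: ler_powR; lra.
 by rewrite powR_mulrn//; lra.
set Q := _ `^ _ => HQ; have p0 := sqr_ge0 p.
have : K r * (1 + Q) <= K r * (2 + p ^+ 2) by rewrite ler_wpM2l//; lra.
by lra.
Qed.

(** At a contact the slope p satisfies K p >= 2 K + 1, because E <= 2 A d0; the term - 2 K p^2 then
    outweighs all the others. *)
Lemma doubling_arith (K E A d d0 e p D : R) : 0 < K -> 0 < e <= 1 -> 0 < A -> 0 < d < d0 -> 0 < E -> E = 1 + A * d + e ->
 d0 * (4 * K + 2) = 1 -> 2 <= A * d0 -> E * (K * p) = A -> D <= 4 * K - 2 * K * p ^+ 2 ->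
 0 <= E * (K * D) + A * d -> False.
Proof.
move=> K0 eI A0 /andP[d0' dd] E0 EE dE Ad pE DP H3.
have Kp : 2 * K + 1 <= K * p.
 have Ed : E <= 2 * (A * d0) by rewrite EE; have : A * d < A * d0 by [rewrite ltr_pM2l]; move: eI Ad; clear -st; lra.
 have : E * (2 * K + 1) <= E * (K * p).
  have k0 : 0 <= 2 * K + 1 by move: K0; clear -st; lra.
  rewrite pE; apply: le_trans (ler_wpM2r k0 Ed) _.
  have -> : 2 * (A * d0) * (2 * K + 1) = A * (d0 * (4 * K + 2)) by ring.
  by rewrite dE mulr1.
 by rewrite ler_pM2l.
have : 0 <= E * (K * (4 * K - 2 * K * p ^+ 2) + 1).
 have H4 : E * (K * D) <= E * (K * (4 * K - 2 * K * p ^+ 2)) by rewrite ler_pM2l// ler_pM2l.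
 apply: le_trans H3 _; rewrite [X in _ <= X]mulrDr mulr1; apply: lerD H4 _.
 by rewrite EE; move: eI; clear -st; lra.
rewrite pmulr_rge0//; have : (2 * K + 1) ^+ 2 <= (K * p) ^+ 2.
 have k0 : 0 <= 2 * K + 1 by move: K0; clear -st; lra.
 by rewrite lerXn2r ?nnegrE// (le_trans k0).
by rewrite !expr2; move: K0; clear -st; nra.
Qed.

(* Doubling of variables: exp (K (u(x + d) - u(x))) is compared with 1 + A(t) d. *)
Lemma touch_absurd K r A e (s : bool) u t x d d0 : 0 < K -> 0 < r -> 0 < e <= 1 -> 0 < t ->
 (forall x xi p, `|xi| <= r -> `|f (x, xi, p)| <= K * (2 + p ^+ 2)) ->
 (forall y, `|Phi t u y| <= r) -> d0 * (4 * K + 2) = 1 -> 2 <= A * d0 -> 0 < d < d0 -> 0 < A ->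
 let z y h := expR (K * ((-1) ^+ s * (Phi t u (y + h) - Phi t u y))) - 1 - A * h - e in
 z x d = 0 -> (forall y h, 0 <= h <= d0 -> z y h <= 0) ->
 0 <= expR (K * ((-1) ^+ s * (Phi t u (x + d) - Phi t u x))) * (K * ((-1) ^+ s * (Pt u t (x + d) - Pt u t x))) + A * d ->
 False.
Proof.
have [a0 al1 _] := params.
move=> K0 r0 eI t0 fK ur dE Ad0 dI A0 z zd zall H3.
pose U := Phi t u; pose g := (-1) ^+ s : R.
have g2 : g * g = 1 by rewrite -expr2 sqrr_sign.
pose E := expR (K * (g * (U (x + d) - U x))).
have EE : E = 1 + A * d + e by move: zd; rewrite /z -/U -/g -/E; lraS.
have dU y : is_derive y 1 U (dX U y) by exact: X_derive.
have [q [q0 q1 q2]] := below2 (ltac:(lraS) : 0 < d / 2) (ltac:(lraS) : 0 < (d0 - d) / 2).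
have D1' : E * (K * (g * dX U (x + d))) = A.
 have dz : is_derive d 1 (z x) (E * (K * (g * dX U (x + d))) - A).
  have ds : is_derive d 1 (fun h => U (x + h)) (dX U (x + d)).
   by apply: deq (@dcomp _ U (fun h => x + h) d _ _ (dU (x + d)) (dD (dcst x d) (did d))) _; ring.
  have de := dexp (dcM K (dcM g (dB ds (dcst (U x) d)))).
  by apply: deq (dB (dB (dB de (dcst 1 d)) (dcM A (did d))) (dcst e d)) _; rewrite /E; ring.
 have : E * (K * (g * dX U (x + d))) - A = 0.
  apply: (max_derive_eq0 q0 dz) => y yq; rewrite zd; apply: zall.
  by move: yq; rewrite ltr_norml; lraS.
 by lraS.
(* Both endpoints move apart symmetrically. The second derivative test then gives that the signed
   difference of u_xx is at most - K (2 p)^2, the gain produced by the exponential. *)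
pose E' (h : R) := expR (K * (g * (U (x + d + h) - U (x - h)))).
pose G h := E' h * (K * (g * (dX U (x + d + h) + dX U (x - h)))) - 2 * A.
have dw (F dF : R -> R) : (forall y : R, is_derive y 1 F (dF y)) -> forall h : R,
  is_derive h 1 (fun h => F (x + d + h)) (dF (x + d + h)) /\ is_derive h 1 (fun h => F (x - h)) (- dF (x - h)).
 move=> FF h; split.
  by apply: deq (@dcomp _ F (fun h => x + d + h) h _ _ (FF (x + d + h)) (dD (dcst (x + d) h) (did h))) _; ring.
 by apply: deq (@dcomp _ F (fun h => x - h) h _ _ (FF (x - h)) (dB (dcst x h) (did h))) _; ring.
have dE' (h : R) : is_derive h 1 E' (E' h * (K * (g * (dX U (x + d + h) + dX U (x - h))))).
 have [d1 d2] := dw U (dX U) dU h.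
 by apply: deq (dexp (dcM K (dcM g (dB d1 d2)))) _; rewrite /E'; ring.
pose F2 h := E' h - 1 - A * (d + 2 * h) - e.
have dF2 (h : R) : is_derive h 1 F2 (G h).
 by apply: deq (dB (dB (dB (dE' h) (dcst 1 h)) (dcM A (dD (dcst d h) (dcM 2 (did h))))) (dcst e h)) _; rewrite /G; ring.
have F2z h : F2 h = z (x - h) (d + 2 * h).
 by rewrite /F2 /E' /z -/U -/g; have -> : x - h + (d + 2 * h) = x + d + h by ring.
have F20 : F2 0 = 0 by rewrite F2z subr0 mulr0 addr0.
have mF2 h : `|h - 0| < q / 2 -> F2 h <= F2 0.
 by rewrite subr0 ltr_norml => hq; rewrite F20 F2z; apply: zall; lraS.
have q20 : 0 < q / 2 by lraS.
have G0 := max_derive_eq0 q20 (dF2 0) mF2.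
have E'0 : E' 0 = E by rewrite /E' /E addr0 subr0.
have dxU y : is_derive y 1 (dX U) (Pxx u t y) by exact: Pxx_derive.
have dG : is_derive (0 : R) 1 G (E * (K * (g * (dX U (x + d) + dX U x))) ^+ 2 + E * (K * (g * (Pxx u t (x + d) - Pxx u t x)))).
 have [d1 d2] := dw (dX U) (Pxx u t) dxU 0.
 apply: deq (dB (dM (dE' 0) (dcM K (dcM g (dD d1 d2)))) (dcst (2 * A) 0)) _.
 by rewrite E'0 !addr0 !subr0; move: (dX U (x + d)) (dX U x) (Pxx _ _ _) (Pxx _ _ _) => q1' q2' q3' q4'; clear -st; ring.
have G2 := max_derive2_le0 q20 (fun y _ => dF2 y) dG mF2.
move: G0; rewrite /G E'0 !addr0 !subr0 => G0.
have E0 : 0 < E by exact: expR_gt0.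
pose p := g * dX U (x + d).
have pE : E * (K * p) = A by [].
have p' : g * dX U x = p.
 have : E * (K * (g * dX U x - p)) = 0 by rewrite /p; move: G0 pE; rewrite /p; move: (dX U (x + d)) (dX U x) => q1' q2'; clear -st; lra.
 by move/eqP; rewrite !mulf_eq0 (gt_eqF E0) (gt_eqF K0)/= subr_eq0 => /eqP.
have sq y (v : R) : v = g * y -> y ^+ 2 = v ^+ 2 by move=> ->; rewrite exprMn [g ^+ 2]expr2 g2 mul1r.
have f1 := fK (x + d) (U (x + d)) (dX U (x + d)) (ur _); rewrite (sq _ p erefl) in f1.
have f2 := fK x (U x) (dX U x) (ur _); rewrite (sq _ p (esym p')) in f2.
have gn (y : R) : g * y <= `|y| by rewrite -[X in _ <= X](normrMsign s) ler_norm.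
have gn' (y : R) : - (g * y) <= `|y| by rewrite -mulrN -normrN; exact: gn.
have n1 := gn (f (x + d, U (x + d), dX U (x + d))); have n2 := gn' (f (x, U x, dX U x)).
pose W := g * (Pxx u t (x + d) - Pxx u t x).
have W1 : W <= - (4 * K * p ^+ 2).
 have : E * (K * ((K * (2 * p) ^+ 2) + W)) <= 0.
  apply: le_trans G2; rewrite le_eqVlt; apply/orP; left; apply/eqP.
  by rewrite [g * (dX U _ + _)]mulrDr p' -/p -/W; ring.
 by rewrite pmulr_rle0// pmulr_rle0//; move: (W) (p) => w pp; clear -st; lra.
(* Each value of f is at most K (2 + p^2) in absolute value, which uses up half of the gain 4 K
   p^2. *)
have PtE : g * (Pt u t (x + d) - Pt u t x) <= 4 * K - 2 * K * p ^+ 2.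
 rewrite !Peq// -/U; move: W1 n1 n2 f1 f2; rewrite /W.
 move: (f _) (f _) (Pxx _ _ _) (Pxx _ _ _) (p ^+ 2) => F1 F2' P1 P2 pp; clear -st; lra.
exact: (doubling_arith K0 eI A0 dI E0 EE dE Ad0 pE PtE H3).
Qed.

(** The constant G is independent of the Lipschitz constant L of the data; L influences the waiting
    time only. This is what makes the C^1 ball absorbing. *)
Lemma lip_bound r : 0 < r -> exists2 G, 0 <= G & forall L, 0 <= L -> exists2 T0, 0 <= T0 & forall u,
 (forall t x, 0 <= t -> `|Phi t u x| <= r) -> (forall x, `|dX u x| <= L) ->
 forall t x, T0 <= t -> `|dX (Phi t u) x| <= G.
Proof.
have [a0 al1 _] := params.
move=> r0; have [K K0 fK] := f_growth r0.
pose d0 := (4 * K + 2)^-1; have d00 : 0 < d0 by rewrite invr_gt0; lraS.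
have dE : d0 * (4 * K + 2) = 1 by rewrite mulVf//; lraS.
pose e2 := expR (2 * K * r); have e20 : 0 < e2 by exact: expR_gt0.
have e21 : 1 <= e2.
 by have := expR_ge1Dx (2 * K * r); have := mulr_gt0 K0 r0; rewrite -/e2; lraS.
(* At the far end h = d0 the majorant 1 + A h exceeds [e2], which bounds the exponential, so no
   contact occurs there. *)
pose Am := 2 * e2 / d0; have Am0 : 0 < Am by rewrite divr_gt0 ?mulr_gt0.
have Amd : Am * d0 = 2 * e2 by rewrite /Am divfK ?gt_eqF.
exists (Am / K) => [|L L0]; first by rewrite divr_ge0 ?ltW.
have Tq0 : 0 <= K * L * e2 / Am by rewrite divr_ge0 ?(ltW Am0)// !mulr_ge0 ?(ltW K0) ?(ltW e20).
exists (K * L * e2 / Am) => [|u ur uL T x TT]; first exact: Tq0.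
have T0 : 0 <= T by exact: le_trans TT.
(* The slope bound relaxes exponentially to [Am] at time T; since exp(T) >= T >= K L e2 / Am, it
   dominates the initial Lipschitz constant. *)
pose A (t : R) := Am * expR (T - t).
have AT t : t <= T -> Am <= A t.
 move=> tT; rewrite -[X in X <= _]mulr1 ler_pM2l// -expR0 ler_expR; lraS.
have A_gt0 t : 0 < A t by rewrite mulr_gt0 ?expR_gt0.
have A0L : K * L * e2 <= A 0.
 move: TT; rewrite ler_pdivrMr// => TT; apply: le_trans TT _; rewrite /A subr0 mulrC; apply: ler_wpM2l; first exact: ltW.
 by have := expR_ge1Dx T; clear -st; lra.
have cA : continuous A.
 apply: ctsZ.
 apply: (cts_comp (f := fun t : R => T - t) (g := expR)); last exact: continuous_expR.
 by apply: ctsB; [exact: ctsC | exact: cts_id].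
have main (s : bool) e : 0 < e <= 1 -> forall t x h, 0 <= t <= T -> 0 <= x <= 2 * pi -> 0 <= h <= d0 ->
  expR (K * ((-1) ^+ s * (Phi t u (x + h) - Phi t u x))) - 1 - A t * h - e < 0.
 move=> eI; have [cU _] := Phi'_joint u.
 pose z (P : R * (R * R)) := expR (K * ((-1) ^+ s * (Phi' u P.1 (P.2.1 + P.2.2) - Phi' u P.1 P.2.1))) - 1 - A P.1 * P.2.2 - e.
 have c1 : continuous (fun P : R * (R * R) => P.1) := @cts_fst _ _.
 have c2 : continuous (fun P : R * (R * R) => P.2.1) := cts_comp (@cts_snd _ _) (@cts_fst _ _).
 have c3 : continuous (fun P : R * (R * R) => P.2.2) := cts_comp (@cts_snd _ _) (@cts_snd _ _).
 have cz : continuous z.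
  apply: ctsB; last exact: ctsC.
  apply: ctsB; last by apply: ctsM c3; exact: (cts_comp c1 cA).
  apply: ctsB; last exact: ctsC.
  apply: (cts_comp (g := expR)); last exact: continuous_expR.
  do 2 (apply: ctsM; first exact: ctsC).
  apply: ctsB; first exact: (cts2 (w := fun t x => Phi' u t x) cU c1 (ctsD c2 c3)).
  exact: (cts2 (w := fun t x => Phi' u t x) cU c1 c2).
 pose KK := (`[0, 2 * pi]%classic `*` `[0, d0]%classic) : set (R * R).
 have cK : compact KK by apply: compact_setX; exact: segment_compact.
 have absg (y : R) : (-1) ^+ s * y <= `|y| by rewrite -[X in _ <= X](normrMsign s) ler_norm.
 have expb t y y' : 0 <= t -> expR (K * ((-1) ^+ s * (Phi t u y - Phi t u y'))) <= e2.
  move=> t0; rewrite ler_expR (_ : 2 * K * r = K * (r + r)); last by ring.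
  rewrite ler_pM2l//; apply: le_trans (absg _) _; apply: le_trans (ler_normB _ _) _.
  by apply: lerD; exact: ur.
 have H : forall t P, 0 <= t <= T -> KK P -> z (t, P) < 0.
  apply: (@first_touch R _ KK T z cK cz).
  - move=> [y h] [/= yI]; rewrite in_itv/= => hI; rewrite /z /= Phi'E// Phi0.
   set Y := K * _; have h0 : 0 <= h by case/andP: hI.
   suff : expR Y - 1 <= A 0 * h by clear -st eI; lra.
   have [Y0|Y0] := lerP Y 0.
    have : expR Y <= 1 by rewrite -expR0 ler_expR.
    by have := mulr_ge0 (ltW (A_gt0 0)) h0; lraS.
   have Ye : expR Y <= e2 by have := @expb 0 (y + h) y (lexx _); rewrite Phi0.
   have YL : Y <= K * (L * h).
    rewrite /Y ler_pM2l//; apply: le_trans (absg _) _.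
    have := @mvt_le R u (dX u) L (y + h) y (fun w => X_derive a0 al1 u w) (fun w _ => uL w).
    by rewrite addrAC subrr add0r (ger0_norm h0).
   apply: le_trans (_ : Y * expR Y <= _).
    have H := expR_ge1Dx (- Y); rewrite expRN in H; have := ler_wpM2r (expR_ge0 Y) H.
    by rewrite mulVf ?gt_eqF ?expR_gt0//; move: (expR Y) => eY; clear -st; lra.
   apply: le_trans (_ : K * (L * h) * e2 <= _); first by apply: ler_pM; [exact: ltW | exact: expR_ge0 | exact: YL | exact: Ye].
   by have := ler_wpM2r h0 A0L; lraS.
  - move=> t [y h] tI [/= yI]; rewrite in_itv/= => hI zt zs; have t0 : 0 < t by case/andP: tI.
   have tT : t <= T by case/andP: tI.
   have zall t' y' h' : 0 <= t' <= t -> 0 <= h' <= d0 -> z (t', (y', h')) <= 0.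
    move=> t'I h'I; have [k kI] := period_shift y'.
    have -> : z (t', (y', h')) = z (t', (y' + 2 * pi * k%:~R, h')).
     rewrite /z /=; have pe w : Phi' u t' (w + 2 * pi * k%:~R) = Phi' u t' w.
      by apply: perZ => v; exact: Xper.
     have -> : y' + 2 * pi * k%:~R + h' = y' + h' + 2 * pi * k%:~R by ring.
     by rewrite !pe.
    by apply: zs => //; split; rewrite /= in_itv/=; clear -st kI h'I; lra.
   have Ad0 : 2 <= A t * d0.
    have := ler_wpM2r (ltW d00) (AT t tT); rewrite Amd; clear -st e21; set w' := A t * d0; lraS.
   have hn0 : h != 0.
    apply/eqP => h0; move: zt; rewrite /z /= h0 addr0 subrr !mulr0 expR0; clear -st eI; lra.
   have hnd : h != d0.
    apply/eqP => hd; move: zt; rewrite /z /= hd Phi'E ?(ltW t0)//.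
    have := @expb t (y + d0) y (ltW t0); have := ler_wpM2r (ltW d00) (AT t tT); rewrite Amd.
    by set w := expR _; set w' := A t * d0; clear -st eI e21; lra.
   have h'I : 0 < h < d0 by rewrite lt_def hn0 (lt_neqAle h) hnd andbA andbT -andbA /=; case/andP: hI => -> ->.
   have dt : is_derive t 1 (fun t => z (t, (y, h))) (expR (K * ((-1) ^+ s * (Phi t u (y + h) - Phi t u y))) *
     (K * ((-1) ^+ s * (Pt u t (y + h) - Pt u t y))) + A t * h).
    have dA : is_derive t 1 A (- A t).
     by apply: deq (dcM Am (dexp (dB (dcst T t) (did t)))) _; rewrite /A; ring.
    have de := dexp (dcM K (dcM ((-1) ^+ s) (dB (Phi'_derive u (y + h) t0) (Phi'_derive u y t0)))).
    have dh : is_derive t 1 (fun t => A t * h) (- A t * h) by apply: deq (dM dA (dcst h t)) _; ring.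
    by apply: deq (dB (dB (dB de (dcst 1 t)) dh) (dcst e t)) _; rewrite !Phi'E ?(ltW t0)//; ring.
   have H3 := touch_derive t0 dt zt (fun s' s'I => zall s' y h s'I hI).
   have zt' : expR (K * ((-1) ^+ s * (Phi t u (y + h) - Phi t u y))) - 1 - A t * h - e = 0.
    by move: zt; rewrite /z /= !Phi'E ?(ltW t0).
   apply: (touch_absurd K0 r0 eI t0 fK (fun w => ur t w (ltW t0)) dE Ad0 h'I (A_gt0 t) zt' _ H3).
   move=> y' h' h'd; have := zall t y' h' ltac:(by rewrite lexx ltW) h'd.
   by rewrite /z /= !Phi'E ?(ltW t0).
 move=> t y h tI yI hI; have t0 : 0 <= t by case/andP: tI.
 by have := H t (y, h) tI; rewrite /z /= Phi'E//; apply; split; rewrite /= in_itv.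
have fin (s : bool) y h : 0 <= h <= d0 -> K * ((-1) ^+ s * (Phi T u (y + h) - Phi T u y)) <= Am * h.
 move=> hI; have [k kI] := period_shift y.
 have pe w : Phi T u (w + 2 * pi * k%:~R) = Phi T u w by apply: perZ => v; exact: Xper.
 rewrite -(pe y) -(pe (y + h)) addrAC; set y' := y + _.
 have AE : A T = Am by rewrite /A subrr expR0 mulr1.
 set Y := K * _; have : expR Y <= 1 + Am * h.
  apply/ler_addgt0Pr => e e0; pose k' := Num.min e 1.
  have kI' : 0 < k' <= 1 by rewrite lt_min e0 ltr01 ge_min lexx orbT.
  have ke : k' <= e by rewrite ge_min lexx.
  have TI : 0 <= T <= T by rewrite lexx T0.
  have yI : 0 <= y' <= 2 * pi by rewrite /y'; clear -st kI; lra.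
  have := main s k' kI' T y' h TI yI hI; rewrite AE -/Y; move: ke; clear -st; lra.
 by have := expR_ge1Dx Y; lraS.
have half (s : bool) : K * ((-1) ^+ s * dX (Phi T u) x) <= Am.
 pose F y := Am * y - K * ((-1) ^+ s * Phi T u y).
 have dF : is_derive x 1 F (Am * 1 - K * ((-1) ^+ s * dX (Phi T u) x)).
  exact: (dB (dcM Am (did x)) (dcM K (dcM ((-1) ^+ s) (X_derive a0 al1 (Phi T u) x)))).
 have : 0 <= Am * 1 - K * ((-1) ^+ s * dX (Phi T u) x).
  apply: (left_max_derive_ge0 d00 dF) => y yI; have := fin s y (x - y) ltac:(lraS).
  by rewrite (_ : y + (x - y) = x); [rewrite /F; clear -st; lra | ring].
 by lraS.
rewrite ler_pdivlMr//.
suff : `|K * dX (Phi T u) x| <= Am by rewrite normrM (gtr0_norm K0) mulrC.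
have := half true; have := half false; rewrite expr0 expr1 mul1r mulN1r.
by rewrite ler_norml; move: (dX _ x) => q; clear -st; lra.
Qed.

(** [lip_bound] is used twice: first with a radius depending on M, to obtain some Lipschitz
    constant, and then, once the sup norm is below d + 1, with a radius that no longer depends on
    M. *)
Lemma absorb_C1 : exists2 r, 0 < r & forall M, exists2 T, 0 <= T & forall u, Xnorm u <= M ->
 forall t x, T <= t -> `|Phi t u x| <= r /\ `|dX (Phi t u) x| <= r.
Proof.
have [a0 al1 _] := params.
have [d dok] := delta_ex; have d0 := dok.1.
have d1 : 0 < d + 1 by lraS.
have [G0 G00 G0P] := lip_bound d1; have [C C0 CP] := X_C1 a0 al1.
exists (d + 1 + G0) => [|M]; first by lraS.
have [M0|M0] := ltrP M 0.
 by exists 0 => // u uM; have := Xnorm_ge0 u; lraS.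
have CM0 : 0 <= C * M by rewrite mulr_ge0 // ltW.
have uC u : Xnorm u <= M -> forall x, `|u x| <= C * M /\ `|dX u x| <= C * M.
 move=> uM x; have [h1 h2] := CP u x; have := ler_wpM2l (ltW C0) uM; split; lraS.
pose r := C * M + d + 1; have r0 : 0 < r by rewrite /r; lraS.
have [G G_0 GP] := lip_bound r0; have [T0 T00 T0P] := GP _ CM0.
have [T1 T10 T1P] := sup_absorb (C * M) dok.
have [T3 T30 T3P] := G0P _ G_0.
have S0 : 0 <= T0 + T1 by lraS.
exists (T0 + T1 + T3) => [|u uM t x tT]; first by lraS.
have uC' := uC u uM.
have b1 t' y : T0 + T1 <= t' -> `|Phi t' u y| <= d + 1.
 by move=> h; apply: T1P; [move=> w; exact: (uC' w).1 | lraS].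
split; first by have := b1 t x ltac:(lraS); lraS.
have b2 y : `|dX (Phi (T0 + T1) u) y| <= G.
 apply: T0P; [| by move=> w; exact: (uC' w).2 | lraS].
 move=> t' w t'0; apply: (sup_stays dok) => //; first by rewrite /r; lraS.
 by move=> w'; have := (uC' w').1; rewrite /r; lraS.
have -> : Phi t u = Phi (t - (T0 + T1)) (Phi (T0 + T1) u) by rewrite -PhiD ?subrK//; lraS.
have : `|dX (Phi (t - (T0 + T1)) (Phi (T0 + T1) u)) x| <= G0.
 apply: T3P; [| exact: b2 | lraS].
 by move=> t' w t'0; rewrite -PhiD//; apply: b1; lraS.
lraS.
Qed.

End gradient.

(** * Absorbing set and global attractor *)

Section attractor.
Implicit Types (x y : R).

Lemma coef_bound (g : R -> R) M N : continuous g -> (forall x, 0 <= x <= 2 * pi -> `|g x| <= M) ->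
 sqsum (coef g) N <= 2 * pi * M ^+ 2.
Proof.
move=> cg gM; apply: le_trans (bessel N (cts_L2 cg)) _; rewrite -circ_cst.
apply: circ_le; [exact: ctsM | exact: ctsC |] => x xI.
rewrite -expr2 -[X in X <= _]real_normK ?num_real// lerXn2r ?nnegrE ?gM//.
by apply: le_trans (gM x xI).
Qed.

Lemma Fu_bound (r : R) : 0 <= r -> exists2 M, 0 <= M & forall u N, (forall x, `|u x| <= r /\ `|dX u x| <= r) ->
 sqsum (coef (Fu u)) N <= M ^+ 2.
Proof.
move=> r0; have [M M0 MP] := box_bound f_cts r0; have p0 := @pi_gt0 R.
pose m := M + a * r; have a0 := st_a st.
have m0 : 0 <= m by rewrite addr_ge0 ?mulr_ge0// ltW.
exists (Num.sqrt (2 * pi) * m) => [|u N ur]; first by rewrite mulr_ge0 ?sqrtr_ge0.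
rewrite exprMn sqr_sqrtr ?mulr_ge0 ?(ltW p0)//.
have al1 : 3 / 4 < alpha by case/andP: (st_al st).
apply: coef_bound; first exact: Fu_cts.
move=> x xI; have [u1 u2] := ur x; rewrite /Fu; apply: le_trans (ler_normD _ _) _.
apply: lerD; first exact: MP.
by rewrite normrM (gtr0_norm a0) ler_pM2l.
Qed.

Definition regular (b L r : R) : set X := [set u : X | hbd a b (coef u) L /\ forall x, `|u x| <= r /\ `|dX u x| <= r].

(** One unit of time spent in the C^1 ball gains, by [duhamel_const], a bound in the norm of an
    exponent b strictly between alpha and 1, hence compactness in [X]. *)
Lemma absorbing : exists b L r, [/\ alpha < b < 1, 0 <= L, 0 < r & forall M, exists2 T, 0 < T & forall u, Xnorm u <= M ->
 forall t, T <= t -> regular b L r (Phi t u)].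
Proof.
have [a0 al1 al2] := params.
have [r r0 rP] := absorb_C1; have [M M0 MP] := Fu_bound (ltW r0).
pose b := (alpha + 1) / 2; have bI : alpha < b < 1 by rewrite /b; lraS.
have b01 : 0 <= b < 1 by lraS.
have p0 := @pi_gt0 R.
pose L1 := M * (1 : R) `^ (1 - b) / (1 - b); pose L2' := (1 : R) `^ (- (b - 0)) * (Num.sqrt (2 * pi) * r).
have L20 : 0 <= L2' by rewrite !mulr_ge0 ?powR_ge0 ?sqrtr_ge0// ltW.
have L10 : 0 <= L1 by rewrite divr_ge0 ?mulr_ge0 ?powR_ge0//; lraS.
exists b, (L1 + L2'), r; split=> //; first exact: addr_ge0.
move=> m; have [T T0 TP] := rP m; exists (T + 1) => [|u um t tT]; first by lraS.
split; last by move=> x; apply: TP => //; lraS.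
have t1 : 0 <= t - 1 by lraS.
have tt : t - 1 < t by lraS.
have := @duhamel_const _ a a0 b (t - 1) t M _ _ b01 tt (sol_ode u t t1) M0.
move=> /(_ _)/hbdD H.
have E1 : t - (t - 1) = 1 by ring.
have HS : hbd a b (fun n => expR (- (lam a n * (t - (t - 1)))) * coef (Phi' u (t - 1)) n) L2'.
 rewrite E1; apply: (@semi_smooth _ a a0 b 0) => //; first by lraS.
 split=> [|N]; first by rewrite mulr_ge0 ?sqrtr_ge0// ltW.
 rewrite exprMn sqr_sqrtr ?mulr_ge0 ?(ltW p0)//; 
 rewrite (_ : (fun n => _ * _) = coef (Phi' u (t - 1))); last by apply: funext => n; rewrite powRr0 mul1r.
 apply: coef_bound; first exact: Xcts.
 by move=> x _; rewrite Phi'E//; have [] := TP u um (t - 1) x ltac:(lraS).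
have := H _ _ _ HS; rewrite E1 Phi'E; last by lraS.
rewrite (_ : (fun n => _ + _) = coef (Phi t u)); last by apply: funext => n; rewrite subrK.
apply=> s N sI; rewrite Phi'E; last by lraS.
by apply: MP => x; apply: TP => //; lraS.
Qed.

Lemma Phi_t_cts t : 0 <= t -> continuous (Phi t).
Proof.
move=> t0 u; apply/eps_cts => e e0; have [d d0 dP] := Phi_cts u t0 e0.
by exists d => // v uv; apply: dP => //; rewrite subrr normr0.
Qed.

(** A ball [B0] of the stronger norm is compact in [X] and is carried into itself from time tau on;
    Gamma is the intersection of its decreasing images at the times n tau. *)
Lemma attractor_exists : exists b L r Gamma, [/\ alpha < b < 1, 0 < r, global_attractor Phi Gamma & Gamma `<=` regular b L r].
Proof.
have [a0 al1 al2] := params.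
have [b [L [r [bI L0 r0 absb]]]] := absorbing.
have ab : alpha < b by lra.
pose B0 := [set u : X | hbd a b (coef u) L].
have cB : compact B0 by exact: hbd_compact.
have BM u : B0 u -> Xnorm u <= a `^ (alpha - b) * L.
 by move=> uB; apply: (Xnorm_le a0 al1); apply: (hbd_mono a0 _ uB); exact: ltW.
have [tau tau0 tauP] := absb (a `^ (alpha - b) * L).
have Bt u t : B0 u -> tau <= t -> regular b L r (Phi t u) by move=> /BM uM; exact: tauP.
pose K n := Phi (n%:R * tau) @` B0.
have nt0 n : 0 <= n%:R * tau by rewrite mulr_ge0 ?ler0n// ltW.
have cK n : compact (K n) by apply: continuous_compact cB; apply: continuous_subspaceT; exact: Phi_t_cts.
have KS n : K n.+1 `<=` K n.
 move=> _ [u uB <-]; exists (Phi tau u); first by have [] := Bt u tau uB (lexx _).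
 by rewrite -PhiD ?(ltW tau0)// -[in RHS]natr1 mulrDl mul1r.
have Kle m n : (m <= n)%N -> K n `<=` K m.
 by move=> /subnKC <-; elim: (n - m)%N => [|k IH]; [rewrite addn0 | rewrite addnS => u /KS/IH].
have K0 : K 0%N `<=` B0 by move=> _ [u uB <-]; rewrite mul0r Phi0.
pose Gamma := \bigcap_n K n.
(* Points taken in [K k] accumulate at a point of Gamma, and do so at arbitrarily late indices;
   nonemptiness, surjectivity and attraction all reduce to this. *)
have cluster (x : nat -> X) : (forall k, K k (x k)) -> exists2 p, Gamma p & forall e m, 0 < e ->
  exists2 k, (m <= k)%N & Xnorm (p - x k) < e.
 move=> xK; have [p pB [phi phiP pP]] := compact_seq cB (fun k => K0 _ (Kle 0%N k (leq0n k) _ (xK k))).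
 have app e m : 0 < e -> exists2 k, (m <= k)%N & Xnorm (p - x k) < e.
  move=> e0; pose k := maxn m (Num.truncn e^-1).
  exists (phi k); first exact: leq_trans (leq_maxl _ _) (phiP k).
  apply: lt_le_trans (pP k) _; rewrite -[X in _ <= X]invrK lef_pV2 ?posrE ?ltr0n ?invr_gt0//.
  apply: ltW; apply: lt_le_trans (truncnS_gt _) _; rewrite ler_nat ltnS leq_maxr//.
 exists p => // m _; apply: (compact_lim a0 al1 (cK m)) => e e0.
 by have [k mk pk] := app e m e0; exists (x k) => //; exact: Kle (xK k).
have Gr : Gamma `<=` regular b L r.
 by move=> v /(_ 1%N I)[u uB <-]; apply: Bt; rewrite ?mul1r.
exists b, L, r, Gamma; split=> //; split.
- have B00 : B0 0.
  split=> // N; rewrite /sqsum big1 ?sqr_ge0// => i _.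
  have -> : coef (0 : X) i = 0 by rewrite -[0 : X](scale0r 0) coefZ mul0r.
  by rewrite mulr0 expr0n.
 have [p pG _] := cluster (fun k => Phi (k%:R * tau) 0) (fun k => ex_intro2 _ _ 0 B00 erefl).
 by exists p.
- apply: (@subclosed_compact _ _ B0 _ cB); last by move=> v /(_ 0%N I)/K0.
 by apply: closed_bigI => n _; apply: compact_closed (cK n); exact: X_hausdorff.
- move=> t t0; rewrite eqEsubset; split=> [_ [v vG <-] n _|v vG].
  have [u uB <-] := vG n.+1 I; exists (Phi (t + tau) u); first by have [] := Bt u (t + tau) uB ltac:(lra).
  rewrite -!PhiD//; last by lra.
  by congr (Phi _ u); rewrite -[n.+1%:R]natr1; ring.
 (* The extra unit makes m tau - t at least tau, so that the flow over this time carries [B0] into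
    itself. *)
 pose m := (Num.truncn (t / tau)).+2.
 have mt : tau <= m%:R * tau - t.
  have := truncnS_gt (t / tau); rewrite ltr_pdivrMr// /m -[_.+2%:R]natr1; lra.
 have ex (k : nat) : exists u, B0 u /\ Phi ((k + m)%:R * tau) u = v by have [u uB uv] := vG (k + m)%N I; exists u.
 have [u uP] := choice ex.
 have [|p pG pP] := cluster (fun k => Phi (k%:R * tau) (Phi (m%:R * tau - t) (u k))).
  move=> k; exists (Phi (m%:R * tau - t) (u k)) => //.
  by have [uB _] := uP k; have [] := Bt (u k) _ uB mt.
 exists p => //; apply: (Xnorm_lim a0 al1) => e e0.
 have [d d0 dP] := Phi_cts p t0 e0.
 have [k _ pk] := pP d 0%N d0.
 have -> : v = Phi t (Phi (k%:R * tau) (Phi (m%:R * tau - t) (u k))).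
  have mt0 : 0 <= m%:R * tau - t by lra.
  rewrite -(PhiD _ t0 (nt0 k)) -(PhiD _ (addr_ge0 t0 (nt0 k)) mt0).
  by have [_ <-] := uP k; congr (Phi _ (u k)); rewrite natrD; ring.
 by have := dP t _ t0 _ pk; rewrite subrr normr0; apply.
- move=> B [M BM'] e e0; apply: contrapT => /forall2NP H.
 have [T T0 TP] := absb M.
 have ex (k : nat) : exists p : R * X, [/\ T + k%:R * tau <= p.1, B p.2 & forall v, Gamma v -> e <= Xnorm (Phi p.1 p.2 - v)].
  have [|/existsNP[t /existsNP[u /not_implyP[tT /not_implyP[uB uN]]]]] := H (T + k%:R * tau); first by have := nt0 k; move=> h []; lra.
  exists (t, u); split=> // v vG; rewrite leNgt; apply/negP => lt; apply: uN; by exists v.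
 have [p pP] := choice ex.
 have [|q qG qP] := cluster (fun k => Phi (p k).1 (p k).2).
  move=> k; have [pT pB _] := pP k; exists (Phi ((p k).1 - k%:R * tau) (p k).2).
   by have [] := TP (p k).2 (BM' _ pB) ((p k).1 - k%:R * tau) ltac:(lra).
  by rewrite -PhiD//; [congr (Phi _ _); ring | lra].
 have [k _ qk] := qP e 0%N e0; have [_ _ /(_ q qG)] := pP k.
 by rewrite XnormC leNgt qk.
Qed.

End attractor.

(** * First-order response to small perturbations *)

Section response.
Implicit Types (p : X) (x y : R).

Lemma small_pow (q e : R) : 0 < q -> 0 < e -> exists2 t0, 0 < t0 < 1 & forall t, 0 < t <= t0 -> t `^ q <= e.
Proof.
move=> q0 e0; exists (Num.min (1 / 2) (e `^ q^-1)).
 by rewrite lt_min powR_gt0// gt_min andbT; lra.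
move=> t /andP[t0]; rewrite le_min => /andP[_ te].
have -> : e = (e `^ q^-1) `^ q by rewrite -powRrM mulVf ?gt_eqF// powRr1 ?ltW.
by apply: powR_mono => //; exact: ltW.
Qed.

Lemma Xnorm_dist u v : `|Xnorm u - Xnorm v| <= Xnorm (u - v).
Proof.
have key (p q : X) : Xnorm p <= Xnorm q + Xnorm (p - q).
 by rewrite -[X in Xnorm X <= _](subrK q) addrC; exact: XnormD.
by have := key u v; have := key v u; rewrite (XnormC v) ler_norml; move: (Xnorm _) (Xnorm _) (Xnorm _) => A B C; clear -st; lra.
Qed.

Lemma unif_time p (T e : R) : 0 <= T -> 0 < e -> exists2 d, 0 < d & forall v, Xnorm (p - v) < d ->
 forall s, 0 <= s <= T -> Xnorm (Phi s p - Phi s v) < e.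
Proof.
move=> T0 e0; apply: contrapT => H.
have ex (k : nat) : exists q : R * X, [/\ 0 <= q.1 <= T, Xnorm (p - q.2) < k.+1%:R^-1 & e <= Xnorm (Phi q.1 p - Phi q.1 q.2)].
 apply: contrapT => H'; apply: H; exists k.+1%:R^-1 => [|v pv s sI]; first by rewrite invr_gt0 ltr0n.
 by rewrite ltNge; apply/negP => le; apply: H'; exists (s, v).
have [q qP] := choice ex.
have [|s sI [phi phiP sP]] := @compact_seq R R `[0, T]%classic (fun k => (q k).1) (@segment_compact R 0 T).
 by move=> k; have [] := qP k; rewrite /= in_itv.
have s0 : 0 <= s by move: sI; rewrite /= in_itv/= => /andP[].
have [d d0 dP] := Phi_cts p s0 (ltac:(lra) : 0 < e / 2).
have [k kd] := inv_small d0.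
have [/andP[q0 _] pq le_e] := qP (phi k).
have sq : `|s - (q (phi k)).1| < d by apply: lt_trans kd; exact: sP.
have pq' : Xnorm (p - (q (phi k)).2) < d.
 apply: lt_le_trans pq _; apply: ltW; apply: le_lt_trans kd.
 by rewrite inv_le ?phiP.
have H1 := dP _ p q0 sq ltac:(by rewrite subrr Xnorm0).
have H2 := dP _ _ q0 sq pq'.
have := Xtri (Phi (q (phi k)).1 p) (Phi s p) (Phi (q (phi k)).1 (q (phi k)).2).
rewrite (XnormC _ (Phi s p)); move: H1 H2 le_e; move: (Xnorm _) (Xnorm _) (Xnorm _) => A B C; clear -st; lra.
Qed.

Lemma coef_sub (g h : R -> R) n : continuous g -> continuous h -> coef (fun x => g x - h x) n = coef g n - coef h n.
Proof.
move=> cg ch; have -> : (fun x => g x - h x) = (fun x => g x + -1 * h x) by apply: funext => x; rewrite mulN1r.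
by rewrite /coef L2dotDl ?L2Z ?bas_L2 ?cts_L2// L2dotZl ?bas_L2 ?cts_L2// mulN1r.
Qed.

Definition C1le (r : R) u := forall x, `|u x| <= r /\ `|dX u x| <= r.

Lemma Fu_lip (r : R) : 0 <= r -> exists2 A, 0 <= A & forall u v N, C1le r u -> C1le r v ->
 sqsum (fun n => coef (Fu u) n - coef (Fu v) n) N <= (A * Xnorm (u - v)) ^+ 2.
Proof.
have [a0 al1 _] := params.
move=> r0; have [L L0 LP] := f_lip r0; have [C C0 CP] := X_C1 a0 al1; have p0 := @pi_gt0 R.
pose B := (2 * L + a) * C; have B0 : 0 <= B by rewrite mulr_ge0 ?(ltW C0)//; lra.
exists (Num.sqrt (2 * pi) * B) => [|u v N ur vr]; first by rewrite mulr_ge0 ?sqrtr_ge0.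
have cu := Fu_cts (u := u); have cv := Fu_cts (u := v).
have -> : sqsum (fun n => coef (Fu u) n - coef (Fu v) n) N = sqsum (coef (fun x => Fu u x - Fu v x)) N.
 by apply: eq_bigr => i _; rewrite coef_sub.
rewrite -mulrA exprMn sqr_sqrtr ?mulr_ge0 ?(ltW p0)//.
apply: coef_bound => // [|x _]; first exact: ctsB.
have [u1 u2] := ur x; have [v1 v2] := vr x; have [w1 w2] := CP (u - v) x.
rewrite XB in w1; rewrite (dXB a0 al1) in w2.
have := LP x _ _ _ _ u1 u2 v1 v2; rewrite /Fu.
set m := Xnorm _ in w1 w2 *; move: w1 w2; move: (f _) (f _) => G F; move: (u x) (v x) (dX u x) (dX v x) => U V U' V' w1 w2 H.
have -> : F + a * U - (G + a * V) = (F - G) + a * (U - V) by ring.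
apply: le_trans (ler_normD _ _) _; rewrite normrM (gtr0_norm a0).
have H1 : L * (`|U - V| + `|U' - V'|) <= L * (C * m + C * m) by apply: ler_wpM2l => //; exact: lerD.
have H2 : a * `|U - V| <= a * (C * m) by rewrite ler_pM2l.
by rewrite /B; move: H H1 H2; move: `|_| `|_| `|_| => A1 A2 A3; clear -st; lra.
Qed.

Lemma pair_ode u v S T : 0 <= S -> coef_ode a S T (fun t n => coef (Phi' u t) n - coef (Phi' v t) n)
 (fun t n => coef (Fu (Phi' u t)) n - coef (Fu (Phi' v t)) n).
Proof.
move=> S0; have [cu du] := sol_ode u T S0; have [cv dv] := sol_ode v T S0.
split=> [n|n t tI]; first exact: ctsB (cu n) (cv n).
by apply: deq (dB (du n t tI) (dv n t tI)) _; ring.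
Qed.

(** For short times the difference of two solutions is the heat semigroup applied to the initial
    difference, up to a relative error e: the nonlinear part is Lipschitz in [X] and contributes a
    factor of order t^(1 - alpha). *)
Lemma lin_response (r e : R) : 0 <= r -> 0 < e -> exists2 t0, 0 < t0 < 1 & forall p v t, 0 < t <= t0 ->
 (forall s, 0 <= s <= t -> C1le r (Phi s p) /\ C1le r (Phi s v)) ->
 hbd a alpha (fun n => coef (Phi t v) n - coef (Phi t p) n - expR (- (lam a n * t)) * (coef v n - coef p n)) (e * Xnorm (v - p)).
Proof.
have [a0 al1 al2] := params.
move=> r0 e0; have [A A0 AP] := Fu_lip r0.
have q0 : 0 < 1 - alpha by lraS.
(* The factor 1/2 first bounds the difference by twice its initial norm on [0, t]; the factor e / 2
   then gives the error e. *)
pose k := Num.min (1 / 2) (e / 2) * (1 - alpha) / (A + 1).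
have m0 : 0 < Num.min (1 / 2) (e / 2) by rewrite lt_min; lraS.
have k0 : 0 < k by rewrite divr_gt0 ?mulr_gt0//; lraS.
have [t0 t0I t0P] := small_pow q0 k0; exists t0 => // p v t tI bnd.
have t_0 : 0 < t by case/andP: tI.
have small s : 0 < s <= t -> A * s `^ (1 - alpha) / (1 - alpha) <= Num.min (1 / 2) (e / 2).
 move=> sI; have sk := t0P s ltac:(lraS).
 rewrite ler_pdivrMr//; apply: le_trans (ler_wpM2l A0 sk) _.
 rewrite /k mulrA ler_pdivrMr; last by lraS.
 by rewrite mulrC; apply: ler_wpM2l; [rewrite mulr_ge0 ?(ltW m0) ?(ltW q0) | lraS].
pose z s := Xnorm (Phi' v s - Phi' p s).
have cz : continuous z.
 move=> s; apply/cvgrPdist_lt => d d0; have d2 : 0 < d / 2 by lraS.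
 have [d1 d10 H1] := Phi'_cts v s d2; have [d3 d30 H3] := Phi'_cts p s d2.
 have [h [h0 hh1 hh3]] := below2 d10 d30.
 apply/nbhs_ballP; exists h => // s' /= ss'; apply: le_lt_trans (Xnorm_dist _ _) _.
 have -> : Phi' v s - Phi' p s - (Phi' v s' - Phi' p s') = (Phi' v s - Phi' v s') + (Phi' p s' - Phi' p s).
  by rewrite !opprD !opprK addrACA [X in _ + X]addrC.
 apply: le_lt_trans (XnormD _ _) _; rewrite (XnormC (Phi' p s')) [X in _ < X](splitr d).
 by apply: ltrD; [apply: H1 | apply: H3]; exact: lt_trans ss' _.
have [s0 s0I sM] := @EVT_max R z 0 t (ltW t_0) (continuous_subspaceT cz).
have z0E : z 0 = Xnorm (v - p) by rewrite /z !Phi'E// !Phi0.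
set m := Xnorm (v - p) in z0E *.
have z_ge0 s : 0 <= z s by exact: Xnorm_ge0.
have A0z : 0 <= A * z s0 by rewrite mulr_ge0.
have al01 : 0 <= alpha < 1 by lraS.
have duh s : 0 < s <= t -> hbd a alpha (fun n => coef (Phi' v s) n - coef (Phi' p s) n - expR (- (lam a n * (s - 0))) * (coef (Phi' v 0) n - coef (Phi' p 0) n)) (A * z s0 * (s - 0) `^ (1 - alpha) / (1 - alpha)).
 move=> sI; have s_0 : 0 < s by case/andP: sI.
 apply: (@duhamel_const _ a a0 alpha 0 s (A * z s0) _ _ al01 s_0 (pair_ode v p s (lexx 0)) A0z).
 move=> s' N s'I; have s'0 : 0 <= s' by lraS.
 have [b1 b2] := bnd s' ltac:(lraS).
 apply: le_trans (_ : (A * z s') ^+ 2 <= _); first by rewrite /z !Phi'E//; exact: AP.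
 rewrite lerXn2r ?nnegrE ?mulr_ge0//; apply: ler_wpM2l => //; apply: sM; rewrite in_itv/=; lraS.
have zm : z s0 <= 2 * m.
 have [s00|s0n] := eqVneq s0 0; first by rewrite s00 z0E; have := Xnorm_ge0 (v - p); rewrite -/m; lraS.
 have s0I' : 0 < s0 <= t by move: s0I; rewrite in_itv/= lt_def s0n.
 have s00 : 0 < s0 by case/andP: s0I'.
 have H := duh s0 s0I'; rewrite subr0 !Phi'E ?(ltW s00)// !Phi0 in H.
 have H0 : hbd a alpha (fun n => expR (- (lam a n * s0)) * (coef v n - coef p n)) m.
  have := @semi_smooth _ a a0 alpha alpha (coef (v - p)) m s0 _ s00 (Xhbd (v - p)).
  rewrite subrr oppr0 powRr0 mul1r (_ : (fun n => _ * coef (v - p) n) = (fun n => expR (- (lam a n * s0)) * (coef v n - coef p n))).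
   by apply; lraS.
  by apply: funext => n; rewrite coefB.
 have := hbdD H H0; rewrite (_ : (fun n => _ + _) = coef (Phi s0 v - Phi s0 p)); last first.
  by apply: funext => n; rewrite subrK coefB.
 move/(Xnorm_le a0 al1); rewrite -[X in X <= _]/(Xnorm (Phi s0 v - Phi s0 p)).
 have -> : Xnorm (Phi s0 v - Phi s0 p) = z s0 by rewrite /z !Phi'E ?(ltW s00).
 have := small s0 s0I'; rewrite le_min => /andP[S1 _].
 have : A * z s0 * s0 `^ (1 - alpha) / (1 - alpha) <= z s0 * (1 / 2).
  by rewrite (_ : A * z s0 * s0 `^ (1 - alpha) / (1 - alpha) = z s0 * (A * s0 `^ (1 - alpha) / (1 - alpha))); [apply: ler_wpM2l | ring].
 by move: (z s0) (_ / (1 - alpha)) => Z W; clear -st; lra.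
have tt : 0 < t <= t by rewrite t_0 lexx.
have := duh t tt; rewrite subr0 !Phi'E ?(ltW t_0)// !Phi0; apply: hbd_le.
have := small t tt; rewrite le_min => /andP[_ S1].
rewrite (_ : A * z s0 * t `^ (1 - alpha) / (1 - alpha) = z s0 * (A * t `^ (1 - alpha) / (1 - alpha))); last by ring.
apply: le_trans (ler_wpM2l (z_ge0 s0) S1) _.
have := ler_wpM2r (ltW e0) zm; move: (z s0) => Z; clear -st; lra.
Qed.

Lemma tp_coef_decay k A B n t : expR (- (lam a n * t)) * coef (@tp R k A B) n = expR (- ((a + k%:R ^+ 2) * t)) * coef (@tp R k A B) n.
Proof.
have [->//|/eqP ne] := eqVneq (lam a n) (a + k%:R ^+ 2).
have G : opG a (@bas R n) (lam a n *: bas n) by exact: opG_bas.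
by rewrite /coef L2dotC (eigen_orth A B (bas_L2 n) G ne) !mulr0.
Qed.

(* A perturbation of the data at time 0 whose effect at a small time t vanishes at x0 with prescribed slope sign. *)
Lemma steer (r : R) (x0 : R) (b : bool) : 0 <= r -> exists2 t0, 0 < t0 < 1 & exists2 Q, 0 < Q &
 forall p t, 0 < t <= t0 -> (forall s, 0 <= s <= 1 -> C1le r (Phi s p)) ->
 forall k0, 0 < k0 -> exists k, [/\ 0 < k < k0,
  exists q, [/\ Xnorm q <= Q, (forall x, `|Phi t (p + k *: q) x - Phi t p x| <= k * Q),
   Phi t (p + k *: q) x0 = Phi t p x0 & 0 < (-1) ^+ b * (dX (Phi t (p + k *: q)) x0 - dX (Phi t p) x0)] &
  exists q, [/\ Xnorm q <= Q, (forall x, `|Phi t (p + k *: q) x - Phi t p x| <= k * Q) &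
   0 < (-1) ^+ b * (Phi t (p + k *: q) x0 - Phi t p x0)]].
Proof.
have [a0 al1 al2] := params.
move=> r0; have [C C0 CP] := X_C1 a0 al1.
pose g : R := (-1) ^+ b.
have g2 : g * g = 1 by rewrite -expr2 sqrr_sign.
(* [q1] is g sin(x - x0), which vanishes at x0 with slope g, and [q2] is the constant 1. Both are
   eigenfunctions, so the linear flow only rescales them. *)
have [q1 q1E] := @tp_in_X R a alpha 1 (- (g * sin x0)) (g * cos x0).
have [q2 q2E] := @tp_in_X R a alpha 0 1 0.
pose Q0 := Xnorm q1 + Xnorm q2 + 1.
have Q00 : 0 < Q0 by have := Xnorm_ge0 q1; have := Xnorm_ge0 q2; rewrite /Q0; move: (Xnorm _) (Xnorm _) => A B; clear -st; lra.
(* With C e Q0 = 1/4 the nonlinear error is at most k / 4 in C^1, against linear effects of at least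
   k / 2. *)
pose e := (4 * C * Q0)^-1; have e0 : 0 < e by rewrite invr_gt0 !mulr_gt0.
have eE : C * (e * Q0) = 1 / 4 by rewrite /e; field; rewrite !gt_eqF.
have r1 : 0 <= r + 1 by clear -st r0; lra.
have [t0 t0I t0P] := lin_response r1 e0.
have t00 : 0 < t0 by case/andP: t0I.
(* Times with (a + 1) t < 1/2 keep the decay factors [e1] and [e2] above 1/2. *)
have a10 : 0 < (2 * (a + 1))^-1 by rewrite invr_gt0 mulr_gt0// addr_gt0.
have [t1 [t10 t1t0 t1a]] := below2 t00 a10.
exists t1; first by clear -st t10 t1t0 t0I; lra.
pose Q := Q0 + C * (e * Q0 + Q0).
exists Q => [|p t tI pb k0 k00]; first by rewrite addr_gt0// mulr_gt0// addr_gt0// mulr_gt0.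
have t_0 : 0 < t by case/andP: tI.
have [d d0 dP] := unif_time p ler01 (divr_gt0 ltr01 C0).
have [k [k_0 kk0 kd]] := below2 k00 (divr_gt0 d0 Q00).
pose q c := q1 + c *: q2; pose v c := p + k *: q c.
have qQ c : -1 <= c <= 1 -> Xnorm (q c) <= Q0.
 move=> cI; apply: le_trans (XnormD _ _) _; rewrite /Q0 -addrA lerD2l.
 apply: le_trans (XnormZ a0 al1 _ _) _; have := Xnorm_ge0 q2.
 have : `|c| <= 1 by rewrite ler_norml.
 by move=> c1 x0'; have := ler_wpM2r x0' c1; rewrite mul1r => H; apply: le_trans H _; rewrite lerDl ler01.
have vp c : Xnorm (v c - p) <= k * Xnorm (q c).
 by rewrite /v addrAC subrr add0r; apply: le_trans (XnormZ a0 al1 _ _) _; rewrite gtr0_norm.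
have vd c : -1 <= c <= 1 -> Xnorm (p - v c) < d.
 move=> cI; rewrite XnormC; apply: le_lt_trans (vp c) _.
 by apply: le_lt_trans (ler_wpM2l (ltW k_0) (qQ c cI)) _; rewrite -ltr_pdivlMr.
have C1v c s : -1 <= c <= 1 -> 0 <= s <= t -> C1le (r + 1) (Phi s p) /\ C1le (r + 1) (Phi s (v c)).
 move=> cI sI; have sI' : 0 <= s <= 1 by clear -st sI tI t1t0 t0I; lra.
 have pr := pb s sI'; split=> x; have [p1 p2] := pr x; first by clear -st p1 p2; lra.
 have [h1 h2] := CP (Phi s p - Phi s (v c)) x; have := dP (v c) (vd c cI) s sI'.
 rewrite ltr_pdivlMr// mulrC => H; rewrite XB in h1; rewrite (dXB a0 al1) in h2.
 move: p1 p2 h1 h2 H; move: (Phi s p x) (dX _ _) (Phi s (v c) x) (dX _ _) (C * _) => A1 A2 A3 A4 A5.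
 by rewrite !ler_norml; clear -st; lra.
pose e1 := expR (- ((a + 1%:R ^+ 2) * t)); pose e2 := expR (- ((a + 0%:R ^+ 2) * t)).
have at1 : (a + 1) * t < 1 / 2.
 have : t < (2 * (a + 1))^-1 by clear -st tI t1a; lra.
 rewrite -[X in _ < X]div1r ltr_pdivlMr; last by rewrite mulr_gt0// addr_gt0.
 by move: (a0); clear -st; lra.
have [e1h e2h] : 1 / 2 <= e1 /\ 1 / 2 <= e2.
 have h1 := expR_ge1Dx (- ((a + 1%:R ^+ 2) * t)); have h2 := expR_ge1Dx (- ((a + 0%:R ^+ 2) * t)).
 split; [apply: le_trans h1; rewrite expr1n | apply: le_trans h2; rewrite expr0n addr0]; by move: at1 t_0; clear -st; lra.
have [e11 e21] : e1 <= 1 /\ e2 <= 1.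
 by split; rewrite -expR0 ler_expR oppr_le0 mulr_ge0 ?(ltW t_0)// addr_ge0 ?sqr_ge0// ltW.
have F1 n : expR (- (lam a n * t)) * coef q1 n = e1 * coef q1 n.
 have -> : coef q1 n = coef (@tp R 1 (- (g * sin x0)) (g * cos x0)) n by congr (coef _ n); apply: funext.
 exact: tp_coef_decay.
have F2 n : expR (- (lam a n * t)) * coef q2 n = e2 * coef q2 n.
 have -> : coef q2 n = coef (@tp R 0 1 0) n by congr (coef _ n); apply: funext.
 exact: tp_coef_decay.
pose D c := Phi t (v c) - Phi t p - k *: (e1 *: q1 + (c * e2) *: q2).
have DQ c : -1 <= c <= 1 -> Xnorm (D c) <= k * (e * Q0).
 move=> cI; have H := t0P p (v c) t ltac:(clear -st tI t1t0; lra) (fun s => C1v c s cI).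
 apply: le_trans (_ : e * Xnorm (v c - p) <= _); last first.
  rewrite mulrCA; apply: ler_wpM2l; first exact: ltW.
  by apply: le_trans (vp c) _; apply: ler_wpM2l; [exact: ltW | exact: qQ].
 apply: (Xnorm_le a0 al1); move: H; congr (hbd _ _ _ _); apply: funext => n.
 have -> : coef (D c) n = coef (Phi t (v c)) n - coef (Phi t p) n - k * (e1 * coef q1 n + c * e2 * coef q2 n).
  by rewrite /D (coefB (Phi t (v c) - Phi t p)) coefB (coefZ k) (coefD (e1 *: q1)) (coefZ e1) (coefZ (c * e2)).
 have -> : coef (v c) n = coef p n + k * (coef q1 n + c * coef q2 n) by rewrite /v (coefD p) (coefZ k) (coefD q1) (coefZ c).
 move: (F1 n) (F2 n); move: (expR (- (lam a n * t))) (coef p n) (coef (Phi t _) n) (coef (Phi t p) n) (coef q1 n) (coef q2 n) => E P A' B' c1' c2' F1' F2'.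
 have -> : E * (P + k * (c1' + c * c2') - P) = k * (E * c1' + c * (E * c2')) by ring.
 by rewrite F1' F2'; ring.
have q1x : q1 x0 = 0 by rewrite q1E /tp mul1r; ring.
have q2x x : q2 x = 1 by rewrite q2E tp0E.
have dq1 : dX q1 x0 = g.
 apply: (dX_uniq a0 al1); rewrite (_ : phase_fun q1 = tp 1 (- (g * sin x0)) (g * cos x0)); last by apply: funext.
 apply: deq (tp_derive _ _ _ _) _; rewrite /tp !mul1r.
 transitivity (g * (cos x0 ^+ 2 + sin x0 ^+ 2)); first by ring.
 by rewrite cos2Dsin2 mulr1.
have dq2 x : dX q2 x = 0.
 apply: (dX_uniq a0 al1); rewrite (_ : phase_fun q2 = (fun _ => 1)); last by apply: funext.
 exact: dcst.
have DE c x : Phi t (v c) x - Phi t p x = D c x + k * (e1 * q1 x + c * e2 * q2 x).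
 by rewrite /D !XB XZ XD !XZ; ring.
have DE' c x : dX (Phi t (v c)) x - dX (Phi t p) x = dX (D c) x + k * (e1 * dX q1 x + c * e2 * dX q2 x).
 by rewrite /D !(dXB a0 al1) (dXZ a0 al1) (dXD a0 al1) !(dXZ a0 al1) subrK.
have Dx c x : -1 <= c <= 1 -> `|D c x| <= k / 4 /\ `|dX (D c) x| <= k / 4.
 move=> cI; have [h1 h2] := CP (D c) x; have := ler_wpM2l (ltW C0) (DQ c cI).
 rewrite mulrCA eE => H; split; [apply: le_trans h1 _ | apply: le_trans h2 _]; apply: le_trans H _; clear -st k_0; lra.
(* The constant component c tunes the displacement at x0, which changes sign between c = -1 and c =
   1. A zero of h gives the first perturbation, and c = g the second. *)
pose h c := Phi t (v c) x0 - Phi t p x0.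
have ch : continuous h.
 apply: ctsB; last exact: ctsC.
 move=> c; apply/cvgrPdist_lt => d1 d10.
 have [d2 d20 d2P] := Phi_cts (v c) (ltW t_0) (divr_gt0 d10 C0).
 have Xq2 := Xnorm_ge0 q2; have X1 : 0 < k * (Xnorm q2 + 1) by rewrite mulr_gt0// ltr_wpDl.
 apply/nbhs_ballP; exists (d2 / (k * (Xnorm q2 + 1))) => [|c' /= cc']; first exact: divr_gt0.
 have := d2P t (v c') (ltW t_0) ltac:(by rewrite subrr normr0).
 have vv : Xnorm (v c - v c') < d2.
  have -> : v c - v c' = (k * (c - c')) *: q2.
   by rewrite /v /q !scalerDr opprD addrACA subrr add0r opprD addrACA subrr add0r !scalerA -scalerBl mulrBr.
  apply: le_lt_trans (XnormZ a0 al1 _ _) _; rewrite normrM (gtr0_norm k_0).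
  move: cc'; rewrite ltr_pdivlMr// => cc'; apply: le_lt_trans cc'.
  rewrite [k * `|_|]mulrC -mulrA; apply: ler_wpM2l => //; apply: ler_wpM2l; [exact: ltW | by rewrite lerDl ler01].
 move=> /(_ vv); have [hx _] := CP (Phi t (v c) - Phi t (v c')) x0; rewrite XB in hx.
 by rewrite ltr_pdivlMr// mulrC; exact: le_lt_trans.
have h1 : 0 < h 1.
 have [d1 _] := @Dx 1 x0 ltac:(clear -st; lra); rewrite /h DE q1x q2x; move: d1 (ler_wpM2l (ltW k_0) e2h).
 by rewrite ler_norml; move: (D 1 x0) (e2) k_0 => A B; clear -st; lra.
have h2 : h (-1) < 0.
 have [d1 _] := @Dx (-1) x0 ltac:(clear -st; lra); rewrite /h DE q1x q2x; move: d1 (ler_wpM2l (ltW k_0) e2h).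
 by rewrite ler_norml; move: (D (-1) x0) (e2) k_0 => A B; clear -st; lra.
have [|c cI hc] := @IVT R h (-1) 1 0 ltac:(clear -st; lra) (continuous_subspaceT ch).
 by rewrite ge_min le_max (ltW h1) (ltW h2) orbT.
have cI' : -1 <= c <= 1 by move: cI; rewrite in_itv.
have Qb c' : -1 <= c' <= 1 -> Xnorm (q c') <= Q /\ forall x, `|Phi t (v c') x - Phi t p x| <= k * Q.
 move=> c'I; split.
  apply: le_trans (qQ c' c'I) _; rewrite lerDl mulr_ge0 ?(ltW C0)// addr_ge0 ?mulr_ge0 ?ltW//.
 move=> x; have [hx _] := CP (Phi t (v c') - Phi t p) x; rewrite XB in hx; apply: le_trans hx _.
 have : Xnorm (Phi t (v c') - Phi t p) <= k * (e * Q0 + Q0).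
  have -> : Phi t (v c') - Phi t p = D c' + k *: (e1 *: q1 + (c' * e2) *: q2) by rewrite /D subrK.
  apply: le_trans (XnormD _ _) _; rewrite mulrDr; apply: lerD; first exact: DQ.
  apply: le_trans (XnormZ a0 al1 _ _) _; rewrite (gtr0_norm k_0); apply: ler_wpM2l; first exact: ltW.
  apply: le_trans (XnormD _ _) _; rewrite /Q0; apply: le_trans (_ : Xnorm q1 + Xnorm q2 <= _); last by rewrite lerDl.
  apply: lerD; apply: le_trans (XnormZ a0 al1 _ _) _.
   by rewrite ger0_norm ?expR_ge0// ler_piMl ?Xnorm_ge0.
  rewrite ler_piMl ?Xnorm_ge0// normrM [`|e2|]ger0_norm ?expR_ge0//.
  by rewrite mulr_ile1 ?expR_ge0// ler_norml.
 move=> H; apply: le_trans (ler_wpM2l (ltW C0) H) _; rewrite mulrCA; apply: ler_wpM2l; first exact: ltW.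
 by rewrite /Q lerDr ltW.
exists k; split; first by rewrite k_0 kk0.
- have [B1 B2] := Qb c cI'; exists (q c); split=> //; first by apply/eqP; rewrite -subr_eq0; apply/eqP.
 have [_ d1] := Dx c x0 cI'; rewrite DE' dq1 dq2 mulr0 addr0 -/g.
 have -> : g * (dX (D c) x0 + k * (e1 * g)) = g * dX (D c) x0 + k * e1 by rewrite mulrDr; congr (_ + _); rewrite -[RHS]mul1r -g2; ring.
 have : `|g * dX (D c) x0| <= k / 4 by rewrite normrMsign.
 have := ler_wpM2l (ltW k_0) e1h; rewrite ler_norml; move: (g * _) (e1) k_0 => A B; clear -st; lra.
- have gI : -1 <= g <= 1 by rewrite /g; case: (b); rewrite ?expr0 ?expr1; clear -st; lra.
 have [B1 B2] := Qb g gI; exists (q g); split=> //; rewrite -/g.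
 suff : 0 < g * h g by [].
 by move: h1 h2; rewrite /g; case: (b); rewrite ?expr0 ?expr1; clear -st; [move: (h (-1)) | move: (h 1)] => H; lra.
Qed.

End response.

(** * Alternations of jointly recurrent pairs and of their limits *)

Section pairs.
Implicit Types (p : X) (x y r : R).

Definition W u v x : R := u x - v x.
Definition dW u v x : R := dX u x - dX v x.

Lemma W_derive u v x : is_derive x 1 (W u v) (dW u v x).
Proof.
have [a0 al1 _] := params.
exact: (dB (X_derive a0 al1 u x) (X_derive a0 al1 v x)).
Qed.

Lemma W_per u v x : W u v (x + 2 * pi) = W u v x.
Proof. by rewrite /W !Xper. Qed.

Lemma dW_per u v x : dW u v (x + 2 * pi) = dW u v x.
Proof.
have [a0 al1 _] := params.
by rewrite /dW !(dX_per a0 al1).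
Qed.

Lemma dW_cts u v : continuous (dW u v).
Proof.
have [a0 al1 _] := params.
by apply: ctsB; exact: dX_cts.
Qed.

Lemma W_close : exists2 C, 0 < C & forall u v u' v' e, Xnorm (u - u') < e / C -> Xnorm (v - v') < e / C ->
 (forall x, `|W u' v' x - W u v x| < 2 * e) /\ forall x, `|dW u' v' x - dW u v x| < 2 * e.
Proof.
have [a0 al1 _] := params.
have [C C0 CP] := X_C1 a0 al1; exists C => // u v u' v' e; rewrite !ltr_pdivlMr// => h1 h2.
split=> x; have [u1 u2] := CP (u - u') x; have [v1 v2] := CP (v - v') x.
 rewrite !XB in u1 v1; rewrite /W; move: h1 h2 u1 v1; rewrite ![_ * C]mulrC; move: (C * _) (C * _) (u x) (u' x) (v x) (v' x) => A B U U' V V'.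
 by rewrite !ler_norml ltr_norml; clear -st; lra.
rewrite !(dXB a0 al1) in u2 v2; rewrite /dW; move: h1 h2 u2 v2; rewrite ![_ * C]mulrC; move: (C * _) (C * _) (dX u x) (dX u' x) (dX v x) (dX v' x) => A B U U' V V'.
by rewrite !ler_norml ltr_norml; clear -st; lra.
Qed.

Lemma pdiffE u v t : 0 <= t -> pdiff u v t = W (Phi t u) (Phi t v).
Proof. by move=> t0; apply: funext => x; rewrite /pdiff !Phi'E. Qed.

Lemma pdiffxE u v t : 0 <= t -> pdiffx u v t = dW (Phi t u) (Phi t v).
Proof. by move=> t0; apply: funext => x; rewrite /pdiffx !Phi'E. Qed.

Lemma alt_mono r n u v t : 0 <= r -> (1 < n)%N -> ~~ odd n -> 0 <= t ->
 (forall s, 0 <= s <= t -> C1le r (Phi s u) /\ C1le r (Phi s v)) ->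
 alternates n (W (Phi t u) (Phi t v)) -> alternates n (W u v).
Proof.
move=> r0 n1 ne t0 b; have [C C0 CP] := pair_parabolic r0.
have pw : parabolic C t (pdiff u v) (pdiffx u v) (fun t x => Pxx u t x - Pxx v t x) (fun t x => Pt u t x - Pt v t x).
 by apply: CP => s x sI; have [H1 H2] := b s ltac:(clear -st sI; lra); [exact: H1 | exact: H2].
rewrite -(pdiffE u v t0) => /(alternates_sub_parabolic C0 n1 ne pw (t := t)).
by rewrite t0 lexx pdiffE// !Phi0; apply.
Qed.

Lemma Phi_close u t e : 0 <= t -> 0 < e -> exists2 d, 0 < d & forall v, Xnorm (u - v) < d -> Xnorm (Phi t u - Phi t v) < e.
Proof.
move=> t0 e0; have [d d0 dP] := Phi_cts u t0 e0; exists d => // v uv.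
by apply: dP => //; rewrite subrr normr0.
Qed.

Section compact_invariant.
Variables (r : R) (Gamma : set X).
Hypotheses (r_ge0 : 0 <= r) (GC1 : forall v, Gamma v -> C1le r v)
 (Ginv : forall t v, 0 <= t -> Gamma v -> Gamma (Phi t v)) (Gcpt : compact Gamma).

Ltac forget := clear -st r_ge0 GC1 Ginv Gcpt.

(** The same return times serve for u and v, so that the difference of the two solutions returns as
    well. *)
Definition jrec u v := [/\ Gamma u, Gamma v & forall e T, 0 < e -> exists2 t, T <= t &
 0 <= t /\ (Xnorm (Phi t u - u) < e /\ Xnorm (Phi t v - v) < e)].

Lemma jrec_sym u v : jrec u v -> jrec v u.
Proof.
by move=> [Gu Gv H]; split=> // e T e0; have [t tT [t0 [h1 h2]]] := H e T e0; exists t.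
Qed.

Lemma jrec_flow u v s : 0 <= s -> jrec u v -> jrec (Phi s u) (Phi s v).
Proof.
move=> s0 [Gu Gv H]; split; [exact: Ginv | exact: Ginv |] => e T e0.
have [d1 d10 h1] := Phi_close u s0 e0; have [d2 d20 h2] := Phi_close v s0 e0.
have [d [d0 dd1 dd2]] := below2 d10 d20.
have [t tT [t0 [r1 r2]]] := H d T d0; exists t => //; split=> //.
rewrite -!PhiD// [t + s]addrC !PhiD// ![Xnorm (Phi s (Phi t _) - _)]XnormC.
by split; [apply: h1 | apply: h2]; rewrite XnormC; [exact: lt_trans dd1 | exact: lt_trans dd2].
Qed.

(** At a return after time t the pair is close to (u, v), so it alternates too, and this goes back
    in time to t: along jointly recurrent pairs the count is constant. *)
Lemma jrec_alt_fwd n u v t : (1 < n)%N -> ~~ odd n -> 0 <= t -> jrec u v ->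
 alternates n (W u v) -> alternates n (W (Phi t u) (Phi t v)).
Proof.
move=> n1 ne t0 j H; have [Gu Gv rec] := j.
have [e e0 eP] := alternates_open H; have [C C0 CP] := W_close.
have [t' tt' [t'0 [r1 r2]]] := rec (e / 2 / C) t ltac:(by rewrite !divr_gt0).
have H1 : alternates n (W (Phi t' u) (Phi t' v)).
 apply: eP => x; have [h _] := CP u v (Phi t' u) (Phi t' v) (e / 2) ltac:(by rewrite XnormC) ltac:(by rewrite XnormC).
 by apply: lt_le_trans (h x) _; forget; lra.
have tt : 0 <= t' - t by clear -st r_ge0 GC1 Ginv Gcpt tt'; lra.
apply: (@alt_mono r n _ _ (t' - t)) => //.
 by move=> s sI; split; apply: GC1; apply: Ginv; [lra | exact: Ginv | lra | exact: Ginv].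
by rewrite -!PhiD// subrK.
Qed.

Lemma jrec_alt_bwd n u v t : (1 < n)%N -> ~~ odd n -> 0 <= t -> Gamma u -> Gamma v ->
 alternates n (W (Phi t u) (Phi t v)) -> alternates n (W u v).
Proof.
move=> n1 ne t0 Gu Gv; apply: (@alt_mono r) => // s sI.
by split; apply: GC1; apply: Ginv => //; lra.
Qed.

(** For n = [alt_bound C] the largest weight decays like exp(-t), while at return times the weight
    of one fixed configuration is at least 2^(-n) times its initial value. *)
Lemma jrec_bounded : exists M, forall u v, jrec u v -> ~ alternates (2 * M.+1) (W u v).
Proof.
have [C C0 CP] := pair_parabolic r_ge0.
pose n := alt_bound C; exists (Num.truncn (16 * pi ^+ 2 * (C + 1) ^+ 2 + 4 * pi * C * (C + 1) + 1)).
rewrite -[(2 * _)%N]/n; have n1 : (1 < n)%N by rewrite /n /alt_bound mulnS.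
suff key u v : jrec u v -> forall w : 'rV[R]_n, (forall i, 0 <= gap w i) -> ~ (forall i : 'I_n, 0 < (-1) ^+ i * W u v (w ord0 i)).
 move=> u v j [s [w [g0 H]]]; have [es|os] := boolP (~~ odd s).
  apply: (key u v j w g0) => i; have := H i.
  by rewrite exprD -signr_odd -(signr_odd _ s) (negbTE es) mulr1 signr_odd.
 apply: (key v u (jrec_sym j) w g0) => i; have := H i.
 rewrite exprD -(signr_odd _ s); move: os; rewrite negbK => -> /=; rewrite expr1 mulrN1 mulNr -mulrN.
 by rewrite /W opprB.
move=> j w0 g0 pos0; have [Gu Gv rec] := j.
have [w Kw wE] := alt_config_shift n1 g0.
have eta0 : 0 < alt_weight (C + 1) (W u v) w by rewrite (wE _ _ (W_per u v)); apply/alt_weight_gt0.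
have pos := elimT (alt_weight_gt0 _ _ _) eta0.
set eta := alt_weight _ _ _ in eta0.
have pw T : parabolic C T (pdiff u v) (pdiffx u v) (fun t x => Pxx u t x - Pxx v t x) (fun t x => Pt u t x - Pt v t x).
 by apply: CP => t x tI; apply: GC1; apply: Ginv => //; lra.
have w00 : pdiff u v 0 = W u v by rewrite pdiffE// !Phi0.
have [B B0 BP] : exists2 B, 0 < B & forall z : 'rV[R]_n, alt_config z -> alt_weight (C + 1) (W u v) z < B.
 have cw : continuous (fun p : R * 'rV[R]_n => alt_weight (C + 1) (pdiff u v p.1) p.2).
  by apply: alt_weight_cts; exact: par_cont (pw 0).
 have cz : continuous (fun z : 'rV[R]_n => alt_weight (C + 1) (W u v) z).
  rewrite -w00; apply: (cts_comp (f := fun z : 'rV[R]_n => (0, z)) _ cw).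
  by apply: cts_pair; [exact: ctsC | exact: cts_id].
 have K0 : (@alt_config R n) !=set0 by exists w.
 have [z _ zM] := compact_EVT_max K0 (@compact_alt_config R n) (continuous_subspaceT cz).
 exists (`|alt_weight (C + 1) (W u v) z| + 1) => [|z' z'K]; first by rewrite ltr_wpDl.
 by have := zM z'; rewrite inE => /(_ z'K); have := ler_norm (alt_weight (C + 1) (W u v) z); forget; lra.
have [m m0 mP] := finite_lb pos.
have [C' C'0 C'P] := W_close.
(* At a return closer than m / 2 each factor keeps at least half of its value. The waiting time B /
   q below makes B exp(-t) at most q. *)
pose q := (1 / 2) ^+ n * eta; have q0 : 0 < q by rewrite mulr_gt0// exprn_gt0.
have [t tT [t0 [r1 r2]]] := rec (m / 4 / C') (B / q) ltac:(by rewrite !divr_gt0).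
have [cl _] := C'P u v (Phi t u) (Phi t v) (m / 4) ltac:(by rewrite XnormC) ltac:(by rewrite XnormC).
have H1 : q <= alt_weight (C + 1) (W (Phi t u) (Phi t v)) w.
 rewrite /q /eta /alt_weight mulrA; apply: ler_wpM2r; first exact: expR_ge0.
 rewrite -[(1 / 2) ^+ n](_ : \prod_(i < n) (1 / 2) = _); last by rewrite prodr_const card_ord.
 rewrite -big_split/=; apply: ler_prod => i _.
 have p1 := pos i; have m1 := mP i; have c1 := cl (w ord0 i).
 have : `|(-1) ^+ i * W (Phi t u) (Phi t v) (w ord0 i) - (-1) ^+ i * W u v (w ord0 i)| < 2 * (m / 4).
  by rewrite -mulrBr normrMsign.
 move: p1 m1; move: ((-1) ^+ i * _) ((-1) ^+ i * _) => A A' p1 m1.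
 rewrite ltr_norml /posp => H; rewrite (gtr0_norm p1) gtr0_norm; last by move: m1 H; clear -st r_ge0 GC1 Ginv Gcpt m0; lra.
 by move: m1 H; clear -st r_ge0 GC1 Ginv Gcpt m0 p1; lra.
have := alt_bound_decay C0 B0 (pw t) (w := pdiff u v) _ (t := t) (v := w) _ Kw.
rewrite w00 => /(_ BP); rewrite t0 lexx => /(_ isT); rewrite pdiffE// => H2.
have : B * expR (- t) <= q.
 rewrite expRN ler_pdivrMr ?expR_gt0// mulrC -ler_pdivrMr//; apply: le_trans tT _.
 by have := expR_ge1Dx t; forget; lra.
by move: H1 H2; forget; lra.
Qed.

(** The counts are bounded, so a largest even K is attained along a subsequence; for K = 0 nothing
    is recorded about alternation. *)
Lemma jrec_level (ak bk : nat -> X) : (forall k, jrec (ak k) (bk k)) ->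
 exists K, [/\ ~~ odd K, (0 < K)%N -> forall n, exists2 k, (n <= k)%N & alternates K (W (ak k) (bk k)) &
  exists n0, forall k, (n0 <= k)%N -> ~ alternates K.+2 (W (ak k) (bk k))].
Proof.
move=> jk; have [M MP] := jrec_bounded.
pose P m := forall n, exists2 k, (n <= k)%N & alternates m (W (ak k) (bk k)).
have nP m : ~ P m -> exists n0, forall k, (n0 <= k)%N -> ~ alternates m (W (ak k) (bk k)).
 by move=> /existsNP[n0 H]; exists n0 => k nk Hk; apply: H; exists k.
apply: contrapT => H.
have all j : P (2 * j.+1)%N.
 elim: j => [|j IH]; apply: contrapT => /nP[n0 n0P]; apply: H.
  by exists 0%N; split=> //; exists n0.
 exists (2 * j.+1)%N; split=> //; first by rewrite oddM.
 by exists n0; move: n0P; rewrite (_ : (2 * j.+2)%N = (2 * j.+1).+2)//; lia.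
by have [k _ /MP] := all M 0%N; apply.
Qed.

(** A degenerate zero at time 1 could be split, by steering from a time t1 < 1 at which all zeros
    are simple, into K + 2 alternations at time 1, hence at t1 by monotonicity. But at t1 the limit
    has no K + 2 alternations, and a C^1-small perturbation of simple zeros cannot create them. *)
Lemma sz_limit (ak bk : nat -> X) A B : (forall k, jrec (ak k) (bk k)) -> Gamma A -> Gamma B ->
 (forall k, Xnorm (A - ak k) < k.+1%:R^-1) -> (forall k, Xnorm (B - bk k) < k.+1%:R^-1) ->
 Phi 1 A <> Phi 1 B -> forall x, W (Phi 1 A) (Phi 1 B) x = 0 -> dW (Phi 1 A) (Phi 1 B) x <> 0.
Proof.
have [a0 al1 _] := params.
move=> jk GA GB ak_A bk_B AB x0 W0 dW0.
have [K [Ke KP [n0 n0P]]] := jrec_level jk.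
have K2e : ~~ odd K.+2 by rewrite /= negbK.
have [C' C'0 C'P] := W_close.
have close e t : 0 < e -> 0 <= t <= 2 -> exists n, forall k, (n <= k)%N ->
  (forall x, `|W (Phi t (ak k)) (Phi t (bk k)) x - W (Phi t A) (Phi t B) x| < e) /\
  forall x, `|dW (Phi t (ak k)) (Phi t (bk k)) x - dW (Phi t A) (Phi t B) x| < e.
 move=> e0 tI; have t_0 : 0 <= t by case/andP: tI.
 have e2 : 0 < e / 2 / C' by rewrite !divr_gt0.
 have [d1 d10 h1] := Phi_close A t_0 e2; have [d2 d20 h2] := Phi_close B t_0 e2.
 have [d [d0 dd1 dd2]] := below2 d10 d20; have [n nd] := inv_small d0.
 exists n => k nk.
 have kd : k.+1%:R^-1 < d by apply: le_lt_trans nd; rewrite inv_le.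
 have := C'P (Phi t A) (Phi t B) (Phi t (ak k)) (Phi t (bk k)) (e / 2).
 rewrite (_ : 2 * (e / 2) = e); last by field.
 apply; [apply: h1; apply: lt_trans (ak_A k) _ | apply: h2; apply: lt_trans (bk_B k) _]; exact: lt_trans kd _.
have G t v : 0 <= t -> Gamma v -> C1le r (Phi t v) by move=> t_0 Gv; apply: GC1; exact: Ginv.
(* on [0, 2] the limit never alternates more than the approximating pairs *)
have noK2 t : 0 <= t <= 2 -> ~ alternates K.+2 (W (Phi t A) (Phi t B)).
 move=> tI H; have [e e0 eP] := alternates_open H; have [n nP] := close e t e0 tI.
 have [|h _] := nP (maxn n n0); first exact: leq_maxl.
 apply: (n0P (maxn n n0)); first exact: leq_maxr.
 have [Gu Gv _] := jk (maxn n n0).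
 by apply: (jrec_alt_bwd _ K2e _ Gu Gv (eP _ h)) => //; case/andP: tI.
have [C C0 CP] := pair_parabolic r_ge0.
have pw T : parabolic C T (pdiff A B) (pdiffx A B) (fun t x => Pxx A t x - Pxx B t x) (fun t x => Pt A t x - Pt B t x).
 by apply: CP => t x tI; apply: G => //; case/andP: tI => /ltW.
(* Forward uniqueness keeps the two solutions distinct up to time 1, and continuity a little
   beyond. *)
have [eta etaI nz] : exists2 eta, 0 < eta < 1 & forall t, 0 <= t <= 1 + eta -> exists x, pdiff A B t x <> 0.
 have d0 : 0 < Xnorm (Phi 1 A - Phi 1 B).
  rewrite lt_neqAle Xnorm_ge0 andbT eq_sym; apply/eqP => /(Xnorm_eq0 a0 al1)/eqP.
  by rewrite subr_eq0 => /eqP.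
 have [d1 d10 h1] := Phi_cts A ler01 (divr_gt0 d0 (ltr0n _ 2)).
 have [d2 d20 h2] := Phi_cts B ler01 (divr_gt0 d0 (ltr0n _ 2)).
 have [d3 [d30 dd1 dd2]] := below2 d10 d20; have [d [d_0 dd3 dd4]] := below2 d30 (ltr01 : 0 < 1 :> R).
 exists d => [|t tI]; first by rewrite d_0 dd4.
 apply: contrapT => H; have t_0 : 0 <= t by case/andP: tI.
 have E : Phi t A = Phi t B.
  apply: X_eq => x; apply: contrapT => ne; apply: H; exists x.
  by rewrite pdiffE// /W => /eqP; rewrite subr_eq0 => /eqP.
 have [t1|t1] := lerP t 1.
  have t1' : 0 <= 1 - t by rewrite subr_ge0.
  apply: AB; transitivity (Phi (1 - t) (Phi t A)); first by rewrite -PhiD// subrK.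
  by rewrite E -PhiD// subrK.
 have dt : `|1 - t| < d3 by rewrite ltr_norml; move: tI t1 dd3; forget; lra.
 have := h1 t A t_0 (lt_trans dt dd1) ltac:(by rewrite subrr Xnorm0).
 have := h2 t B t_0 (lt_trans dt dd2) ltac:(by rewrite subrr Xnorm0).
 have tri := Xtri (Phi 1 A) (Phi t A) (Phi 1 B); rewrite {2}E (XnormC (Phi t B)) in tri; move: tri.
 by move: (Xnorm _) (Xnorm _) (Xnorm _) => q1 q2 q3; forget; lra.
have noK20 : ~ alternates K.+2 (pdiff A B 0).
 by rewrite pdiffE//; apply: noK2; forget; lra.
have gen s0 s1 : 0 <= s0 -> s0 < s1 -> s1 <= 1 + eta -> exists2 t, s0 < t < s1 &
  forall x, W (Phi t A) (Phi t B) x = 0 -> dW (Phi t A) (Phi t B) x <> 0.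
 move=> s00 s01 s1e; have [t tI tz] := generic_simple_zeros C0 (pw (1 + eta)) (isT : (1 < K.+2)%N) K2e noK20 nz s00 s01 s1e.
 have t_0 : 0 <= t by case/andP: tI => /ltW h _; exact: le_trans h.
 by exists t => // x; have := tz x; rewrite pdiffE// pdiffxE.
have [t2 t2I sz2] := gen 1 (1 + eta) ler01 ltac:(clear -st r_ge0 GC1 Ginv Gcpt etaI; lra) (lexx _).
(* Simple zeros at [t2] > 1 make non-alternation stable in C^1, so the K alternations of the
   approximating pairs survive in the limit at [t2], and then go back to time 1. *)
have altK : (0 < K)%N -> alternates K (W (Phi 1 A) (Phi 1 B)).
 move=> K0; have K1 : (1 < K)%N by move: Ke K0; clear; case: K => [|[]].
 have t20 : 0 <= t2 by clear -st r_ge0 GC1 Ginv Gcpt t2I; lra.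
 have t22 : 0 <= t2 <= 2 by clear -st r_ge0 GC1 Ginv Gcpt t2I etaI; lra.
 have H2 : alternates K (W (Phi t2 A) (Phi t2 B)).
  apply: contrapT => H; have [e e0 eP] := alternates_closed Ke K1 (@dW_cts _ _) (W_derive _ _) (W_per _ _) (dW_per _ _) sz2 H.
  have [n nP] := close e t2 e0 t22; have [k nk kK] := KP K0 n; have [c1 c2] := nP k nk.
  apply: (eP _ _ (W_derive (Phi t2 (ak k)) (Phi t2 (bk k))) (W_per _ _) c1 c2).
  exact: jrec_alt_fwd.
 have t21 : 0 <= t2 - 1 by clear -st r_ge0 GC1 Ginv Gcpt t2I; lra.
 apply: (@jrec_alt_bwd K _ _ (t2 - 1)) => //; [exact: Ginv | exact: Ginv |].
 by rewrite -!PhiD// subrK.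
have nz1 : exists x, W (Phi 1 A) (Phi 1 B) x <> 0.
 by have [|x] := nz 1; [clear -st r_ge0 GC1 Ginv Gcpt etaI; lra | rewrite pdiffE//; exists x].
have W1d : is_derive x0 1 (W (Phi 1 A) (Phi 1 B)) 0 by rewrite -dW0; exact: W_derive.
(* an evolved small perturbation splits the degenerate zero *)
have [b bP] : exists b : bool, forall Q, 0 < Q -> exists2 k0, 0 < k0 & forall k v, 0 < k < k0 ->
  (forall x, `|v x - Phi 1 A x| <= k * Q) ->
  (v x0 = Phi 1 A x0 -> 0 < (-1) ^+ b * (dX v x0 - dX (Phi 1 A) x0) -> (0 < K)%N -> alternates K.+2 (W v (Phi 1 B))) /\
  (0 < (-1) ^+ b * (v x0 - Phi 1 A x0) -> K = 0%N -> alternates K.+2 (W v (Phi 1 B))).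
 have sgn (s : nat) (y : R) : (-1) ^+ s * - y = (-1) ^+ (odd s.+1) * y by rewrite signr_odd exprS mulN1r mulNr mulrN.
 have Wv v k : 0 < k -> W v (Phi 1 B) = (fun x => W (Phi 1 A) (Phi 1 B) x - k * - ((v x - Phi 1 A x) / k)).
  by move=> k_0; apply: funext => x; rewrite /W; field; rewrite gt_eqF.
 have yb v k Q : 0 < k -> (forall x, `|v x - Phi 1 A x| <= k * Q) -> forall x, `|- ((v x - Phi 1 A x) / k)| <= Q.
  by move=> k_0 H x; rewrite normrN normrM normfV (gtr0_norm k_0) ler_pdivrMr// mulrC.
 have yp v k x : - ((v (x + 2 * pi) - Phi 1 A (x + 2 * pi)) / k) = - ((v x - Phi 1 A x) / k) by rewrite !Xper.
 have [K0|K0] := posnP K.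
  have [s _ sP] := split_zero0 (W_per _ _) W0 nz1; exists (odd s.+1) => Q Q0.
  have [k0 k00 k0P] := sP Q Q0; exists k0 => // k v kI vQ; have k_0 : 0 < k by case/andP: kI.
  split=> [_ _|vx _]; first by rewrite K0.
  rewrite (Wv v k k_0) K0; apply: (k0P k _ kI (yp v k) (yb v k Q k_0 vQ)).
  by rewrite sgn mulrA divr_gt0.
 have K1 : (1 < K)%N by move: Ke K0; clear; case: K => [|[]].
 have [s _ sP] := split_zero K1 Ke (W_per _ _) W1d W0 (altK K0); exists (odd s.+1) => Q Q0.
 have [k0 k00 k0P] := sP Q Q0; exists k0 => // k v kI vQ; have k_0 : 0 < k by case/andP: kI.
 split=> [vx dvx _|_ K00]; last by move: K0; rewrite K00.
 rewrite (Wv v k k_0); apply: (k0P k _ (- ((dX v x0 - dX (Phi 1 A) x0) / k)) kI (yp v k) (yb v k Q k_0 vQ)).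
 - have d1 := dB (X_derive a0 al1 v x0) (X_derive a0 al1 (Phi 1 A) x0).
  rewrite (_ : (fun x => _) = (fun x => - (k^-1 * (v x - Phi 1 A x)))); last by apply: funext => x; rewrite [_ / k]mulrC.
  by apply: deq (dN (dcM k^-1 d1)) _; rewrite [_ / k]mulrC.
 - by rewrite vx subrr mul0r oppr0.
 - by rewrite sgn mulrA divr_gt0.
have r1 : 0 <= r + 1 by rewrite addr_ge0.
have cancel4 (x y z : R) : x + z - y - (x - y) = z by ring.
have [tau tauI [Q Q0 steerP]] := steer x0 b r_ge0.
(* A time within tau of 1, so that [steerP] applies over the remaining time h = 1 - t1. *)
have [t1 t1I sz1] := gen (1 - tau) 1 ltac:(clear -st r_ge0 GC1 Ginv Gcpt tauI; lra) ltac:(clear -st r_ge0 GC1 Ginv Gcpt tauI; lra) ltac:(clear -st r_ge0 GC1 Ginv Gcpt etaI; lra).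
have t10 : 0 <= t1 by clear -st r_ge0 GC1 Ginv Gcpt t1I tauI; lra.
have t12 : 0 <= t1 <= 2 by clear -st r_ge0 GC1 Ginv Gcpt t1I tauI; lra.
pose p := Phi t1 A; pose q := Phi t1 B; pose h := 1 - t1.
have hI : 0 < h <= tau by rewrite /h; clear -st r_ge0 GC1 Ginv Gcpt t1I; lra.
have h0 : 0 <= h by case/andP: hI => /ltW.
have pE : Phi h p = Phi 1 A by rewrite /p -PhiD// /h subrK.
have qE : Phi h q = Phi 1 B by rewrite /q -PhiD// /h subrK.
have Gp : Gamma p by exact: Ginv.
have Gq : Gamma q by exact: Ginv.
have [e e0 eP] := alternates_closed K2e (isT : (1 < K.+2)%N) (@dW_cts _ _) (W_derive _ _) (W_per _ _) (dW_per _ _) sz1 (noK2 t1 t12).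
have [k0 k00 bk0] := bP Q Q0.
have [C1 C10 C1P] := X_C1 a0 al1.
have [d d0 dP] := unif_time p ler01 (divr_gt0 ltr01 C10).
have [k1 [k10 k1k0 k1d]] := below2 k00 (divr_gt0 d0 Q0).
have [k2 [k20 k2k1 k2e]] := below2 k10 (divr_gt0 e0 (mulr_gt0 C10 Q0)).
have [k [kI [q1 [q1Q q1b q1x q1d]] [q2 [q2Q q2b q2x]]]] := steerP p h hI (fun s sI => G s p ltac:(by case/andP: sI) Gp) k2 k20.
have k_0 : 0 < k by case/andP: kI.
have kk0 : 0 < k < k0 by clear -st r_ge0 GC1 Ginv Gcpt kI k2k1 k1k0; lra.
(* It remains to find a direction w of size at most Q whose evolved perturbation has K + 2
   alternations at time 1; the bounds on k keep the perturbation C^1-close at t1 and its orbit in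
   the ball of radius r + 1. *)
suff [w [wQ walt]] : exists w, Xnorm w <= Q /\ alternates K.+2 (W (Phi h (p + k *: w)) (Phi 1 B)).
 have kw : Xnorm (k *: w) <= k * Q.
  by apply: le_trans (XnormZ a0 al1 _ _) _; rewrite gtr0_norm// ler_pM2l.
 have pw' : Xnorm (p - (p + k *: w)) < d.
  rewrite opprD addrA subrr add0r XnormN; apply: le_lt_trans kw _; rewrite -ltr_pdivlMr//.
  by clear -st r_ge0 GC1 Ginv Gcpt kI k2k1 k1d; lra.
 have kC : C1 * (k * Q) < e.
  rewrite mulrCA -ltr_pdivlMr ?mulr_gt0//; clear -st r_ge0 GC1 Ginv Gcpt kI k2e; lra.
 have far s : 0 <= s <= h -> C1le (r + 1) (Phi s (p + k *: w)).
  move=> sI x; have sI' : 0 <= s <= 1 by move: sI; rewrite /h; clear -st r_ge0 GC1 Ginv Gcpt t10; lra.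
  have [p1 p2] := G s p ltac:(by case/andP: sI) Gp x.
  have [c1 c2] := C1P (Phi s p - Phi s (p + k *: w)) x; have := dP _ pw' s sI'.
  rewrite ltr_pdivlMr// mulrC => H; rewrite XB in c1; rewrite (dXB a0 al1) in c2.
  move: p1 p2 c1 c2 H; move: (Phi s p x) (dX _ _) (Phi s (p + k *: w) x) (dX _ _) (C1 * _) => A1 A2 A3 A4 A5.
  by rewrite !ler_norml; forget; lra.
 apply: (eP (W (p + k *: w) q) (dW (p + k *: w) q) (W_derive _ _) (W_per _ _)).
 - move=> x; have [c1 _] := C1P (k *: w) x; apply: le_lt_trans kC.
  rewrite /W -/p -/q XD cancel4.
  by apply: le_trans c1 _; rewrite ler_pM2l.
 - move=> x; have [_ c2] := C1P (k *: w) x; apply: le_lt_trans kC.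
  rewrite /dW -/p -/q (dXD a0 al1) cancel4.
  by apply: le_trans c2 _; rewrite ler_pM2l.
 - apply: (@alt_mono (r + 1) _ _ _ h) => //; last by rewrite qE.
  move=> s sI; split; first exact: far.
  move=> x; have [p1 p2] := G s q ltac:(by case/andP: sI) Gq x; clear -st r_ge0 GC1 Ginv Gcpt p1 p2; lra.
have [K0|K0] := posnP K.
 exists q2; split=> //; have [_ H] := bk0 k (Phi h (p + k *: q2)) kk0 ltac:(by move=> x; rewrite -pE).
 by apply: H => //; rewrite -pE.
exists q1; split=> //; have [H _] := bk0 k (Phi h (p + k *: q1)) kk0 ltac:(by move=> x; rewrite -pE).
by apply: H; rewrite -?pE.
Qed.

End compact_invariant.
End pairs.

(** * Injectivity of the map to the plane *)

Section separation.
Implicit Types (p : X) (x y r : R).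
Variables (r : R) (Gamma : set X).
Hypotheses (r_ge0 : 0 <= r) (GC1 : forall v, Gamma v -> C1le r v)
 (Ginv : forall t v, 0 <= t -> Gamma v -> Gamma (Phi t v)) (Gcpt : compact Gamma).

Definition jclose u v := forall e, 0 < e -> exists u', exists2 v', jrec Gamma u' v' & Xnorm (u - u') < e /\ Xnorm (v - v') < e.

Lemma jrec_shift u s t : 0 <= s -> 0 <= t -> jrec Gamma u u -> jrec Gamma (Phi s u) (Phi t u).
Proof.
move=> s0 t0 ju; have [G1 _ H1] := jrec_flow Ginv s0 ju; have [Gu _ H] := ju.
split; [exact: G1 | exact: Ginv |] => e T e0.
have [d1 d10 h1] := Phi_close u s0 e0; have [d2 d20 h2] := Phi_close u t0 e0.
have [d [d0 dd1 dd2]] := below2 d10 d20.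
have [h hT [h0 [r1 _]]] := H d T d0; exists h => //; split=> //.
rewrite -!PhiD// [h + s]addrC [h + t]addrC !PhiD// ![Xnorm (Phi _ (Phi h u) - _)]XnormC.
by split; [apply: h1 | apply: h2]; rewrite XnormC; [exact: lt_trans dd1 | exact: lt_trans dd2].
Qed.

(** The pair is written as (Phi 1 A, Phi 1 B) in order to apply [sz_limit]: by recurrence each
    approximating pair is close to its image at some time t >= 1, and the pairs at the times t - 1
    accumulate at (A, B). *)
Lemma jclose_inj u v x0 : jclose u v -> u x0 = v x0 -> dX u x0 = dX v x0 -> u = v.
Proof.
move=> uv e1 e2; apply: contrapT => nuv.
have ex (k : nat) : exists q : X * X, jrec Gamma q.1 q.2 /\ (exists2 t, 1 <= t &
  Xnorm (u - Phi t q.1) < k.+1%:R^-1 /\ Xnorm (v - Phi t q.2) < k.+1%:R^-1).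
 have k0 : 0 < (k.+1%:R^-1 / 2 : R) by rewrite divr_gt0 ?invr_gt0 ?ltr0n.
 have [u' [v' j [h1 h2]]] := uv _ k0; exists (u', v'); split=> //.
 have [_ _ /(_ _ 1 k0)[t t1 [_ [g1 g2]]]] := j; exists t => //.
 rewrite /= [k.+1%:R^-1]splitr; rewrite XnormC in g1; rewrite XnormC in g2; split.
  exact: le_lt_trans (Xtri _ u' _) (ltrD h1 g1).
 exact: le_lt_trans (Xtri _ v' _) (ltrD h2 g2).
have {ex}[q qP] := choice ex.
have ex (k : nat) : exists c : X * X, [/\ jrec Gamma c.1 c.2,
  Xnorm (u - Phi 1 c.1) < k.+1%:R^-1 & Xnorm (v - Phi 1 c.2) < k.+1%:R^-1].
 have [j [t t1 [h1 h2]]] := qP k; have t10 : 0 <= t - 1 by rewrite subr_ge0.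
 have E : 1 + (t - 1) = t by rewrite addrC subrK.
 exists (Phi (t - 1) (q k).1, Phi (t - 1) (q k).2); split; first exact (jrec_flow Ginv t10 j).
  by rewrite /= -(PhiD _ ler01 t10) E; exact h1.
 by rewrite /= -(PhiD _ ler01 t10) E; exact h2.
have {ex}[c cP] := choice ex.
have [|[A B] [GA GB] [phi phiP cv]] := @compact_seq R (X * X)%type (Gamma `*` Gamma) c (compact_setX Gcpt Gcpt).
 by move=> k; have [[]] := cP k.
have cA k : Xnorm (A - (c (phi k)).1) < k.+1%:R^-1 by have [+ _] := cv k; rewrite /= Xball_.
have cB k : Xnorm (B - (c (phi k)).2) < k.+1%:R^-1 by have [_ +] := cv k; rewrite /= Xball_.
have lim w C (g : X * X -> X) : (forall k, Xnorm (C - g (c (phi k))) < k.+1%:R^-1) ->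
  (forall k, Xnorm (w - Phi 1 (g (c k))) < k.+1%:R^-1) -> Phi 1 C = w.
 move=> h1 h2; apply: Xnorm_lim; [exact: st_a st | by case/andP: (st_al st) |] => e e0.
 have e02 : 0 < e / 2 by rewrite divr_gt0.
 have [d d0 dP] := Phi_close C ler01 e02.
 have [k [k0 kd ke]] := below2 d0 e02; have [n nk] := inv_small k0.
 apply: le_lt_trans (Xtri _ (Phi 1 (g (c (phi n)))) _) _; rewrite [e]splitr; apply: ltrD.
  by apply: dP; apply: lt_trans (h1 n) (lt_trans nk kd).
 rewrite XnormC; apply: lt_trans (h2 _) _; apply: le_lt_trans (_ : n.+1%:R^-1 < _); last exact: lt_trans nk ke.
 by rewrite inv_le ?phiP.
have EA : Phi 1 A = u by apply: (lim u A fst cA) => k; have [_ h _] := cP k; exact h.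
have EB : Phi 1 B = v by apply: (lim v B snd cB) => k; have [_ _ h] := cP k; exact h.
have jc k : jrec Gamma (c (phi k)).1 (c (phi k)).2 by have [] := cP (phi k).
have := @sz_limit r Gamma r_ge0 GC1 Ginv _ _ A B jc GA GB cA cB.
rewrite EA EB => /(_ nuv x0); rewrite /W /dW e1 e2 !subrr => /(_ erefl); exact.
Qed.

End separation.

(** * Continuity of the velocity on the attractor *)

Section time_regularity.
Implicit Types (p : X) (x y r h : R).

(** The properties of the attractor used from here on. Surjectivity [ic_sur] lets every point be
    seen as the end of a time interval on which [smoothing] acts. *)
Record invariant_compact (r M : R) (Gamma : set X) : Prop := InvariantCompact {
 ic_r : 0 <= r; ic_M : 0 <= M; ic_C1 : forall v, Gamma v -> C1le r v;
 ic_bd : forall v, Gamma v -> Xnorm v <= M;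
 ic_inv : forall t v, 0 <= t -> Gamma v -> Gamma (Phi t v);
 ic_sur : forall t v, 0 <= t -> Gamma v -> exists2 w, Gamma w & Phi t w = v;
 ic_cpt : compact Gamma }.

Lemma coef_odeB S T z g z' g' : coef_ode a S T z g -> coef_ode a S T z' g' ->
 coef_ode a S T (fun t n => z t n - z' t n) (fun t n => g t n - g' t n).
Proof.
move=> [c1 d1] [c2 d2]; split=> [n|n t tI]; first exact: ctsB.
by apply: deq (dB (d1 n t tI) (d2 n t tI)) _; ring.
Qed.

Lemma coefB_le u v L : hbd a alpha (fun n => coef u n - coef v n) L -> Xnorm (u - v) <= L.
Proof.
have [a0 al1 al2] := params; move=> H; apply: (Xnorm_le a0 al1).
by rewrite (_ : coef _ = (fun n => coef u n - coef v n))//; apply: funext => n; rewrite coefB.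
Qed.

Lemma Xhbd_sub u v L : Xnorm (u - v) <= L -> hbd a alpha (fun n => coef u n - coef v n) L.
Proof.
have /andP[al1 al2] := st_al st; move=> H; apply: hbd_le H _.
rewrite (_ : (fun n => _) = coef (u - v)); first exact: Xhbd.
by apply: funext => n; rewrite coefB.
Qed.

(** The solutions from Phi h w and from w differ by O(h^alpha) in L^2 at time 0, and [smoothing]
    converts this into the norm of [X] at time tau, where w is chosen with Phi tau w = v. *)
Lemma first_difference r M Gamma : invariant_compact r M Gamma ->
 exists2 C, 0 < C & forall v h, Gamma v -> 0 < h <= 1 -> Xnorm (Phi h v - v) <= C * h `^ alpha.
Proof.
have [a0 al1 al2] := params.
move=> G; have r0 := ic_r G; have M0 := ic_M G.
have [M1 M10 MP] := Fu_bound r0; have [A A0 AP] := Fu_lip r0.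
have al01 : 0 < alpha < 1 by clear -st al1 al2; lra.
have [tau [K [tauI K0 KP]]] := @smoothing _ a a0 alpha A al01 A0.
exists (K * (M1 + M + 1)) => [|v h Gv hI]; first by rewrite mulr_gt0//; clear -st M10 M0; lra.
have h0 : 0 < h by case/andP: hI.
have tau0 : 0 <= tau by clear -st tauI; lra.
have [w Gw wv] := ic_sur G tau0 Gv.
pose z := fun (t : R) (n : nat) => coef (Phi' (Phi h w) t) n - coef (Phi' w t) n.
have D0 : hbd a 0 (z 0) ((M1 + M) * h `^ alpha).
 have b01 : 0 <= (0:R) < 1 by rewrite lexx ltr01.
 have H1 := @duhamel_const _ a a0 0 0 h M1 _ _ b01 h0 (sol_ode w h (lexx 0)) M10.
 have Hb t N : 0 < t < h -> sqsum (coef (Fu (Phi' w t))) N <= M1 ^+ 2.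
  by move=> /andP[/ltW t0 _]; rewrite Phi'E//; apply: MP; apply: (ic_C1 G); exact: (ic_inv G).
 have {}H1 := H1 Hb.
 have H2 := @semi_cont _ a a0 alpha 0 (coef w) M h _ h0 (hbd_le (ic_bd G Gw) (Xhbd w)).
 have := hbdD H1 (H2 _).
 rewrite !Phi'E ?lexx ?(ltW h0)// !Phi0 !subr0 powRr1 ?(ltW h0)// divr1 => H.
 rewrite (_ : z 0 = fun n => coef (Phi h w) n - expR (- (lam a n * h)) * coef w n + (expR (- (lam a n * h)) - 1) * coef w n).
  apply: (hbd_le _ (H _)).
  - by rewrite mulrDl [M * _]mulrC lerD2r ler_wpM2l// ger1_powR// ltW.
  by clear -st al1 al2; lra.
 by apply: funext => n; rewrite /z !Phi'E ?lexx// !Phi0; ring.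
have zE t : 0 <= t -> z t = fun n => coef (Phi h (Phi t w)) n - coef (Phi t w) n.
 by move=> t0; rewrite /z !Phi'E// -!PhiD// ?(ltW h0)// addrC.
have Ph t : 0 <= t -> Gamma (Phi t w) by move=> t0; apply: (ic_inv G).
have H := KP z _ _ 0 (2 * M) (pair_ode (Phi h w) w 1 (lexx 0)) (lexx 0) D0.
rewrite addr0 in H; rewrite -mulrA; apply: coefB_le; rewrite -wv -zE//.
apply: hbd_le (H _ _).
- by rewrite ler_pM2l// ler_wpM2r ?powR_ge0// lerDl ler01.
- move=> t tI; have t0 : 0 <= t by clear -st tI; lra.
 rewrite zE//; apply: Xhbd_sub; apply: le_trans (XnormD _ _) _; rewrite XnormN mulr2n mulrDl !mul1r.
 by apply: lerD; apply: (ic_bd G); [apply: (ic_inv G) (ltW h0) _|]; exact: Ph.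
- move=> t m tI; have t0 : 0 <= t by clear -st tI; lra.
 rewrite zE// addr0 => /coefB_le le N; rewrite !Phi'E// -!PhiD// ?(ltW h0)// [t + h]addrC PhiD// ?(ltW h0)//.
 apply: le_trans (AP _ _ N (ic_C1 G (ic_inv G (ltW h0) (Ph t t0))) (ic_C1 G (Ph t t0))) _.
 by rewrite lerXn2r ?nnegrE ?mulr_ge0 ?Xnorm_ge0 ?(le_trans _ le) ?ler_wpM2l// Xnorm_ge0.
Qed.

Lemma Fu_second r : 0 <= r -> exists2 A, 0 <= A & forall u0 u1 u2 m d N, C1le r u0 -> C1le r u1 -> C1le r u2 ->
 Xnorm ((u2 - u1) - (u1 - u0)) <= m -> Xnorm (u2 - u1) <= d -> Xnorm (u1 - u0) <= d ->
 sqsum (fun n => (coef (Fu u2) n - coef (Fu u1) n) - (coef (Fu u1) n - coef (Fu u0) n)) N <= (A * (m + d ^+ 2)) ^+ 2.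
Proof.
have [a0 al1 _] := params.
move=> r0; have [_ cf] := st_A st; have [L L0 LP] := second_diff cf r0; have [C C0 CP] := X_C1 a0 al1; have p0 := @pi_gt0 R.
pose B := (2 * L + a) * C + 16 * L * C ^+ 2; have B0 : 0 <= B.
 by rewrite addr_ge0 ?mulr_ge0 ?exprn_ge0 ?(ltW C0)//; clear -st L0 a0; lra.
exists (Num.sqrt (2 * pi) * B) => [|u0 u1 u2 m d N b0 b1 b2 m2 d1 d0]; first by rewrite mulr_ge0 ?sqrtr_ge0.
have c u := Fu_cts (u := u).
rewrite (_ : sqsum _ N = sqsum (coef (fun x => (Fu u2 x - Fu u1 x) - (Fu u1 x - Fu u0 x))) N); last first.
 by apply: eq_bigr => i _; rewrite coef_sub ?coef_sub//; exact: ctsB.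
have m0 : 0 <= m := le_trans (Xnorm_ge0 _) m2.
rewrite -mulrA exprMn sqr_sqrtr ?mulr_ge0 ?(ltW p0)//.
apply: coef_bound => [|x xI]; first by apply: ctsB; exact: ctsB.
have [p1 q1] := b0 x; have [p2 q2] := b1 x; have [p3 q3] := b2 x.
have [w1 w2] := CP (u2 - u1 - (u1 - u0)) x; have [v1 v2] := CP (u2 - u1) x; have [z1 z2] := CP (u1 - u0) x.
rewrite !XB in w1 v1 z1; rewrite !(dXB a0 al1) in w2 v2 z2.
have := LP x _ _ _ _ _ _ (And3 xI p1 q1) (And3 xI p2 q2) (And3 xI p3 q3); rewrite /Fu.
have {m2}m2 := ler_wpM2l (ltW C0) m2; have {d1}d1 := ler_wpM2l (ltW C0) d1; have {d0}d0 := ler_wpM2l (ltW C0) d0.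
have {}w1 := le_trans w1 m2; have {}w2 := le_trans w2 m2; have {}v1 := le_trans v1 d1; have {}v2 := le_trans v2 d1.
have {}z1 := le_trans z1 d0; have {}z2 := le_trans z2 d0.
move: w1 w2 v1 v2 z1 z2; move: (f (x, u0 x, _)) (f (x, u1 x, _)) (f (x, u2 x, _)) => F0 F1 F2.
move: (u0 x) (u1 x) (u2 x) (dX u0 x) (dX u1 x) (dX u2 x) => U0 U1 U2 V0 V1 V2 w1 w2 v1 v2 z1 z2.
have -> : F2 - 2 * F1 + F0 = (F2 - F1) - (F1 - F0) by ring.
have -> : U2 - 2 * U1 + U0 = (U2 - U1) - (U1 - U0) by ring.
have -> : V2 - 2 * V1 + V0 = (V2 - V1) - (V1 - V0) by ring.
have -> : F2 + a * U2 - (F1 + a * U1) - (F1 + a * U1 - (F0 + a * U0)) = (F2 - F1) - (F1 - F0) + a * ((U2 - U1) - (U1 - U0)) by ring.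
move=> H; apply: le_trans (ler_normD _ _) _; rewrite normrM (gtr0_norm a0).
have H1 : L * (`|(U2 - U1) - (U1 - U0)| + `|(V2 - V1) - (V1 - V0)|) <= L * (C * m + C * m) by apply: ler_wpM2l => //; exact: lerD.
have H2 : a * `|(U2 - U1) - (U1 - U0)| <= a * (C * m) by rewrite ler_pM2l.
have H3 : L * (`|U2 - U1| + `|U1 - U0| + `|V2 - V1| + `|V1 - V0|) ^+ 2 <= L * (C * d + C * d + C * d + C * d) ^+ 2.
 apply: ler_wpM2l => //; have D0 : 0 <= C * d := le_trans (normr_ge0 _) v1.
 rewrite lerXn2r ?nnegrE ?addr_ge0//; apply: lerD => //; apply: lerD => //; exact: lerD.
have H4 : 0 <= 16 * L * C ^+ 2 * m by rewrite !mulr_ge0 ?exprn_ge0 ?(ltW C0).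
have H5 : 0 <= (2 * L + a) * C * d ^+ 2 by rewrite mulr_ge0 ?sqr_ge0// mulr_ge0 ?(ltW C0)//; clear -st L0 a0; lra.
apply: le_trans (lerD H (lexx _)) _; apply: le_trans (lerD (lerD H1 H3) H2) _.
have -> : L * (C * m + C * m) + L * (C * d + C * d + C * d + C * d) ^+ 2 + a * (C * m) = B * (m + d ^+ 2) - 16 * L * C ^+ 2 * m - (2 * L + a) * C * d ^+ 2.
 by rewrite /B; ring.
by rewrite -addrA gerDl -opprD oppr_le0 addr_ge0.
Qed.

(** Same scheme one order higher: the nonlinearity contributes squares of first differences, h^(2
    alpha) <= h^(3/2) because alpha > 3/4. A power of h above 1 is what makes difference quotients
    converge. *)
Lemma second_difference r M Gamma : invariant_compact r M Gamma ->
 exists2 C, 0 < C & forall v h, Gamma v -> 0 < h <= 1 -> Xnorm ((Phi h (Phi h v) - Phi h v) - (Phi h v - v)) <= C * (h * Num.sqrt h).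
Proof.
have [a0 al1 al2] := params.
move=> G; have r0 := ic_r G; have M0 := ic_M G.
have [C1 C10 CP] := first_difference G.
have [A A0 AP] := Fu_lip r0; have [B B0 BP] := Fu_second r0.
have al01 : 0 < alpha < 1 by clear -st al1 al2; lra.
have [tau [K [tauI K0 KP]]] := @smoothing _ a a0 alpha B al01 B0.
exists (K * (A * C1 + C1 + B * C1 ^+ 2)) => [|v h Gv hI].
 rewrite mulr_gt0//; have := mulr_ge0 A0 (ltW C10); have := mulr_ge0 B0 (sqr_ge0 C1).
 by move: (A * C1) (B * _) => x y; clear -st C10; lra.
have /andP[h0 h1] := hI; have hh := ltW h0.
have tau0 : 0 <= tau by clear -st tauI; lra.
have [w0 Gw0 wv] := ic_sur G tau0 Gv.
pose q := h `^ alpha; have q0 : 0 <= q := powR_ge0 _ _.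
have hq : h <= q by apply: ger1_powR => //; exact: ltW.
have qq : q * q <= h * Num.sqrt h.
 have e : h * Num.sqrt h = h `^ (3 / 4) * h `^ (3 / 4).
  rewrite -powRD ?(gt_eqF h0) ?implybT// -(powR12_sqrt hh) -[X in X * _](powRr1 hh) -powRD ?(gt_eqF h0) ?implybT//; congr powR; clear -st; lra.
 rewrite e; have le : q <= h `^ (3 / 4) by apply: ger_powR => //; exact: ltW.
 by apply: ler_pM.
pose w1 := Phi h w0; pose w2 := Phi h w1.
pose z := fun (t : R) (n : nat) => (coef (Phi' w2 t) n - coef (Phi' w1 t) n) - (coef (Phi' w1 t) n - coef (Phi' w0 t) n).
have D0 : hbd a 0 (z 0) ((A * C1 + C1) * (q * q)).
 have b01 : 0 <= (0:R) < 1 by rewrite lexx ltr01.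
 have m1 : 0 <= A * (C1 * q) by rewrite mulr_ge0 ?mulr_ge0 ?(ltW C10).
 have H1 := @duhamel_const _ a a0 0 0 h (A * (C1 * q)) _ _ b01 h0 (pair_ode w1 w0 h (lexx 0)) m1.
 have H2 := @semi_cont _ a a0 alpha 0 _ _ h _ h0 (Xhbd_sub (CP w0 h Gw0 hI)).
 have := hbdD (H1 _) (H2 _); rewrite -/w1 -/q.
 rewrite !Phi'E ?lexx// !Phi0 !subr0 powRr1// divr1 => H.
 rewrite (_ : z 0 = fun n => coef (Phi h w1) n - coef (Phi h w0) n - expR (- (lam a n * h)) * (coef w1 n - coef w0 n) + (expR (- (lam a n * h)) - 1) * (coef w1 n - coef w0 n)).
  apply: (hbd_le _ (H _ _)).
  - rewrite mulrDl; apply: lerD; last by rewrite mulrCA.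
   by rewrite !mulrA ler_wpM2l// !mulr_ge0 ?(ltW C10).
  - move=> t N /andP[/ltW t0 th]; rewrite !Phi'E// /w1 -PhiD// addrC PhiD//.
   have Gt : Gamma (Phi t w0) by exact: (ic_inv G).
   apply: le_trans (AP _ _ N (ic_C1 G (ic_inv G hh Gt)) (ic_C1 G Gt)) _.
   rewrite lerXn2r ?nnegrE ?mulr_ge0 ?Xnorm_ge0 ?(ltW C10)//.
   by apply: ler_wpM2l => //; exact: CP.
  by clear -st al1 al2; lra.
 by apply: funext => n; rewrite /z !Phi'E ?lexx// !Phi0 /w2 /w1; ring.
have zE t : 0 <= t -> z t = fun n => coef (Phi h (Phi h (Phi t w0)) - Phi h (Phi t w0)) n - coef (Phi h (Phi t w0) - Phi t w0) n.
 move=> t0; rewrite /z !Phi'E//; apply: funext => n; rewrite !coefB /w2 /w1.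
 have hc u : Phi t (Phi h u) = Phi h (Phi t u) by rewrite -!PhiD// addrC.
 by rewrite !hc.
have Ph t : 0 <= t -> Gamma (Phi t w0) by move=> t0; apply: (ic_inv G).
have S0 : 0 <= B * (C1 * q) ^+ 2 by rewrite mulr_ge0 ?sqr_ge0.
have H := KP z _ _ _ (4 * M) (coef_odeB (pair_ode w2 w1 1 (lexx 0)) (pair_ode w1 w0 1 (lexx 0))) S0 D0.
apply: le_trans (_ : K * ((A * C1 + C1 + B * C1 ^+ 2) * (q * q)) <= _); last first.
 by rewrite -[X in _ <= X]mulrA ler_pM2l// ler_wpM2l// !addr_ge0 ?mulr_ge0 ?sqr_ge0 ?(ltW C10).
rewrite [_ * (q * q)]mulrDl (_ : B * C1 ^+ 2 * (q * q) = B * (C1 * q) ^+ 2); last by ring.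
apply: coefB_le; rewrite -wv -zE//; apply: H.
- move=> t tI; have t0 : 0 <= t by clear -st tI; lra.
 rewrite zE//; apply: Xhbd_sub; have g0 := Ph t t0; have g1 := ic_inv G hh g0; have g2 := ic_inv G hh g1.
 have Nn (u u' : X) : Gamma u -> Gamma u' -> Xnorm (u - u') <= 2 * M.
  move=> Gu Gv'; apply: le_trans (XnormD _ _) _; rewrite XnormN mulr2n mulrDl !mul1r.
  by apply: lerD; exact: (ic_bd G).
 have k1 := Nn _ _ g2 g1; have k2 := Nn _ _ g1 g0.
 apply: le_trans (XnormD _ _) _; rewrite XnormN; apply: le_trans (lerD k1 k2) _.
 by rewrite -mulrDl; clear -st M0; lra.
- move=> t m tI; have t0 : 0 <= t by clear -st tI; lra.
 have g0 := Ph t t0; have g1 := ic_inv G hh g0; have g2 := ic_inv G hh g1.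
 rewrite zE// => /coefB_le le N; rewrite !Phi'E// /w2 /w1.
 have hc u : Phi t (Phi h u) = Phi h (Phi t u) by rewrite -!PhiD// addrC.
 rewrite !hc.
 have := BP _ _ _ _ _ N (ic_C1 G g0) (ic_C1 G g1) (ic_C1 G g2) le (CP _ h g1 hI) (CP _ h g0 hI).
 by rewrite -/q mulrDr.
Qed.

Definition quotient v (x0 : R) (k : nat) : R := (Phi (2^-1 ^+ k) v x0 - v x0) / 2^-1 ^+ k.

(** Consecutive dyadic quotients differ by a second difference divided by the step, that is O(sqrt
    h), summable uniformly over Gamma; the limit is the velocity. *)
Lemma quotient_limit r M Gamma x0 : invariant_compact r M Gamma -> forall e, 0 < e ->
 exists k, forall w t, Gamma w -> 0 < t -> `|quotient (Phi t w) x0 k - Pt w t x0| <= e.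
Proof.
have [a0 al1 al2] := params.
move=> G e e0; have [C C0 CP] := second_difference G; have [D D0 DP] := X_C1 a0 al1.
pose hk k : R := 2^-1 ^+ k; pose th : R := Num.sqrt 2^-1.
have h0 k : 0 < hk k by rewrite exprn_gt0// invr_gt0.
have hS k : hk k = 2 * hk k.+1 by rewrite /hk exprS mulrA divff ?mul1r// pnatr_eq0.
have h1 k : hk k <= 1 by rewrite exprn_ile1// invf_le1// ler1n.
have th0 : 0 < th by rewrite sqrtr_gt0 invr_gt0.
have th1 : th < 1 by rewrite -[X in _ < X]sqrtr1 ltr_sqrt// invf_lt1// ltr1n.
have sS k : Num.sqrt (hk k.+1) = th * Num.sqrt (hk k) by rewrite /hk exprS sqrtrM// invr_ge0.
have t1 : 0 < 1 - th by rewrite subr_gt0.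
pose Kc := D * C / (1 - th); have Kc0 : 0 < Kc by rewrite divr_gt0 ?mulr_gt0.
have step v k : Gamma v -> `|quotient v x0 k - quotient v x0 k.+1| <= Kc * (Num.sqrt (hk k) - Num.sqrt (hk k.+1)).
 move=> Gv; rewrite /quotient -/(hk k) -/(hk k.+1).
 have hp := h0 k.+1; have hI : 0 < hk k.+1 <= 1 by rewrite hp h1.
 have [B1 _] := DP ((Phi (hk k.+1) (Phi (hk k.+1) v) - Phi (hk k.+1) v) - (Phi (hk k.+1) v - v)) x0.
 have {}B1 := le_trans B1 (ler_wpM2l (ltW D0) (CP v _ Gv hI)); rewrite !XB in B1.
 have E : Phi (hk k) v = Phi (hk k.+1) (Phi (hk k.+1) v) by rewrite -PhiD ?(ltW hp)// hS mulrDl mul1r.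
 rewrite E (hS k); move: B1; move: (Phi _ (Phi _ v) x0) (Phi _ v x0) (v x0) => P2 P1 P0 B1.
 have -> : (P2 - P0) / (2 * hk k.+1) - (P1 - P0) / hk k.+1 = (P2 - P1 - (P1 - P0)) / (2 * hk k.+1).
  by field; rewrite gt_eqF.
 have h20 : 0 < 2 * hk k.+1 by rewrite mulr_gt0.
 rewrite normrM normfV (gtr0_norm h20) ler_pdivrMr//; apply: le_trans B1 _.
 rewrite -(hS k) sS (_ : Kc * _ * hk k = D * C * (Num.sqrt (hk k) * hk k)); last by rewrite /Kc; field; rewrite gt_eqF.
 have H : th * Num.sqrt (hk k) * hk k.+1 <= Num.sqrt (hk k) * hk k.
  apply: ler_pM; rewrite ?mulr_ge0 ?(ltW th0) ?(ltW hp)//.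
   by rewrite ler_piMl ?(ltW th1).
  by rewrite (hS k) ler_peMl ?(ltW hp)// ler1n.
 rewrite -!mulrA ler_pM2l// ler_pM2l//.
 by rewrite [hk k.+1 * _]mulrC.
have tel v k n : Gamma v -> `|quotient v x0 k - quotient v x0 (n + k)| <= Kc * (Num.sqrt (hk k) - Num.sqrt (hk (n + k))).
 move=> Gv; elim: n => [|n IH]; first by rewrite !add0n !subrr normr0 mulr0.
 apply: le_trans (ler_distD (quotient v x0 (n + k)) _ _) _; apply: le_trans (lerD IH (step v _ Gv)) _.
 by rewrite -mulrDr addrA subrK.
have [k hkP] : exists k, Kc * Num.sqrt (hk k) <= e / 2.
 have e20 : 0 < e / 2 by rewrite divr_gt0.
 have eK : 0 < e / 2 / Kc := divr_gt0 e20 Kc0.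
 have d0 : 0 < (e / 2 / Kc) ^+ 2 by rewrite exprn_gt0.
 have [m md] := inv_small d0; exists m.
 have q0 : 0 <= e / 2 / Kc by exact: ltW.
 rewrite mulrC -ler_pdivlMr// -[X in _ <= X]ger0_norm// -sqrtr_sqr.
 rewrite ler_sqrt ?(ltW d0)//; apply: le_trans (ltW md); rewrite /hk exprVn lef_pV2 ?posrE ?exprn_gt0 ?ltr0n//.
 by rewrite -natrX ler_nat ltn_expl.
exists k => w t Gw t0.
have e2 : 0 < e / 2 by rewrite divr_gt0.
have [d d0 dP] := is_derive_eps (Pt_derive w x0 t0) e2.
have [m md] := inv_small d0.
have hd : hk (m + k) < d.
 apply: le_lt_trans md; rewrite /hk exprVn lef_pV2 ?posrE ?exprn_gt0 ?ltr0n// -natrX ler_nat.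
 by apply: leq_ltn_trans (leq_addr k m) _; exact: ltn_expl.
have Gv : Gamma (Phi t w) by exact: (ic_inv G) (ltW t0) Gw.
have hp := h0 (m + k)%N.
have Q : `|quotient (Phi t w) x0 (m + k) - Pt w t x0| <= e / 2.
 have := dP (t + hk (m + k)); rewrite [t + _]addrC addrK gtr0_norm// => /(_ hd).
 rewrite PhiD ?(ltW t0) ?(ltW hp)// /quotient -/(hk (m + k)).
 move: (Phi (hk _) (Phi t w) x0) (Phi t w x0) (Pt _ _ _) => P1 P0 V H.
 have -> : (P1 - P0) / hk (m + k) - V = (P1 - P0 - V * hk (m + k)) / hk (m + k) by field; rewrite gt_eqF.
 by rewrite normrM normfV (gtr0_norm hp) ler_pdivrMr.
apply: le_trans (ler_distD (quotient (Phi t w) x0 (m + k)) _ _) _; rewrite [e]splitr; apply: lerD => //.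
apply: le_trans (tel _ k m Gv) _; apply: le_trans hkP; rewrite ler_wpM2l ?(ltW Kc0)//.
by rewrite gerBl sqrtr_ge0.
Qed.

(** The velocity is a uniform limit of difference quotients, each of which is continuous for the
    norm of [X]. *)
Lemma velocity_continuous r M Gamma x0 w t e : invariant_compact r M Gamma -> Gamma w -> 0 < t -> 0 < e ->
 exists2 d, 0 < d & forall w' t', Gamma w' -> 0 < t' -> Xnorm (Phi t w - Phi t' w') < d ->
 `|Pt w t x0 - Pt w' t' x0| < e.
Proof.
have [a0 al1 al2] := params.
move=> G Gw t0 e0; have e4 : 0 < e / 4 by rewrite divr_gt0.
have [k kP] := quotient_limit x0 G e4; have [C C0 CP] := X_C1 a0 al1.
have h0 : 0 < (2^-1 : R) ^+ k by rewrite exprn_gt0// invr_gt0.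
pose m := e / 4 * 2^-1 ^+ k / C; have m0 : 0 < m by rewrite divr_gt0// mulr_gt0.
have [d1 d10 dP] := Phi_close (Phi t w) (ltW h0) m0.
have [d [d0 dd1 dm]] := below2 d10 m0; exists d => // w' t' Gw' t'0 cl.
have k1 := kP w t Gw t0; have k2 := kP w' t' Gw' t'0.
have [c1 _] := CP (Phi (2^-1 ^+ k) (Phi t w) - Phi (2^-1 ^+ k) (Phi t' w')) x0.
have [c2 _] := CP (Phi t w - Phi t' w') x0.
have {}c1 : `|Phi (2^-1 ^+ k) (Phi t w) x0 - Phi (2^-1 ^+ k) (Phi t' w') x0| < e / 4 * 2^-1 ^+ k.
 move: c1; rewrite XB => c1; apply: le_lt_trans c1 _; rewrite mulrC -ltr_pdivlMr//; apply: dP; exact: lt_trans cl dd1.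
have {}c2 : `|Phi t w x0 - Phi t' w' x0| < e / 4 * 2^-1 ^+ k.
 move: c2; rewrite XB => c2; apply: le_lt_trans c2 _; rewrite mulrC -ltr_pdivlMr//; exact: lt_trans cl dm.
have k3 : `|quotient (Phi t w) x0 k - quotient (Phi t' w') x0 k| < e / 2.
 rewrite /quotient -mulrBl normrM normfV (gtr0_norm h0) ltr_pdivrMr//.
 move: c1 c2; move: (Phi _ (Phi t w) x0) (Phi _ (Phi t' w') x0) (Phi t w x0) (Phi t' w' x0) => A B D E c1 c2.
 have -> : A - D - (B - E) = (A - B) - (D - E) by ring.
 apply: le_lt_trans (ler_normB _ _) _; apply: lt_le_trans (ltrD c1 c2) _.
 by rewrite -mulrDl ler_pM2r//; clear -st; lra.
move: k1 k2 k3; move: (quotient _ _ _) (quotient _ _ _) (Pt _ _ _) (Pt _ _ _) => A B D E.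
by rewrite !ler_norml !ltr_norml; clear -st; lra.
Qed.

End time_regularity.

(** * Recurrent points are periodic *)

Section periodicity.
Implicit Types (p : X) (x y r h : R).

Definition recurs u := forall e T, 0 < e -> exists2 t, T <= t & 0 <= t /\ Xnorm (Phi t u - u) < e.

Lemma recurs_jrec Gamma u : Gamma u -> recurs u -> jrec Gamma u u.
Proof. by move=> Gu H; split=> // e T e0; have [t tT [t0 h]] := H e T e0; exists t. Qed.

Lemma recurs_flow u s : 0 <= s -> recurs u -> recurs (Phi s u).
Proof.
move=> s0 H; have j : jrec setT u u by exact: recurs_jrec.
have [_ _ H'] := jrec_flow (fun _ _ _ _ => I) s0 j.
by move=> e T e0; have [t tT [t0 [h _]]] := H' e T e0; exists t.
Qed.

(** The coincidence makes the orbit periodic from time s on, and u is a limit of such points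
    [Phi tau u], all fixed by Phi (t - s). *)
Lemma recurs_return u s t : recurs u -> 0 <= s -> s < t -> Phi s u = Phi t u -> Phi (t - s) u = u.
Proof.
have [a0 al1 al2] := params.
move=> rc s0 s_t E; have ts : 0 <= t - s by rewrite subr_ge0 ltW.
apply: (Xnorm_lim a0 al1) => e e0; have e2 : 0 < e / 2 by rewrite divr_gt0.
have [d d0 dP] := Phi_close u ts e2; have [m [m0 md me]] := below2 d0 e2.
have [tau taus [tau0 close]] := rc m s m0.
have per : Phi (t - s) (Phi tau u) = Phi tau u.
 have q0 : 0 <= tau - s by rewrite subr_ge0.
 have -> : Phi tau u = Phi (tau - s) (Phi s u) by rewrite -PhiD// subrK.
 by rewrite -PhiD// [t - s + _]addrC PhiD// -(PhiD _ ts)// subrK E.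
rewrite XnormC in close; apply: le_lt_trans (Xtri _ (Phi (t - s) (Phi tau u)) _) _; rewrite [e]splitr; apply: ltrD.
 exact: dP (lt_trans close md).
by rewrite per XnormC; exact: lt_trans close me.
Qed.

Lemma small_eq (C x y : R) : (forall k : nat, `|x - y| <= C * k.+1%:R^-1) -> x = y.
Proof.
move=> H; apply/eqP; rewrite -subr_eq0 -normr_eq0 eq_le normr_ge0 andbT leNgt; apply/negP => p0.
have C0 : 0 < C by have := H 0%N; rewrite invr1 mulr1 => h; exact: lt_le_trans p0 h.
have [k kP] := inv_small (divr_gt0 p0 C0); have := H k.
by rewrite leNgt mulrC -ltr_pdivlMr// kP.
Qed.

Lemma pos_derive_crosses (g : R -> R) t d : is_derive t 1 g d -> 0 < d -> crosses_up g (g t) t.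
Proof.
move=> dg d0; have d2 : 0 < d / 2 by rewrite divr_gt0.
have [h h0 hP] := is_derive_eps dg d2; exists h => // s /hP; move: (g s) (g t) => G F H; split=> st'.
 have n0 : s - t < 0 by rewrite subr_lt0.
 have := ler_norm (G - F - d * (s - t)); move: H; rewrite (ltr0_norm n0); move: `|_| n0 d0; move: (s - t) => q n n0 d0 H1 H2.
 have : d * q < 0 by rewrite pmulr_rlt0.
 by move: H1 H2; clear -st; lra.
have n0 : 0 < s - t by rewrite subr_gt0.
have := ler_norm (- (G - F - d * (s - t))); move: H; rewrite normrN (gtr0_norm n0); move: `|_| n0 d0; move: (s - t) => q n n0 d0 H1 H2.
have : 0 < d * q by rewrite mulr_gt0.
by move: H1 H2; clear -st; lra.
Qed.

Lemma jrec_jclose Gamma u v : jrec Gamma u v -> jclose Gamma u v.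
Proof. by move=> j e e0; exists u, v => //; rewrite !subrr !Xnorm0. Qed.

Lemma cts_slice (w : R -> R -> R) (x0 t0 : R) : continuous (fun p : R * R => w p.1 p.2) ->
 continuous (fun t : R => w t x0) /\ continuous (fun t : R => w (t + t0) x0).
Proof.
move=> cw; split; first by apply: (@cts2 R R w (fun t => t) (fun _ => x0) cw); [exact: cts_id | exact: ctsC].
apply: (@cts2 R R w (fun t => t + t0) (fun _ => x0) cw); last exact: ctsC.
by apply: ctsD; [exact: cts_id | exact: ctsC].
Qed.

Section orbit.
Variables (r M : R) (Gamma : set X) (u : X).
Hypotheses (G : invariant_compact r M Gamma) (Gu : Gamma u) (rc : recurs u).

Lemma orbit_inj x0 s t : (forall T, 0 < T -> Phi T u <> u) -> 0 <= s -> 0 <= t ->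
 Phi s u x0 = Phi t u x0 -> dX (Phi s u) x0 = dX (Phi t u) x0 -> s = t.
Proof.
move=> np; wlog st' : s t / s <= t.
 move=> H s0 t0 e1 e2; have [l|l] := leP s t; first exact: H.
 by apply/esym/H => //; exact: ltW.
move=> s0 t0 e1 e2; apply/eqP; rewrite eq_le st' leNgt; apply/negP => l.
have jr : jrec Gamma (Phi s u) (Phi t u).
 by apply: (jrec_shift (ic_inv G)) => //; exact: recurs_jrec.
have E := jclose_inj (ic_r G) (ic_C1 G) (ic_inv G) (ic_cpt G) (jrec_jclose jr) e1 e2.
by apply: (np (t - s)); [rewrite subr_gt0 | exact: recurs_return].
Qed.

(** Otherwise offending times would give points accumulating at some v with the value and slope of
    [Phi t0 u] at x0. Two times of one recurrent orbit form a jointly recurrent pair, so v =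
    [Phi t0 u], against the continuity of the velocity. *)
Lemma velocity_near x0 t0 sg : 0 < t0 -> sg = 1 \/ sg = -1 -> 0 < sg * Pt u t0 x0 ->
 exists2 rho, 0 < rho & forall t, 0 <= t -> Phi (t + t0) u x0 = Phi t0 u x0 ->
  `|dX (Phi (t + t0) u) x0 - dX (Phi t0 u) x0| < rho -> 0 < sg * Pt u (t + t0) x0.
Proof.
have [a0 al1 al2] := params.
move=> t00 sg1 V0; apply: contrapT => H.
have ex (k : nat) : exists t, [/\ 0 <= t, Phi (t + t0) u x0 = Phi t0 u x0,
  `|dX (Phi (t + t0) u) x0 - dX (Phi t0 u) x0| < k.+1%:R^-1 & sg * Pt u (t + t0) x0 <= 0].
 apply: contrapT => H'; apply: H; exists k.+1%:R^-1 => [|t tt0 E1 E2]; first by rewrite invr_gt0 ltr0n.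
 by rewrite ltNge; apply/negP => le; apply: H'; exists t.
have {ex}[q qP] := choice ex.
have q0 k : 0 <= q k + t0 by have [h _ _ _] := qP k; rewrite addr_ge0// ltW.
have [|v Gv [phi phiP vP]] := @compact_seq R X Gamma (fun k => Phi (q k + t0) u) (ic_cpt G).
 by move=> k; exact: (ic_inv G).
have vX k : Xnorm (v - Phi (q (phi k) + t0) u) < k.+1%:R^-1 by have := vP k; rewrite Xball_.
have [C C0 CP] := X_C1 a0 al1.
have e1 : Phi t0 u x0 = v x0.
 apply: (@small_eq C) => k; have [_ <- _ _] := qP (phi k); rewrite distrC -XB.
 by have [h _] := CP (v - Phi (q (phi k) + t0) u) x0; apply: le_trans h _; rewrite ler_pM2l// ltW.
have e2 : dX (Phi t0 u) x0 = dX v x0.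
 apply: (@small_eq (C + 1)) => k; have [_ _ h1 _] := qP (phi k).
 have [_ h2] := CP (v - Phi (q (phi k) + t0) u) x0; rewrite (dXB a0 al1) in h2.
 have pk : (phi k).+1%:R^-1 <= k.+1%:R^-1 :> R by rewrite inv_le ?phiP.
 rewrite distrC; apply: le_trans (ler_distD (dX (Phi (q (phi k) + t0) u) x0) _ _) _; rewrite mulrDl mul1r; apply: lerD.
  by apply: le_trans h2 _; rewrite ler_pM2l// ltW.
 exact: le_trans (ltW h1) pk.
have jc : jclose Gamma (Phi t0 u) v.
 move=> e e0; have [k ke] := inv_small e0; exists (Phi t0 u), (Phi (q (phi k) + t0) u).
  by apply: (jrec_shift (ic_inv G)) => //; [exact: ltW | exact: recurs_jrec].
 by rewrite subrr Xnorm0; split=> //; exact: lt_trans (vX k) ke.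
have E := jclose_inj (ic_r G) (ic_C1 G) (ic_inv G) (ic_cpt G) jc e1 e2.
have [d d0 dP] := velocity_continuous x0 G Gu t00 V0.
have [k kd] := inv_small d0; have [tk _ _ neg] := qP (phi k).
have tp : 0 < q (phi k) + t0 by rewrite ltr_wpDl.
have := dP u _ Gu tp; rewrite E => /(_ (lt_trans (vX k) kd)).
move: V0 neg; move: (Pt _ _ _) (Pt _ _ _) => A B V0 neg; rewrite ltr_norml.
by case: sg1 V0 neg => ->; clear -st G Gu rc; lra.
Qed.

(** A late return follows the piece of orbit around t0, along which the value at x0 passes strictly
    from one side of its level to the other; the intermediate value theorem gives the crossing. *)
Lemma crossings x0 t0 sg e T : 0 < t0 -> sg = 1 \/ sg = -1 -> 0 < sg * Pt u t0 x0 -> 0 < e ->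
 exists2 t, T <= t & 0 < t /\ (Phi (t + t0) u x0 = Phi t0 u x0 /\ `|dX (Phi (t + t0) u) x0 - dX (Phi t0 u) x0| < e).
Proof.
have [a0 al1 al2] := params.
move=> t00 sg1 V0 e0; have [c1 c2] := Phi'_joint u; have [C C0 CP] := X_C1 a0 al1.
have e2 : 0 < e / 2 by rewrite divr_gt0.
have dG : is_derive t0 1 (fun t => sg * Phi' u t x0) (sg * Pt u t0 x0) by apply: dcM; exact: Phi'_derive.
have [h1 h10 h1P] := pos_derive_crosses dG V0.
have g2c : continuous (fun t => dX (Phi' u t) x0).
 by have [] := @cts_slice (fun t x => dX (Phi' u t) x) x0 t0 c2.
have /cvgrPdist_lt/(_ _ e2)/nbhs_ballP[h2 h20 h2P] := g2c t0.
have [h3 [h30 h31 h32]] := below2 h10 h20.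
have [h [h0 hh3 ht0]] := below2 h30 t00.
have th : 0 <= t0 - h by rewrite subr_ge0 ltW.
pose p := Phi (t0 - h) u; have rp : recurs p by exact: recurs_flow.
have [lo _] := h1P (t0 - h) ltac:(rewrite addrAC subrr add0r normrN gtr0_norm//; exact: lt_trans hh3 h31).
have [_ hi] := h1P (t0 + h) ltac:(rewrite addrAC subrr add0r gtr0_norm//; exact: lt_trans hh3 h31).
have {lo}lo := lo ltac:(by rewrite gtrBl); have {hi}hi := hi ltac:(by rewrite ltrDl).
have tph : 0 <= t0 + h by rewrite addr_ge0 ?ltW.
rewrite !Phi'E ?(ltW t00)// in lo hi.
have lo' : 0 < sg * Phi t0 u x0 - sg * Phi (t0 - h) u x0 by rewrite subr_gt0.
have hi' : 0 < sg * Phi (t0 + h) u x0 - sg * Phi t0 u x0 by rewrite subr_gt0.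
have [m1 [m10 m1l m1h]] := below2 lo' hi'; have [m [m0 mm1 me]] := below2 m10 e2.
have mC : 0 < m / C by rewrite divr_gt0.
have hh0 : 0 <= 2 * h by rewrite mulr_ge0 ?(ltW h0).
have [d d0 dP] := unif_time p hh0 mC.
have [tau tauT [tau0 close]] := rp d (`|T| + h + 1) d0.
rewrite XnormC in close.
have near_ s : 0 <= s <= 2 * h -> `|Phi (t0 - h + s) u x0 - Phi (tau + (t0 - h) + s) u x0| < m /\
  `|dX (Phi (t0 - h + s) u) x0 - dX (Phi (tau + (t0 - h) + s) u) x0| < m.
 move=> sI; have := dP _ close s sI; have s0 : 0 <= s by case/andP: sI.
 have A1 : Phi s p = Phi (t0 - h + s) u by rewrite /p -PhiD// addrC.
 have A2 : Phi s (Phi tau p) = Phi (tau + (t0 - h) + s) u.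
  by rewrite /p -(PhiD _ tau0 th) -(PhiD _ s0 (addr_ge0 tau0 th)) addrC.
 rewrite A1 A2 => H.
 have [k1 k2] := CP (Phi (t0 - h + s) u - Phi (tau + (t0 - h) + s) u) x0.
 rewrite XB in k1; rewrite (dXB a0 al1) in k2.
 have H' : C * Xnorm (Phi (t0 - h + s) u - Phi (tau + (t0 - h) + s) u) < m by rewrite mulrC -ltr_pdivlMr.
 by split; [exact: le_lt_trans k1 H' | exact: le_lt_trans k2 H'].
have [lo1 _] := near_ 0 ltac:(by rewrite lexx hh0).
have [hi1 _] := near_ (2 * h) ltac:(by rewrite lexx hh0).
rewrite !addr0 (_ : t0 - h + 2 * h = t0 + h) in lo1 hi1; last by ring.
rewrite (_ : tau + (t0 - h) + 2 * h = tau + (t0 + h)) in hi1; last by ring.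
have cg : continuous (fun t => sg * Phi' u t x0).
 by apply: ctsM; [exact: ctsC | by have [] := @cts_slice (fun t x => Phi' u t x) x0 t0 c1].
have ab : tau + (t0 - h) <= tau + (t0 + h) by rewrite !lerD2l; clear -st G Gu rc h0; lra.
have tn0 : 0 <= tau + (t0 - h) by rewrite addr_ge0.
have tn1 : 0 <= tau + (t0 + h) by rewrite addr_ge0.
have [|t tI tE] := IVT ab (continuous_subspaceT cg) (v := sg * Phi t0 u x0).
 rewrite !Phi'E// ge_min le_max; apply/andP; split; apply/orP; [left|right].
  move: lo1 mm1 m1l; move: (Phi _ u x0) (Phi _ u x0) (Phi _ u x0) => A B D; rewrite ltr_norml.
  by case: sg1 => ->; clear -st G Gu rc; lra.
 move: hi1 mm1 m1h; move: (Phi _ u x0) (Phi _ u x0) (Phi _ u x0) => A B D; rewrite ltr_norml.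
 by case: sg1 => ->; clear -st G Gu rc; lra.
move: tI; rewrite in_itv/= => tI.
have T0 := ler_norm T; have aT := normr_ge0 T.
exists (t - t0); first by clear -st G Gu rc T0 tI tauT h0; lra.
split; first by clear -st G Gu rc aT tI tauT h0; lra.
rewrite subrK; have tt0 : 0 <= t by clear -st G Gu rc tn0 tI; lra.
rewrite Phi'E// in tE.
have tE' : Phi t u x0 = Phi t0 u x0 by case: sg1 tE => ->; rewrite ?mul1r ?mulN1r//; exact: oppr_inj.
split=> //; pose s := t - tau - (t0 - h); have sI : 0 <= s <= 2 * h by rewrite /s; clear -st G Gu rc tI; lra.
have [_ k2] := near_ s sI; rewrite (_ : tau + (t0 - h) + s = t) in k2; last by rewrite /s; ring.
have s1 : 0 <= t0 - h + s by rewrite addr_ge0//; case/andP: sI.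
have k3 : `|t0 - (t0 - h + s)| < h2.
 rewrite (_ : t0 - _ = h - s); last by ring.
 by apply: le_lt_trans (_ : h < _); [rewrite ler_norml; clear -st G Gu rc sI; lra | exact: lt_trans hh3 h32].
have k4 : `|dX (Phi' u t0) x0 - dX (Phi' u (t0 - h + s)) x0| < e / 2 := h2P _ k3.
rewrite !Phi'E ?(ltW t00)// distrC in k4; apply: le_lt_trans (ler_distD (dX (Phi (t0 - h + s) u) x0) _ _) _.
by rewrite [e]splitr; apply: ltrD; [rewrite distrC; exact: lt_trans k2 me | exact: k4].
Qed.

Lemma recurrent_periodic : exists2 T, 0 < T & Phi T u = u.
Proof.
have [a0 al1 al2] := params.
apply: contrapT => H; have np T : 0 < T -> Phi T u <> u by move=> T0 E; apply: H; exists T.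
(* If the velocity vanished for all positive times, Phi 1 u = Phi 2 u would contradict [orbit_inj].
   Otherwise the section is placed where the velocity is nonzero, with the sign [sg] making it
   positive. *)
have [[t0 [x0 [t00 V]]]|H'] := pselect (exists t0 x0 : R, 0 < t0 /\ Pt u t0 x0 <> 0); last first.
 have E : Phi 1 u = Phi 2 u.
  apply: X_eq => x; have [|z zI] := @mvt R (fun t => Phi t u x) (fun t => Pt u t x) 1 2 ltac:(by rewrite ltr1n).
   by move=> z zI; apply: Pt_derive; clear -st G Gu rc zI; lra.
  have -> : Pt u z x = 0 by apply: contrapT => h; apply: H'; exists z, x; split=> //; clear -st G Gu rc zI; lra.
  by rewrite mul0r => /eqP; rewrite subr_eq0 => /eqP.
 have := @orbit_inj 0 1 2 np ler01 (ler0n _ _) (congr1 (fun w : X => w 0) E) (congr1 (fun w : X => dX w 0) E).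
 by move=> E12; have : (1 : R) < 2 by [rewrite ltr1n]; rewrite -E12 ltxx.
pose sg : R := if 0 < Pt u t0 x0 then 1 else -1.
have sg1 : sg = 1 \/ sg = -1 by rewrite /sg; case: ifP; [left|right].
have V0 : 0 < sg * Pt u t0 x0.
 rewrite /sg; case: ifP => h; first by rewrite mul1r.
 by rewrite mulN1r oppr_gt0 lt_neqAle leNgt h andbT; apply/eqP.
have sgI (x y : R) : sg * x = sg * y -> x = y by case: sg1 => ->; rewrite ?mul1r ?mulN1r//; exact: oppr_inj.
have sgn (x : R) : `|sg * x| = `|x| by case: sg1 => ->; rewrite ?mul1r ?mulN1r ?normrN.
have [rho rho0 rhoP] := velocity_near t00 sg1 V0.
have [c1 c2] := Phi'_joint u; have [C C0 CP] := X_C1 a0 al1.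
pose g1 t := sg * Phi' u (t + t0) x0; pose g2 t := dX (Phi' u (t + t0)) x0.
have ct : continuous (fun t => t + t0) by apply: ctsD; [exact: cts_id | exact: ctsC].
have pos t : 0 <= t -> 0 <= t + t0 by move=> tt; rewrite addr_ge0 ?(ltW t00).
apply: (@recurrent_curve_absurd R g1 g2 rho) => //; last first.
 move=> e T e0; have [t tT [tt0 [E1 E2]]] := @crossings x0 t0 sg e T t00 sg1 V0 e0.
 have p1 := pos _ (ltW tt0); have p2 := ltW t00.
 exists t; first exact: tT.
 by split; [exact: tt0 | rewrite /g1 /g2 !add0r (Phi'E _ p1) (Phi'E _ p2) E1; split; [reflexivity | exact: E2]].
split.
- split; first by apply: ctsM; [exact: ctsC | by have [] := @cts_slice (fun t x => Phi' u t x) x0 t0 c1].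
 by have [] := @cts_slice (fun t x => dX (Phi' u t) x) x0 t0 c2.
- move=> s t s0 tt0 /sgI; rewrite /g2 !Phi'E ?pos// => e1 e2.
 by have /addIr := orbit_inj np (pos _ s0) (pos _ tt0) e1 e2.
- move=> s e T s0 e0; have eC : 0 < e / C by rewrite divr_gt0.
 have rs := recurs_flow (pos _ s0) rc.
 have [t tT [tt0 h]] := rs _ (T - s) eC; have ts : 0 <= t + s by rewrite addr_ge0.
 exists (t + s); first by rewrite -lerBlDr.
 split=> //; rewrite /g1 /g2 -mulrBr sgn !Phi'E ?pos//.
 have [k1 k2] := CP (Phi t (Phi (s + t0) u) - Phi (s + t0) u) x0.
 rewrite XB in k1; rewrite (dXB a0 al1) in k2; rewrite -PhiD ?pos// addrA in k1 k2 h.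
 by split; [apply: le_lt_trans k1 _ | apply: le_lt_trans k2 _]; rewrite mulrC -ltr_pdivlMr.
- move=> t tt0 e1 e2.
 have P : 0 < sg * Pt u (t + t0) x0.
  have p1 := pos _ tt0; have p2 := ltW t00; apply: rhoP; first exact: tt0.
   by move/sgI: e1; rewrite add0r (Phi'E _ p1) (Phi'E _ p2).
  by move: e2; rewrite /g2 add0r (Phi'E _ p1) (Phi'E _ p2).
 have dg : is_derive t 1 g1 (sg * Pt u (t + t0) x0).
  by apply: (dcM sg); apply: (dshift (f := fun t => Phi' u t x0)); apply: Phi'_derive; rewrite ltr_wpDl.
 by rewrite -e1; exact: pos_derive_crosses dg P.
Qed.

End orbit.
End periodicity.

(** * Planar components of sets with dense periodic points *)

Section components.
Implicit Types (w p : X) (x y h : R).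

Definition periodic_point u := exists2 T, 0 < T & Phi T u = u.

Lemma periodic_iter u T n : 0 < T -> Phi T u = u -> Phi (n%:R * T) u = u.
Proof.
move=> T0 E; elim: n => [|n IH]; first by rewrite mul0r Phi0.
by rewrite -natr1 mulrDl mul1r PhiD ?E ?(ltW T0) ?mulr_ge0 ?(ltW T0).
Qed.

(** At nearly equal multiples of the two periods one point has returned exactly and the other is a
    short time after an exact return. *)
Lemma periodic_jrec Gamma u v : Gamma u -> Gamma v -> periodic_point u -> periodic_point v -> jrec Gamma u v.
Proof.
move=> Gu Gv [T1 t1 E1] [T2 t2 E2]; split=> // e T e0.
have nr w : exists2 d, 0 < d & forall s, 0 <= s < d -> Xnorm (Phi s w - w) < e.
 have [d d0 dP] := Phi_cts w (lexx 0) e0; exists d => // s /andP[s0 sd].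
 rewrite -[X in _ - X]Phi0 XnormC; apply: dP => //; first by rewrite sub0r normrN ger0_norm.
 by rewrite subrr Xnorm0.
have [d1 d10 h1] := nr u; have [d2 d20 h2] := nr v; have [d [d0 dd1 dd2]] := below2 d10 d20.
have [n [m [Tn Tm c]]] := simultaneous_multiples T t1 t2 d0.
have p1 : 0 <= n%:R * T1 by rewrite mulr_ge0 ?(ltW t1).
have p2 : 0 <= m%:R * T2 by rewrite mulr_ge0 ?(ltW t2).
have [le|lt] := leP (m%:R * T2) (n%:R * T1).
 have q : 0 <= n%:R * T1 - m%:R * T2 by rewrite subr_ge0.
 exists (n%:R * T1); [exact: Tn | split; [exact: p1 |]].
 rewrite (periodic_iter _ t1 E1) subrr Xnorm0; split; first exact: e0.
 rewrite -(subrK (m%:R * T2) (n%:R * T1)) (PhiD _ q p2) (periodic_iter _ t2 E2); apply: h2.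
 by rewrite q; apply: lt_trans dd2; rewrite ger0_norm in c.
have q : 0 <= m%:R * T2 - n%:R * T1 by rewrite subr_ge0 ltW.
exists (m%:R * T2); [exact: Tm | split; [exact: p2 |]].
rewrite (periodic_iter _ t2 E2) subrr Xnorm0; split; last exact: e0.
rewrite -(subrK (n%:R * T1) (m%:R * T2)) (PhiD _ q p1) (periodic_iter _ t1 E1); apply: h1.
by rewrite q; apply: lt_trans dd1; rewrite distrC ger0_norm in c.
Qed.

Variables (r M : R) (Gamma A : set X).
Hypotheses (G : invariant_compact r M Gamma) (Acl : closed A) (AG : A `<=` Gamma)
 (Af : forall t v, 0 <= t -> A v -> A (Phi t v))
 (Ad : forall u e, A u -> 0 < e -> exists v, [/\ A v, periodic_point v & Xnorm (u - v) < e]).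

Let h v : R * R := (v 0, dX v 0).

Lemma planar_inj u v : A u -> A v -> h u = h v -> u = v.
Proof.
move=> Au Av [e1 e2]; apply: (jclose_inj (ic_r G) (ic_C1 G) (ic_inv G) (ic_cpt G) _ e1 e2) => e e0.
have [u' [Au' pu cu]] := Ad Au e0; have [v' [Av' pv cv]] := Ad Av e0.
by exists u', v'; [apply: periodic_jrec; [exact: AG | exact: AG | exact: pu | exact: pv] | split; [exact: cu | exact: cv]].
Qed.

Lemma closed_compact_part (C : set X) : closed C -> C `<=` Gamma -> compact C.
Proof. by move=> Ccl CG; exact: (subclosed_compact Ccl (ic_cpt G) CG). Qed.

(** Periodic points have preimages on their own orbits; density and compactness extend this to A. *)
Lemma part_sur t v : 0 <= t -> A v -> exists2 w, A w & Phi t w = v.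
Proof.
have [a0 al1 al2] := params.
move=> t0 Av.
have ex (k : nat) : exists w, A w /\ Xnorm (v - Phi t w) < k.+1%:R^-1.
 have k0 : 0 < (k.+1%:R^-1 : R) by rewrite invr_gt0 ltr0n.
 have [p [Ap [T T0 E] c]] := Ad Av k0; pose n := (Num.truncn (t / T)).+1.
 have nt : 0 <= n%:R * T - t by rewrite subr_ge0 -ler_pdivrMr// ltW// truncnS_gt.
 exists (Phi (n%:R * T - t) p); split; first exact: Af.
 have e : t + (n%:R * T - t) = n%:R * T by rewrite addrC subrK.
 by rewrite -(PhiD _ t0 nt) e (periodic_iter _ T0 E).
have {ex}[q qP] := choice ex.
have [|w Aw [phi phiP wP]] := @compact_seq R X A q (closed_compact_part Acl AG); first by move=> k; have [] := qP k.
exists w => //; apply: (Xnorm_lim a0 al1) => e e0; have e2 : 0 < e / 2 by rewrite divr_gt0.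
have [d d0 dP] := Phi_close w t0 e2; have [m [m0 md me]] := below2 d0 e2.
have [k km] := inv_small m0; have wk := wP k; rewrite Xball_ in wk.
apply: le_lt_trans (Xtri _ (Phi t (q (phi k))) _) _; rewrite [e]splitr; apply: ltrD.
 by apply: dP; exact: lt_trans wk (lt_trans km md).
have [_ c] := qP (phi k); rewrite XnormC; apply: lt_trans c (le_lt_trans _ (lt_trans km me)).
by rewrite inv_le ?phiP.
Qed.

Lemma path_component v t : 0 <= t -> A v -> connected_component A v (Phi t v).
Proof.
move=> t0 Av; pose B := [set Phi' v s | s in `[0, t]%classic].
have H : B `<=` connected_component A v.
 apply: connected_component_max.
 - by exists 0; rewrite ?Phi'E ?Phi0//= in_itv/= lexx.
 - by move=> _ [s /= + <-]; rewrite in_itv/= => /andP[s0 _]; rewrite Phi'E//; exact: Af.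
 apply: connected_continuous_connected; first exact: segment_connected.
 apply: continuous_subspaceT => s; apply/eps_cts => e e0.
 have [d d0 dP] := Phi'_cts v s e0; exists d; first exact: d0.
 by move=> y sy; rewrite Xball_; exact: dP.
by apply: H; exists t; rewrite ?Phi'E//= in_itv/= t0 lexx.
Qed.

Lemma planar_components u : A u -> homeo_planar_compact_invariant Phi (connected_component A u).
Proof.
have [a0 al1 al2] := params.
move=> Au; set C := connected_component A u.
have CA : C `<=` A := @connected_component_sub _ A u.
have Ccpt : compact C by apply: closed_compact_part; [exact: component_closed | exact: subset_trans CA AG].
have Cf t v : 0 <= t -> C v -> C (Phi t v).
 by move=> t0 Cv; apply: (connected_component_trans Cv); exact: path_component (CA _ Cv).
have Cs t v : 0 <= t -> C v -> exists2 w, C w & Phi t w = v.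
 move=> t0 Cv; have [w Aw E] := part_sur t0 (CA _ Cv); exists w => //.
 apply: (connected_component_trans Cv); apply: connected_component_sym; rewrite -E; exact: path_component.
(* The inverse is chosen pointwise on the image of C, with the default value 0 elsewhere. *)
have [g gP] : exists g : R * R -> X, forall q, (h @` C) q -> C (g q) /\ h (g q) = q.
 suff /choice[g gP] : forall q : R * R, exists v : X, (h @` C) q -> C v /\ h v = q by exists g.
 move=> q; by have [[v Cv <-]|nC] := pselect ((h @` C) q); [exists v | exists 0].
have gh v : C v -> g (h v) = v.
 move=> Cv; have [Cg E] := gP (h v) (imageP _ Cv).
 exact: planar_inj (CA _ Cg) (CA _ Cv) E.
have [K K0 KP] := X_C1 a0 al1.
have hlip v w : `|v 0 - w 0| <= K * Xnorm (v - w) /\ `|dX v 0 - dX w 0| <= K * Xnorm (v - w).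
 by have [h1 h2] := KP (v - w) 0; rewrite XB in h1; rewrite (dXB a0 al1) in h2.
have hc : {within C, continuous h}.
 apply: (@within_eps R X (R * R)%type) => v _ e e0; have eK : 0 < e / K by rewrite divr_gt0.
 exists (e / K) => // w _; rewrite Xball_ => vw; have [h1 h2] := hlip v w.
 by split; [apply: le_lt_trans h1 _ | apply: le_lt_trans h2 _]; rewrite mulrC -ltr_pdivlMr.
exists (h @` C), h, g; split.
- split=> //; last by move=> v; rewrite inE => /gh.
 (* Continuity of the inverse: points of C whose images converge to q accumulate, by compactness, at
    a point with image q, hence at g q by injectivity. *)
 apply: (@within_eps R (R * R)%type X) => q hq e e0; apply: contrapT => H.
 have ex (k : nat) : exists y : R * R, [/\ (h @` C) y, ball q k.+1%:R^-1 y & ~ ball (g q) e (g y)].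
  apply: contrapT => H'; apply: H; exists k.+1%:R^-1 => [|y yK qy]; first by rewrite invr_gt0 ltr0n.
  by apply: contrapT => nb; apply: H'; exists y.
 have {ex}[y yP] := choice ex.
 have [|w Cw [phi phiP wP]] := @compact_seq R X C (g \o y) Ccpt.
  by move=> k; have [h1 _ _] := yP k; have [] := gP _ h1.
 have hw : h w = q.
  have b k : [/\ `|w 0 - q.1| <= (K + 1) * k.+1%:R^-1 & `|dX w 0 - q.2| <= (K + 1) * k.+1%:R^-1].
   have wk := wP k; rewrite Xball_ /= in wk; have [h1 h2] := hlip w (g (y (phi k))).
   have [yK [b1 b2] _] := yP (phi k); have [_ E] := gP _ yK.
   have pk : (phi k).+1%:R^-1 <= k.+1%:R^-1 :> R by rewrite inv_le ?phiP.
   have Kk := ler_wpM2l (ltW K0) (ltW wk).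
   have {}b1 : `|(y (phi k)).1 - q.1| <= k.+1%:R^-1 by rewrite distrC; exact: le_trans (ltW b1) pk.
   have {}b2 : `|(y (phi k)).2 - q.2| <= k.+1%:R^-1 by rewrite distrC; exact: le_trans (ltW b2) pk.
   rewrite -E /= in b1 b2; rewrite mulrDl mul1r; split.
    apply: le_trans (ler_distD (g (y (phi k)) 0) _ _) _; exact: lerD (le_trans h1 Kk) b1.
   apply: le_trans (ler_distD (dX (g (y (phi k))) 0) _ _) _; exact: lerD (le_trans h2 Kk) b2.
  rewrite [q]surjective_pairing /h; congr pair; [apply: (@small_eq (K + 1)) | apply: (@small_eq (K + 1))] => k; by have [] := b k.
 have [k ke] := inv_small e0; have wk := wP k; have [_ _ nb] := yP (phi k).
 apply: nb; rewrite -hw gh// Xball_; rewrite Xball_ in wk; exact: lt_trans wk ke.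
- exact: continuous_compact.
- by move=> t t0 _ [v Cv <-]; exact: Cf.
- move=> t t0; apply/seteqP; split=> [_ [q hq <-]|_ [v Cv <-]].
  by have [Cg _] := gP q hq; apply: imageP; exact: Cf.
 have [w Cw E] := Cs t v t0 Cv; exists (h w); first exact: imageP.
 by rewrite /= gh// E.
Qed.

End components.

(** * Recurrence in the supports of invariant measures *)

Section supports.
Implicit Types (w x y : X) (h : R) (E O : set X).
Variables (r M : R) (Gamma : set X).
Hypotheses (G : invariant_compact r M Gamma)
 (attr : forall B : set X, Xbounded B -> forall e : R, 0 < e -> exists2 t0, 0 <= t0 & forall t u, t0 <= t -> B u ->
    exists2 v, Gamma v & Xnorm (Phi t u - v) < e)
 (mu : probability (borel X) R) (muI : invariant_measure Phi mu).

Local Notation meas E := (@measurable _ (borel X) E).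

Lemma open_meas O : open O -> meas O.
Proof. by move=> Oo; apply: sub_sigma_algebra. Qed.

Lemma closed_meas E : closed E -> meas E.
Proof. by move=> Ec; rewrite -[E]setCK; apply: measurableC; apply: open_meas; exact: closed_openC. Qed.

Lemma open_norm_lt u d : open [set v : X | Xnorm (u - v) < d].
Proof.
rewrite openE => v /= uv; apply/nbhs_ballP; exists (d - Xnorm (u - v)); first by rewrite /= subr_gt0.
by move=> w; rewrite Xball_ ltrBrDl => vw /=; apply: le_lt_trans (Xtri _ v _) vw.
Qed.

Lemma closed_norm_le u d : closed [set v : X | Xnorm (u - v) <= d].
Proof.
move=> v cv /=; rewrite leNgt; apply/negP => lt; have d0 : 0 < Xnorm (u - v) - d by rewrite subr_gt0.
have [w [/= uw vw]] := cv _ (nbhsx_ballx v _ d0); rewrite Xball_ XnormC in vw.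
by have := le_lt_trans (Xtri u w v) (ler_ltD uw vw); rewrite [d + _]addrC subrK ltxx.
Qed.

Lemma mu_preimage t E : 0 <= t -> meas E -> mu (Phi t @^-1` E) = mu E.
Proof. exact: muI. Qed.

Lemma preimage_closed t E : 0 <= t -> closed E -> closed (Phi t @^-1` E).
Proof. by move=> t0 Ec; apply: closed_comp => // v _; exact: Phi_t_cts. Qed.

Lemma preimage_open t E : 0 <= t -> open E -> open (Phi t @^-1` E).
Proof. by move=> t0 Eo; apply: open_comp => // v _; exact: Phi_t_cts. Qed.

Lemma mu_U E E' : meas E -> meas E' -> (mu (E `|` E') <= mu E + mu E')%E.
Proof. by move=> mE mE'; exact: measureU2. Qed.

Lemma mu_U0 E E' : meas E -> meas E' -> mu E = 0%E -> mu E' = 0%E -> mu (E `|` E') = 0%E.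
Proof.
move=> mE mE' h h'; apply/eqP; rewrite eq_le measure_ge0 andbT.
by apply: le_trans (mu_U mE mE') _; rewrite h h' adde0.
Qed.

Lemma mu_split E E' : meas E -> meas E' -> mu (E `&` E') = 0%E -> mu (E `|` E') = (mu E + mu E')%E.
Proof.
move=> mE mE' h; have -> : E `|` E' = E `|` (E' `\` E).
 apply/seteqP; split=> v [?|H]; [by left | | by left | by right; case: H].
 by have [?|?] := pselect (E v); [left | right].
rewrite measureU//; [|exact: measurableD | by apply/seteqP; split=> // v [h1 [_ h2]]].
rewrite measureD//; last by rewrite ltey_eq fin_num_measure.
by rewrite [E' `&` E]setIC [X in (_ - X)%E]h sube0.
Qed.

Lemma attractor_gap E : closed E -> (forall v, Gamma v -> ~ E v) -> exists2 e : R, 0 < e & forall v w, Gamma v -> E w -> e <= Xnorm (w - v).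
Proof.
move=> Ec disj; apply: contrapT => H.
have ex (k : nat) : exists q : X * X, [/\ Gamma q.1, E q.2 & Xnorm (q.2 - q.1) < k.+1%:R^-1].
 apply: contrapT => H'; apply: H; exists k.+1%:R^-1 => [|v w Gv Ew]; first by rewrite invr_gt0 ltr0n.
 by rewrite leNgt; apply/negP => lt; apply: H'; exists (v, w).
have [q qP] := choice ex.
have [|v Gv [phi phiP vP]] := @compact_seq R X Gamma (fun k => (q k).1) (ic_cpt G).
 by move=> k; have [] := qP k.
apply: (disj v Gv); apply: Ec => V /nbhs_ballP[d d0 dV]; have d2 : 0 < d / 2 by rewrite divr_gt0.
have [k kd] := inv_small d2; have [_ Eq c] := qP (phi k); have vk := vP k; rewrite Xball_ in vk.
exists (q (phi k)).2; split; first exact: Eq.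
apply: dV; rewrite Xball_; apply: le_lt_trans (Xtri _ (q (phi k)).1 _) _; rewrite [d]splitr; apply: ltrD.
 exact: lt_trans vk kd.
rewrite XnormC; apply: lt_trans c (le_lt_trans _ kd).
by rewrite inv_le ?phiP.
Qed.

(** Some Phi t carries a given ball into a neighbourhood of Gamma that misses E, so the ball is
    disjoint from the preimage of E, which has the measure of E. The balls exhaust the space, and
    the total mass is 1. *)
Lemma off_attractor E : closed E -> (forall v, Gamma v -> ~ E v) -> mu E = 0%E.
Proof.
move=> Ec disj; have [e e0 eP] := attractor_gap Ec disj; have mE := closed_meas Ec.
pose B (n : nat) : set X := [set v | Xnorm (0 - v) < n%:R].
have mB n : meas (B n) by apply: open_meas; exact: open_norm_lt.
have le1 n : (mu (B n) + mu E <= 1)%E.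
 have Bb : Xbounded (B n) by exists n%:R => v; rewrite /B /= sub0r XnormN => /ltW.
 have [t t0 tP] := attr Bb e0.
 rewrite -(mu_preimage t0 mE) -measureU//.
 - apply: probability_le1; apply: measurableU => //; apply: closed_meas; exact: preimage_closed.
 - by apply: closed_meas; exact: preimage_closed.
 apply/seteqP; split=> // v [Bv Ev]; have [w Gw c] := tP t v (lexx _) Bv.
 by have := eP w (Phi t v) Gw Ev; rewrite leNgt c.
have fE : mu E \is a fin_num by exact: fin_num_measure.
have cv : mu (B n) @[n --> \oo] --> mu (\bigcup_n B n).
 apply: nondecreasing_cvg_mu => //; first exact: bigcupT_measurable.
 move=> n m nm; apply/subsetPset => v; rewrite /B /= => h; apply: lt_le_trans h _; by rewrite ler_nat.
have BT : \bigcup_n B n = setT.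
 apply/seteqP; split=> // v _; exists (Num.truncn (Xnorm (0 - v))).+1 => //; exact: truncnS_gt.
rewrite BT probability_setT in cv.
have H : (1 <= 1 - mu E)%E.
 have L : (limn (fun n => mu (B n)) <= 1 - mu E)%E.
  apply: lime_le; first by apply/cvg_ex; exists 1%E.
  by apply: nearW => n; rewrite leeBrDr//; exact: le1.
 by rewrite (cvg_lim _ cv) in L.
apply/eqP; rewrite eq_le measure_ge0 andbT; move: H; rewrite -(fineK fE) -EFinB !lee_fin; lra.
Qed.

(** Poincare recurrence: the preimages of E at the times k tau all have the measure of E. If no
    return had positive measure they would be almost disjoint, and enough of them would exceed the
    total mass; tau = |T| + 1 makes all these returns late. *)
Lemma returns E T : meas E -> (0 < mu E)%E -> exists2 t, T <= t & 0 <= t /\ (0 < mu (E `&` (Phi t @^-1` E)))%E.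
Proof.
move=> mE E0; apply: contrapT => H; pose tau := `|T| + 1.
have tau1 : 1 <= tau by rewrite lerDr.
have tau0 : 0 <= tau by exact: le_trans ler01 tau1.
pose Ek (k : nat) : set X := Phi (k%:R * tau) @^-1` E.
have k0 (k : nat) : 0 <= k%:R * tau by rewrite mulr_ge0.
have mpre t : 0 <= t -> meas (Phi t @^-1` E).
 move=> t0; have Pm : measurable_fun setT (Phi t : borel X -> borel X).
  move=> _ Y mY; rewrite setTI; have : <<s @open X >> `<=` [set V : set X | meas (Phi t @^-1` V)].
   apply: smallest_sub; last by move=> V Vo; apply: open_meas; exact: preimage_open.
   split=> [|V mV|F mF]; first by rewrite /= preimage_set0; exact: measurable0.
    by rewrite /= setTD preimage_setC; exact: measurableC.
   by rewrite /= preimage_bigcup; exact: bigcupT_measurable.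
  by apply.
 by rewrite -[X in meas X]setTI; exact: Pm.
have mEk k : meas (Ek k) by exact: mpre.
have muEk k : mu (Ek k) = mu E by exact: mu_preimage.
have disj i j : (i < j)%N -> mu (Ek i `&` Ek j) = 0%E.
 move=> ij; pose t := (j - i)%:R * tau; have t0 : 0 <= t by rewrite mulr_ge0.
 have -> : Ek i `&` Ek j = Phi (i%:R * tau) @^-1` (E `&` (Phi t @^-1` E)).
  apply/seteqP; split=> v [h1 h2]; split=> //; move: h2; rewrite /Ek /preimage /= -PhiD// /t natrB ?(ltnW ij)// -mulrDl subrK//.
 rewrite mu_preimage//; last by apply: measurableI => //; exact: mpre.
 apply/eqP; rewrite eq_le measure_ge0 andbT leNgt; apply/negP => p; apply: H; exists t => //.
 apply: le_trans (ler_norm T) _; apply: le_trans (_ : 1 * tau <= _); first by rewrite mul1r lerDl.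
 by rewrite ler_wpM2r// ler1n subn_gt0.
pose U n : set X := \bigcup_(k in [set k | (k < n)%N]) Ek k.
have mU n : meas (U n) by apply: bigcup_measurable => k _; exact: mEk.
have US n : U n.+1 = U n `|` Ek n.
 apply/seteqP; split=> [v [k /= kn vk]|v [[k /= kn vk]|vn]].
 - by move: kn; rewrite ltnS leq_eqVlt => /orP[/eqP <-|kn]; [right | left; exists k].
 - by exists k => //=; exact: ltnW.
 - by exists n => /=.
have U0 : U 0%N = set0 by apply/seteqP; split=> // v [k].
have nullI n j : (n <= j)%N -> mu (U n `&` Ek j) = 0%E.
 elim: n => [|n IH] nj; first by rewrite U0 set0I measure0.
 rewrite US setIUl; apply: mu_U0; [exact: measurableI | exact: measurableI | exact: IH (ltnW nj) | exact: disj].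
have fE : mu E \is a fin_num by exact: fin_num_measure.
have grow n : ((n%:R * fine (mu E))%:E <= mu (U n))%E.
 elim: n => [|n IH]; first by rewrite mul0r.
 rewrite US mu_split//; last exact: nullI.
 rewrite -natr1 mulrDl mul1r EFinD; apply: leeD => //.
 by rewrite fineK// muEk.
have p0 : 0 < fine (mu E) by rewrite fine_gt0// E0 ltey_eq fE.
pose n := (Num.truncn (fine (mu E))^-1).+1.
have := le_trans (grow n) (probability_le1 mu (mU n)); rewrite lee_fin leNgt => /negP; apply.
rewrite -ltr_pdivrMr// div1r; exact: truncnS_gt.
Qed.

Lemma supportP u : measure_support mu u <-> forall O, open O -> O u -> (0 < mu O)%E.
Proof.
split=> [su O Oo Ou|H [V [Vo V0] Vu]]; last by have := H V Vo Vu; rewrite V0 ltxx.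
rewrite lt0e measure_ge0 andbT; apply/eqP => O0; apply: su; by exists O.
Qed.

Lemma support_closed : closed (measure_support mu).
Proof. by apply: open_closedC; apply: bigcup_open => O []. Qed.

Lemma Gamma_closed : closed Gamma.
Proof. have [a0 al1 al2] := params; exact: (compact_closed (X_hausdorff a0 al1) (ic_cpt G)). Qed.

Lemma support_sub : measure_support mu `<=` Gamma.
Proof.
move=> u /supportP su; apply: Gamma_closed => V /nbhs_ballP[d d0 dV].
apply: contrapT => H; have d2 : 0 < d / 2 by rewrite divr_gt0.
have := su [set v | Xnorm (u - v) < d / 2] (@open_norm_lt _ _); rewrite /= subrr Xnorm0 => /(_ d2).
rewrite ltNge => /negP; apply; rewrite -(_ : mu [set v | Xnorm (u - v) <= d / 2] = 0%E).
 apply: le_measure; rewrite ?inE; [exact: open_meas (@open_norm_lt _ _) | exact: closed_meas (@closed_norm_le _ _) |].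
 by move=> v /ltW.
apply: off_attractor; first exact: closed_norm_le.
move=> v Gv uv; apply: H; exists v; split=> //; apply: dV; rewrite Xball_.
by apply: le_lt_trans uv _; rewrite ltr_pdivrMr// ltr_pMr// ltr1n.
Qed.

Lemma support_flow t u : 0 <= t -> measure_support mu u -> measure_support mu (Phi t u).
Proof.
move=> t0 /supportP su; apply/supportP => O Oo Ou; rewrite -(mu_preimage t0 (open_meas Oo)).
by apply: su => //; exact: preimage_open.
Qed.

Lemma null_union (s : seq X) (F : X -> set X) : (forall x, meas (F x)) -> (forall x, x \in s -> mu (F x) = 0%E) ->
 exists U : set X, [/\ meas U, mu U = 0%E & forall x, x \in s -> F x `<=` U].
Proof.
move=> mF; elim: s => [|x s IH] H; first by exists set0; split.
have [y ys|U [mU U0 sU]] := IH; first by apply: H; rewrite inE ys orbT.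
exists (F x `|` U); split; first exact: measurableU.
 by apply: mu_U0 => //; apply: H; exact: mem_head.
by move=> y; rewrite inE => /orP[/eqP ->|/sU h] v Fv; [left | right; exact: h].
Qed.

(** The part of E that returns at a late time has positive measure. Finitely many small closed balls
    cover it up to a closed set off the attractor, which is null, so one of the balls retains
    positive measure. *)
Lemma shrink n E : closed E -> (0 < mu E)%E -> exists E' : set X, [/\ closed E', (0 < mu E')%E, E' `<=` E,
 forall v w, E' v -> E' w -> Xnorm (v - w) < n.+1%:R^-1 & exists2 t, n%:R <= t & forall v, E' v -> E (Phi t v)].
Proof.
move=> Ec E0; have [t nt [t0 rt]] := returns n%:R (closed_meas Ec) E0.
set E1 := E `&` _ in rt; have E1c : closed E1 by apply: closedI => //; exact: preimage_closed.
have d0 : 0 < (n.+1%:R^-1 / 3 : R) by rewrite divr_gt0 ?invr_gt0 ?ltr0n.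
set d := _ / 3 in d0.
move: (ic_cpt G); rewrite compact_cover => /(_ X setT (fun x => [set v | Xnorm (x - v) < d])) [||S _ Sc].
- by move=> x _; exact: open_norm_lt.
- by move=> x Gx; exists x => //=; rewrite subrr Xnorm0.
pose s : seq X := finmap.enum_fset S; pose F x := E1 `&` [set v : X | Xnorm (x - v) <= d].
have Fc x : closed (F x) by apply: closedI => //; exact: closed_norm_le.
have [[x [xs Fx0]]|nx] := pselect (exists x, x \in s /\ (0 < mu (F x))%E).
 exists (F x); split=> //; first by move=> v [[]].
  move=> v w [_ xv] [_ xw]; apply: le_lt_trans (Xtri _ x _) _; rewrite XnormC.
  apply: le_lt_trans (lerD xv xw) _; have -> : n.+1%:R^-1 = d + d + d by rewrite /d; field.
  by rewrite ltrDl.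
 by exists t => // v [[]].
have Fm x : meas (F x) by exact: closed_meas.
have [x xs|U [mU U0 sU]] := @null_union s F Fm.
 apply/eqP; rewrite eq_le measure_ge0 andbT leNgt; apply/negP => p; by apply: nx; exists x.
pose W : set X := ~` \bigcup_(x in [set x | x \in s]) [set v | Xnorm (x - v) < d].
have Wc : closed W by apply: open_closedC; apply: bigcup_open => x _; exact: open_norm_lt.
have W0 : mu W = 0%E by apply: off_attractor => // v /Sc[x xS xv]; apply; by exists x.
have sub : E1 `<=` U `|` W.
 move=> v Ev; have [[x /= xS xv]|nv] := pselect ((\bigcup_(x in [set x | x \in s]) [set v | Xnorm (x - v) < d]) v); last by right.
 by left; apply: (sU x xS); split=> //; exact: ltW.
have : (mu E1 <= 0)%E.
 apply: le_trans (le_measure mu _ _ sub) _; rewrite ?inE.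
 - exact: closed_meas.
 - by apply: measurableU => //; exact: closed_meas.
 have e0 := mu_U0 mU (closed_meas Wc) U0 W0; have le0 : (mu (U `|` W) <= 0)%E by rewrite e0.
 exact: le0.
by rewrite leNgt rt.
Qed.

(** Nested closed sets of positive measure, with diameters tending to 0 and each returning to its
    predecessor at a late time, have a common point by compactness of Gamma; it is recurrent, and
    every neighbourhood of it has positive measure. *)
Lemma support_recurrent u (e : R) : measure_support mu u -> 0 < e ->
 exists v, [/\ measure_support mu v, recurs v & Xnorm (u - v) < e].
Proof.
move=> /supportP su e0; have e2 : 0 < e / 2 by rewrite divr_gt0.
pose E0 : set X := [set v | Xnorm (u - v) <= e / 2].
have E0p : (0 < mu E0)%E.
 have := su [set v | Xnorm (u - v) < e / 2] (@open_norm_lt _ _); rewrite /= subrr Xnorm0 => /(_ e2) h.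
 apply: lt_le_trans h _; apply: le_measure; rewrite ?inE; [exact: open_meas (@open_norm_lt _ _) | exact: closed_meas (@closed_norm_le _ _) |].
 by move=> v /ltW.
have step (z : nat * set X) : exists E' : set X, closed z.2 -> (0 < mu z.2)%E -> [/\ closed E', (0 < mu E')%E, E' `<=` z.2,
 forall v w, E' v -> E' w -> Xnorm (v - w) < z.1.+1%:R^-1 & exists2 t, z.1%:R <= t & forall v, E' v -> z.2 (Phi t v)].
 have [[c p]|np] := pselect (closed z.2 /\ (0 < mu z.2)%E); last by exists set0 => c p; case: np.
 by have [E' ?] := shrink z.1 c p; exists E'.
have [nx nxP] := choice step.
pose E := fix E n : set X := if n is m.+1 then nx (m, E m) else E0.
have En n : closed (E n) /\ (0 < mu (E n))%E.
 by elim: n => [|n [c p]]; [split=> //; exact: closed_norm_le | have [] := nxP (n, E n) c p].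
have ES n : [/\ E n.+1 `<=` E n, forall v w, E n.+1 v -> E n.+1 w -> Xnorm (v - w) < n.+1%:R^-1 &
  exists2 t, n%:R <= t & forall v, E n.+1 v -> E n (Phi t v)].
 by have [c p] := En n; have [_ _ h1 h2 h3] := nxP (n, E n) c p.
have Emono n j : E (n + j)%N `<=` E n.
 by elim: j => [|j IH]; [rewrite addn0 | rewrite addnS => v Ev; apply: IH; have [s _ _] := ES (n + j)%N; exact: s].
have ex n : exists v, Gamma v /\ E n v.
 apply: contrapT => H; have [c p] := En n; move: p; rewrite off_attractor ?ltxx// => v Gv Ev; apply: H; by exists v.
have [q qP] := choice ex.
have [|v Gv [phi phiP vP]] := @compact_seq R X Gamma q (ic_cpt G); first by move=> k; have [] := qP k.
have vE n : E n v.
 have [c _] := En n; apply: c => V /nbhs_ballP[d d0 dV]; have [k kd] := inv_small d0.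
 pose j := phi (maxn k n); have nj : (n <= j)%N by apply: leq_trans (phiP _); exact: leq_maxr.
 exists (q j); split; first by have [_ h] := qP j; apply: (Emono n (j - n)%N); rewrite subnKC.
 apply: dV; have h := vP (maxn k n); rewrite Xball_ in h; rewrite Xball_; apply: lt_trans h (le_lt_trans _ kd).
 by rewrite inv_le ?leq_maxl.
exists v; split.
- apply/supportP => O Oo Ov; have /nbhs_ballP[d d0 dO] : nbhs v O by exact: open_nbhs_nbhs.
 have [k kd] := inv_small d0; have [c p] := En k.+1; apply: lt_le_trans p _.
 apply: le_measure; rewrite ?inE; [exact: closed_meas | exact: open_meas |].
 move=> w Ew; apply: dO; rewrite Xball_; have [_ h _] := ES k; exact: lt_trans (h v w (vE _) Ew) kd.
- move=> d T d0; have [k kd] := inv_small d0.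
 pose n := maxn k (Num.truncn `|T|).+1; have [_ _ [t nt tE]] := ES n.+1.
 have Tn : `|T| <= n%:R by apply: le_trans (ltW (truncnS_gt _)) _; rewrite ler_nat leq_maxr.
 have nt' : n%:R <= t by apply: le_trans nt; rewrite ler_nat.
 exists t; first exact: le_trans (ler_norm T) (le_trans Tn nt').
 split; first exact: le_trans (ler0n _ _) nt'.
 have [_ h _] := ES n; apply: lt_le_trans (h _ _ (tE v (vE _)) (vE _)) (le_trans _ (ltW kd)).
 by rewrite inv_le ?leq_maxl.
- have := vE 0%N; rewrite /= /E0 /= => h; apply: le_lt_trans h _; by rewrite ltr_pdivrMr// ltr_pMr// ltr1n.
Qed.

End supports.

(** * Birkhoff center, supports and entropy *)

Section conclusion.
Implicit Types (w x y : X) (h : R).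

Lemma attractor_invariant_compact b L r Gamma : alpha < b < 1 -> 0 < r -> global_attractor Phi Gamma ->
 Gamma `<=` regular b L r -> exists M, invariant_compact r M Gamma.
Proof.
have [a0 al1 al2] := params.
move=> /andP[ab _] r0 [[v0 Gv0] Gc Gi _] Gr.
have bd v : Gamma v -> Xnorm v <= a `^ (alpha - b) * L.
 by move=> /Gr[H _]; apply: (Xnorm_le a0 al1); exact: (hbd_mono a0 (ltW ab) H).
exists (a `^ (alpha - b) * L); split => //.
- exact: ltW.
- exact: le_trans (Xnorm_ge0 _) (bd v0 Gv0).
- by move=> v /Gr[].
- by move=> t v t0 Gv; rewrite -(Gi t t0); exists v.
- by move=> t v t0; rewrite -{1}(Gi t t0) => -[w Gw E]; exists w.
Qed.

Lemma iter_Phi1 k u : iter k (Phi 1) u = Phi k%:R u.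
Proof.
elim: k => [|k IH] /=; first by rewrite Phi0.
by rewrite IH -PhiD// -natr1 addrC.
Qed.

Lemma recurs_omega u : recurs u <-> omega_limit Phi u u.
Proof.
split=> [H t /= t0 V /nbhs_ballP[e e0 eV]|H e T e0].
 have [s ts [s0 c]] := H e t e0; exists (Phi s u); split; first by exists s.
 by apply: eV; rewrite Xball_ XnormC.
have T0 : 0 <= `|T| by [].
have [w [[s /= Ts <-] uw]] := H `|T| T0 _ (nbhsx_ballx u e e0); rewrite Xball_ XnormC in uw.
by exists s; [exact: le_trans (ler_norm T) Ts | split; [exact: le_trans T0 Ts | exact: uw]].
Qed.

Section attractor.
Variables (r M : R) (Gamma : set X).
Hypotheses (G : invariant_compact r M Gamma) (ga : global_attractor Phi Gamma).

(** A recurrent point is approached by its own late orbit, which the closed set Gamma attracts. *)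
Lemma recurs_attractor u : recurs u -> Gamma u.
Proof.
move=> H; apply: (Gamma_closed G) => V /nbhs_ballP[e e0 eV]; have e2 : 0 < e / 2 by rewrite divr_gt0.
have [_ _ _ attr] := ga; have [|t0 t00 tP] := attr [set u] _ (e / 2) e2; first by exists (Xnorm u) => v ->.
have [t tt [tp c]] := H (e / 2) t0 e2; have [v Gv vc] := tP t u tt erefl.
exists v; split=> //; apply: eV; rewrite Xball_ XnormC; apply: le_lt_trans (Xtri _ (Phi t u) _) _.
by rewrite [e]splitr; apply: ltrD => //; rewrite XnormC.
Qed.

Lemma recurs_periodic u : recurs u -> periodic_point u.
Proof. by move=> H; exact: (recurrent_periodic G (recurs_attractor H) H). Qed.

Lemma birkhoff_components u : birkhoff_center Phi u ->
 homeo_planar_compact_invariant Phi (connected_component (birkhoff_center Phi) u).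
Proof.
apply: (planar_components G).
- exact: closed_closure.
- move=> v cv; apply: (Gamma_closed G) => V Vv; have [w [/= rw Vw]] := cv V Vv.
 by exists w; split=> //; apply: recurs_attractor; apply/recurs_omega.
- move=> t v t0 cv V Vv; have Pv : nbhs v (Phi t @^-1` V) by exact: (Phi_t_cts t0).
 have [w [/= rw Vw]] := cv _ Pv.
 exists (Phi t w); split=> //; apply/recurs_omega; apply: (recurs_flow t0); exact/recurs_omega.
- move=> v e cv e0; have [w [/= rw vw]] := cv _ (nbhsx_ballx v e e0); rewrite Xball_ in vw.
 exists w; split=> //; first exact: subset_closure.
 by apply: recurs_periodic; exact/recurs_omega.
Qed.

Lemma support_components (mu : probability (borel X) R) u : invariant_measure Phi mu -> measure_support mu u ->
 homeo_planar_compact_invariant Phi (connected_component (measure_support mu) u).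
Proof.
have [_ _ _ attr] := ga; move=> muI; apply: (planar_components G).
- exact: support_closed.
- exact: (support_sub G attr muI).
- by move=> t v t0; exact: (support_flow muI t0).
- move=> v e sv e0; have [w [sw rw vw]] := support_recurrent G attr muI sv e0.
 by exists w; split=> //; exact: recurs_periodic.
Qed.

(* Points within a small time of each other on a periodic orbit stay uniformly close, so boundedly many
  Bowen neighbourhoods of points of the orbit cover it whatever the number of iterations. *)
Lemma periodic_covers v (e : R) : Gamma v -> periodic_point v -> 0 < e ->
 exists L K, [/\ closed L, forall k, L (iter k (Phi 1) v) & forall n, cov (Phi 1) e n L K].
Proof.
have [a0 al1 al2] := params.
move=> Gv [T T0 E] e0; have e2 : 0 < e / 2 by rewrite divr_gt0.
(* The modulus of continuity in time is uniform over Gamma, so one time step h serves along the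
   whole future of the orbit. *)
have [C C0 CP] := first_difference G; have e2C : 0 < e / 2 / C / 2 by rewrite !divr_gt0.
have alp : 0 < alpha by apply: lt_trans al1; rewrite divr_gt0.
have [h /andP[h0 h1] hP] := small_pow alp e2C.
have close w s : Gamma w -> 0 <= s <= h -> Xnorm (Phi s w - w) < e / 2.
 move=> Gw /andP[s0 sh]; have [->|sn] := eqVneq s 0; first by rewrite Phi0 subrr Xnorm0.
 have sp : 0 < s by rewrite lt_def sn.
 apply: le_lt_trans (CP w s Gw _) _; first by rewrite sp (le_trans sh (ltW h1)).
 rewrite mulrC -ltr_pdivlMr//; apply: le_lt_trans (hP s _) _; first by rewrite sp.
 by rewrite ltr_pdivrMr// ltr_pMr ?divr_gt0// ltr1n.
pose L : set X := [set Phi' v s | s in `[0, T]%classic].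
have Lc : compact L.
 apply: continuous_compact; last exact: segment_compact.
 apply: continuous_subspaceT => s; apply/eps_cts => d d0.
 have [c c0 cP] := Phi'_cts v s d0; exists c; first exact: c0.
 by move=> y sy; rewrite Xball_; exact: cP.
pose K := (Num.truncn (T / h)).+1.
have per t : 0 <= t -> L (Phi t v).
 move=> t0; pose n := Num.truncn (t / T); have tT : 0 <= t / T by rewrite divr_ge0 ?(ltW T0).
 have /andP[l1 l2] : n%:R <= t / T < n.+1%:R by apply: truncn_itv.
 rewrite ler_pdivlMr// in l1; rewrite ltr_pdivrMr// -natr1 mulrDl mul1r in l2.
 have s0 : 0 <= t - n%:R * T by rewrite subr_ge0.
 exists (t - n%:R * T); first by rewrite /= in_itv/= s0 lerBlDl ltW.
 have nT : 0 <= n%:R * T by rewrite mulr_ge0 ?(ltW T0).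
 by rewrite Phi'E// -{2}(subrK (n%:R * T) t) (PhiD _ s0 nT) (periodic_iter n T0 E).
exists L, K; split.
- exact: (compact_closed (X_hausdorff a0 al1) Lc).
- by move=> k; rewrite iter_Phi1; exact: per.
move=> n; pose p (i : 'I_K) := Phi (i%:R * h) v.
have i0 (i : 'I_K) : 0 <= i%:R * h by rewrite mulr_ge0 ?(ltW h0).
pose D i := \bigcap_(k in [set k | (k < n)%N]) (iter k (Phi 1) @^-1` [set y | Xnorm (iter k (Phi 1) (p i) - y) < e / 2]).
exists 'I_K, D; split.
- by rewrite card_ord.
- move=> i; rewrite /D bigcap_mkord; elim/big_ind: _ => [|A B|k _]; [exact: openT | exact: openI |].
 apply: open_comp; last exact: open_norm_lt.
 by move=> x _; apply: iter_cts; exact: Phi_t_cts.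
- move=> i x y Dx Dy k kn; rewrite Xball_.
 apply: le_lt_trans (Xtri _ (iter k (Phi 1) (p i)) _) _; rewrite [e]splitr; apply: ltrD; last exact: Dy k kn.
 by rewrite XnormC; exact: Dx k kn.
- move=> _ [s /= sI <-]; move: sI; rewrite in_itv/= => /andP[s0 sT].
 have sh : 0 <= s / h by rewrite divr_ge0 ?(ltW h0).
 have /andP[l1 l2] : (Num.truncn (s / h))%:R <= s / h < (Num.truncn (s / h)).+1%:R by apply: truncn_itv.
 have iK : (Num.truncn (s / h) < K)%N by rewrite ltnS; apply: le_truncn; rewrite ler_pM2r ?invr_gt0.
 exists (Ordinal iK) => k _ /=; rewrite Phi'E// !iter_Phi1 /p /=.
 set i := Num.truncn _ in l1 l2 *; have ih : 0 <= i%:R * h by rewrite mulr_ge0 ?(ltW h0).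
 rewrite ler_pdivlMr// in l1; rewrite ltr_pdivrMr// -natr1 mulrDl mul1r in l2.
 have d0 : 0 <= s - i%:R * h by rewrite subr_ge0.
 have -> : Phi k%:R (Phi s v) = Phi (s - i%:R * h) (Phi k%:R (Phi (i%:R * h) v)).
  have kk : 0 <= k%:R :> R by [].
  rewrite -(PhiD _ kk s0) -(PhiD _ kk ih) -(PhiD _ d0 (addr_ge0 kk ih)).
  by congr (Phi _ v); ring.
 rewrite XnormC; apply: close; first by apply: (ic_inv G) => //; exact: (ic_inv G).
 by rewrite d0 lerBlDl ltW.
Qed.

Lemma attractor_entropy : topological_entropy (Phi 1) Gamma = 0%E.
Proof.
have [Gne _ _ _] := ga; have Gcl := Gamma_closed G.
have Fc := Phi_t_cts ler01; have GF v : Gamma v -> Gamma (Phi 1 v) by apply: (ic_inv G).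
apply: (entropy_zero Fc GF Gne) => e rho e0 rho1.
apply: (not_big_attractor Fc (ic_cpt G) Gcl GF e0 rho1) => v Gv rv.
apply: periodic_covers => //; apply: recurs_periodic => d T d0.
have [k kT vk] := rv d (Num.truncn `|T|).+1 d0; rewrite iter_Phi1 Xball_ XnormC in vk.
exists k%:R; last by split; [exact: ler0n | exact: vk].
by apply: le_trans (ler_norm T) (le_trans (ltW (truncnS_gt _)) _); rewrite ler_nat.
Qed.

End attractor.
End conclusion.

End semiflow.

Theorem theorem6p2 (R : realType) (a alpha : R) (f : R * R * R -> R)
  (Phi : R -> phase_space a alpha -> phase_space a alpha)
  (a_gt0 : 0 < a) (alpha_itv : 3 / 4 < alpha < 1)
  (hA : hypothesis_A f) (hB : hypothesis_B f)
  (Phi_semiflow : continuous_semiflow Phi) (Phi_gen : generated_by Phi f) :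
 [/\ forall u, birkhoff_center Phi u ->
    homeo_planar_compact_invariant Phi
     (connected_component (birkhoff_center Phi) u),
   forall mu : probability (borel (phase_space a alpha)) R,
    invariant_measure Phi mu ->
    forall u, measure_support mu u ->
     homeo_planar_compact_invariant Phi
      (connected_component (measure_support mu) u) &
   exists2 Gamma, global_attractor Phi Gamma &
    topological_entropy (Phi 1) Gamma = 0%E].
Proof.
have st := Setting a_gt0 alpha_itv hA hB Phi_semiflow Phi_gen.
have [b [L [r [Gamma [bI r0 ga Gr]]]]] := attractor_exists st.
have [M G] := attractor_invariant_compact st bI r0 ga Gr.
split; first exact: (birkhoff_components st G ga).
 by move=> mu muI u; exact: (support_components st G ga muI).
by exists Gamma; [exact: ga | exact: (attractor_entropy st G ga)].
Qed.
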